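(* Let $k$ be an algebraically closed field of characteristic zero and $X$ a smooth elliptic curve over $k$. Let $\mathcal{E}_{-1}$ and $\mathcal{E}_0$ be simple vector bundles over $X$ with ranks $r_{-1}, r_0$, degrees $d_{-1}, d_0$, and slopes $\mu_{-1}=d_{-1}/r_{-1}$, $\mu_0=d_0/r_0$, such that $\mu_{-1}<\mu_0$. Let $d:=\dim_k \operatorname{Hom}(\mathcal{E}_{-1},\mathcal{E}_0)$. Then the ordered pair $(\mathcal{E}_{-1},\mathcal{E}_0)$ extends, via mutation, to a two-periodic elliptic helix if and only if one of the following holds: (i) $d=2$, $r_{-1}=r_0=1$ and $d_0=d_{-1}+2$; or (ii) $d>2$ and $$d\,r_{-1}r_0-r_{-1}^2-r_0^2>0.$$
   Context: A vector bundle is simple if its endomorphism ring is $k$. Elliptically exceptional: an object $\mathcal{E}$ of $\mathsf{Coh}\,X$ (coherent sheaves on $X$) is elliptically exceptional if $\operatorname{Ext}^j(\mathcal{E},\mathcal{E})\cong k$ for $j=0,1$ and is zero otherwise, and for every $\mathcal{F}\in\mathsf{Coh}\,X$ the natural pairing $\operatorname{Hom}(\mathcal{E},\mathcal{F})\otimes\operatorname{Ext}^1(\mathcal{F},\mathcal{E})\to\operatorname{Ext}^1(\mathcal{E},\mathcal{E})=k$ is non-degenerate. Mutation: an ordered pair $(\mathcal{E},\mathcal{F})$ is left mutable if $\operatorname{Ext}^j(\mathcal{E},\mathcal{F})=0$ for $j\ne 0$ and the evaluation map $\epsilon\colon\operatorname{Hom}(\mathcal{E},\mathcal{F})\otimes_k\mathcal{E}\to\mathcal{F}$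 is surjective. In this case one says that $\mathcal{F}$ left mutates through $\mathcal{E}$, and the left mutation is $L_{\mathcal{E}}\mathcal{F}:=\ker\epsilon$. A two-periodic elliptic helix is a sequence $\underline{\mathcal{E}}=(\mathcal{E}_i)_{i\in\mathbb{Z}}$ of elliptically exceptional objects of $\mathsf{Coh}\,X$ such that (1) $\operatorname{Ext}^1(\mathcal{E}_i,\mathcal{E}_j)=0$ for all $i<j$, and (2) for all $i$, $\mathcal{E}_i$ left mutates through $\mathcal{E}_{i-1}$ and this left mutation is isomorphic to $\mathcal{E}_{i-2}$. (Such a sequence is determined up to termwise isomorphism by any two consecutive terms.) ''$(\mathcal{E}_{-1},\mathcal{E}_0)$ extends, via mutation, to a two-periodic elliptic helix'' means that there is a two-periodic elliptic helix whose terms of index $-1$ and $0$ are the given bundles. *)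

(* Defs.v *)
From HB Require Import structures.
From mathcomp Require Import all_boot all_order all_algebra.
From mathcomp Require Import mpoly.
From mathcomp Require Import all_classical.
From mathcomp Require Import topology_structure subtype_topology.

Set Implicit Arguments.
Unset Strict Implicit.
Unset Printing Implicit Defensive.

Import GRing.Theory.
Local Open Scope classical_set_scope.
Local Open Scope ring_scope.

(* Varieties are classical ones: the k-points of a closed subset of P^n with
   the Zariski topology and the sheaf of regular functions.  A point of P^n is
   a line in k^(n+1). *)
Definition pspace (k : fieldType) (n : nat) :=
  {l : {vspace 'rV[k]_n.+1} | \dim l == 1%N}.

HB.instance Definition _ (k : fieldType) (n : nat) := Choice.on (pspace k n).

(* The value of f at the representative [vpick l] of the point l.  It is only
   used through the vanishing of a homogeneous f and through quotients of
   homogeneous f, g of equal degree, which do not depend on the nonzero vector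
   of l that is chosen. *)
Definition fval (k : fieldType) (n : nat) (f : {mpoly k[n.+1]})
  (l : pspace k n) : k := f.@[vpick (val l) ord0].

Section Zariski.
Variables (k : fieldType) (n : nat).
Local Notation P := (pspace k n).

Definition zopen (U : set P) := exists S : set {mpoly k[n.+1]},
  (forall f, S f -> exists d : nat, f \is d.-homog) /\
  U = ~` [set l | forall f, S f -> fval f l = 0].

Lemma zopenT : zopen setT.
Proof.
exists [set 1]; split=> [f ->|]; first by exists 0%N; exact: dhomog1.
apply/seteqP; split=> l // _ /(_ 1 erefl) /eqP.
by rewrite /fval meval1 oner_eq0.
Qed.

Lemma zopenI : setI_closed zopen.
Proof.
move=> _ _ [S [hS ->]] [T [hT ->]].
exists [set f | exists g h, [/\ S g, T h & f = g * h]]; split.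
  move=> _ [g [h [/hS[d hd] /hT[e he] ->]]].
  by exists (d + e)%N; exact: dhomogM.
apply/seteqP; split=> l /=.
  move=> [/existsNP[g /not_implyP[Sg g0]] /existsNP[h /not_implyP[Th h0]]].
  move=> /(_ (g * h)); rewrite /fval mevalM => H.
  have /eqP := H (ex_intro _ g (ex_intro _ h (And3 Sg Th erefl))).
  by rewrite mulf_eq0 => /orP[]/eqP.
move=> /existsNP[_ /not_implyP[[g [h [Sg Th ->]]] gh0]].
split=> H; apply: gh0; rewrite /fval mevalM.
  by have := H g Sg; rewrite /fval => ->; rewrite mul0r.
by have := H h Th; rewrite /fval => ->; rewrite mulr0.
Qed.

Lemma zopen_bigU (I : Type) (f : I -> set P) :
  (forall i, zopen (f i)) -> zopen (\bigcup_i f i).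
Proof.
move=> fo; exists [set p | (exists d : nat, p \is d.-homog) /\
  exists i, forall l, ~ f i l -> fval p l = 0]; split=> [p []//|].
apply/seteqP; split=> l /=.
  move=> [i _ fil] H; have [S [hS fE]] := fo i.
  move: (fil); rewrite fE; apply=> p Sp; apply: H; split; first exact: hS.
  by exists i => m; rewrite fE => /contrapT /(_ p Sp).
move=> /existsNP[p /not_implyP[[_ [i Hi]] pl0]].
by exists i => //; apply: contrapT => /Hi.
Qed.

HB.instance Definition _ :=
  isOpenTopological.Build P zopenT zopenI zopen_bigU.
End Zariski.

Record opens (T : topologicalType) :=
  Opens { oset :> set T; opensP : open oset }.

Definition opensI (T : topologicalType) (U V : opens T) : opens T :=
  Opens (openI (opensP U) (opensP V)).

Lemma opensIl (T : topologicalType) (U V : opens T) : opensI U V `<=` U.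
Proof. exact: subIsetl. Qed.

Lemma opensIr (T : topologicalType) (U V : opens T) : opensI U V `<=` V.
Proof. exact: subIsetr. Qed.

Section RegularFunctions.
Variables (k : fieldType) (n : nat) (X : set (pspace k n)).

Definition regular (U : opens X) (f : U -> k) := forall x : U,
  exists V : opens X, oset V (val x) /\
  exists (d : nat) (g h : {mpoly k[n.+1]}),
    [/\ g \is d.-homog, h \is d.-homog &
        forall y : U, oset V (val y) ->
          fval h (val (val y)) != 0 /\
          f y = fval g (val (val y)) / fval h (val (val y))].

Definition regularb (U : opens X) : {pred U -> k} :=
  fun f => `[< regular f >].

Lemma regularb_subring U : subring_closed (@regularb U).
Proof.
have fvalM (f g : {mpoly k[n.+1]}) l : fval (f * g) l = fval f l * fval g l.
  by rewrite /fval mevalM.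
split.
- apply/asboolP => x; exists (Opens (@openT X)); split=> //.
  exists 0%N, 1, 1; split; rewrite ?dhomog1 // => y _.
  by rewrite /fval meval1 oner_eq0 divr1.
- move=> f g /asboolP rf /asboolP rg; apply/asboolP => x.
  have [V [Vx [d [a [b [ha hb H]]]]]] := rf x.
  have [W [Wx [e [p [q [hp hq K]]]]]] := rg x.
  exists (opensI V W); split=> //.
  exists (d + e)%N, (a * q - b * p), (b * q).
  split; [|exact: dhomogM|move=> y [/H[b0 fE] /K[q0 gE]]].
    by rewrite rpredB ?dhomogM.
  rewrite !fvalM mulf_neq0 //; split=> //.
  have -> : (f - g) y = f y - g y by [].
  rewrite fE gE /fval mevalB !mevalM -!/(fval _ _) -mulNr addf_div //.
  by rewrite mulNr [fval p _ * _]mulrC.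
- move=> f g /asboolP rf /asboolP rg; apply/asboolP => x.
  have [V [Vx [d [a [b [ha hb H]]]]]] := rf x.
  have [W [Wx [e [p [q [hp hq K]]]]]] := rg x.
  exists (opensI V W); split=> //.
  exists (d + e)%N, (a * p), (b * q).
  split; [exact: dhomogM|exact: dhomogM|move=> y [/H[b0 fE] /K[q0 gE]]].
  rewrite !fvalM mulf_neq0 //; split=> //.
  have -> : (f * g) y = f y * g y by [].
  by rewrite fE gE mulf_div.
Qed.

Record regfun (U : opens X) := RegFun { rf :> U -> k; _ : rf \in @regularb U }.
HB.instance Definition _ (U : opens X) := [isSub for @rf U].
HB.instance Definition _ (U : opens X) := [Choice of regfun U by <:].
HB.instance Definition _ (U : opens X) :=
  GRing.SubChoice_isSubComPzRing.Build (U -> k) (@regularb U) (regfun U)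
    (regularb_subring U).

Definition point_in (U : opens X) (x : X) (Ux : oset U x) : U := SigSub (mem_set Ux).

Lemma restr_subproof (U V : opens X) (VU : V `<=` U) (f : regfun U) :
  (fun y : V => f (subfun VU y)) \in @regularb V.
Proof.
case: f => f /= /asboolP rf_; apply/asboolP => x.
have [W [Wx [d [g [h [hg hh H]]]]]] := rf_ (subfun VU x).
by exists W; split=> //; exists d, g, h; split=> // y /(H (subfun VU y)).
Qed.

Definition restr (U V : opens X) (VU : V `<=` U) (f : regfun U) : regfun V :=
  RegFun (restr_subproof VU f).

Lemma cstf_subproof (U : opens X) (c : k) :
  (fun _ : U => c) \in @regularb U.
Proof.
apply/asboolP => x; exists (Opens (@openT X)); split=> //.
exists 0%N, c%:MP, 1; split; rewrite ?dhomog1 //.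
  by rewrite -[c%:MP]mulr1 mul_mpolyC dhomogZ ?dhomog1.
by move=> y _; rewrite /fval meval1 mevalC oner_eq0 divr1.
Qed.

Definition cstf (U : opens X) (c : k) : regfun U :=
  RegFun (cstf_subproof U c).

End RegularFunctions.

Arguments regfun {k n X} U.

Section Modules.
Variables (k : fieldType) (n : nat) (X : set (pspace k n)).

(* Sheaves of modules over the sheaf of regular functions of X. *)
Record omod := OMod {
  sec : forall U : opens X, lmodType (regfun U);
  res : forall U V : opens X, V `<=` U -> sec U -> sec V;
  resB : forall (U V : opens X) (VU : V `<=` U) (s t : sec U),
    res VU (s - t) = res VU s - res VU t;
  resZ : forall (U V : opens X) (VU : V `<=` U) (a : regfun U) (s : sec U),
    res VU (a *: s) = restr VU a *: res VU s;
  res_id : forall (U : opens X) (UU : U `<=` U) (s : sec U), res UU s = s;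
  res_comp : forall (U V W : opens X) (VU : V `<=` U) (WV : W `<=` V)
    (WU : W `<=` U) (s : sec U), res WV (res VU s) = res WU s;
  sec_separated : forall (U : opens X) (I : Type) (C : I -> opens X)
    (CU : forall i, C i `<=` U), U `<=` \bigcup_i C i ->
    forall s t : sec U, (forall i, res (CU i) s = res (CU i) t) -> s = t;
  sec_glue : forall (U : opens X) (I : Type) (C : I -> opens X)
    (CU : forall i, C i `<=` U), U `<=` \bigcup_i C i ->
    forall s : forall i, sec (C i),
    (forall i j (W : opens X) (Wi : W `<=` C i) (Wj : W `<=` C j),
      res Wi (s i) = res Wj (s j)) ->
    exists t : sec U, forall i, res (CU i) t = s i
}.

Record hom (F G : omod) := Hom {
  happ :> forall U : opens X, {linear sec F U -> sec G U};
  hom_res : forall (U V : opens X) (VU : V `<=` U) (s : sec F U),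
    happ V (res VU s) = res VU (happ U s)
}.

Definition iso (F G : omod) := exists (f : hom F G) (g : hom G F),
  (forall U (s : sec F U), g U (f U s) = s) /\
  (forall U (t : sec G U), f U (g U t) = t).

Definition locally_in_image (F G : omod) (f : hom F G) (U : opens X)
    (t : sec G U) :=
  forall x : X, oset U x -> exists (V : opens X) (VU : V `<=` U),
    oset V x /\ exists s : sec F V, f V s = res VU t.

Definition mono (F G : omod) (f : hom F G) :=
  forall U (s : sec F U), f U s = 0 -> s = 0.

Definition epi (F G : omod) (f : hom F G) :=
  forall U (t : sec G U), locally_in_image f t.

Definition exact_at (F G H : omod) (f : hom F G) (g : hom G H) :=
  forall U (t : sec G U), g U t = 0 <-> locally_in_image f t.

(* The structure sheaf. *)
Lemma restrB (U V : opens X) (VU : V `<=` U) (f g : (regfun U)^o) :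
  restr VU (f - g) = restr VU f - restr VU g.
Proof. exact: val_inj. Qed.

Lemma restrM (U V : opens X) (VU : V `<=` U) (f : regfun U) (g : (regfun U)^o) :
  restr VU (f *: g) = restr VU f *: (restr VU g : (regfun V)^o).
Proof. exact: val_inj. Qed.

Lemma subfun_id (T : Type) (A : set T) (AA : A `<=` A) (x : A) :
  subfun AA x = x.
Proof. exact: val_inj. Qed.

Lemma restr_id (U : opens X) (UU : U `<=` U) (f : regfun U) : restr UU f = f.
Proof. by apply/val_inj/funext => x /=; rewrite subfun_id. Qed.

Lemma restr_comp (U V W : opens X) (VU : V `<=` U) (WV : W `<=` V)
  (WU : W `<=` U) (f : regfun U) : restr WV (restr VU f) = restr WU f.
Proof.
apply/val_inj/funext => x /=; congr (rf f _); exact: val_inj.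
Qed.

Lemma restr_separated (U : opens X) (I : Type) (C : I -> opens X)
  (CU : forall i, C i `<=` U) : U `<=` \bigcup_i C i ->
  forall f g : regfun U, (forall i, restr (CU i) f = restr (CU i) g) -> f = g.
Proof.
move=> cov f g fg; apply/val_inj/funext => x.
have [i _ Cx] := cov _ (set_valP x).
have -> : x = subfun (CU i) (point_in Cx) by exact: val_inj.
exact: (congr1 (fun h : regfun (C i) => h (point_in Cx)) (fg i)).
Qed.

Lemma restr_glue (U : opens X) (I : Type) (C : I -> opens X)
  (CU : forall i, C i `<=` U) : U `<=` \bigcup_i C i ->
  forall f : forall i, regfun (C i),
  (forall i j (W : opens X) (Wi : W `<=` C i) (Wj : W `<=` C j),
    restr Wi (f i) = restr Wj (f j)) ->
  exists g : regfun U, forall i, restr (CU i) g = f i.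
Proof.
move=> cov f ff.
have covx (x : U) : exists i, oset (C i) (val x).
  by have [i _ ?] := cov _ (set_valP x); exists i.
pose ix x := projT1 (cid (covx x)).
have ixP x : oset (C (ix x)) (val x) := projT2 (cid (covx x)).
pose g x := f (ix x) (point_in (ixP x)).
have gE i (y : C i) : g (subfun (CU i) y) = f i y.
  set x := subfun (CU i) y; rewrite /g.
  pose W := opensI (C (ix x)) (C i).
  have Wy : oset W (val y) by split; [exact: (ixP x)|exact: (set_valP y)].
  have := congr1 (fun h : regfun W => h (point_in Wy))
    (ff (ix x) i W (@subIsetl _ _ _) (@subIsetr _ _ _)).
  rewrite /= => E; transitivity
    (f (ix x) (subfun (@subIsetl _ (C (ix x)) (C i)) (point_in Wy))).
    by congr (rf _ _); exact: val_inj.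
  by rewrite E; congr (rf _ _); exact: val_inj.
have gr : g \in @regularb _ _ _ U.
  apply/asboolP => x; case: (f (ix x)) (gE (ix x)) => h /= /asboolP hr hE.
  have [V [Vx [d [p [q [hp hq H]]]]]] := hr (point_in (ixP x)).
  exists (opensI V (C (ix x))); split; first by split=> //; exact: ixP.
  exists d, p, q; split=> // y [Vy Cy].
  have -> : y = subfun (CU (ix x)) (point_in Cy) by exact: val_inj.
  by rewrite hE; exact: H.
exists (RegFun gr) => i; apply/val_inj/funext => y; exact: gE.
Qed.

Definition osheaf : omod :=
  OMod restrB restrM restr_id restr_comp restr_separated restr_glue.

(* Finite direct sums F^m. *)
Section Power.
Variables (F : omod) (m : nat).

Definition pow_sec (U : opens X) : lmodType (regfun U) := {ffun 'I_m -> sec F U}.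

Definition pow_res (U V : opens X) (VU : V `<=` U) (s : pow_sec U) : pow_sec V :=
  [ffun i => res VU (s i)].

Lemma pow_resB (U V : opens X) (VU : V `<=` U) (s t : pow_sec U) :
  pow_res VU (s - t) = pow_res VU s - pow_res VU t.
Proof. by apply/ffunP => i; rewrite !ffunE resB. Qed.

Lemma pow_resZ (U V : opens X) (VU : V `<=` U) (a : regfun U) (s : pow_sec U) :
  pow_res VU (a *: s) = restr VU a *: pow_res VU s.
Proof. by apply/ffunP => i; rewrite !ffunE resZ. Qed.

Lemma pow_res_id (U : opens X) (UU : U `<=` U) (s : pow_sec U) :
  pow_res UU s = s.
Proof. by apply/ffunP => i; rewrite !ffunE res_id. Qed.

Lemma pow_res_comp (U V W : opens X) (VU : V `<=` U) (WV : W `<=` V)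
  (WU : W `<=` U) (s : pow_sec U) : pow_res WV (pow_res VU s) = pow_res WU s.
Proof. by apply/ffunP => i; rewrite !ffunE (res_comp VU WV WU). Qed.

Lemma pow_separated (U : opens X) (I : Type) (C : I -> opens X)
  (CU : forall i, C i `<=` U) : U `<=` \bigcup_i C i ->
  forall s t : pow_sec U,
    (forall i, pow_res (CU i) s = pow_res (CU i) t) -> s = t.
Proof.
move=> cov s t st; apply/ffunP => j; apply: (sec_separated cov) => i.
by have /ffunP/(_ j) := st i; rewrite !ffunE => ->.
Qed.

Lemma pow_glue (U : opens X) (I : Type) (C : I -> opens X)
  (CU : forall i, C i `<=` U) : U `<=` \bigcup_i C i ->
  forall s : forall i, pow_sec (C i),
  (forall i j (W : opens X) (Wi : W `<=` C i) (Wj : W `<=` C j),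
    pow_res Wi (s i) = pow_res Wj (s j)) ->
  exists t : pow_sec U, forall i, pow_res (CU i) t = s i.
Proof.
move=> cov s ss.
have gl (a : 'I_m) : exists t : sec F U, forall i, res (CU i) t = s i a.
  apply: (sec_glue CU cov (s := fun i => s i a)) => i j W Wi Wj.
  by have /ffunP/(_ a) := ss i j W Wi Wj; rewrite !ffunE.
have [t tP] := choice gl.
by exists [ffun a => t a] => i; apply/ffunP => a; rewrite !ffunE tP.
Qed.

Definition pow : omod :=
  OMod pow_resB pow_resZ pow_res_id pow_res_comp pow_separated pow_glue.
End Power.

(* The kernel of a morphism. *)
Section Kernel.
Variables (F G : omod) (f : hom F G).

Definition kerb (U : opens X) : {pred sec F U} := fun s => f U s == 0.

Lemma kerb_submod (U : opens X) : submod_closed (@kerb U).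
Proof.
split; first by rewrite /in_mem /= /kerb linear0.
move=> a s t; rewrite /in_mem /= /kerb => /eqP s0 /eqP t0.
by rewrite linearP s0 t0 scaler0 addr0.
Qed.

Record kersec (U : opens X) :=
  KerSec { kval :> sec F U; _ : kval \in @kerb U }.
HB.instance Definition _ (U : opens X) := [isSub for @kval U].
HB.instance Definition _ (U : opens X) := [Choice of kersec U by <:].
HB.instance Definition _ (U : opens X) :=
  GRing.SubChoice_isSubZmodule.Build (sec F U) (@kerb U) (kersec U)
    (GRing.submod_closedB (kerb_submod U)).
HB.instance Definition _ (U : opens X) :=
  GRing.SubZmodule_isSubLmodule.Build (regfun U) (sec F U) (@kerb U) (kersec U)
    (kerb_submod U).

Lemma ker_res_subproof (U V : opens X) (VU : V `<=` U) (s : kersec U) :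
  res VU (kval s) \in @kerb V.
Proof.
case: s => s /= /eqP s0; apply/eqP; rewrite hom_res s0.
by rewrite -[0]subr0 resB subrr.
Qed.

Definition ker_res (U V : opens X) (VU : V `<=` U) (s : kersec U) : kersec V :=
  KerSec (ker_res_subproof VU s).

Lemma ker_resB (U V : opens X) (VU : V `<=` U) (s t : kersec U) :
  ker_res VU (s - t) = ker_res VU s - ker_res VU t.
Proof. by apply/val_inj; rewrite /= resB. Qed.

Lemma ker_resZ (U V : opens X) (VU : V `<=` U) (a : regfun U) (s : kersec U) :
  ker_res VU (a *: s) = restr VU a *: ker_res VU s.
Proof. by apply/val_inj; rewrite /= resZ. Qed.

Lemma ker_res_id (U : opens X) (UU : U `<=` U) (s : kersec U) :
  ker_res UU s = s.
Proof. by apply/val_inj; rewrite /= res_id. Qed.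

Lemma ker_res_comp (U V W : opens X) (VU : V `<=` U) (WV : W `<=` V)
  (WU : W `<=` U) (s : kersec U) : ker_res WV (ker_res VU s) = ker_res WU s.
Proof. by apply/val_inj; rewrite /= (res_comp VU WV WU). Qed.

Lemma ker_separated (U : opens X) (I : Type) (C : I -> opens X)
  (CU : forall i, C i `<=` U) : U `<=` \bigcup_i C i ->
  forall s t : kersec U,
    (forall i, ker_res (CU i) s = ker_res (CU i) t) -> s = t.
Proof.
move=> cov s t st; apply/val_inj; apply: (sec_separated cov) => i.
exact: (congr1 (@kval _) (st i)).
Qed.

Lemma ker_glue (U : opens X) (I : Type) (C : I -> opens X)
  (CU : forall i, C i `<=` U) : U `<=` \bigcup_i C i ->
  forall s : forall i, kersec (C i),
  (forall i j (W : opens X) (Wi : W `<=` C i) (Wj : W `<=` C j),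
    ker_res Wi (s i) = ker_res Wj (s j)) ->
  exists t : kersec U, forall i, ker_res (CU i) t = s i.
Proof.
move=> cov s ss.
have [t tP] : exists t : sec F U, forall i, res (CU i) t = kval (s i).
  apply: (sec_glue CU cov (s := fun i => kval (s i))) => i j W Wi Wj.
  exact: (congr1 (@kval _) (ss i j W Wi Wj)).
have t0 : t \in @kerb U.
  apply/eqP; apply: (sec_separated cov) => i.
  rewrite -hom_res tP; case: (s i) => r /= /eqP ->.
  by rewrite -[0 in RHS]subr0 resB subrr.
by exists (KerSec t0) => i; apply/val_inj; rewrite /= tP.
Qed.

Definition ker : omod := OMod (sec := fun U => kersec U)
  ker_resB ker_resZ ker_res_id ker_res_comp ker_separated ker_glue.
End Kernel.

(* [e] is a basis of F restricted to U, i.e. it defines an isomorphism from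
   the r-th power of the structure sheaf of U. *)
Definition frame (F : omod) (r : nat) (U : opens X) (e : 'I_r -> sec F U) :=
  forall (V : opens X) (VU : V `<=` U) (s : sec F V),
    exists! a : {ffun 'I_r -> regfun V}, s = \sum_i a i *: res VU (e i).

(* Vector bundles of rank r, identified with locally free sheaves. *)
Definition bundle (F : omod) (r : nat) := forall x : X,
  exists (U : opens X) (e : 'I_r -> sec F U), oset U x /\ frame e.

(* Coherence: F is of finite type, and so is the kernel of every morphism to F
   from a finite free sheaf over an open set. *)
Definition generates (F : omod) (m : nat) (U : opens X) (s : 'I_m -> sec F U) :=
  forall (V : opens X) (VU : V `<=` U) (t : sec F V) (y : X), oset V y ->
  exists (W : opens X) (WV : W `<=` V) (WU : W `<=` U), oset W y /\
  exists a : 'I_m -> regfun W, res WV t = \sum_i a i *: res WU (s i).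

Definition relations_generated (F : omod) (m l : nat) (U V : opens X)
    (VU : V `<=` U) (s : 'I_m -> sec F U) (r : 'I_l -> 'I_m -> regfun V) :=
  (forall j, \sum_i r j i *: res VU (s i) = 0) /\
  forall (W : opens X) (WV : W `<=` V) (WU : W `<=` U) (a : 'I_m -> regfun W),
    \sum_i a i *: res WU (s i) = 0 ->
  forall y : X, oset W y ->
  exists (W' : opens X) (W'W : W' `<=` W) (W'V : W' `<=` V), oset W' y /\
  exists c : 'I_l -> regfun W',
    forall i, restr W'W (a i) = \sum_j c j * restr W'V (r j i).

Definition coherent (F : omod) :=
  (forall x : X, exists (U : opens X) (m : nat) (s : 'I_m -> sec F U),
    oset U x /\ generates s) /\
  (forall (U : opens X) (m : nat) (s : 'I_m -> sec F U) (x : X), oset U x ->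
   exists (V : opens X) (VU : V `<=` U) (l : nat)
     (r : 'I_l -> 'I_m -> regfun V), oset V x /\ relations_generated VU s r).

Definition hom_basis (E F : omod) (m : nat) (b : 'I_m -> hom E F) :=
  forall f : hom E F, exists! c : {ffun 'I_m -> k},
    forall U (s : sec E U), f U s = \sum_i cstf U (c i) *: b i U s.

Definition hom_dim (E F : omod) (m : nat) :=
  exists b : 'I_m -> hom E F, hom_basis b.

(* The map from k to End(E) is bijective. *)
Definition simple_omod (E : omod) :=
  forall f : hom E E, exists! c : k, forall U (s : sec E U),
    f U s = cstf U c *: s.

(* Ext groups are the right derived functors of Hom in the category of sheaves
   of modules: Ext^j(E, F) is the j-th cohomology of Hom(E, I) for an injective
   resolution I of F.  For coherent E and F on the noetherian X it agrees with
   the Ext of the category of coherent sheaves. *)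
Definition injective_omod (I : omod) :=
  forall (A B : omod) (i : hom A B) (f : hom A I), mono i ->
  exists g : hom B I, forall U (s : sec A U), g U (i U s) = f U s.

Record injres (F : omod) := InjRes {
  inj_obj :> nat -> omod;
  inj_d : forall j, hom (inj_obj j) (inj_obj j.+1);
  inj_aug : hom F (inj_obj 0%N);
  inj_objP : forall j, injective_omod (inj_obj j);
  inj_aug_mono : mono inj_aug;
  inj_aug_exact : exact_at inj_aug (inj_d 0%N);
  inj_exact : forall j, exact_at (inj_d j) (inj_d j.+1)
}.

Section Ext.
Variables (E F : omod) (I : injres F).

Definition cocycle (j : nat) (z : hom E (I j)) :=
  forall U (s : sec E U), inj_d I j U (z U s) = 0.

Definition coboundary (j : nat) :
    (forall U : opens X, sec E U -> sec (I j) U) -> Prop :=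
  if j is i.+1 then fun z => exists w : hom E (I i),
    forall U (s : sec E U), z U s = inj_d I i U (w U s)
  else fun z => forall U (s : sec E U), z U s = 0.

Definition ext_basis (j m : nat) (b : 'I_m -> hom E (I j)) :=
  (forall i, cocycle (b i)) /\
  forall z : hom E (I j), cocycle z -> exists! c : {ffun 'I_m -> k},
    coboundary (fun U s => z U s - \sum_i cstf U (c i) *: b i U s).
End Ext.

Definition ext_dim (E F : omod) (j m : nat) :=
  exists (I : injres F) (b : 'I_m -> hom E (I j)), ext_basis b.

(* The pairing of f with the class of z is the class of z o f. *)
Definition pairing_nondegenerate (E F : omod) := exists I : injres E,
  (forall f : hom E F,
    (forall z : hom F (I 1%N), cocycle z ->
      coboundary (fun U s => z U (f U s))) ->
    forall U (s : sec E U), f U s = 0) /\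
  (forall z : hom F (I 1%N), cocycle z ->
    (forall f : hom E F, coboundary (fun U s => z U (f U s))) ->
    coboundary (fun U s => z U s)).

Definition elliptically_exceptional (E : omod) :=
  [/\ coherent E,
      forall j : nat, ext_dim E E j (j <= 1)%N &
      forall F : omod, coherent F -> pairing_nondegenerate E F].

(* The evaluation map Hom(E, F) (x) E -> F; a basis b of Hom(E, F) identifies
   its source with E^m. *)
Section Evaluation.
Variables (E F : omod) (m : nat) (b : 'I_m -> hom E F).

Definition evalm_app (U : opens X) (s : sec (pow E m) U) : sec F U :=
  \sum_i b i U ((s : {ffun _ -> _}) i).

Lemma evalm_linear (U : opens X) : linear (@evalm_app U).
Proof.
move=> a s t; rewrite /evalm_app scaler_sumr -big_split /=.
by apply: eq_bigr => i _; rewrite !ffunE linearP.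
Qed.

HB.instance Definition _ (U : opens X) :=
  GRing.isLinear.Build (regfun U) (sec (pow E m) U) (sec F U) *:%R
    (@evalm_app U) (@evalm_linear U).

Lemma evalm_res (U V : opens X) (VU : V `<=` U) (s : sec (pow E m) U) :
  evalm_app (res VU s) = res VU (evalm_app s).
Proof.
have res0 : res VU (0 : sec F U) = 0 by rewrite -[0]subr0 resB subrr.
have resD s1 s2 : res VU (s1 + s2 : sec F U) = res VU s1 + res VU s2.
  by rewrite -[s2 in LHS]opprK -[- s2]sub0r !resB res0 sub0r opprK.
rewrite /evalm_app (big_morph _ resD res0).
by apply: eq_bigr => i _; rewrite !ffunE hom_res.
Qed.

Definition evalm : hom (pow E m) F :=
  Hom (happ := fun U => @evalm_app U) evalm_res.
End Evaluation.

Definition left_mutable (E F : omod) :=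
  (forall j : nat, j <> 0%N -> ext_dim E F j 0) /\
  exists (m : nat) (b : 'I_m -> hom E F), hom_basis b /\ epi (evalm b).

Definition is_left_mutation (E F L : omod) :=
  exists (m : nat) (b : 'I_m -> hom E F), hom_basis b /\ iso L (ker (evalm b)).

Definition two_periodic_helix (E : int -> omod) :=
  [/\ forall i, elliptically_exceptional (E i),
      forall i j : int, (i < j)%R -> ext_dim (E i) (E j) 1 0 &
      forall i, left_mutable (E (i - 1)) (E i) /\
                is_left_mutation (E (i - 1)) (E i) (E (i - 2))].

(* pi generates the maximal ideal of the local ring at p *)
Definition local_parameter (p : X) (V : opens X) (Vp : oset V p)
    (pi : regfun V) :=
  pi (point_in Vp) = 0 /\
  forall (W : opens X) (Wp : oset W p) (f : regfun W), f (point_in Wp) = 0 ->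
  exists (U : opens X) (UV : U `<=` V) (UW : U `<=` W) (h : regfun U),
    oset U p /\ restr UW f = h * restr UV pi.

(* f = u pi^m near p, away from the zeros of pi, with u a unit at p; f itself
   need not be defined at p. *)
Definition has_order (p : X) (W : opens X) (f : regfun W) (m : int) :=
  exists (V : opens X) (Vp : oset V p) (pi u : regfun V),
    [/\ local_parameter Vp pi, u (point_in Vp) != 0 &
        forall (x : X) (Wx : oset W x) (Vx : oset V x),
          pi (point_in Vx) != 0 ->
          f (point_in Wx) = u (point_in Vx) * pi (point_in Vx) ^ m].

(* A frame s over a nonempty open U is a rational section s_1 ^ ... ^ s_r of
   det F.  Its order at p is that of det g, where s = g t for a frame t near
   p. *)
Definition frame_order (F : omod) (r : nat) (U : opens X)
    (s : 'I_r -> sec F U) (p : X) (m : int) :=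
  exists (V : opens X) (t : 'I_r -> sec F V) (g : 'M[regfun (opensI U V)]_r),
    [/\ oset V p, frame t,
        forall i, res (@opensIl _ U V) (s i)
                  = \sum_j g i j *: res (@opensIr _ U V) (t j) &
        has_order p (\det g) m].

(* deg F = deg det F is the degree of the divisor of such a section. *)
Definition degree (F : omod) (d : int) :=
  exists (r : nat) (U : opens X) (s : 'I_r -> sec F U) (D : seq X)
    (o : X -> int),
    [/\ (exists x : X, oset U x) /\ frame s,
        uniq D /\ (forall p : X, p \in D <-> ~ oset U p),
        forall p : X, p \in D -> frame_order s p (o p) &
        d = \sum_(p <- D) o p].

End Modules.

Definition irreducible (T : topologicalType) (Z : set T) :=
  Z !=set0 /\ forall A B : set T, closed A -> closed B ->
    Z `<=` A `|` B -> Z `<=` A \/ Z `<=` B.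

Definition irreducible_chain (T : topologicalType) (X : set T) (l : nat) :=
  exists Z : nat -> set T,
    (forall i, (i <= l)%N -> [/\ closed (Z i), irreducible (Z i) & Z i `<=` X]) /\
    (forall i, (i < l)%N -> Z i `<` Z i.+1).

Definition dimension_one (T : topologicalType) (X : set T) :=
  irreducible_chain X 1 /\ ~ irreducible_chain X 2.

(* All local rings are regular of dimension 1. *)
Definition smooth_curve (k : fieldType) (n : nat) (X : set (pspace k n)) :=
  [/\ closed X, irreducible X, dimension_one X &
      forall p : X, exists (V : opens X) (Vp : oset V p) (pi : regfun V),
        local_parameter Vp pi].

(* The genus is the dimension of H^1(X, O) = Ext^1(O, O). *)
Definition elliptic_curve (k : fieldType) (n : nat) (X : set (pspace k n)) :=
  smooth_curve X /\ ext_dim (osheaf X) (osheaf X) 1 1.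

Definition slope (d : int) (r : nat) : rat := d%:Q / r%:R.

(* Main.v *)
Require Import Defs.
From HB Require Import structures.
From mathcomp Require Import all_boot all_order all_algebra.
From mathcomp Require Import all_classical.
From mathcomp Require Import ring_quotient generic_quotient mpoly topology_structure subtype_topology separation_axioms initial_topology.
From mathcomp Require Import fingroup perm ring lra zify.
Require Import Defs.
Set Implicit Arguments.
Unset Strict Implicit.
Unset Printing Implicit Defensive.

(** Sheaves are replaced by linear algebra over the function field K of X. A bundle of rank r
is a lattice: an invertible matrix over K at every point, whose rows span the stalk inside
K^r, almost all of these matrices being integral with integral inverse. Morphisms of bundles
are the matrices over K that are integral at every point with respect to these bases
(bundle_iso, lhom_of, of_lhom). The constant sheaf K^r followed by the sheaf of principal
parts is an injective resolution with two terms (lres_of), so that Ext^1 consists of adelic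
classes and the higher Ext vanish. The assumption that Ext^1(O, O) is a line gives a
functional on the adeles that kills the constants and the integral adeles (genus1_ext), and
Weil's argument turns it into Serre duality with trivial dualizing sheaf (weil, serre). It
follows that simple bundles are elliptically exceptional (bundle_exceptional).

Suppose that the numerical condition holds, for ranks a and b. Simplicity and duality make the
evaluation A^d -> B surjective, with a simple kernel of rank d a - b (evaluation,
left_mutation). The form d a b - a^2 - b^2 takes the same value on (d a - b, a) as on (a, b),
so that mutation can be repeated to the left; passing to duals repeats it to the right
(right_mutation). This gives a helix of lattices (lattice_helix) and, by taking sheaves, the
helix that is sought (converse).

Conversely, let a helix be given. The dimension of Hom between consecutive terms is constant
along it (helix_step), and ranks are additive along the mutation sequences, so that the ranks
satisfy x(i-2) + x(i) = d x(i-1) with all terms positive (rank_mutation, helix_ranks). Then d is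
at least 2; for d > 2 the form above is positive, and for d = 2 the ranks are constant
(helix_numbers). In the latter case let r be the common rank. Riemann-Roch (rr_simple), with
no maps from the later term back to the earlier one (helix_no_back), gives
r (d0 - dm1) = 2. So either r = 1, as claimed, or r = 2 and the degrees are consecutive
integers. The second case is impossible because a simple bundle of rank 2 has odd degree
(no_even). *)

(** Re-importing these libraries gives their names precedence over earlier parts. *)
Module Alg.
Export all_boot all_order all_algebra all_classical fingroup perm.
End Alg.
Module Geo.
Export all_boot all_order all_algebra all_classical.
Export ring_quotient generic_quotient mpoly topology_structure subtype_topology.
Export separation_axioms initial_topology fingroup perm.
End Geo.

(** * Valuation rings and row reduction *)
Module LocalRings.
Import Defs.
Import Alg.
Import Order.TTheory GRing.Theory Num.Theory.
Local Open Scope classical_set_scope.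
Local Open Scope ring_scope.

Record dvrs (k K : fieldType) (P : choiceType) := Dvrs {
  kinc : {rmorphism k -> K};
  dO : P -> K -> Prop;
  unif : P -> K;
  dO1 : forall p, dO p 1;
  dOB : forall p x y, dO p x -> dO p y -> dO p (x - y);
  dOM : forall p x y, dO p x -> dO p y -> dO p (x * y);
  dO_inc : forall p c, dO p (kinc c);
  unif_neq0 : forall p, unif p != 0;
  dO_unif : forall p, dO p (unif p);
  unif_nunit : forall p, ~ dO p (unif p)^-1;
  dO_fact : forall p x, x != 0 ->
    exists (u : K) (m : int), [/\ dO p u, dO p u^-1 & x = u * unif p ^ m];
  dO_res : forall p x, dO p x ->
    exists (c : k) (y : K), dO p y /\ x = kinc c + unif p * y;
  dO_fin : forall x, finite_set [set p | ~ dO p x]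
}.

Section Family.
Variables (k K : fieldType) (P : choiceType) (D : dvrs k K P).
Local Notation O := (dO D).
Local Notation ι := (kinc D).
Local Notation π := (unif D).

Lemma dO0 p : O p 0. Proof. by rewrite -(subrr 1); apply: dOB; apply: dO1. Qed.
Lemma dON p x : O p x -> O p (- x).
Proof. by move=> h; rewrite -sub0r; apply: dOB => //; apply: dO0. Qed.
Lemma dOD p x y : O p x -> O p y -> O p (x + y).
Proof. by move=> hx hy; rewrite -[y]opprK; apply: dOB => //; apply: dON. Qed.
Lemma dO_sum p (I : Type) (r : seq I) (Q : pred I) (F : I -> K) :
  (forall i, Q i -> O p (F i)) -> O p (\sum_(i <- r | Q i) F i).
Proof. by move=> h; apply: (big_ind (O p)) => //; [exact: dO0|exact: dOD]. Qed.
Lemma dO_prod p (I : Type) (r : seq I) (Q : pred I) (F : I -> K) :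
  (forall i, Q i -> O p (F i)) -> O p (\prod_(i <- r | Q i) F i).
Proof. by move=> h; apply: (big_ind (O p)) => //; [exact: dO1|exact: dOM]. Qed.
Lemma dOX p x n : O p x -> O p (x ^+ n).
Proof. by move=> h; elim: n => [|n IH]; rewrite ?expr0 ?exprS; [exact: dO1|exact: dOM]. Qed.

Lemma dO_valuation p x y : x != 0 ->
  (exists2 c, O p c & y = c * x) \/ (exists2 c, O p c & x = c * π p * y).
Proof.
move=> x0; have [->|y0] := eqVneq y 0.
  by left; exists 0; [exact: dO0|rewrite mul0r].
have [u [m [hu hu' ex]]] := dO_fact D p x0.
have [v [n [hv hv' ey]]] := dO_fact D p y0.
have p0 := unif_neq0 D p.
have u0 : u != 0 by apply: contraNneq x0 => u0; rewrite ex u0 mul0r.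
have v0 : v != 0 by apply: contraNneq y0 => v0; rewrite ey v0 mul0r.
have [mn|nm] := lerP m n.
  left; have [a ea] : exists a : nat, (n - m = a%:Z)%R.
    by exists `|n - m|%N; rewrite gez0_abs // subr_ge0.
  exists (v * u^-1 * π p ^+ a); first by do !apply: dOM => //; apply/dOX/dO_unif.
  rewrite ex ey; have -> : n = m + a%:Z by rewrite -ea addrC subrK.
  by rewrite expfzDr // -exprnP; field.
right; have [a ea] : exists a : nat, (m - n = a.+1%:Z)%R.
  exists `|m - n|.-1; rewrite prednK ?gez0_abs ?subr_ge0 ?ltW //.
  by rewrite absz_gt0 subr_eq0 gt_eqF.
exists (u * v^-1 * π p ^+ a); first by do !apply: dOM => //; apply/dOX/dO_unif.
rewrite ex ey; have -> : m = n + a.+1%:Z by rewrite -ea addrC subrK.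
by rewrite expfzDr // -exprnP exprS; field.
Qed.

Lemma dO_pole p x : ~ O p x -> exists2 a, O p a & a * x = (π p)^-1.
Proof.
move=> hx; have x0 : x != 0 by apply: contra_notN hx => /eqP ->; exact: dO0.
have [[c hc e]|[c hc e]] := @dO_valuation p 1 x (oner_neq0 _).
  by case: hx; rewrite e mulr1.
exists c => //; have p0 := unif_neq0 D p.
by apply: (mulfI p0); rewrite mulfV // e; ring.
Qed.

(** ** Integral matrices *)
Definition intm p m n (A : 'M[K]_(m, n)) := forall i j, O p (A i j).

Lemma intm0 p m n : intm p (0 : 'M_(m, n)).
Proof. by move=> i j; rewrite mxE; exact: dO0. Qed.
Lemma intmD p m n (A B : 'M_(m, n)) : intm p A -> intm p B -> intm p (A + B).
Proof. by move=> a b i j; rewrite mxE; exact: dOD. Qed.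
Lemma intmB p m n (A B : 'M_(m, n)) : intm p A -> intm p B -> intm p (A - B).
Proof. by move=> a b i j; rewrite !mxE; exact: dOB. Qed.
Lemma intmN p m n (A : 'M_(m, n)) : intm p A -> intm p (- A).
Proof. by move=> a i j; rewrite !mxE; exact: dON. Qed.
Lemma intmM p m n l (A : 'M_(m, n)) (B : 'M_(n, l)) :
  intm p A -> intm p B -> intm p (A *m B).
Proof. by move=> a b i j; rewrite !mxE; apply: dO_sum => t _; exact: dOM. Qed.
Lemma intmZ p m n a (A : 'M_(m, n)) : O p a -> intm p A -> intm p (a *: A).
Proof. by move=> ha hA i j; rewrite !mxE; exact: dOM. Qed.
Lemma intm_tr p m n (A : 'M_(m, n)) : intm p A -> intm p A^T.
Proof. by move=> a i j; rewrite mxE. Qed.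
Lemma intm_scalar p n a : O p a -> intm p (a%:M : 'M_n).
Proof. by move=> h i j; rewrite mxE; case: eqP => _; [exact: h|exact: dO0]. Qed.
Lemma intm1 p n : intm p (1%:M : 'M_n).
Proof. exact/intm_scalar/dO1. Qed.
Lemma intm_det p n (A : 'M_n) : intm p A -> O p (\det A).
Proof.
move=> h; apply: dO_sum => s _; apply: dOM; last by apply: dO_prod => i _.
by apply: dOX; apply: dON; apply: dO1.
Qed.
Lemma intm_adj p n (A : 'M_n) : intm p A -> intm p (\adj A).
Proof.
move=> h i j; rewrite mxE; apply: dOM.
  by apply: dOX; apply: dON; apply: dO1.
by apply: intm_det => a b; rewrite !mxE.
Qed.
Lemma intm_row p m n (A : 'M_(m, n)) : (forall i, intm p (row i A)) -> intm p A.
Proof. by move=> h i j; have := h i ord0 j; rewrite mxE. Qed.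
Lemma intm_pid p m n r : intm p (pid_mx r : 'M_(m, n)).
Proof. by move=> i j; rewrite mxE; case: (_ && _); [exact: dO1|exact: dO0]. Qed.
Lemma intm_block p m1 m2 n1 n2 (A : 'M_(m1, n1)) (B : 'M_(m1, n2))
    (C : 'M_(m2, n1)) (E : 'M_(m2, n2)) :
  intm p A -> intm p B -> intm p C -> intm p E -> intm p (block_mx A B C E).
Proof.
move=> a b c d i j; rewrite mxE; case: (fintype.split i) => x; rewrite mxE;
  case: (fintype.split j) => y; [exact: a|exact: b|exact: c|exact: d].
Qed.
Lemma intm_perm p n (s : {perm 'I_n}) : intm p (perm_mx s : 'M_n).
Proof. by move=> i j; rewrite !mxE; case: eqP => _; [exact: dO1|exact: dO0]. Qed.

Definition unimod p n (g : 'M[K]_n) :=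
  [/\ g \in unitmx, intm p g & intm p (invmx g)].

Lemma unimod_mul p n (g h : 'M_n) : unimod p g -> unimod p h -> unimod p (g *m h).
Proof.
move=> [ug ig ig'] [uh ih ih']; split; first by rewrite unitmx_mul ug.
  exact: intmM.
have -> : invmx (g *m h) = invmx h *m invmx g.
  have u : g *m h \in unitmx by rewrite unitmx_mul ug.
  apply: (can_inj (mulKmx u)).
  by rewrite mulmxV // -mulmxA mulKVmx // mulmxV.
exact: intmM.
Qed.

Lemma unimod_of_inv p n (g h : 'M_n) : intm p g -> intm p h -> g *m h = 1%:M ->
  unimod p g.
Proof.
move=> ig ih e; have [ug _] := mulmx1_unit e; split => //.
by rewrite -[invmx g]mulmx1 -e mulKmx.
Qed.

(* Row reduction over the valuation ring: pivot on an entry of least valuation. *)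
(** Gaussian elimination works over a valuation ring when the pivot is an entry of least
valuation, because the other entries of its column are then integral multiples of it. The
zero rows that remain give the relations between the rows of S. *)
Lemma echelon p m n (S : 'M[K]_(m, n)) : exists (g : 'M_m) (l : nat) (B : 'M_(l, n)),
  [/\ unimod p g, row_free B, (l <= m)%N & g *m S = pid_mx l *m B].
Proof.
elim: m => [|m IH] in S *.
  exists 1%:M, 0%N, 0; split => //; last by apply/matrixP => [[]].
    by split; [exact: unitmx1|exact: intm1|rewrite invmx1; exact: intm1].
  by rewrite /row_free mxrank0.
have [->|S0] := eqVneq S 0.
  exists 1%:M, 0%N, 0; split => //; last by rewrite !mulmx0.
    by split; [exact: unitmx1|exact: intm1|rewrite invmx1; exact: intm1].
  by rewrite /row_free mxrank0.
have [j [i Sij]] : exists j i, S i j != 0.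
  apply: contrapT => h; move/eqP: S0; apply; apply/matrixP => i j; rewrite mxE.
  by apply: contrapT => /eqP e; apply: h; exists j, i.
have [i0 [Si0 hmin]] : exists i0, S i0 j != 0 /\
    forall i, exists2 c, O p c & S i j = c * S i0 j.
  have H (l : seq 'I_m.+1) : exists i0, S i0 j != 0 /\
      forall i, i \in l -> exists2 c, O p c & S i j = c * S i0 j.
    elim: l => [|a l [i1 [h1 h2]]]; first by exists i.
    have [h|[c hc e]] := @dO_valuation p _ (S a j) h1.
      by exists i1; split => // b; rewrite inE => /orP[/eqP ->|/h2].
    have a0 : S a j != 0 by apply: contraNneq h1 => e0; rewrite e e0 mulr0.
    exists a; split => // b; rewrite inE => /orP[/eqP ->|/h2 [d hd ed]].
      by exists 1; [exact: dO1|rewrite mul1r].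
    exists (d * (c * π p)); last by rewrite ed e; ring.
    by do !apply: dOM => //; exact: dO_unif.
  have [i0 [h1 h2]] := H (enum 'I_m.+1).
  by exists i0; split => // b; apply: h2; rewrite mem_enum.
pose s := tperm ord0 i0.
pose T : 'M_(1 + m, n) := row_perm s S.
have T0 : T ord0 j != 0 by rewrite mxE tpermL.
have /choice[c hc] : forall i : 'I_m, exists c, O p c /\ (dsubmx T) i j = c * T ord0 j.
  move=> a; rewrite !mxE tpermL; have [c h1 h2] := hmin (s (rshift 1 a)).
  by exists c.
pose C : 'M_(m, 1) := \matrix_(a, b) c a.
pose E : 'M_(1 + m) := block_mx 1%:M 0 (- C) 1%:M.
have hE : unimod p E.
  have iC : intm p C by move=> a b; rewrite mxE; case: (hc a).
  apply: (@unimod_of_inv _ _ _ (block_mx 1%:M 0 C 1%:M)).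
  - by apply: intm_block; [exact: intm1|exact: intm0|exact: intmN|exact: intm1].
  - by apply: intm_block; [exact: intm1|exact: intm0| |exact: intm1].
  rewrite mulmx_block !mul1mx !mul0mx !mulmx0 !mulmx1 addr0 addNr !add0r.
  by rewrite -scalar_mx_block.
pose u := usubmx T; pose S1 := dsubmx T - C *m u.
have ET : E *m T = col_mx u S1.
  rewrite -[T]vsubmxK mul_block_col !mul1mx mul0mx addr0 mulNmx.
  by rewrite /S1 addrC.
have u0 : u ord0 j = T ord0 j by rewrite mxE; congr (T _ _); exact: val_inj.
have S1j a : S1 a j = 0.
  rewrite /S1 mxE (hc a).2 [X in _ + X]mxE [X in _ - X]mxE big_ord1 u0.
  by rewrite [C _ _]mxE subrr.
have [g [l [B [hg fB lm e]]]] := IH S1.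
pose G : 'M_(1 + m) := block_mx 1%:M 0 0 g.
have hG : unimod p G.
  case: hg => ug ig ig'; apply: (@unimod_of_inv _ _ _ (block_mx 1%:M 0 0 (invmx g))).
  - by apply: intm_block => //; [exact: intm1|exact: intm0|exact: intm0].
  - by apply: intm_block => //; [exact: intm1|exact: intm0|exact: intm0].
  rewrite mulmx_block !mul1mx !mul0mx !mulmx0 !addr0 add0r mulmxV //.
  by rewrite -scalar_mx_block.
have hP : unimod p (perm_mx s : 'M_(1 + m)).
  apply: (@unimod_of_inv _ _ _ (perm_mx s)); try exact: intm_perm.
  by rewrite -perm_mxM tperm2 perm_mx1.
exists (G *m (E *m perm_mx s)), (1 + l)%N, (col_mx u B); split.
- by apply: unimod_mul => //; apply: unimod_mul.
- apply/row_freeP; have /row_freeP[B' hB'] := fB.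
  have Bj a : B a j = 0.
    have ->: B = (pid_mx l : 'M_(l, m)) *m (g *m S1).
      by rewrite e mulmxA mul_pid_mx minnn (minn_idPr lm) pid_mx_1 mul1mx.
    rewrite mulmxA mxE big1 // => b _; rewrite S1j mulr0 //.
  pose w : 'M_(n, 1) := (u ord0 j)^-1 *: delta_mx j ord0.
  have uw : u *m w = 1%:M.
    rewrite -scalemxAr -colE; apply/matrixP => a b; rewrite !ord1.
    by rewrite [LHS]mxE [col j u _ _]mxE mulVf ?u0 // mxE eqxx.
  have Bw : B *m w = 0.
    rewrite -scalemxAr -colE; apply/matrixP => a b.
    by rewrite [LHS]mxE [col j B _ _]mxE Bj mulr0 mxE.
  exists (row_mx w (B' - w *m (u *m B'))).
  rewrite mul_col_row !mulmxBr !mulmxA uw mul1mx subrr Bw !mul0mx subr0 hB'.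
  by rewrite -scalar_mx_block.
- by [].
have -> : G *m (E *m perm_mx s) *m S = G *m col_mx u S1.
  by rewrite -!mulmxA -ET /T row_permE.
rewrite mul_block_col !mul1mx !mul0mx addr0 add0r e.
have -> : (pid_mx (1 + l) : 'M[K]_(1 + m, 1 + l)) = block_mx 1%:M 0 0 (pid_mx l).
  apply/matrixP => a b; rewrite [RHS]mxE.
  by case: (fintype.splitP a) => x ex; rewrite [RHS]mxE;
    case: (fintype.splitP b) => y ey; rewrite !mxE ex ey ?ord1 //= ltnS.
by rewrite (mul_block_col 1%:M 0 0 (pid_mx l) u B) !mul1mx !mul0mx addr0 add0r.
Qed.
End Family.
End LocalRings.

(** * Adeles in genus one and Weil's duality *)
Module Adeles.
Import Defs.
Export LocalRings.
Import Alg.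
Import Order.TTheory GRing.Theory Num.Theory.
Local Open Scope classical_set_scope.
Local Open Scope ring_scope.

Section Adeles.
Variables (k K : fieldType) (P : choiceType) (D : dvrs k K P).
Local Notation O := (dO D).
Local Notation ι := (kinc D).
Local Notation π := (unif D).

Definition at_ (V : zmodType) (p : P) (x : V) : P -> V :=
  fun q => if q == p then x else 0.

Definition adele (a : P -> K) := finite_set [set p | ~ O p (a p)].
Definition split (a : P -> K) := exists x, forall p, O p (a p - x).

Lemma adele_cst x : adele (fun=> x).
Proof. exact: dO_fin. Qed.

Lemma adele_int a : (forall p, O p (a p)) -> adele a.
Proof. by move=> h; rewrite /adele (_ : mkset _ = set0) // -subset0 => p /=. Qed.

Lemma adele_at p x : adele (at_ p x).
Proof.
apply: (sub_finite_set _ (finite_set1 p)) => q /=; rewrite /at_.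
by case: eqP => // _ []; exact: dO0.
Qed.

Lemma adeleD a b : adele a -> adele b -> adele (fun p => a p + b p).
Proof.
move=> ha hb; apply: (@sub_finite_set _ _ ([set p | ~ O p (a p)] `|` [set p | ~ O p (b p)])).
  move=> p /= h; apply: contrapT => /not_orP[/contrapT h1 /contrapT h2].
  by apply: h; exact: dOD.
by rewrite finite_setU.
Qed.

Lemma adeleM a b : adele a -> adele b -> adele (fun p => a p * b p).
Proof.
move=> ha hb; apply: (@sub_finite_set _ _ ([set p | ~ O p (a p)] `|` [set p | ~ O p (b p)])).
  move=> p /= h; apply: contrapT => /not_orP[/contrapT h1 /contrapT h2].
  by apply: h; exact: dOM.
by rewrite finite_setU.
Qed.

Lemma adeleN a : adele a -> adele (fun p => - a p).
Proof. by apply: sub_finite_set => p /= h h'; apply: h; exact: dON. Qed.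

Lemma adeleB a b : adele a -> adele b -> adele (fun p => a p - b p).
Proof. by move=> ha hb; apply: adeleD => //; exact: adeleN. Qed.

(** The functional om plays the role of the residue of a regular differential: in genus one
the adeles modulo the integral ones and the constants form a line. *)
Record genus1 := Genus1 {
  om : (P -> K) -> k;
  omD : forall a b, adele a -> adele b -> om (fun p => a p + b p) = om a + om b;
  omZ : forall c a, adele a -> om (fun p => ι c * a p) = c * om a;
  om_split : forall a, adele a -> om a = 0 <-> split a;
  om_unit : exists2 a, adele a & om a = 1
}.

Lemma genus1_of (a0 : P -> K) : adele a0 ->
  (forall a, adele a -> exists! c : k, split (fun p => a p - ι c * a0 p)) ->
  inhabited genus1.
Proof.
move=> ha0 H.
have /choice[f hf] : forall a, exists c : k, adele a ->
    split (fun p => a p - ι c * a0 p) /\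
    forall c', split (fun p => a p - ι c' * a0 p) -> c = c'.
  move=> a; have [ha|na] := pselect (adele a); last by exists 0.
  by have [c [h1 h2]] := H _ ha; exists c.
have fE a c : adele a -> split (fun p => a p - ι c * a0 p) -> f a = c.
  by move=> ha hc; exact: (hf a ha).2.
have acst c a : adele a -> adele (fun p => ι c * a p).
  by move=> h; apply: adeleM => //; exact: adele_cst.
constructor; exists f.
- move=> a b ha hb; apply: fE; first exact: adeleD.
  have [[x hx] _] := hf _ ha; have [[y hy] _] := hf _ hb.
  exists (x + y) => p; have := dOD (hx p) (hy p); rewrite rmorphD.
  by congr (dO D p _); ring.
- move=> c a ha; apply: fE; first exact: acst.
  have [[x hx] _] := hf _ ha; exists (ι c * x) => p.
  have := dOM (dO_inc D p c) (hx p); rewrite rmorphM.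
  by congr (dO D p _); ring.
- move=> a ha; split => [f0|[x hx]]; last first.
    by apply: fE => //; exists x => p; rewrite rmorph0 mul0r subr0.
  have [[x hx] _] := hf _ ha; exists x => p.
  by have := hx p; rewrite f0 rmorph0 mul0r subr0.
- exists a0 => //; apply: fE => //; exists 0 => p.
  by rewrite rmorph1 mul1r !subr0 subrr; exact: dO0.
Qed.

Section Genus1.
Variable G : genus1.
Local Notation ω := (om G).

Lemma om_ext a b : (forall p, a p = b p) -> ω a = ω b.
Proof. by move=> h; congr (om G _); apply/funext. Qed.

Lemma om_int a : (forall p, O p (a p)) -> ω a = 0.
Proof.
move=> h; apply/om_split; first exact: adele_int.
by exists 0 => p; rewrite subr0.
Qed.

Lemma om_cst x : ω (fun=> x) = 0.
Proof.
apply/om_split; first exact: adele_cst.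
by exists x => p; rewrite subrr; exact: dO0.
Qed.

Lemma omB a b : adele a -> adele b -> ω (fun p => a p - b p) = ω a - ω b.
Proof.
move=> ha hb; rewrite omD //; last exact: adeleN.
have := omZ G (-1) hb; rewrite rmorphN1 mulN1r => <-; congr (_ + _).
by apply: om_ext => p; rewrite mulN1r.
Qed.

Lemma om_at_int p x y : O p (x - y) -> ω (at_ p x) = ω (at_ p y).
Proof.
move=> h; apply/eqP; rewrite -subr_eq0 -omB; try exact: adele_at.
apply/eqP/om_int => q; rewrite /at_; case: eqP => [->//|_].
by rewrite subrr; exact: dO0.
Qed.

Lemma mult_const x : (forall a, (forall p, O p (a p)) -> split (fun p => x * a p)) ->
  exists c, x = ι c.
Proof.
move=> hx; have [a0 ha0 w0] := om_unit G.
have xcst a : adele a -> adele (fun p => x * a p).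
  by move=> h; apply: adeleM => //; exact: adele_cst.
pose c := ω (fun p => x * a0 p).
have key a : adele a -> ω (fun p => x * a p) = c * ω a.
  move=> ha; pose b p := a p - ι (ω a) * a0 p.
  have h0 : adele (fun p => ι (ω a) * a0 p) by apply: adeleM => //; exact: adele_cst.
  have hb : adele b by exact: adeleB.
  have [y hy] : split b.
    by apply/(om_split G hb); rewrite omB // omZ // w0 mulr1 subrr.
  have hxy : split (fun p => x * b p).
    have [z hz] := hx (fun p => b p - y) hy.
    exists (z + x * y) => p; have := hz p; congr (dO D p _); ring.
  move/(om_split G (xcst _ hb)): hxy => e0.
  rewrite [c * _]mulrC /c -omZ; last exact: xcst.
  rewrite -[RHS]addr0 -e0 -omD; last exact: xcst.
    by apply: om_ext => p; rewrite /b; ring.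
  by apply: adeleM; [exact: adele_cst|exact: xcst].
exists c; apply: contrapT => /eqP; rewrite -subr_eq0 => xc.
pose b p := (x - ι c)^-1 * a0 p.
have hb : adele b by apply: adeleM => //; exact: adele_cst.
suff : ω a0 = 0 by rewrite w0 => /eqP; rewrite oner_eq0.
transitivity (ω (fun p => x * b p - ι c * b p)).
  by apply: om_ext => p; rewrite -mulrBl /b mulrA mulfV // mul1r.
rewrite omB ?key ?omZ ?subrr //; first exact: xcst.
by apply: adeleM => //; exact: adele_cst.
Qed.

Lemma no_simple_pole p x : (forall q, q != p -> O q x) -> O p (π p * x) -> O p x.
Proof.
move=> hx hp; apply: contrapT => np; apply: np.
have [c ->] : exists c, x = ι c; last exact: dO_inc.
apply: mult_const => a ha.
have [c [y [hy e]]] := dO_res (ha p).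
exists (ι c * x) => q; have [->|qp] := eqVneq q p.
  by have := dOM hp hy; rewrite e; congr (dO D p _); ring.
apply: dOB; apply: dOM => //; [exact: hx|exact: dO_inc|exact: hx].
Qed.

Lemma om_pole p : ω (at_ p (π p)^-1) != 0.
Proof.
apply/eqP => /(om_split G (adele_at _ _))[y hy].
have hp := hy p; rewrite /at_ eqxx in hp.
suff hO : O p y by apply: (@unif_nunit _ _ _ D p); have := dOD hp hO; rewrite subrK.
apply: no_simple_pole => [q qp|].
  by have := dON (hy q); rewrite /at_ (negPf qp) sub0r opprK.
have := dOB (dO1 D p) (dOM (dO_unif D p) hp).
by rewrite mulrBr mulfV ?unif_neq0 // subKr.
Qed.

Lemma om_nondeg p x : ~ O p x -> exists2 a, O p a & ω (at_ p (a * x)) != 0.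
Proof. by move=> h; have [a ha e] := dO_pole h; exists a => //; rewrite e om_pole. Qed.

Lemma approx (L : seq P) b : L != [::] -> adele b ->
  exists f, forall p, O p (π p ^+ (count_mem p L) * (b p - f)).
Proof.
case: L => // q0 L _ hb.
pose c := ω b / ω (at_ q0 (π q0)^-1).
have h0 : adele (fun p => ι c * at_ q0 (π q0)^-1 p).
  by apply: adeleM; [exact: adele_cst|exact: adele_at].
have [f hf] : split (fun p => b p - ι c * at_ q0 (π q0)^-1 p).
  apply/(om_split G); first exact: adeleB.
  rewrite omB // omZ; last exact: adele_at.
  by rewrite /c mulfVK ?subrr // om_pole.
exists f => p; have hp := hf p; rewrite /at_ in hp.
have [e|np] := eqVneq p q0; last first.
  rewrite (negPf np) mulr0 subr0 in hp.
  by apply: dOM => //; apply/dOX/dO_unif.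
rewrite -e eqxx /= in hp; rewrite -e /= eqxx exprS /=.
rewrite mulrAC; apply: dOM; last by apply/dOX/dO_unif.
have h1 := dOD (dOM (dO_unif D p) hp) (dO_inc D p c).
move: h1; congr (dO D p _).
have := unif_neq0 D p; move: (π p) => z z0; field => //.
Qed.

(** Induction on L, one point at a time: the adeles that are small along L exceed those that
are small along p :: L by a line, spanned by an adele t at p. The base case is genus one
itself, where the classes modulo constants and integral adeles form a line on which om is a
coordinate. *)
Theorem weil (L : seq P) (l : (P -> K) -> k) :
  (forall a b, adele a -> adele b -> l (fun p => a p + b p) = l a + l b) ->
  (forall c a, adele a -> l (fun p => ι c * a p) = c * l a) ->
  (forall x, l (fun=> x) = 0) ->
  (forall a, (forall p, exists2 y, O p y & a p = π p ^+ (count_mem p L) * y) -> l a = 0) ->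
  exists x, forall a, adele a -> l a = ω (fun p => x * a p).
Proof.
have xcst x a : adele a -> adele (fun p => x * a p).
  by move=> h; apply: adeleM => //; exact: adele_cst.
have xcst2 x y a : adele a -> adele (fun p => x * (y * a p)).
  by move=> h; apply: (xcst x (fun p => y * a p)); exact: xcst.
have smallP L' a : (forall p, exists2 y, O p y & a p = π p ^+ (count_mem p L') * y) ->
    forall p, O p (a p).
  by move=> h p; have [y hy ->] := h p; apply: dOM => //; apply/dOX/dO_unif.
have base l' : (forall a b, adele a -> adele b -> l' (fun p => a p + b p) = l' a + l' b) ->
  (forall c a, adele a -> l' (fun p => ι c * a p) = c * l' a) ->
  (forall x, l' (fun=> x) = 0) -> (forall a, (forall p, O p (a p)) -> l' a = 0) ->
  exists x, forall a, adele a -> l' a = ω (fun p => x * a p).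
  move=> lD lZ lK lL.
  have [a0 ha0 w0] := om_unit G.
  exists (ι (l' a0)) => a ha.
  rewrite omZ // mulrC -lZ //.
  have h0 : adele (fun p => ι (ω a) * a0 p) by exact: xcst.
  have [x hx] : split (fun p => a p - ι (ω a) * a0 p).
    by apply/(om_split G (adeleB ha h0)); rewrite omB // omZ // w0 mulr1 subrr.
  move: (ω a) h0 x hx => c h0 x hx.
  transitivity (l' (fun p => ι c * a0 p + (x + (a p - ι c * a0 p - x)))).
    by congr l'; apply/funext => p; ring.
  have hi : adele (fun p => a p - ι c * a0 p - x) by exact: adele_int.
  rewrite lD //; last by apply: adeleD => //; exact: adele_cst.
  rewrite (lD (fun=> x) (fun p => _ - x)) //; last exact: adele_cst.
  by rewrite lK add0r (lL (fun p => _ - x)) ?addr0.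
elim: L l => [|p L IH] l lD lZ lK lL.
  by apply: base => // a ha; apply: lL => p; exists (a p); rewrite //= expr0 mul1r.
pose n := count_mem p L; pose t := at_ p (π p ^+ n).
have cnt q : count_mem q (p :: L) = ((p == q) + count_mem q L)%N by [].
have ht : adele t by exact: adele_at.
(* the part of a small adele that is seen by the residue at p *)
have dec a : (forall q, exists2 y, O q y & a q = π q ^+ (count_mem q L) * y) ->
    exists (c : k) (r : P -> K), a = (fun q => ι c * t q + r q) /\
      forall q, exists2 y, O q y & r q = π q ^+ (count_mem q (p :: L)) * y.
  move=> ha; have [y hy ey] := ha p; have [c [z [hz ez]]] := dO_res hy.
  exists c, (fun q => a q - ι c * t q); split; first by apply/funext => q; ring.
  move=> q; rewrite cnt eq_sym /t /at_; have [->|qp] := eqVneq q p.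
    by exists z => //; rewrite ey ez -/n exprD expr1; ring.
  by rewrite mulr0 subr0; exact: ha.
have [L0|L0] := eqVneq L [::].
  (* a constant minus its part at p is small *)
  have lt : l t = 0.
    have := lK 1; rewrite (_ : (fun=> 1) = fun q => t q + (if q == p then 0 else 1)).
      rewrite lD //; last first.
        by apply: adele_int => q; case: eqP => _; [exact: dO0|exact: dO1].
      rewrite [X in _ + X]lL ?addr0 // => q; rewrite cnt L0 /= addn0 eq_sym.
      case: eqP => _; first by exists 0; [exact: dO0|rewrite mulr0].
      by exists 1; [exact: dO1|rewrite expr0 mul1r].
    apply/funext => q; rewrite /t /at_ /n L0 /= expr0.
    by case: eqP => _; rewrite ?addr0 ?add0r.
  apply: base => // a ha; have [|c [r [-> hr]]] := dec a.
    by move=> q; exists (a q) => //; rewrite L0 /= expr0 mul1r.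
  have har := adele_int (smallP _ _ hr).
  by rewrite lD ?lZ ?lt ?mulr0 ?lL ?addr0 //; exact: xcst.
have [f0 hf0] := approx L0 (adele_at p (π p ^- n.+1)).
have p0 := unif_neq0 D p.
have hfp : O p (π p ^+ n * f0 - (π p)^-1).
  have := dON (hf0 p); rewrite /at_ eqxx -/n; congr (dO D p _).
  by rewrite exprS invfM mulrBr mulrCA mulfV ?expf_neq0 // mulr1 opprB.
have hfq q : q != p -> O q (π q ^+ count_mem q L * f0).
  move=> qp; have := dON (hf0 q); rewrite /at_ (negPf qp) sub0r mulrN.
  by rewrite opprK.
have hfs a : (forall q, exists2 y, O q y & a q = π q ^+ (count_mem q (p :: L)) * y) ->
    forall q, O q (f0 * a q).
  move=> ha q; have [y hy ->] := ha q; rewrite cnt eq_sym.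
  have [e|qp] := eqVneq q p.
    subst q; have := dOM (dOD (dOM (dO_unif D p) hfp) (dO1 D p)) hy.
    by congr (dO D p _); rewrite -/n add1n exprS; field.
  by rewrite add0n mulrA; apply: dOM => //; rewrite mulrC; exact: hfq.
have wt : ω (fun q => f0 * t q) != 0.
  rewrite (om_ext (b := at_ p (f0 * π p ^+ n))) => [|q]; last first.
    by rewrite /t /at_; case: eqP => _; rewrite ?mulr0.
  by rewrite (om_at_int (y := (π p)^-1)) ?om_pole // mulrC.
pose c0 := l t / ω (fun q => f0 * t q).
pose l' a := l a - ω (fun q => ι c0 * (f0 * a q)).
have [| | | |x hx] := IH l'.
- move=> a b ha hb; rewrite /l' lD // [RHS]addrACA -opprD -omD; try exact: xcst2.
  by congr (_ - _); apply: om_ext => q; ring.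
- move=> c a ha; rewrite /l' lZ // mulrBr -omZ; last exact: xcst2.
  by congr (_ - _); apply: om_ext => q; ring.
- move=> y; by rewrite /l' lK (om_cst (ι c0 * (f0 * y))) subr0.
- move=> a /dec[c [r [-> hr]]]; have har := adele_int (smallP _ _ hr).
  rewrite /l' lD ?lZ ?(lL _ hr) ?addr0 //; last exact: xcst.
  transitivity (c * l t - ω (fun q => ι c * (ι c0 * (f0 * t q)) + ι c0 * (f0 * r q))).
    by congr (_ - _); apply: om_ext => q; ring.
  rewrite omD; [|by apply: (xcst _ (fun q => ι c0 * _)); exact: xcst2|exact: xcst2].
  rewrite (omZ G c (xcst2 _ _ _ ht)) (omZ G c0 (xcst _ _ ht)) (omZ G c0 (xcst _ _ har)).
  rewrite (om_int (hfs _ hr)) mulr0 addr0.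
  by rewrite /c0 mulfVK // subrr.
exists (x + ι c0 * f0) => a ha; rewrite -[l a](subrK (ω (fun q => ι c0 * (f0 * a q)))).
rewrite -/(l' a) hx // -omD; [|exact: xcst|exact: xcst2].
by apply: om_ext => q; ring.
Qed.
End Genus1.
End Adeles.
End Adeles.

(** * Lattices and Serre duality *)
Module SerreDuality.
Import Defs.
Export Adeles.
Import Alg.
Import Order.TTheory GRing.Theory Num.Theory.
Local Open Scope classical_set_scope.
Local Open Scope ring_scope.

Section Lattices.
Variables (k K : fieldType) (P : choiceType) (D : dvrs k K P).
Local Notation O := (dO D).
Local Notation ι := (kinc D).
Local Notation π := (unif D).
Local Notation intm := (intm D).

Lemma finite_or (A B : P -> Prop) : finite_set [set p | ~ A p] -> finite_set [set p | ~ B p] ->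
  finite_set [set p | ~ (A p /\ B p)].
Proof.
move=> a b; apply: (@sub_finite_set _ _ ([set p | ~ A p] `|` [set p | ~ B p])).
  by move=> p /= /not_andP.
by rewrite finite_setU.
Qed.

Lemma finite_imp (A B : P -> Prop) : (forall p, A p -> B p) ->
  finite_set [set p | ~ A p] -> finite_set [set p | ~ B p].
Proof. by move=> h; apply: sub_finite_set => p /= nB a; apply: nB; exact: h. Qed.

Lemma finite_forall (I : finType) (A : I -> P -> Prop) :
  (forall i, finite_set [set p | ~ A i p]) -> finite_set [set p | ~ forall i, A i p].
Proof.
move=> h; apply: (@sub_finite_set _ _ (\bigcup_(i in [set: I]) [set p | ~ A i p])).
  by move=> p /= /existsNP[i hi]; exists i.
by apply: bigcup_finite.
Qed.

Lemma intm_fin m n (A : 'M_(m, n)) : finite_set [set p | ~ intm p A].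
Proof. by apply: finite_forall => i; apply: finite_forall => j; exact: dO_fin. Qed.

Lemma tr_delta m n (X : 'M[K]_(m, n)) i j : \tr (delta_mx j i *m X) = X i j.
Proof.
rewrite /mxtrace (bigD1 j) //= [X in _ + X]big1 ?addr0 => [|a aj]; last first.
  by rewrite mxE big1 // => b _; rewrite mxE (negPf aj) mul0r.
rewrite mxE (bigD1 i) //= big1 ?addr0 => [|b bi]; last by rewrite mxE (negPf bi) andbF mul0r.
by rewrite mxE !eqxx mul1r.
Qed.

Lemma functional (V : lmodType K) (W : set V) (v : V) :
  W 0 -> (forall x y, W x -> W y -> W (x + y)) -> (forall c x, W x -> W (ι c *: x)) ->
  ~ W v -> exists l : V -> k, [/\ forall x y, l (x + y) = l x + l y,
    forall c x, l (ι c *: x) = c * l x, forall x, W x -> l x = 0 & l v != 0].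
Proof.
move=> W0 WD WZ nv.
pose sub (A : set V) := [/\ W `<=` A, forall x y, A x -> A y -> A (x + y),
  forall c x, A x -> A (ι c *: x) & ~ A v].
have [|M [hM maxM]] := @Zorn_bigcup V (fun A => A = set0 \/ sub A).
  move=> F hF tF; have [h|] := pselect (exists A, F A /\ sub A); last first.
    move=> h; left; rewrite -subset0 => x [A FA Ax].
    by have [e|sA] := hF A FA; [rewrite e in Ax|case: h; exists A].
  have [A0 [FA0 sA0]] := h; right; split.
  - by move=> x Wx; exists A0 => //; case: sA0 => h1 _ _ _; exact: h1.
  - move=> x y [A FA Ax] [B FB By].
    have sAB C : F C -> C !=set0 -> sub C.
      by move=> /hF[->|//] [].
    have [AB|BA] := tF _ _ FA FB.
      exists B => //; have [_ hD _ _] := sAB B FB (ex_intro _ y By).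
      by apply: hD => //; exact: AB.
    exists A => //; have [_ hD _ _] := sAB A FA (ex_intro _ x Ax).
    by apply: hD => //; exact: BA.
  - move=> c x [A FA Ax]; exists A => //.
    have [e|[_ _ hZ _]] := hF A FA; [by rewrite e in Ax|exact: hZ].
  - by move=> [A FA Av]; have [e|[]] := hF A FA; [rewrite e in Av|].
have {hM}[WM MD MZ nM] : sub M.
  case: hM => // e; case: (maxM W); last by right; split.
  by rewrite e; split => // h; exact: (h 0).
have key x : exists c : k, M (x - ι c *: v).
  have [Mx|nx] := pselect (M x); first by exists 0; rewrite rmorph0 scale0r subr0.
  apply: contrapT => hx; pose B := [set y | exists c m, M m /\ y = m + ι c *: x].
  case: (maxM B).
    split => [y My|h]; first by exists 0, y; rewrite rmorph0 scale0r addr0.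
    apply: nx; apply: h; exists 1, 0; split; first exact: WM.
    by rewrite rmorph1 scale1r add0r.
  right; split.
  - by move=> y /WM My; exists 0, y; rewrite rmorph0 scale0r addr0.
  - move=> y z [c [m [hm ->]]] [c' [m' [hm' ->]]]; exists (c + c'), (m + m').
    by split; [exact: MD|rewrite rmorphD scalerDl addrACA].
  - move=> c y [c' [m' [hm' ->]]]; exists (c * c'), (ι c *: m').
    by split; [exact: MZ|rewrite rmorphM scalerDr scalerA].
  - move=> [c [m [hm ev]]]; apply: hx; exists c^-1.
    have c0 : ι c != 0.
      by apply: contra_notN nM => /eqP c0; rewrite ev c0 scale0r addr0.
    rewrite ev scalerDr scalerA fmorphV mulVf // scale1r opprD addrCA subrr addr0.
    by rewrite -scaleNr -[- _]mulN1r -(rmorphN1 ι) -fmorphV -rmorphM; exact: MZ.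
have MB x y : M x -> M y -> M (x - y).
  move=> hx hy; rewrite -scaleN1r -(rmorphN1 ι); apply: MD => //; exact: MZ.
have uniq c x c' : M (x - ι c *: v) -> M (x - ι c' *: v) -> c = c'.
  move=> h h'; have := MB _ _ h' h; rewrite opprB addrC addrA subrK -scalerBl -rmorphB.
  move=> hc; apply/eqP; rewrite -subr_eq0; apply: contra_notT nM => c0.
  have := MZ (c - c')^-1 _ hc; rewrite scalerA -rmorphM mulVf // rmorph1.
  by rewrite scale1r.
have [l hl] := choice key.
have lE x c : M (x - ι c *: v) -> l x = c by move=> h; exact: uniq (hl x) h.
exists l; split.
- move=> x y; apply: lE; rewrite rmorphD scalerDl opprD addrACA.
  exact: MD.
- by move=> c x; apply: lE; rewrite rmorphM -scalerA -scalerBr; exact: MZ.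
- by move=> x Wx; apply: lE; rewrite rmorph0 scale0r subr0; exact: WM.
- rewrite (lE v 1) ?oner_neq0 // rmorph1 scale1r subrr.
  exact: WM.
Qed.

Lemma denominator p (I : finType) (F : I -> K) : exists n, forall i, O p (π p ^+ n * F i).
Proof.
have /choice[n hn] : forall i, exists n, O p (π p ^+ n * F i).
  move=> i; have [->|x0] := eqVneq (F i) 0.
    by exists 0%N; rewrite mulr0; exact: dO0.
  have [u [m [hu _ ->]]] := dO_fact D p x0; exists `|m|%N.
  have [m0|m0] := lerP 0 m.
    rewrite -(gez0_abs m0) -exprnP; do !apply: dOM => //; apply/dOX/dO_unif.
  have -> : π p ^ m = (π p ^+ `|m|)^-1 by rewrite exprnP ltz0_abs // invr_expz opprK.
  by rewrite mulrCA mulfV ?mulr1 // expf_neq0 // unif_neq0.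
exists (\sum_i n i)%N => i; rewrite (bigD1 i) //= addnC exprD -mulrA.
by apply: dOM => //; apply/dOX/dO_unif.
Qed.

Record lattice := Lattice {
  lr : nat;
  lg : P -> 'M[K]_lr;
  lg_unit : forall p, lg p \in unitmx;
  lg_fin : finite_set [set p | ~ (intm p (lg p) /\ intm p (invmx (lg p)))]
}.

Definition homp (A B : lattice) p (f : 'M_(lr A, lr B)) :=
  intm p (lg A p *m f *m invmx (lg B p)).
Definition lhom (A B : lattice) (f : 'M_(lr A, lr B)) := forall p, homp p f.
(** Adelic matrices represent the classes in Ext^1(A, B); constants and matrices that map A
to B at every point represent zero. *)
Definition madele (A B : lattice) (v : P -> 'M_(lr A, lr B)) :=
  finite_set [set p | ~ homp p (v p)].

Lemma homp_id A p : @homp A A p 1%:M.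
Proof. by rewrite /homp mulmx1 mulmxV ?lg_unit //; exact: intm1. Qed.
Lemma homp0 A B p : @homp A B p 0.
Proof. by rewrite /homp mulmx0 mul0mx; exact: intm0. Qed.
Lemma hompD A B p (f g : 'M_(lr A, lr B)) : homp p f -> homp p g -> homp p (f + g).
Proof. by move=> hf hg; rewrite /homp mulmxDr mulmxDl; exact: intmD. Qed.
Lemma hompN A B p (f : 'M_(lr A, lr B)) : homp p f -> homp p (- f).
Proof. by move=> hf; rewrite /homp mulmxN mulNmx; exact: intmN. Qed.
Lemma hompB A B p (f g : 'M_(lr A, lr B)) : homp p f -> homp p g -> homp p (f - g).
Proof. by move=> hf hg; apply: hompD => //; exact: hompN. Qed.
Lemma hompZ A B p a (f : 'M_(lr A, lr B)) : O p a -> homp p f -> homp p (a *: f).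
Proof. by move=> ha hf; rewrite /homp -scalemxAr -scalemxAl; exact: intmZ. Qed.
Lemma hompM A B C p (f : 'M_(lr A, lr B)) (g : 'M_(lr B, lr C)) :
  homp p f -> homp p g -> homp p (f *m g).
Proof.
move=> hf hg; rewrite /homp.
have -> : lg A p *m (f *m g) *m invmx (lg C p) =
  (lg A p *m f *m invmx (lg B p)) *m (lg B p *m g *m invmx (lg C p)).
  by rewrite !mulmxA mulmxKV // lg_unit.
exact: intmM.
Qed.
Lemma homp_sum A B p (I : finType) (Q : pred I) (F : I -> 'M_(lr A, lr B)) :
  (forall i, Q i -> homp p (F i)) -> homp p (\sum_(i | Q i) F i).
Proof.
move=> h; apply: (big_ind (@homp A B p)) => //; [exact: homp0|exact: hompD].
Qed.
Lemma homp_tr A p (f : 'M_(lr A)) : @homp A A p f -> O p (\tr f).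
Proof.
move=> h; have -> : \tr f = \tr (lg A p *m f *m invmx (lg A p)).
  by rewrite mxtrace_mulC mulmxA mulVmx ?mul1mx // lg_unit.
by apply: dO_sum => i _; exact: h.
Qed.

Lemma homp_fin A B (f : 'M_(lr A, lr B)) : finite_set [set p | ~ homp p f].
Proof.
apply: finite_imp (finite_or (finite_or (lg_fin A) (lg_fin B)) (intm_fin f)).
by move=> p [[[h1 _] [_ h2]] h3]; apply: intmM => //; exact: intmM.
Qed.

Lemma madele_cst A B (f : 'M_(lr A, lr B)) : madele (fun=> f).
Proof. exact: homp_fin. Qed.
Lemma madeleB A B (v w : P -> 'M_(lr A, lr B)) :
  madele v -> madele w -> madele (fun p => v p - w p).
Proof.
by move=> hv hw; apply: finite_imp (finite_or hv hw) => p []; exact: hompB.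
Qed.
Lemma madeleM A B C (v : P -> 'M_(lr A, lr B)) (w : P -> 'M_(lr B, lr C)) :
  madele v -> madele w -> madele (fun p => v p *m w p).
Proof.
by move=> hv hw; apply: finite_imp (finite_or hv hw) => p []; exact: hompM.
Qed.
Lemma madele_int A B (v : P -> 'M_(lr A, lr B)) : (forall p, homp p (v p)) -> madele v.
Proof. by move=> h; apply: (@sub_finite_set _ _ set0) => // p /= []. Qed.
Lemma madele_at A B p (f : 'M_(lr A, lr B)) : madele (at_ p f).
Proof.
apply: (sub_finite_set _ (finite_set1 p)) => q /=; rewrite /at_.
by case: eqP => // _ []; exact: homp0.
Qed.
Lemma adele_tr A (v : P -> 'M_(lr A)) : @madele A A v -> adele D (fun p => \tr (v p)).
Proof. by apply: finite_imp => p; exact: homp_tr. Qed.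

Lemma madele_entry A B (v : P -> 'M_(lr A, lr B)) i j :
  madele v -> adele D (fun p => v p i j).
Proof.
move=> hv; apply: finite_imp (finite_or (finite_or (lg_fin A) (lg_fin B)) hv).
move=> p [[[_ hA] [hB _]] h].
have -> : v p = invmx (lg A p) *m (lg A p *m v p *m invmx (lg B p)) *m lg B p.
  by rewrite !mulmxA mulVmx ?lg_unit // mul1mx mulmxKV // lg_unit.
by apply: intmM => //; exact: intmM.
Qed.

Variable G : genus1 D.
Local Notation ω := (om G).

Lemma om_sum (I : finType) (a : I -> P -> K) : (forall i, adele D (a i)) ->
  ω (fun p => \sum_i a i p) = \sum_i ω (a i).
Proof.
move=> ha; suff H (r : seq I) : ω (fun p => \sum_(i <- r) a i p) = \sum_(i <- r) ω (a i) /\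
    adele D (fun p => \sum_(i <- r) a i p) by exact: (H _).1.
elim: r => [|i r [IH1 IH2]].
  rewrite big_nil (om_ext _ (b := fun=> 0)) ?om_cst; last by move=> p; rewrite big_nil.
  split => //; rewrite (_ : (fun _ => _) = fun=> 0); first exact: adele_cst.
  by apply/funext => p; rewrite big_nil.
have -> : (fun p => \sum_(j <- i :: r) a j p) = fun p => a i p + \sum_(j <- r) a j p.
  by apply/funext => p; rewrite big_cons.
by rewrite big_cons omD // IH1; split => //; exact: adeleD.
Qed.

(** Every functional on the classes of adelic matrices comes, entry by entry through Weil's
theorem, from a matrix over K, and integrality at each point makes this matrix a
homomorphism in the other direction. So a class that is orthogonal to all homomorphisms
vanishes. *)
Theorem serre (F E : lattice) (v : P -> 'M_(lr F, lr E)) : madele v ->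
  (forall h : 'M_(lr E, lr F), lhom h -> ω (fun p => \tr (v p *m h)) = 0) ->
  exists x : 'M[K]_(lr F, lr E), forall p, homp p (v p - x).
Proof.
move=> hv hortho; apply: contrapT => nsplit.
pose W : set (P -> 'M[K]_(lr F, lr E)) := [set w | exists x : 'M[K]_(lr F, lr E), forall p, homp p (w p - x)].
have [| | | |l [lD lZ lW /eqP]] := @functional (P -> 'M[K]_(lr F, lr E)) W v; last apply.
- by exists 0 => p; rewrite subr0; exact: homp0.
- move=> w w' [x hx] [x' hx']; exists (x + x') => p.
  by rewrite opprD addrACA; apply: hompD.
- move=> c w [x hx]; exists (ι c *: x) => p.
  have -> : (ι c *: w) p - ι c *: x = ι c *: (w p - x) by rewrite scalerBr.
  by apply: hompZ => //; exact: dO_inc.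
- by [].
have lfE w w' : (forall p, w p = w' p) -> l w = l w' by move=> h; congr l; apply/funext.
have [L hL] : exists L : seq P, forall p i j a,
    (exists2 y, O p y & a = π p ^+ (count_mem p L) * y) ->
    @homp F E p (a *: delta_mx i j).
  have /choice[n hn] : forall p, exists n, forall i j, @homp F E p (π p ^+ n *: delta_mx i j).
    move=> p; have [n hn] := denominator p (fun t : ('I_(lr F) * 'I_(lr E)) * ('I_(lr F) * 'I_(lr E)) =>
      (lg F p *m delta_mx t.1.1 t.1.2 *m invmx (lg E p)) t.2.1 t.2.2).
    exists n => i j i' j'; rewrite -scalemxAr -scalemxAl mxE.
    exact: (hn ((i, j), (i', j'))).
  have [s hs] : exists s : seq P, forall p, p \notin s ->
      forall i j, @homp F E p (delta_mx i j).
    have hf : finite_set [set p | ~ forall i j, @homp F E p (delta_mx i j)].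
      by apply: finite_forall => i; apply: finite_forall => j; exact: homp_fin.
    have [s /seteqP[s1 s2]] := (finite_seqP _).1 hf.
    exists s => p hp; apply: contrapT => h; move/negP: hp; apply; exact: s1.
  exists (flatten [seq nseq (n q) q | q <- s]) => p i j a [y hy ->].
  have [ps|ps] := boolP (p \in s); last first.
    by apply: hompZ (hs p ps i j); apply: dOM => //; apply/dOX/dO_unif.
  have le : (n p <= count_mem p (flatten [seq nseq (n q) q | q <- s]))%N.
    elim: s ps {hs} => //= q s IH; rewrite inE count_cat => /orP[/eqP <-|/IH h].
      by rewrite count_nseq /= eqxx mul1n leq_addr.
    exact: leq_trans h (leq_addl _ _).
  rewrite -(subnK le) exprD mulrAC [_ * y]mulrC mulrC -scalerA -/(homp _ _).
  rewrite scalerA mulrC -scalerA; apply: hompZ (hn p i j).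
  by apply: dOM => //; apply/dOX/dO_unif.
have /choice[x hx] : forall ij : 'I_(lr F) * 'I_(lr E), exists x, forall a, adele D a ->
    l (fun p => a p *: delta_mx ij.1 ij.2) = ω (fun p => x * a p).
  move=> [i j] /=; apply: (@weil _ _ _ D G L (fun a => l (fun p => a p *: delta_mx i j))).
  - by move=> a b _ _; rewrite -lD; apply: lfE => p; rewrite scalerDl.
  - by move=> c a _; rewrite -lZ; apply: lfE => p; rewrite -scalerA.
  - move=> y; apply: lW; exists (y *: delta_mx i j) => p; rewrite subrr; exact: homp0.
  - move=> a ha; apply: lW; exists 0 => p; rewrite subr0; exact: hL.
pose h : 'M[K]_(lr E, lr F) := \matrix_(j, i) x (i, j).
have lom (w : P -> 'M[K]_(lr F, lr E)) : (forall i j, adele D (fun p => w p i j)) -> l w = ω (fun p => \tr (w p *m h)).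
  move=> hw; pose a (ij : 'I_(lr F) * 'I_(lr E)) (p : P) : K := w p ij.1 ij.2.
  have -> : l w = \sum_ij l (fun p => a ij p *: delta_mx ij.1 ij.2).
    have lsum (r : seq ('I_(lr F) * 'I_(lr E))) :
        l (fun p => \sum_(ij <- r) a ij p *: delta_mx ij.1 ij.2) =
        \sum_(ij <- r) l (fun p => a ij p *: delta_mx ij.1 ij.2).
      elim: r => [|ij r IH].
        rewrite big_nil; apply: lW; exists 0 => p; rewrite big_nil subr0; exact: homp0.
      by rewrite big_cons -IH -lD; apply: lfE => p; rewrite big_cons.
    rewrite -lsum; apply: lfE => p; rewrite {1}(matrix_sum_delta (w p)).
    by rewrite pair_bigA.
  rewrite (eq_bigr (fun ij => ω (fun p => x ij * a ij p))); last by move=> ij _; apply: hx; exact: hw.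
  rewrite -om_sum; last by move=> ij; apply: adeleM; [exact: adele_cst|exact: hw].
  apply: om_ext => p; rewrite /mxtrace; under [RHS]eq_bigr do rewrite mxE.
  by rewrite pair_bigA; apply: eq_bigr => -[i j] _; rewrite /= mxE mulrC.
rewrite lom; last by move=> i j; exact: madele_entry.
apply: hortho => p i j; apply: contrapT => nO.
have [c hc /eqP] := om_nondeg G nO; apply.
pose w := c *: (invmx (lg F p) *m delta_mx j i *m lg E p).
have hw : @homp F E p w.
  rewrite /w -mulmxA; apply: hompZ => //.
  rewrite /homp !mulmxA mulmxV ?lg_unit // mul1mx mulmxK ?lg_unit //.
  by move=> a b; rewrite mxE; case: (_ && _); [exact: dO1|exact: dO0].
have : l (at_ p w) = 0.
  apply: lW; exists 0 => q; rewrite subr0 /at_; case: eqP => [->//|_]; exact: homp0.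
rewrite lom; last first.
  move=> a b; rewrite (_ : (fun _ => _) = at_ p (w a b)); first exact: adele_at.
  by apply/funext => q; rewrite /at_; case: eqP => // _; rewrite mxE.
move=> <-; apply: om_ext => q; rewrite /at_; case: eqP => [_|_]; last first.
  by rewrite mul0mx mxtrace0.
rewrite /w -scalemxAl mxtraceZ; congr (c * _).
by rewrite -!mulmxA mxtrace_mulC -!mulmxA tr_delta !mulmxA.
Qed.
End Lattices.
End SerreDuality.

(** * Duals, powers and exact sequences of lattices *)
Module LatticeSequences.
Import Defs.
Export SerreDuality.
Import Alg.
Import Order.TTheory GRing.Theory Num.Theory.
Local Open Scope classical_set_scope.
Local Open Scope ring_scope.

Section Mutations.
Variables (k K : fieldType) (P : choiceType) (D : dvrs k K P) (G : genus1 D).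
Local Notation O := (dO D).
Local Notation ι := (kinc D).
Local Notation π := (unif D).
Local Notation intm := (intm D).
Local Notation lattice := (lattice D).

Lemma some_point : inhabited P.
Proof.
have [a ha wa] := om_unit G; apply: contrapT => nP.
suff : om G a = 0 by rewrite wa => /eqP; rewrite oner_eq0.
by apply: om_int => p; case: nP.
Qed.

(** ** Duals and powers *)
Lemma dual_unit (A : lattice) p : (invmx (lg A p))^T \in unitmx.
Proof. by rewrite unitmx_tr unitmx_inv lg_unit. Qed.
Lemma dual_fin (A : lattice) :
  finite_set [set p | ~ (intm p (invmx (lg A p))^T /\ intm p (invmx (invmx (lg A p))^T))].
Proof.
apply: finite_imp (lg_fin A) => p [h1 h2]; rewrite -trmx_inv invmxK.
by split; apply: intm_tr.
Qed.
Definition dual (A : lattice) : lattice := Lattice (@dual_unit A) (@dual_fin A).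

Lemma homp_dual A B p (f : 'M_(lr A, lr B)) :
  @homp _ _ _ _ A B p f -> @homp _ _ _ _ (dual B) (dual A) p f^T.
Proof.
rewrite /homp /= => h.
have -> : (invmx (lg B p))^T *m f^T *m invmx (invmx (lg A p))^T =
          (lg A p *m f *m invmx (lg B p))^T.
  by rewrite -trmx_inv invmxK !trmx_mul mulmxA.
exact: intm_tr.
Qed.

Lemma homp_dualr A B p (f : 'M_(lr A, lr B)) :
  @homp _ _ _ _ A (dual B) p f -> @homp _ _ _ _ B (dual A) p f^T.
Proof.
rewrite /homp /= => h.
have -> : lg B p *m f^T *m invmx (invmx (lg A p))^T =
          (lg A p *m f *m invmx (invmx (lg B p))^T)^T.
  by rewrite -!trmx_inv !invmxK !trmx_mul mulmxA trmxK.
exact: intm_tr.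
Qed.

Lemma homp_duall A B p (f : 'M_(lr A, lr B)) :
  @homp _ _ _ _ (dual A) B p f -> @homp _ _ _ _ (dual B) A p f^T.
Proof.
rewrite /homp /= => h.
have -> : (invmx (lg B p))^T *m f^T *m invmx (lg A p) =
          ((invmx (lg A p))^T *m f *m invmx (lg B p))^T.
  by rewrite !trmx_mul trmxK mulmxA.
exact: intm_tr.
Qed.

Section Power.
Variables (d : nat) (A : lattice).
Let g p := \mxdiag_(i < d) lg A p.
Lemma mul_mxdiag (X Y : 'I_d -> 'M[K]_(lr A)) :
  \mxdiag_(i < d) X i *m \mxdiag_(i < d) Y i = \mxdiag_(i < d) (X i *m Y i).
Proof.
rewrite [X in _ *m X]/mxdiag mul_mxdiag_mxblock; apply/eq_mxblock => i j.
by case: eqVneq => [e|]; rewrite ?mulmx0 //; subst j; rewrite !conform_mx_id.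
Qed.
Lemma pw_mul p : g p *m \mxdiag_(i < d) invmx (lg A p) = 1%:M.
Proof.
rewrite mul_mxdiag -(@mxdiagZ K d (fun=> lr A) 1); apply/eq_mxdiag => i.
by rewrite mulmxV // lg_unit.
Qed.
Lemma pw_unit p : g p \in unitmx.
Proof. by have [] := mulmx1_unit (pw_mul p). Qed.
Lemma pw_inv p : invmx (g p) = \mxdiag_(i < d) invmx (lg A p).
Proof. by rewrite -[LHS]mulmx1 -(pw_mul p) mulKmx // pw_unit. Qed.
Lemma intm_mxdiag p (X : 'I_d -> 'M[K]_(lr A)) : (forall i, intm p (X i)) ->
  intm p (\mxdiag_(i < d) X i).
Proof.
move=> h i j; rewrite !mxE; case: eqVneq => [e|_]; last by rewrite mxE; exact: dO0.
by rewrite conform_mx_id; exact: h.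
Qed.
Lemma pw_fin : finite_set [set p | ~ (intm p (g p) /\ intm p (invmx (g p)))].
Proof.
apply: finite_imp (lg_fin A) => p [h1 h2]; rewrite pw_inv.
by split; apply: intm_mxdiag.
Qed.
Definition pw : lattice := Lattice pw_unit pw_fin.

Lemma intm_mxcol p n (X : 'I_d -> 'M[K]_(lr A, n)) :
  intm p (\mxcol_(i < d) X i) <-> forall i, intm p (X i).
Proof.
split=> [h i a b|h i j]; last by rewrite mxE; exact: h.
by rewrite -(mxcolK X i) mxE; exact: h.
Qed.
Lemma intm_mxrow p n (X : 'I_d -> 'M[K]_(n, lr A)) :
  intm p (\mxrow_(i < d) X i) <-> forall i, intm p (X i).
Proof.
split=> [h i a b|h i j]; last by rewrite mxE; exact: h.
by rewrite -(mxrowK X i) mxE; exact: h.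
Qed.

Lemma homp_mxcol (B : lattice) p (b : 'I_d -> 'M_(lr A, lr B)) :
  @homp _ _ _ _ pw B p (\mxcol_(i < d) b i) <-> forall i, homp p (b i).
Proof. by rewrite /homp /= mul_mxdiag_mxcol mxcol_mul intm_mxcol. Qed.
Lemma homp_mxrow (B : lattice) p (b : 'I_d -> 'M_(lr B, lr A)) :
  @homp _ _ _ _ B pw p (\mxrow_(i < d) b i) <-> forall i, homp p (b i).
Proof. by rewrite /homp /= pw_inv mul_mxrow mul_mxrow_mxdiag intm_mxrow. Qed.
End Power.

(** ** Kernels, images and cokernels *)
Lemma lattice_of (m l : nat) (S : P -> 'M[K]_(m, l)) : (forall p, row_full (S p)) ->
  finite_set [set p | ~ (intm p (S p) /\ exists T, intm p T /\ T *m S p = 1%:M)] ->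
  exists g : P -> 'M[K]_l, [/\ forall p, g p \in unitmx,
    finite_set [set p | ~ (intm p (g p) /\ intm p (invmx (g p)))] &
    forall p, exists (a : 'M_(m, l)) (b : 'M_(l, m)),
      [/\ intm p a, intm p b, S p = a *m g p & g p = b *m S p]].
Proof.
move=> fS finS.
have H p : exists g : 'M[K]_l, [/\ g \in unitmx,
    (intm p (S p) /\ exists T, intm p T /\ T *m S p = 1%:M) ->
      intm p g /\ intm p (invmx g) &
    exists (a : 'M_(m, l)) (b : 'M_(l, m)),
      [/\ intm p a, intm p b, S p = a *m g & g = b *m S p]].
  have [[hS [T [hT e]]]|ngood] := pselect (intm p (S p) /\ exists T, intm p T /\ T *m S p = 1%:M).
    exists 1%:M; split; first exact: unitmx1.
      by move=> _; rewrite invmx1; split; exact: intm1.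
    by exists (S p), T; rewrite mulmx1.
  have [h [l' [B [[uh ih ih'] fB lm e]]]] := echelon D p (S p).
  have el : l' = l.
    apply/eqP; rewrite eqn_leq; apply/andP; split.
      by move: fB; rewrite /row_free => /eqP <-; exact: rank_leq_col.
    have := fS p; rewrite /row_full => /eqP <-.
    rewrite -(mxrankMfree_unit _ uh) || rewrite -(eqmxMfull (S p) (A := h)) ?row_full_unit //.
    by rewrite e (leq_trans (mxrankM_maxr _ _)) // rank_leq_row.
  subst l'; exists B; split => //; first by rewrite -row_free_unit.
  have eB : B = pid_mx l *m h *m S p.
    by rewrite -mulmxA e mulmxA pid_mx_id // pid_mx_1 mul1mx.
  exists (invmx h *m pid_mx l), (pid_mx l *m h); split => //.
  - by apply: intmM => //; exact: intm_pid.
  - by apply: intmM => //; exact: intm_pid.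
  - by rewrite -mulmxA -e mulKmx.
have [g hg] := choice H.
exists g; split; [by move=> p; case: (hg p)| |by move=> p; case: (hg p)].
by apply: finite_imp finS => p; case: (hg p).
Qed.

Definition lsurj (M B : lattice) (f : 'M_(lr M, lr B)) := forall p,
  homp p f /\ exists s : 'M_(lr B, lr M), homp p s /\ s *m f = 1%:M.
Definition linj (L M : lattice) (n : 'M_(lr L, lr M)) := forall p,
  homp p n /\ exists r : 'M_(lr M, lr L), homp p r /\ n *m r = 1%:M.
Definition ses (L M B : lattice) (n : 'M_(lr L, lr M)) (f : 'M_(lr M, lr B)) :=
  forall p, exists (r : 'M_(lr M, lr L)) (s : 'M_(lr B, lr M)),
  [/\ homp p n, homp p f, homp p r & homp p s] /\
  [/\ n *m r = 1%:M, s *m f = 1%:M, n *m f = 0 & r *m n + f *m s = 1%:M].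

Lemma lattice_kernel (M B : lattice) (f : 'M_(lr M, lr B)) : lsurj f ->
  exists (L : lattice) (n : 'M_(lr L, lr M)), ses n f.
Proof.
move=> sf; have [p0] := some_point; have [_ [s0 [_ es0]]] := sf p0.
pose n0 := row_base (kermx f).
have n0f : n0 *m f = 0 by apply/sub_kermxP; rewrite eq_row_base.
have /row_freeP[r0 er0] : row_free n0 := row_base_free _.
pose r s := (1%:M - f *m s) *m r0.
have rn s : s *m f = 1%:M -> r s *m n0 = 1%:M - f *m s.
  move=> es; have : (1%:M - f *m s <= n0)%MS.
    rewrite eq_row_base; apply/sub_kermxP.
    by rewrite mulmxBl mul1mx -mulmxA es mulmx1 subrr.
  by move=> /submxP[X eX]; rewrite /r eX -(mulmxA X n0 r0) er0 mulmx1.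
have nr s : n0 *m r s = 1%:M.
  by rewrite /r mulmxA mulmxBr mulmx1 mulmxA n0f mul0mx subr0.
have /choice[s hs] : forall p, exists s, [/\ @homp _ _ _ _ B M p s, s *m f = 1%:M &
    @homp _ _ _ _ B M p s0 -> s = s0].
  move=> p; have [h|h] := pselect (@homp _ _ _ _ B M p s0); first by exists s0.
  by have [_ [s [h1 h2]]] := sf p; exists s.
have [| |g [ug fg Hg]] := @lattice_of _ _ (fun p => lg M p *m r (s p)).
- move=> p; apply/row_fullP; exists (n0 *m invmx (lg M p)).
  by rewrite -mulmxA mulKmx ?lg_unit // nr.
- apply: finite_imp (finite_or (finite_or (@homp_fin _ _ _ _ B M s0) (lg_fin M))
    (finite_or (intm_fin D n0) (intm_fin D (r s0)))).
  move=> p [[h1 [h2 h3]] [h4 h5]]; have [_ _ /(_ h1) ->] := hs p.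
  split; first exact: intmM.
  exists (n0 *m invmx (lg M p)); split; first exact: intmM.
  by rewrite -mulmxA mulKmx ?lg_unit // nr.
exists (Lattice ug fg), n0 => p; exists (r (s p)), (s p).
have [a [b [ia ib eS eg]]] := Hg p; have [h1 h2 _] := hs p; have [h3 _] := sf p.
have hr : @homp _ _ _ _ M M p (1%:M - f *m s p).
  by apply: hompB; [exact: homp_id|exact: hompM h3 h1].
split; split => //.
- rewrite /homp /= eg.
  have -> : b *m (lg M p *m r (s p)) *m n0 *m invmx (lg M p) =
    b *m (lg M p *m (1%:M - f *m s p) *m invmx (lg M p)) by rewrite -(rn _ h2) !mulmxA.
  exact: intmM.
- by rewrite /homp /= eS mulmxK.
- by rewrite rn // subrK.
Qed.

Lemma lattice_image (M B : lattice) (f : 'M_(lr M, lr B)) : lhom f ->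
  exists (I : lattice) (a : 'M_(lr M, lr I)) (b : 'M_(lr I, lr B)),
  [/\ f = a *m b, row_free b, lhom b & lsurj a].
Proof.
move=> hf; have [l [b [a [fb el ea]]]] : exists l (b : 'M_(l, lr B)) a,
    [/\ row_free b, l = \rank f & f = a *m b].
  have /submxP[a ea] : (f <= row_base f)%MS by rewrite eq_row_base.
  by exists (\rank f), (row_base f), a; rewrite row_base_free.
have /row_fullP[t et] : row_full a.
  have := mxrankM_maxl a b; rewrite -ea -el => h.
  by rewrite /row_full eqn_leq rank_leq_col.
have [| |g [ug fg Hg]] := @lattice_of _ _ (fun p => lg M p *m a).
- move=> p; apply/row_fullP; exists (t *m invmx (lg M p)).
  by rewrite -mulmxA mulKmx ?lg_unit.
- apply: finite_imp (finite_or (finite_or (intm_fin D t) (lg_fin M)) (intm_fin D a)).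
  move=> p [[h1 [h2 h3]] h4]; split; first exact: intmM.
  exists (t *m invmx (lg M p)); split; first exact: intmM.
  by rewrite -mulmxA mulKmx ?lg_unit.
exists (Lattice ug fg), a, b; split => // p; rewrite /homp /=;
  have [x [y [ix iy eS eg]]] := Hg p.
  have -> : g p *m b *m invmx (lg B p) = y *m (lg M p *m f *m invmx (lg B p)).
    by rewrite eg ea !mulmxA.
  by apply: intmM => //; exact: hf.
split; first by rewrite /homp /= eS mulmxK.
exists (invmx (g p) *m y *m lg M p); split.
  by rewrite /homp /= !mulmxA mulmxV // mul1mx mulmxK ?lg_unit.
by rewrite -!mulmxA -eg mulVmx.
Qed.

Lemma linj_dual L M (n : 'M_(lr L, lr M)) : linj n -> @lsurj (dual M) (dual L) n^T.
Proof.
move=> h p; have [h1 [r [h2 h3]]] := h p; split; first exact: homp_dual.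
exists r^T; split; first exact: homp_dual.
by rewrite -trmx_mul h3 trmx1.
Qed.

Lemma ses_dual L M B (n : 'M_(lr L, lr M)) (f : 'M_(lr M, lr B)) :
  ses n f -> @ses (dual B) (dual M) (dual L) f^T n^T.
Proof.
move=> h p; have [r [s [[h1 h2 h3 h4] [e1 e2 e3 e4]]]] := h p.
exists s^T, r^T; split; split; try exact: homp_dual.
- by rewrite -trmx_mul e2 trmx1.
- by rewrite -trmx_mul e1 trmx1.
- by rewrite -trmx_mul e3 trmx0.
- by rewrite -trmx1 -e4 linearD /= !trmx_mul addrC.
Qed.

Lemma homp_ddl A B p (f : 'M_(lr A, lr B)) :
  @homp _ _ _ _ (dual (dual A)) B p f <-> homp p f.
Proof. by rewrite /homp /= -trmx_inv invmxK trmxK. Qed.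
Lemma homp_ddr A B p (f : 'M_(lr A, lr B)) :
  @homp _ _ _ _ A (dual (dual B)) p f <-> homp p f.
Proof. by rewrite /homp /= -trmx_inv !invmxK trmxK. Qed.

Lemma lattice_cokernel (L M : lattice) (n : 'M_(lr L, lr M)) : linj n ->
  exists (B : lattice) (f : 'M_(lr M, lr B)), ses n f.
Proof.
move=> /linj_dual /lattice_kernel[B' [f' /ses_dual h]].
exists (dual B'), f'^T => p; have [r [s [[h1 h2 h3 h4] [e1 e2 e3 e4]]]] := h p.
rewrite trmxK in h1 e1 e3 e4; exists r, s; split; split => //.
- by move/homp_ddl/homp_ddr: h1.
- by move/homp_ddl: h2.
- by move/homp_ddl/homp_ddr: h3.
- by move/homp_ddr: h4.
Qed.

(** The image has smaller rank in general; echelon forms at the points give it bases, so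
that the homomorphism factors through a lattice. *)
Lemma saturation (M B : lattice) (f : 'M_(lr M, lr B)) : lhom f ->
  exists (I : lattice) (a : 'M_(lr M, lr I)) (b : 'M_(lr I, lr B)),
  [/\ f = a *m b, row_full a, lhom a & linj b].
Proof.
move=> hf; have [|I [a [b [e fb hb sa]]]] := @lattice_image (dual B) (dual M) f^T.
  by move=> p; apply: homp_dual.
exists (dual I), b^T, a^T; split.
- by rewrite -trmx_mul -e trmxK.
- by rewrite -row_free_tr || rewrite /row_full mxrank_tr.
- by move=> p; apply: homp_dualr.
- move=> p; have [h [s [hs es]]] := sa p; split; first exact: homp_duall.
  by exists s^T; split; [exact: homp_dualr|rewrite -trmx_mul es trmx1].
Qed.
End Mutations.
End LatticeSequences.

(** * Evaluation maps between simple lattices *)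
Module Evaluation.
Import Defs.
Export LatticeSequences.
Import Alg.
Import Order.TTheory GRing.Theory Num.Theory.
Local Open Scope classical_set_scope.
Local Open Scope ring_scope.

Arguments homp {k K P D} A B p f.
Arguments lhom {k K P D} A B f.
Arguments madele {k K P D} A B v.
Arguments lsurj {k K P D} M B f.
Arguments linj {k K P D} L M n.
Arguments ses {k K P D} L M B n f.

Section Evaluation.
Variables (k K : fieldType) (P : choiceType) (D : dvrs k K P) (G : genus1 D).
Local Notation O := (dO D).
Local Notation ι := (kinc D).
Local Notation lattice := (lattice D).

Implicit Types A B C L M F E I : lattice.

Definition simple (A : lattice) := (0 < lr A)%N /\
  forall f, lhom A A f -> exists c, f = (ι c)%:M.

Definition lbasis (A B : lattice) d (b : 'I_d -> 'M[K]_(lr A, lr B)) :=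
  [/\ forall j, lhom A B (b j),
      forall f, lhom A B f -> exists c : 'I_d -> k, f = \sum_j ι (c j) *: b j &
      forall c : 'I_d -> k, \sum_j ι (c j) *: b j = 0 -> forall j, c j = 0].

Lemma lhomM A B C f g : lhom A B f -> lhom B C g -> lhom A C (f *m g).
Proof. by move=> hf hg p; apply: hompM (hf p) (hg p). Qed.
Lemma lhomB A B f g : lhom A B f -> lhom A B g -> lhom A B (f - g).
Proof. by move=> hf hg p; apply: hompB (hf p) (hg p). Qed.
Lemma lhomZ A B c f : lhom A B f -> lhom A B (ι c *: f).
Proof. by move=> hf p; apply: hompZ (hf p); exact: dO_inc. Qed.
Lemma lhom_sum A B (I : finType) (F : I -> 'M_(lr A, lr B)) :
  (forall i, lhom A B (F i)) -> lhom A B (\sum_i F i).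
Proof. by move=> h p; apply: homp_sum => i _; exact: h. Qed.
Lemma lhom_id A : lhom A A 1%:M. Proof. by move=> p; exact: homp_id. Qed.
Lemma lhom_scalar A c : lhom A A (ι c)%:M.
Proof. by rewrite -scalemx1; apply: lhomZ; exact: lhom_id. Qed.

(** With trivial dualizing sheaf, Ext^1(F, E) is dual to Hom(E, F), so that it vanishes with
the latter. *)
Lemma serre0 (F E : lattice) v : (forall h, lhom E F h -> h = 0) -> madele F E v ->
  exists x : 'M[K]_(lr F, lr E), forall p, homp F E p (v p - x).
Proof.
move=> h0 hv; apply: (serre (G := G) hv) => h /h0 ->.
by rewrite (om_ext _ (b := fun=> 0)) ?om_cst // => p; rewrite mulmx0 mxtrace0.
Qed.

Lemma span_pred d (W : 'rV[k]_d -> Prop) : W 0 ->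
  exists s (w : 'M[k]_(s, d)), [/\ row_free w, forall i, W (row i w) &
    forall x, W x -> (x <= w)%MS].
Proof.
move=> W0.
pose Q s := exists w : 'M[k]_(s, d), row_free w /\ forall i, W (row i w).
have exQ : exists s, `[< Q s >].
  exists 0%N; apply/asboolP; exists 0; split; first by rewrite /row_free mxrank0.
  by case.
have bQ s : `[< Q s >] -> (s <= d)%N.
  by move=> /asboolP[w [fw _]]; rewrite -(eqP fw) rank_leq_col.
case: (ex_maxnP exQ bQ) => s /asboolP[w [fw hw]] maxs.
exists s, w; split => // x Wx; apply: contrapT => /negP nx.
suff /maxs : `[< Q (s + 1)%N >] by rewrite addn1 ltnn.
apply/asboolP; exists (col_mx w x); split; last first.
  move=> i; rewrite -[i]splitK; case: (fintype.split i) => j /=.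
    by rewrite rowKu.
  by rewrite rowKd row_id.
rewrite /row_free eqn_leq rank_leq_row /= -addsmxE.
rewrite addn1 -[X in (X < _)%N](eqP fw) ltn_neqAle mxrankS ?addsmxSl // andbT.
apply: contraNneq nx => e; apply: submx_trans (addsmxSr w x) _.
by rewrite -(mxrank_leqif_sup (addsmxSl w x)) -e.
Qed.

Lemma lift_ses L M B C (n : 'M_(lr L, lr M)) (f : 'M_(lr M, lr B)) g :
  ses L M B n f -> (forall h, lhom L C h -> h = 0) -> lhom C B g ->
  exists2 g', lhom C M g' & g' *m f = g.
Proof.
move=> sf h0 hg; have [p0] := some_point G.
have /choice[r /choice[s hs]] := sf.
have [x hx] : exists x : 'M[K]_(lr C, lr L), forall p, homp C L p ((g *m s p0 - g *m s p) *m r p - x).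
  apply: (serre0 h0).
  apply: (@madeleM _ _ _ D C M L (fun p => g *m s p0 - g *m s p)).
    apply: madeleB; first exact: madele_cst.
    by apply: madele_int => p; apply: hompM (hg p) _; case: (hs p) => -[].
  by apply: madele_int => p; case: (hs p) => -[].
have nf : n *m f = 0 by case: (hs p0) => _ [].
exists (g *m s p0 - x *m n) => [p|]; last first.
  rewrite mulmxBl -!mulmxA nf mulmx0 subr0.
  by have [_ [_ -> _ _]] := hs p0; rewrite mulmx1.
have [[h1 h2 h3 h4] [e1 e2 e3 e4]] := hs p.
have -> : g *m s p0 - x *m n = g *m s p + ((g *m s p0 - g *m s p) *m r p - x) *m n.
  rewrite [in RHS]mulmxBl -mulmxA.
  have -> : r p *m n = 1%:M - f *m s p by rewrite -e4 addrK.
  rewrite mulmxBr mulmx1 mulmxA mulmxBl -[g *m s p0 *m f]mulmxA -[g *m s p *m f]mulmxA e2.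
  have [_ [_ -> _ _]] := hs p0.
  by rewrite subrr mul0mx subr0 addrA addrCA subrr addr0.
apply: hompD; first exact: hompM (hg p) h4.
by apply: hompM h1; exact: hx.
Qed.

Section EvLemma.
Variables (A B : lattice) (d : nat) (b : 'I_d -> 'M[K]_(lr A, lr B)).
Hypotheses (sA : simple A) (sB : simple B) (hb : lbasis b).
Local Notation E := (\mxcol_(j < d) b j).

(** The evaluation map has as its rows the members of a basis of homomorphisms. *)
Lemma ev_hom : lhom (pw d A) B E.
Proof. by move=> p; apply/homp_mxcol => i; case: hb => h _ _; exact: h. Qed.

(** Split off from the image I of the evaluation as many copies of A as possible. Either I
is a sum of copies of A, and then independence of the basis makes the evaluation injective,
or no copy splits off, and then duality shows that the image is all of B. *)
Theorem evaluation : row_free E \/ lsurj (pw d A) B E.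
Proof.
have [A0 scA] := sA; have [B0 scB] := sB; have [hb1 hb2 hb3] := hb.
have [p0] := some_point G.
have [I [a [be [eE fbe hbe sa]]]] := lattice_image ev_hom.
pose bt j := submxcol a j : 'M[K]_(lr A, lr I).
have aE : a = \mxcol_j bt j by rewrite submxcolK.
have ha : lhom (pw d A) I a by move=> p; case: (sa p).
have hbt j : lhom A I (bt j).
  by move=> p; have := ha p; rewrite aE => /homp_mxcol /(_ j).
have btb j : bt j *m be = b j.
  by rewrite -(mxcolK b j) eE submxcol_mul.
have afull m (x : 'M_(lr I, m)) : (forall j, bt j *m x = 0) -> x = 0.
  move=> h; have [_ [s [_ es]]] := sa p0.
  by rewrite -[x]mul1mx -es -mulmxA aE mxcol_mul (eq_mxcol (fun j => h j)) mxcol0 mulmx0.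
have aint C x : (forall j, lhom A C (bt j *m x)) -> lhom I C x.
  move=> h p; have [_ [s [hs es]]] := sa p; rewrite -[x]mul1mx -es -mulmxA.
  by apply: hompM hs _; rewrite aE mxcol_mul; apply/homp_mxcol => j; exact: h.
have becan m (x y : 'M_(m, lr I)) : x *m be = y *m be -> x = y.
  by have /row_freeP[be' e] := fbe => h; rewrite -[x]mulmx1 -[y]mulmx1 -e !mulmxA h.
(* the homomorphisms from I to A are determined by vectors of scalars *)
pose W (x : 'rV[k]_d) := exists2 r, lhom I A r & forall j, bt j *m r = (ι (x 0 j))%:M.
have W0 : W 0.
  exists 0; first by move=> p; exact: homp0.
  by move=> j; rewrite mulmx0 mxE rmorph0 scalemx0 || rewrite mulmx0 mxE rmorph0 raddf0.
have [s [w [fw Ww spanw]]] := span_pred W0.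
have /choice[r hr] : forall i, exists r, lhom I A r /\ forall j, bt j *m r = (ι (w i j))%:M.
  by move=> i; have [r h1 h2] := Ww i; exists r; split => // j; rewrite h2 mxE.
have /row_freeP[w' ew'] := fw.
pose bo i := \sum_j ι (w' j i) *: bt j.
have hbo i : lhom A I (bo i) by apply: lhom_sum => j; apply: lhomZ.
have bor i i' : bo i *m r i' = (ι ((i' == i)%:R))%:M.
  rewrite mulmx_suml (eq_bigr (fun j => (ι (w i' j * w' j i))%:M)); last first.
    move=> j _; rewrite -scalemxAl (hr i').2 scale_scalar_mx -rmorphM mulrC //.
  rewrite -raddf_sum -rmorph_sum /=; congr (ι _)%:M.
  by have /matrixP/(_ i' i) := ew'; rewrite !mxE => <-.
pose e := 1%:M - \sum_i r i *m bo i.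
have he : lhom I I e.
  apply: lhomB; first exact: lhom_id.
  by apply: lhom_sum => i; apply: lhomM (hbo i); case: (hr i).
have er i : e *m r i = 0.
  rewrite mulmxBl mul1mx mulmx_suml (bigD1 i) //= big1 ?addr0.
    by rewrite -mulmxA bor eqxx rmorph1 mulmx1 subrr.
  move=> j ji; rewrite -mulmxA bor eq_sym (negPf ji) rmorph0 raddf0 mulmx0 //.
have bte j : bt j = bt j *m e + \sum_i ι (w i j) *: bo i.
  rewrite mulmxBr mulmx1 mulmx_sumr -addrA [X in _ = _ + X](_ : _ = 0) ?addr0 //.
  rewrite addrC; apply/eqP; rewrite subr_eq0; apply/eqP; apply: eq_bigr => i _.
  by rewrite mulmxA (hr i).2 mul_scalar_mx.
(* the complement I' of the copies of A in I *)
have [I' [a' [b' [eE' fb' hb' sa']]]] := lattice_image he.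
have ha' : lhom I I' a' by move=> p; case: (sa' p).
have b'a' : b' *m a' = 1%:M.
  have [_ [s' [_ es']]] := sa' p0; have /row_freeP[b'' eb''] := fb'.
  have ee : e *m e = e.
    rewrite {2}/e mulmxBr mulmx1 mulmx_sumr big1 ?subr0 // => i _.
    by rewrite mulmxA er mul0mx.
  have : s' *m (e *m e) *m b'' = s' *m e *m b'' by rewrite ee.
  by rewrite eE' !mulmxA es' !mul1mx -!mulmxA eb'' !mulmx1.
have b'r i : b' *m r i = 0.
  by rewrite -[b']mul1mx -b'a' -[b' *m a' *m b']mulmxA -eE' -!mulmxA er mulmx0.
have I'A f : lhom I' A f -> f = 0.
  move=> hf; have h1 : lhom I A (a' *m f) by exact: lhomM hf.
  have /choice[x hx] : forall j, exists x, bt j *m (a' *m f) = (ι x)%:M.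
    by move=> j; apply: scA; exact: lhomM h1.
  have Wx : W (\row_j x j) by exists (a' *m f) => // j; rewrite hx mxE.
  have /submxP[y ey] := spanw _ Wx.
  have e1 : a' *m f = \sum_i ι (y 0 i) *: r i.
    apply/eqP; rewrite -subr_eq0; apply/eqP; apply: afull => j.
    rewrite mulmxBr hx mulmx_sumr (eq_bigr (fun i => (ι (y 0 i * w i j))%:M)); last first.
      by move=> i _; rewrite -scalemxAr (hr i).2 scale_scalar_mx -rmorphM.
    rewrite -raddf_sum -rmorph_sum /=.
    by have /matrixP/(_ 0 j) := ey; rewrite !mxE => ->; rewrite subrr.
  rewrite -[f]mul1mx -b'a' -mulmxA e1 mulmx_sumr big1 // => i _.
  by rewrite -scalemxAr b'r scaler0.
have [J [g1 [g2 [eg fg1 hg1 lg2]]]] := saturation (lhomM hb' hbe).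
have /row_fullP[t et] := fg1.
have [B2 [th st]] := lattice_cokernel G lg2.
have g2th : g2 *m th = 0 by have [? [? [_ []]]] := st p0.
have hth : lhom B B2 th by move=> p; have [? [? [[]]]] := st p.
have hg2 : lhom J B g2 by move=> p; case: (lg2 p).
have JA f : lhom J A f -> f = 0.
  move=> hf; have := I'A _ (lhomM hg1 hf); rewrite -[f in X in _ -> X]mul1mx -et -mulmxA.
  by move=> ->; rewrite mulmx0.
pose N i := bo i *m be *m th.
have bth j : b j *m th = \sum_i ι (w i j) *: N i.
  rewrite -btb {1}bte mulmxDl mulmxDl eE'.
  rewrite [X in X + _](_ : _ = 0) ?add0r.
    rewrite !mulmx_suml; apply: eq_bigr => i _; by rewrite -!scalemxAl.
  by rewrite -!mulmxA (mulmxA b') eg -mulmxA g2th !mulmx0.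
have fN : row_free (\mxcol_(i < s) N i).
  rewrite -kermx_eq0; apply/eqP/row_matrixP => q.
  set X := row q _; have : X *m \mxcol_i N i = 0 by rewrite -row_mul mulmx_ker row0.
  rewrite row0 -(submxrowK X) mul_mxrow_mxcol; set x := submxrow X => hx.
  suff x0 i : x i = 0 by rewrite (eq_mxrow (fun i => x0 i)) mxrow0.
  have [r0 [s0 [_ [_ _ _ e4]]]] := st p0.
  pose y := \sum_i x i *m bo i.
  have yth : y *m be *m th = 0.
    by rewrite -hx !mulmx_suml; apply: eq_bigr => l _; rewrite /N !mulmxA.
  have ybe : y *m be = y *m be *m r0 *m t *m b' *m be.
    rewrite -[LHS]mulmx1 -e4 mulmxDr [X in _ + X]mulmxA yth mul0mx addr0.
    by rewrite -(mulmxA _ b' be) eg !mulmxA -(mulmxA _ t) et mulmx1.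
  have := congr1 (mulmx^~ (r i)) (becan _ _ _ ybe).
  rewrite -[X in _ = X]mulmxA b'r mulmx0 mulmx_suml (bigD1 i) //= big1 ?addr0.
    by rewrite -mulmxA bor eqxx rmorph1 mulmx1.
  move=> l li; rewrite -mulmxA bor eq_sym (negPf li) rmorph0 raddf0 mulmx0 //.
have /row_freeP[N' eN'] := fN.
have JB2 h : lhom J B2 h -> h = 0.
  move=> hh; pose x := a' *m g1 *m h.
  have hx : lhom I B2 x by apply: lhomM hh; exact: lhomM hg1.
  have /choice[c hc] : forall j, exists c : 'I_d -> k, bt j *m x = (\sum_m ι (c m) *: b m) *m th.
    move=> j; have [f hf <-] := lift_ses st JA (lhomM (hbt j) hx).
    by have [c ->] := hb2 _ hf; exists c.
  pose C j i := \sum_m c j m * w i m.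
  pose R j := \mxrow_(i < s) (ι (C j i))%:M : 'M[K]_(lr A, \sum_(i < s) lr A).
  have hR j : bt j *m x = R j *m \mxcol_i N i.
    rewrite hc mul_mxrow_mxcol mulmx_suml.
    under eq_bigr do rewrite -scalemxAl bth scaler_sumr.
    rewrite exchange_big; apply: eq_bigr => i _ /=.
    rewrite mul_scalar_mx /C rmorph_sum scaler_suml; apply: eq_bigr => m _.
    by rewrite scalerA -rmorphM.
  pose xi := x *m N'.
  have hxi j : bt j *m xi = R j by rewrite mulmxA hR -mulmxA eN' mulmx1.
  have exi : xi *m \mxcol_i N i = x.
    apply/eqP; rewrite -subr_eq0; apply/eqP; apply: afull => j.
    by rewrite mulmxBr mulmxA hxi hR subrr.
  have hxii i : lhom I A (submxrow xi i).
    apply: aint => j; rewrite mul_submxrow hxi mxrowK; exact: lhom_scalar.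
  have b'xi : b' *m xi = 0.
    rewrite -(submxrowK xi) mul_mxrow (eq_mxrow (B_ := fun=> 0)) ?mxrow0 // => i.
    by apply: I'A; exact: lhomM (hxii i).
  have : b' *m x = 0 by rewrite -exi mulmxA b'xi mul0mx.
  rewrite /x !mulmxA b'a' mul1mx => e0.
  by rewrite -[h]mul1mx -et -mulmxA e0 mulmx0.
have [sg hsg esg] := lift_ses st JB2 (@lhom_id B2).
have [c ec] := scB _ (lhomM hth hsg).
have g2c : ι c *: g2 = 0.
  by rewrite -mul_mx_scalar -ec mulmxA g2th mul0mx.
have thc : ι c *: th = th.
  by rewrite -mul_scalar_mx -ec -mulmxA esg mulmx1.
have [c0|c0] := eqVneq c 0; last first.
  (* I' vanishes: I is a sum of copies of A *)
  left; have g20 : g2 = 0.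
    by apply/eqP; move/eqP: g2c; rewrite scaler_eq0 fmorph_eq0 (negPf c0).
  have b'0 : b' = 0 by apply: becan; rewrite eg g20 mulmx0 mul0mx.
  have bj j : b j = \sum_i ι (w i j) *: (bo i *m be).
    rewrite -btb {1}bte eE' b'0 !mulmx0 add0r mulmx_suml.
    by apply: eq_bigr => i _; rewrite scalemxAl.
  have /row_freeP[u eu] : row_free w^T.
    rewrite -kermx_eq0; apply/eqP/row_matrixP => q.
    set y := row q _; have : y *m w^T = 0 by rewrite -row_mul mulmx_ker row0.
    move=> yw; rewrite row0; apply/rowP => j; rewrite [RHS]mxE.
    apply: (hb3 (fun j => y 0 j) _ j).
    under eq_bigr do rewrite bj scaler_sumr.
    rewrite exchange_big big1 // => i _ /=.
    under eq_bigr do rewrite scalerA -rmorphM.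
    rewrite -scaler_suml -rmorph_sum; have /matrixP/(_ 0 i) := yw.
    rewrite !mxE => e0; rewrite (eq_bigr (fun l => y 0 l * w^T l i)) ?e0 ?rmorph0 ?scale0r //.
    by move=> l _; rewrite [w^T _ _]mxE.
  rewrite -kermx_eq0; apply/eqP/row_matrixP => q.
  set X := row q _; have : X *m E = 0 by rewrite -row_mul mulmx_ker row0.
  rewrite row0 -(submxrowK X) mul_mxrow_mxcol; set x := submxrow X => hx.
  suff x0 i : x i = 0 by rewrite (eq_mxrow (fun i => x0 i)) mxrow0.
  have hx1 : \sum_j x j *m bt j = 0.
    apply: becan; rewrite mul0mx -hx mulmx_suml; apply: eq_bigr => j _.
    by rewrite -mulmxA btb.
  have hx2 l : \sum_j ι (w l j) *: x j = 0.
    have := congr1 (mulmx^~ (r l)) hx1; rewrite mul0mx mulmx_suml => e0.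
    by rewrite -[RHS]e0; apply: eq_bigr => j _; rewrite -mulmxA (hr l).2 mul_mx_scalar.
  have : \sum_l ι (u l i) *: (\sum_j ι (w l j) *: x j) = 0.
    by rewrite big1 // => l _; rewrite hx2 scaler0.
  under eq_bigr do rewrite scaler_sumr.
  rewrite exchange_big (bigD1 i) //= [X in _ + X]big1 ?addr0 => [|j ji].
    under eq_bigr do rewrite scalerA -rmorphM mulrC.
    rewrite -scaler_suml -rmorph_sum; have /matrixP/(_ i i) := eu; rewrite !mxE eqxx.
    by under eq_bigr do rewrite mxE; move=> ->; rewrite rmorph1 scale1r.
  under eq_bigr do rewrite scalerA -rmorphM mulrC.
  rewrite -scaler_suml -rmorph_sum; have /matrixP/(_ j i) := eu; rewrite !mxE (negPf ji).
  by under eq_bigr do rewrite mxE; move=> ->; rewrite rmorph0 scale0r.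
(* no copy of A splits off: the image is all of B *)
right.
have th0 : th = 0 by rewrite -thc c0 rmorph0 scale0r.
have oneA0 : (1%:M : 'M[K]_(lr A)) != 0.
  apply/eqP => /matrixP/(_ (Ordinal A0) (Ordinal A0)); rewrite !mxE eqxx => /eqP.
  by rewrite oner_eq0.
have no_i (i : 'I_s) : False.
  have N0 : \mxcol_(i < s) N i = 0.
    rewrite (eq_mxcol (B_ := fun=> 0)) ?mxcol0 // => l.
    by rewrite /N th0 mulmx0.
  have : (1%:M : 'M[K]_(\sum_(i < s) lr A)) = 0 by rewrite -eN' N0 mul0mx.
  move/(congr1 (mulmx (\mxrow_(l < s) (1%:M : 'M[K]_(lr A))))).
  rewrite mulmx1 mulmx0 => /(congr1 (fun X => submxrow X i)); rewrite mxrowK submxrow0.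
  by move/eqP; rewrite (negPf oneA0).
have e1 : e = 1%:M.
  by rewrite /e big1 ?subr0 // => i; case: (no_i i).
have IA f : lhom I A f -> f = 0.
  move=> hf; rewrite -[f]mul1mx -e1 eE' -mulmxA (I'A (b' *m f)) ?mulmx0 //; exact: lhomM hf.
have [bi ebi] : exists bi, bi *m be = 1%:M.
  have [r0 [s0 [_ [_ _ _ e4]]]] := st p0.
  exists (r0 *m t *m b'); rewrite -mulmxA eg mulmxA -(mulmxA r0) et mulmx1.
  by move: e4; rewrite th0 mul0mx addr0.
have ebe : be *m bi = 1%:M by apply: becan; rewrite -mulmxA ebi mulmx1 mul1mx.
suff hbi p : homp B I p bi.
  move=> p; split; first exact: ev_hom.
  have [_ [sI [hsI esI]]] := sa p; exists (bi *m sI); split; first exact: hompM hsI.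
  by rewrite eE mulmxA -(mulmxA bi) esI mulmx1.
move=> i q; pose i0 := Ordinal A0.
pose f := invmx (lg A p) *m delta_mx i0 i *m lg B p *m bi.
have hfb : homp A B p (f *m be).
  rewrite /f -mulmxA ebi mulmx1 /homp !mulmxA mulmxV ?lg_unit // mul1mx.
  rewrite mulmxK ?lg_unit // => x y; rewrite mxE.
  by case: (_ && _); [exact: dO1|exact: dO0].
have [Phi hPhi] := serre0 IA (@madele_at _ _ _ D A I p f).
have hPb : lhom A B (Phi *m be).
  move=> q'; have hq := hompM (hPhi q') (hbe q'); rewrite mulmxBl in hq.
  have h2 : homp A B q' (at_ p f q' *m be).
    rewrite /at_; case: eqP => [->//|_]; rewrite mul0mx; exact: homp0.
  by have := hompB h2 hq; rewrite subKr.
have [c1 ec1] := hb2 _ hPb.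
have hP : lhom A I Phi.
  rewrite (becan _ Phi (\sum_j ι (c1 j) *: bt j)).
    by apply: lhom_sum => j; exact: lhomZ.
  rewrite ec1 mulmx_suml; apply: eq_bigr => j _; by rewrite -scalemxAl btb.
have hf : homp A I p f.
  by have := hompD (hPhi p) (hP p); rewrite /at_ eqxx subrK.
have := hf i0 q; rewrite /f /homp !mulmxA mulmxV ?lg_unit // mul1mx.
rewrite -!mulmxA; set X := lg B p *m _; rewrite mxE (bigD1 i) //= mxE !eqxx mul1r.
by rewrite big1 ?addr0 // => l li; rewrite mxE (negPf li) andbF mul0r.
Qed.
End EvLemma.
End Evaluation.
End Evaluation.

(** * Mutation of pairs of simple lattices *)
Module LatticeMutations.
Import Defs.
Export Evaluation.
Import Alg.
Import Order.TTheory GRing.Theory Num.Theory.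
Local Open Scope classical_set_scope.
Local Open Scope ring_scope.

Section Helix.
Variables (k K : fieldType) (P : choiceType) (D : dvrs k K P) (G : genus1 D).
Local Notation O := (dO D).
Local Notation ι := (kinc D).
Local Notation lattice := (lattice D).
Implicit Types A B C L M F E I : lattice.

(** For d > 2 this is positivity of the quadratic form d a b - a^2 - b^2, which the
substitution (a, b) -> (d a - b, a) preserves; for d = 2 that form is -(a - b)^2. *)
Definition numeric (d a b : nat) : Prop :=
  (d = 2 /\ a = 1 /\ b = 1)%N \/ ((2 < d)%N /\ (a * a + b * b < d * a * b)%N).

Definition good d A B := [/\ simple A, simple B, forall f, lhom B A f -> f = 0 &
  numeric d (lr A) (lr B)] /\ exists b : 'I_d -> 'M[K]_(lr A, lr B), lbasis b.

Definition triple d A B C := exists (n : 'I_d -> 'M[K]_(lr A, lr B)) (c : 'I_d -> 'M[K]_(lr B, lr C)),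
  [/\ lbasis n, lbasis c & ses A (pw d B) C (\mxrow_(j < d) n j) (\mxcol_(j < d) c j)].

(** This inequality makes d a - b a possible rank, so that the evaluation cannot be
injective. *)
Lemma numeric_lt d a b : (0 < a)%N -> (0 < b)%N -> numeric d a b -> (b < d * a)%N.
Proof. by move=> a0 b0 [[-> [-> ->]]|[d2 h]] //; rewrite ltnNge; apply/negP => ?; nia. Qed.

Lemma ses_rank L M B n f : ses L M B n f -> (lr L + lr B = lr M)%N.
Proof.
move=> h; have [p] := some_point G; have [r [s [_ [e1 e2 e3 e4]]]] := h p.
have fn : \rank n = lr L.
  by apply/eqP; rewrite eqn_leq rank_leq_row -{1}(mxrank1 K (lr L)) -e1 mxrankM_maxl.
have ff : \rank f = lr B.
  by apply/eqP; rewrite eqn_leq rank_leq_col -{1}(mxrank1 K (lr B)) -e2 mxrankM_maxr.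
apply/eqP; rewrite eqn_leq; apply/andP; split.
  have : (n <= kermx f)%MS by apply/sub_kermxP.
  move/mxrankS; rewrite mxrank_ker fn ff => h1.
  have := rank_leq_row f; rewrite ff; lia.
have := mxrank_add (r *m n) (f *m s); rewrite e4 mxrank1 => h1.
have h2 := mxrankM_maxr r n; have h3 := mxrankM_maxl f s.
by rewrite -{1}fn -ff; lia.
Qed.

Lemma lbasis_uniq A B d (b : 'I_d -> 'M[K]_(lr A, lr B)) : lbasis b ->
  forall c c' : 'I_d -> k, \sum_j ι (c j) *: b j = \sum_j ι (c' j) *: b j -> c =1 c'.
Proof.
move=> [_ _ h] c c' e j; apply/eqP; rewrite -subr_eq0; apply/eqP.
apply: (h (fun j => c j - c' j)).
rewrite (eq_bigr (fun j => ι (c j) *: b j - ι (c' j) *: b j)) ?sumrB ?e ?subrr //.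
by move=> l _; rewrite rmorphB scalerBl.
Qed.

Section Left.
Variables (A B L : lattice) (d : nat) (b : 'I_d -> 'M[K]_(lr A, lr B)).
Variable n : 'I_d -> 'M[K]_(lr L, lr A).
Hypotheses (sA : simple A) (sB : simple B) (hb : lbasis b).
Hypothesis BA : forall f, lhom B A f -> f = 0.
Hypothesis hs : ses L (pw d A) B (\mxrow_(j < d) n j) (\mxcol_(j < d) b j).
Local Notation Em := (\mxcol_(j < d) b j).
Local Notation Nm := (\mxrow_(j < d) n j).

Lemma left_hom j : lhom L A (n j).
Proof. by move=> p; have [? [? [[/homp_mxrow h _ _ _] _]]] := hs p. Qed.
Let hE : lhom (pw d A) B Em.
Proof. by move=> p; have [? [? [[]]]] := hs p. Qed.
Let NE : Nm *m Em = 0.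
Proof. by have [p] := some_point G; have [? [? [_ []]]] := hs p. Qed.

Lemma left_AL h : lhom A L h -> h = 0.
Proof.
move=> hh; have /choice[c hc] : forall j, exists c, h *m n j = (ι c)%:M.
  by move=> j; apply: sA.2; exact: lhomM (left_hom j).
have e0 : \sum_j ι (c j) *: b j = 0.
  transitivity (h *m Nm *m Em); last by rewrite -mulmxA NE mulmx0.
  rewrite mul_mxrow mul_mxrow_mxcol; apply: eq_bigr => j _.
  by rewrite hc mul_scalar_mx.
have [_ _ fb] := hb.
have hN : h *m Nm = 0.
  rewrite mul_mxrow (eq_mxrow (B_ := fun=> 0)) ?mxrow0 // => j.
  by rewrite hc (fb _ e0) rmorph0 raddf0.
have [p] := some_point G; have [r [_ [_ [e1 _ _ _]]]] := hs p.
by rewrite -[h]mulmx1 -e1 mulmxA hN mul0mx.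
Qed.

Lemma left_extend f : lhom L A f -> exists2 g : 'M_(lr (pw d A), lr A), lhom (pw d A) A g & Nm *m g = f.
Proof.
move=> hf; have [p0] := some_point G.
have /choice[r /choice[s hrs]] := hs.
pose g0 := r p0 *m f.
have eg0 : Nm *m g0 = f.
  by rewrite mulmxA; have [_ [-> _ _ _]] := hrs p0; rewrite mul1mx.
pose Dl p := r p *m f - g0.
have NDl p : Nm *m Dl p = 0.
  by rewrite mulmxBr eg0 mulmxA; have [_ [-> _ _ _]] := hrs p; rewrite mul1mx subrr.
have EsD p : Em *m (s p *m Dl p) = Dl p.
  have [_ [_ _ _ e4]] := hrs p.
  by rewrite -[RHS]mul1mx -e4 mulmxDl -[r p *m _ *m _]mulmxA NDl mulmx0 add0r mulmxA.
have [x hx] : exists x : 'M[K]_(lr B, lr A), forall p, homp B A p (s p *m Dl p - x).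
  apply: (serre (G := G)).
    apply: (@madeleM _ _ _ D B (pw d A) A s Dl).
      by apply: madele_int => p; case: (hrs p) => -[].
    apply: madeleB; last exact: madele_cst.
    by apply: madele_int => p; apply: hompM (hf p); case: (hrs p) => -[].
  move=> h /(hb.2)[c ->] || move=> h hh; have [_ sp _] := hb; have [c ->] := sp _ hh.
  pose X p := \sum_j ι (c j) * \tr (submxcol (r p *m f : 'M_(\sum_(i < d) lr A, lr A)) j).
  pose Y := \sum_j ι (c j) * \tr (submxcol (g0 : 'M_(\sum_(i < d) lr A, lr A)) j).
  have iX p : O p (X p).
    apply: dO_sum => j _; apply: dOM; first exact: dO_inc.
    apply: homp_tr; have : homp (pw d A) A p (r p *m f).
      by apply: hompM (hf p); case: (hrs p) => -[].
    by rewrite -{1}(submxcolK (r p *m f : 'M_(\sum_(i < d) lr A, lr A))) => /homp_mxcol.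
  rewrite (om_ext _ (b := fun p => X p - Y)).
    by rewrite (omB G (adele_int iX) (adele_cst D Y)) (om_int G iX) om_cst subrr.
  move=> p; rewrite mulmx_sumr raddf_sum /X /Y -sumrB; apply: eq_bigr => j _ /=.
  rewrite -scalemxAr mxtraceZ -mulrBr; congr (_ * _).
  rewrite mxtrace_mulC -raddfB -submxcolB -/(Dl p) -(EsD p).
  by rewrite -submxcol_mul mxcolK EsD.
exists (g0 + Em *m x); last by rewrite mulmxDr mulmxA NE mul0mx addr0 eg0.
move=> p; have -> : g0 + Em *m x = r p *m f - Em *m (s p *m Dl p - x).
  by rewrite mulmxBr EsD /Dl !opprB addrCA [X in _ = _ + X]addrC subrK addrC.
apply: hompB; first by apply: hompM (hf p); case: (hrs p) => -[].
exact: hompM (hE p) (hx p).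
Qed.

Lemma left_basis : lbasis n.
Proof.
split; first exact: left_hom.
  move=> f /left_extend[g hg <-].
  have /choice[c hc] : forall j, exists c, submxcol (g : 'M_(\sum_(i < d) lr A, lr A)) j = (ι c)%:M.
    move=> j; apply: sA.2 => p; have := hg p.
    by rewrite -{1}(submxcolK (g : 'M_(\sum_(i < d) lr A, lr A))) => /homp_mxcol.
  exists c; rewrite -{1}(submxcolK (g : 'M_(\sum_(i < d) lr A, lr A))) mul_mxrow_mxcol.
  by apply: eq_bigr => j _; rewrite hc mul_mx_scalar.
move=> c e0; have [p0] := some_point G.
pose C : 'M[K]_(\sum_(i < d) lr A, lr A) := \mxcol_(j < d) (ι (c j))%:M.
have NC : Nm *m C = 0.
  by rewrite mul_mxrow_mxcol -[RHS]e0; apply: eq_bigr => j _; rewrite mul_mx_scalar.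
have EC s r : r *m Nm + Em *m s = 1%:M -> Em *m (s *m C) = C.
  move=> e4; rewrite -[RHS]mul1mx -e4 mulmxDl -[r *m _ *m _]mulmxA NC mulmx0 add0r.
  by rewrite mulmxA.
have [r0 [s0 [_ [_ f2 _ f4]]]] := hs p0.
have t0 : s0 *m C = 0.
  apply: BA => p; have [r [s [[_ _ _ h4] [_ e2 _ e4]]]] := hs p.
  have -> : s0 *m C = s *m C.
    by rewrite -[RHS]mul1mx -f2 -mulmxA (EC _ _ e4).
  apply: hompM h4 _; apply/homp_mxcol => j; exact: lhom_scalar.
have C0 : C = 0 by rewrite -(EC _ _ f4) t0 mulmx0.
move=> j; have /(congr1 (fun X => submxcol X j)) := C0.
rewrite mxcolK submxcol0 => /matrixP/(_ (Ordinal sA.1) (Ordinal sA.1)).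
by rewrite !mxE eqxx => /eqP; rewrite fmorph_eq0 => /eqP.
Qed.

Lemma left_simple : (0 < lr L)%N -> simple L.
Proof.
move=> L0; split => // f hf; have [p0] := some_point G.
have [r [s [_ [e1 e2 _ e4]]]] := hs p0.
have [_ spn _] := left_basis; have [_ spb fb] := hb.
have /choice[c hc] : forall j, exists c : 'I_d -> k, f *m n j = \sum_m ι (c m) *: n m.
  by move=> j; apply: spn; exact: lhomM (left_hom j).
pose C : 'I_d -> 'M[K]_(lr A, lr B) := fun m => \sum_j ι (c j m) *: b j.
have hC : lhom (pw d A) B (\mxcol_m C m).
  by move=> p; apply/homp_mxcol => m; apply: lhom_sum => j; apply: lhomZ; case: hb.
have NC : Nm *m \mxcol_m C m = 0.
  transitivity (f *m Nm *m Em); last by rewrite -mulmxA NE mulmx0.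
  rewrite mul_mxrow !mul_mxrow_mxcol.
  under eq_bigr do rewrite mulmx_sumr.
  rewrite exchange_big; apply: eq_bigr => j _ /=; rewrite hc mulmx_suml.
  by apply: eq_bigr => m _; rewrite -scalemxAr -scalemxAl.
have EC s' r' : r' *m Nm + Em *m s' = 1%:M -> Em *m (s' *m \mxcol_m C m) = \mxcol_m C m.
  move=> h4; rewrite -[RHS]mul1mx -h4 mulmxDl -[r' *m _ *m _]mulmxA NC mulmx0 add0r.
  by rewrite mulmxA.
have [|g eg] := sB.2 (s *m \mxcol_m C m).
  move=> p; have [r' [s' [[_ _ _ h4] [_ h2 _ h5]]]] := hs p.
  have -> : s *m (\mxcol_m C m) = s' *m (\mxcol_m C m).
    by rewrite -[RHS]mul1mx -e2 -mulmxA (EC _ _ h5).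
  exact: hompM h4 (hC p).
have Cb m : \sum_j ι (c j m) *: b j = ι g *: b m.
  have := EC _ _ e4; rewrite eg => /(congr1 (fun X => submxcol X m)).
  by rewrite -submxcol_mul !mxcolK mul_mx_scalar => e; exact: esym e.
have cE m j : c j m = (if j == m then g else 0).
  apply: (lbasis_uniq hb (c := fun j => c j m) (c' := fun j => if j == m then g else 0)).
  rewrite Cb (bigD1 m) //= eqxx big1 ?addr0 // => l lm.
  by rewrite (negPf lm) rmorph0 scale0r.
exists g; have fN : f *m Nm = (ι g)%:M *m Nm.
  rewrite !mul_mxrow; apply: eq_mxrow => j; rewrite hc (bigD1 j) //= cE eqxx.
  rewrite big1 ?addr0 => [|m mj]; last by rewrite cE eq_sym (negPf mj) rmorph0 scale0r.
  by rewrite mul_scalar_mx.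
by rewrite -[f]mulmx1 -e1 mulmxA fN -mulmxA e1 mulmx1.
Qed.
End Left.

(** The kernel of the evaluation is simple because an endomorphism of it extends to A^d and
descends to B, and Serre duality provides the extension. *)
Lemma left_mutation d A B : good d A B -> exists L, triple d L A B /\ good d L A.
Proof.
move=> [[sA sB BA num] [b hb]].
have lt := numeric_lt sA.1 sB.1 num.
have [/eqP fE|sE] := evaluation G sA sB hb.
  have := rank_leq_col (\mxcol_(j < d) b j); rewrite fE sum_nat_const card_ord.
  by rewrite leqNgt lt.
have [L [n0 hs]] := lattice_kernel G sE.
pose n j := submxrow (n0 : 'M[K]_(lr L, \sum_(i < d) lr A)) j.
have {}hs : ses L (pw d A) B (\mxrow_(j < d) n j) (\mxcol_(j < d) b j).
  by rewrite submxrowK.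
have rk : (lr L + lr B = d * lr A)%N.
  by rewrite (ses_rank hs) /= sum_nat_const card_ord.
have L0 : (0 < lr L)%N by lia.
have hn := left_basis sA hb BA hs.
exists L; split; first by exists n, b.
split; last by exists n.
split => //; [exact: (left_simple sA sB hb BA hs L0)|by move=> f; exact: (left_AL sA hb hs)|].
case: num => [[d2 [a1 b1]]|[d2 h]]; [left|right]; first by rewrite d2 a1 b1 in rk *; lia.
split => //.
have e1 : (d * lr L * lr A = lr L * (lr L + lr B))%N by rewrite rk; nia.
have e2 : (d * lr A * lr B = (lr L + lr B) * lr B)%N by rewrite rk.
by rewrite e1; nia.
Qed.

Lemma lattice_ext r (g g' : P -> 'M[K]_r) u f u' f' : (forall p, g p = g' p) ->
  @Lattice _ _ _ D r g u f = @Lattice _ _ _ D r g' u' f'.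
Proof.
move=> /funext e; subst g'; congr Lattice; exact: Prop_irrelevance.
Qed.

Lemma ddE A : dual (dual A) = A.
Proof.
case: A => r g u f; apply: lattice_ext => p /=.
by rewrite -trmx_inv invmxK trmxK.
Qed.

Lemma dual_pw d A p : lg (dual (pw d A)) p = lg (pw d (dual A)) p.
Proof. by rewrite /= pw_inv tr_mxdiag. Qed.

Lemma homp_dual_pwr d A C p f : homp C (dual (pw d A)) p f -> homp C (pw d (dual A)) p f.
Proof. by rewrite /homp dual_pw. Qed.

Lemma homp_dual_pwl d A C p f : homp (dual (pw d A)) C p f -> homp (pw d (dual A)) C p f.
Proof. by rewrite /homp dual_pw. Qed.

Lemma lhom_dual A B f : lhom A B f -> lhom (dual B) (dual A) f^T.
Proof. by move=> h p; exact: homp_dual. Qed.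

Lemma lhom_undual A B f : lhom (dual B) (dual A) f -> lhom A B f^T.
Proof. by move=> h p; have := homp_dual (h p) => /homp_ddl/homp_ddr. Qed.

Lemma simple_dual A : simple A -> simple (dual A).
Proof.
move=> [A0 h]; split => // f /lhom_undual/h[c e]; exists c.
by rewrite -[f]trmxK e tr_scalar_mx.
Qed.

Lemma lbasis_dual A B d (b : 'I_d -> 'M[K]_(lr A, lr B)) : lbasis b ->
  @lbasis _ _ _ D (dual B) (dual A) d (fun j => (b j)^T).
Proof.
have trs (c : 'I_d -> k) : (\sum_j ι (c j) *: b j)^T = \sum_j ι (c j) *: (b j)^T.
  by rewrite linear_sum; apply: eq_bigr => j _; rewrite linearZ.
move=> [h1 h2 h3]; split => [j|f /lhom_undual/h2[c e]|c e].
- exact: lhom_dual.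
- by exists c; rewrite -trs -e trmxK.
- by apply: h3; apply: trmx_inj; rewrite trs e trmx0.
Qed.

Lemma triple_dual d A B C : triple d A B C -> triple d (dual C) (dual B) (dual A).
Proof.
move=> [n [c [hn hc hs]]].
exists (fun j => (c j)^T), (fun j => (n j)^T).
split; [exact: lbasis_dual|exact: lbasis_dual|].
move=> p; have := ses_dual hs p; rewrite tr_mxcol tr_mxrow.
move=> [r [s [[h1 h2 h3 h4] e]]]; exists r, s; split => //.
by split; [exact: homp_dual_pwr|exact: homp_dual_pwl|exact: homp_dual_pwl|exact: homp_dual_pwr].
Qed.

Lemma good_dual d A B : good d A B -> good d (dual B) (dual A).
Proof.
move=> [[sA sB BA num] [b hb]]; split; last by eexists; exact: lbasis_dual hb.
split; [exact: simple_dual|exact: simple_dual| |].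
  by move=> f /lhom_undual/BA e; rewrite -[f]trmxK e trmx0.
case: num => [[-> [a b1]]|[d2 h]]; [by left; rewrite /= a b1|right; split => //].
by rewrite /= addnC mulnAC.
Qed.

(** Transposition reverses arrows, so that the right mutation is the left mutation of the
dual pair. *)
Lemma right_mutation d A B : good d A B -> exists R, triple d A B R /\ good d B R.
Proof.
move=> /good_dual/left_mutation[L [h1 h2]]; exists (dual L).
move: (triple_dual h1) (good_dual h2); rewrite !ddE //.
Qed.

(** Left and right mutation preserve good pairs and are inverse to each other, so that both
can be iterated and the results glued at the given pair. *)
Theorem lattice_helix d A B : good d A B -> exists E : int -> lattice,
  [/\ E (-1) = A, E 0 = B, forall i, good d (E (i - 1)) (E i) &
      forall i, triple d (E (i - 2)) (E (i - 1)) (E i)].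
Proof.
move=> gAB; pose T := {X : lattice * lattice | good d X.1 X.2}.
have /choice[lf hlf] : forall t : T, exists t' : T,
    (sval t').2 = (sval t).1 /\ triple d (sval t').1 (sval t).1 (sval t).2.
  move=> -[[X Y] /= g]; have [L [h1 h2]] := left_mutation g.
  by exists (exist _ (L, X) h2).
have /choice[rt hrt] : forall t : T, exists t' : T,
    (sval t').1 = (sval t).2 /\ triple d (sval t).1 (sval t).2 (sval t').2.
  move=> -[[X Y] /= g]; have [R [h1 h2]] := right_mutation g.
  by exists (exist _ (Y, R) h2).
pose t0 : T := exist (fun X => good d X.1 X.2) (A, B) gAB.
pose pr (i : int) := match i with Posz n => iter n rt t0 | Negz n => iter n.+1 lf t0 end.
have stepE (i : int) : (sval (pr (i - 1))).2 = (sval (pr i)).1 /\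
    triple d (sval (pr (i - 1))).1 (sval (pr i)).1 (sval (pr i)).2.
  case: i => [[|n]|n].
  - rewrite sub0r; exact: hlf t0.
  - have -> : (n.+1%:Z - 1 = n%:Z)%R by lia.
    by have [e h] := hrt (pr n); rewrite /= e.
  - have -> : (Negz n - 1 = Negz n.+1)%R by lia.
    exact: hlf (pr (Negz n)).
pose E i := (sval (pr i)).2.
have E1 i : E (i - 1) = (sval (pr i)).1 by case: (stepE i).
have i2 (i : int) : i - 2 = i - 1 - 1 by lia.
exists E; split => //.
- exact: (E1 0).
- by move=> i; rewrite E1; exact: (svalP (pr i)).
- by move=> i; rewrite i2 !E1; case: (stepE i) => _; rewrite -E1.
Qed.

Lemma helix_hom0 d (E : int -> lattice) : (forall i, good d (E (i - 1)) (E i)) ->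
  (forall i, triple d (E (i - 2)) (E (i - 1)) (E i)) ->
  forall i j : int, i < j -> forall f, lhom (E j) (E i) f -> f = 0.
Proof.
move=> gE tE i j ij; have [m ->] : exists m : nat, j = i + 1 + m%:Z.
  by exists (absz (j - i - 1)%R); lia.
elim: m => [|m IH] f hf.
  have [[_ _ h _] _] := gE (i + 1); have e : i + 1 - 1 = i by lia.
  by move: f hf; rewrite addr0; rewrite e in h.
have [n [c [_ hc hs]]] := tE (i + 1 + m.+1%:Z).
have e : i + 1 + m.+1%:Z - 1 = i + 1 + m%:Z by lia.
rewrite e in n c hc hs.
have [p] := some_point G; have [r [s [_ [_ e2 _ _]]]] := hs p.
rewrite -[f]mul1mx -e2 -mulmxA mxcol_mul (eq_mxcol (B_ := fun=> 0)) ?mxcol0 ?mulmx0 //.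
by move=> l; apply: IH; case: hc => h _ _; exact: lhomM hf.
Qed.

(** The vanishing of Hom(B, A) has to be deduced: a nonzero map B -> A composed with the
maps A -> B gives endomorphisms, which are scalars by simplicity. *)
Lemma good_of_numeric d A B (b : 'I_d -> 'M[K]_(lr A, lr B)) : simple A -> simple B ->
  lbasis b -> numeric d (lr A) (lr B) -> good d A B.
Proof.
move=> sA sB hb num; split; last by exists b.
split => // g hg; have lt := numeric_lt sA.1 sB.1 num.
have [/eqP fE|sE] := evaluation G sA sB hb.
  have := rank_leq_col (\mxcol_(j < d) b j); rewrite fE sum_nat_const card_ord.
  by rewrite leqNgt lt.
have [hb1 hb2 hb3] := hb.
have /choice[c hc] : forall j, exists c, b j *m g = (ι c)%:M.
  by move=> j; apply: sA.2; exact: lhomM hg.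
have [p] := some_point G; have [_ [s [_ es]]] := sE p.
have [c0|[j cj]] : (forall j, c j = 0) \/ exists j, c j != 0.
- by have [/existsP|/existsPn h] := boolP [exists j, c j != 0]; [right|left => j; apply/eqP; rewrite -[_ == _]negbK].
- rewrite -[g]mul1mx -es -mulmxA mxcol_mul (eq_mxcol (B_ := fun=> 0)) ?mxcol0 ?mulmx0 //.
  by move=> j; rewrite hc c0 rmorph0 raddf0.
have [e he] := sB.2 _ (lhomM hg (hb1 j)).
have e0 : ι e != 0.
  apply: contraTneq isT => e0; have : b j *m g *m (b j *m g) = 0.
    by rewrite -mulmxA (mulmxA g) he e0 raddf0 mul0mx mulmx0.
  rewrite hc -scalar_mxM => /matrixP/(_ (Ordinal sA.1) (Ordinal sA.1)).
  by rewrite !mxE eqxx => /eqP; rewrite mulf_eq0 fmorph_eq0 (negPf cj).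
have bi i : ι e *: b i = ι (c i) *: b j.
  by rewrite -mul_mx_scalar -he mulmxA hc mul_scalar_mx.
have [i ij] : exists i : 'I_d, i != j.
  have d2 : (1 < d)%N by case: num => [[-> _]|[h _]] //; exact: ltnW h.
  have [j0|j0] := eqVneq (val j) 0%N.
    by exists (Ordinal d2); rewrite -val_eqE /= j0.
  by exists (Ordinal (ltnW d2)); rewrite -val_eqE /= eq_sym.
have h := hb3 (fun l => if l == i then e else if l == j then - c i else 0) _ i.
rewrite eqxx in h; move: e0; rewrite h ?rmorph0 ?eqxx //.
rewrite (bigD1 i) //= (bigD1 j) /= 1?eq_sym // eqxx [j == i]eq_sym (negPf ij) eqxx.
rewrite big1 ?addr0; first by rewrite bi rmorphN scaleNr subrr.
by move=> l /andP[li lj]; rewrite (negPf li) (negPf lj) rmorph0 scale0r.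
Qed.
End Helix.
End LatticeMutations.

(** * The basis theorem *)
Module HilbertBasis.
Import Defs.
Export LatticeMutations.
Import all_boot all_order all_algebra.
Import all_classical.
Import mpoly topology_structure subtype_topology.
Import fingroup perm.
Import Order.TTheory GRing.Theory Num.Theory.
Local Open Scope classical_set_scope.
Local Open Scope ring_scope.

Definition noetherian_seq (R : comNzRingType) := forall f : nat -> R,
  exists (N : nat) (c : nat -> R), f N = \sum_(i < N) c i * f i.

Lemma noetherian_field (F : fieldType) : noetherian_seq F.
Proof.
move=> f; have [f0|f0] := eqVneq (f 0%N) 0.
  by exists 0%N, (fun=> 0); rewrite big_ord0.
by exists 1%N, (fun=> f 1%N / f 0%N); rewrite big_ord1 mulfVK.
Qed.

Lemma noetherian_surj (R S : comNzRingType) (phi : {rmorphism S -> R}) :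
  (forall x, exists y, phi y = x) -> noetherian_seq S -> noetherian_seq R.
Proof.
move=> sphi nS f; have /choice[g hg] := fun i => sphi (f i).
have [N [c e]] := nS g; exists N, (fun i => phi (c i)).
by rewrite -hg e rmorph_sum; apply: eq_bigr => i _; rewrite rmorphM hg.
Qed.

Section Hilbert.
Variables (R : comNzRingType) (nR : noetherian_seq R).

Definition in_span (S : comNzRingType) (f : nat -> S) (n : nat) (x : S) :=
  exists c : nat -> S, x = \sum_(i < n) c i * f i.

Lemma in_span_sub (S : comNzRingType) (f : nat -> S) n x y :
  in_span f n x -> in_span f n y -> in_span f n (x - y).
Proof.
move=> [c ->] [c' ->]; exists (fun i => c i - c' i).
by rewrite -sumrB; apply: eq_bigr => i _; rewrite mulrBl.
Qed.
Lemma in_span_mul (S : comNzRingType) (f : nat -> S) n a x :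
  in_span f n x -> in_span f n (a * x).
Proof.
move=> [c ->]; exists (fun i => a * c i).
by rewrite mulr_sumr; apply: eq_bigr => i _; rewrite mulrA.
Qed.
Lemma in_span_gen (S : comNzRingType) (f : nat -> S) n i : (i < n)%N -> in_span f n (f i).
Proof.
move=> ni; exists (fun j => (j == i)%:R); rewrite (bigD1 (Ordinal ni)) //= eqxx mul1r.
by rewrite big1 ?addr0 // => j; rewrite -val_eqE /= => /negPf ->; rewrite mul0r.
Qed.
Lemma in_span_le (S : comNzRingType) (f : nat -> S) n m x : (n <= m)%N ->
  in_span f n x -> in_span f m x.
Proof.
move=> nm [c ->]; elim/big_rec: _ => [|i y _ hy].
  by exists (fun=> 0); rewrite big1 // => i _; rewrite mul0r.
rewrite -[_ + y]opprK opprD -[- (_ * _)]sub0r; have h0 : in_span f m 0.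
  by exists (fun=> 0); rewrite big1 // => j _; rewrite mul0r.
rewrite -[X in in_span _ _ X]sub0r; apply: (in_span_sub h0).
apply: in_span_sub => //; apply: (in_span_sub h0); apply: in_span_mul.
by apply: in_span_gen; exact: leq_trans (ltn_ord i) nm.
Qed.

(* Hilbert's basis theorem: compare leading coefficients of elements of least degree. *)
(** Ideals are replaced by sequences of elements: a ring is noetherian when, in every
sequence, some term lies in the span of the earlier ones. *)
Theorem hilbert_basis : noetherian_seq {poly R}.
Proof.
move=> g; apply: contrapT => bad.
have gbad N : ~ in_span g N (g N) by move=> [c e]; apply: bad; exists N, c.
pose I x := exists N, in_span g N x.
have IB x y : I x -> I y -> I (x - y).
  move=> [N h] [M h']; exists (maxn N M); apply: in_span_sub.
    exact: in_span_le (leq_maxl _ _) h.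
  exact: in_span_le (leq_maxr _ _) h'.
have IM a x : I x -> I (a * x) by move=> [N h]; exists N; exact: in_span_mul.
have I0 : I 0 by exists 0%N, (fun=> 0); rewrite big_ord0.
pose sp (s : seq {poly R}) x := in_span (nth 0 s) (size s) x.
pose all_in (s : seq {poly R}) := forall x, x \in s -> I x.
have next s : all_in s -> exists x, [/\ I x, ~ sp s x &
    forall y, I y -> ~ sp s y -> (size x <= size y)%N].
  move=> hs; have [M hM] : exists M, forall x, x \in s -> in_span g M x.
    elim: s hs => [|a s IH] hs; first by exists 0%N.
    have [|M hM] := IH; first by move=> x xs; apply: hs; rewrite inE xs orbT.
    have [|N hN] := hs a; first by rewrite inE eqxx.
    exists (maxn N M) => x; rewrite inE => /orP[/eqP ->|/hM h].
      exact: in_span_le (leq_maxl _ _) hN.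
    exact: in_span_le (leq_maxr _ _) h.
  have nM : ~ sp s (g M).
    move=> [c e]; apply: (gbad M); rewrite e.
    have h0 : in_span g M 0 by exists (fun=> 0); rewrite big1 // => j _; rewrite mul0r.
    apply: (big_ind (in_span g M)) => // [x y hx hy|i _].
      by rewrite -[y]opprK -[- y]sub0r; apply: in_span_sub => //; apply: in_span_sub.
    by apply: in_span_mul; apply: hM; exact: mem_nth.
  have ex : exists m, `[< exists x, [/\ I x, ~ sp s x & size x = m] >].
    exists (size (g M)); apply/asboolP; exists (g M); split => //.
    by exists M.+1; exact: in_span_gen.
  case: (ex_minnP ex) => m /asboolP[x [Ix nx <-]] hmin.
  by exists x; split => // y Iy ny; apply: hmin; apply/asboolP; exists y.
have /choice[nx hnx] : forall s, exists x, all_in s -> [/\ I x, ~ sp s x &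
    forall y, I y -> ~ sp s y -> (size x <= size y)%N].
  move=> s; have [h|h] := pselect (all_in s); last by exists 0.
  by have [x hx] := next s h; exists x.
pose L := fix L n := if n is m.+1 then rcons (L m) (nx (L m)) else [::].
have sL n : size (L n) = n by elim: n => //= n IH; rewrite size_rcons IH.
have hL n : all_in (L n).
  elim: n => //= n IH x; rewrite mem_rcons inE => /orP[/eqP ->|/IH //].
  by case: (hnx _ IH).
pose f n := nx (L n).
have nthL n i : (i < n)%N -> nth 0 (L n) i = f i.
  elim: n => // n IH; rewrite ltnS leq_eqVlt => /orP[/eqP ->|h] /=.
    by rewrite nth_rcons sL ltnn eqxx.
  by rewrite nth_rcons sL h; exact: IH.
have spL n x : sp (L n) x <-> in_span f n x.
  by rewrite /sp sL; split => -[c ->]; exists c; apply: eq_bigr => i _; rewrite nthL.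
have If n : I (f n) by case: (hnx _ (hL n)).
have nf n : ~ in_span f n (f n) by move/spL; case: (hnx _ (hL n)).
have mf n y : I y -> ~ in_span f n y -> (size (f n) <= size y)%N.
  by move=> Iy ny; case: (hnx _ (hL n)) => _ _; apply=> // /spL.
have sle i n : (i <= n)%N -> (size (f i) <= size (f n))%N.
  by move=> le; apply: mf => // h; apply: (nf n); exact: in_span_le le h.
have [N [c e]] := nR (fun n => lead_coef (f n)).
have f0 i : f i != 0.
  apply/eqP => fi0; apply: (nf i); rewrite fi0.
  by exists (fun=> 0); rewrite big1 // => j _; rewrite mul0r.
pose h := \sum_(i < N) (c i *: 'X^(size (f N) - size (f i))) * f i.
have hs : in_span f N h.
  by exists (fun i => c i *: 'X^(size (f N) - size (f i))).
have Ih : I h.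
  rewrite /h; apply: (big_ind I) => // [x y hx hy|i _]; last exact: IM.
  by rewrite -[y]opprK -[- y]sub0r; apply: (IB) => //; apply: (IB).
have : (size (f N) <= size (f N - h)%R)%N.
  apply: mf; first exact: IB.
  move=> h1; apply: (nf N); have := in_span_sub h1 (in_span_mul (-1) hs).
  by rewrite mulN1r opprK subrK.
rewrite leqNgt => /negP; apply.
have sN : (0 < size (f N))%N by rewrite size_poly_gt0.
rewrite -[X in (_ < X)%N](prednK sN) ltnS; apply/leq_sizeP => j.
rewrite leq_eqVlt => /orP[/eqP <-|hj].
  rewrite coefB -/(lead_coef (f N)) e coef_sum -sumrB big1 // => i _.
  rewrite -scalerAl coefZ coefXnM ltnNge.
  have le : (size (f i) <= size (f N))%N by apply: sle; exact: ltnW.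
  have si : (0 < size (f i))%N by rewrite size_poly_gt0.
  have -> : (size (f N) - size (f i) <= (size (f N)).-1)%N by lia.
  have -> : ((size (f N)).-1 - (size (f N) - size (f i)) = (size (f i)).-1)%N by lia.
  by rewrite subrr.
rewrite prednK // in hj.
rewrite coefB nth_default // sub0r coef_sum big1 ?oppr0 // => i _.
rewrite -scalerAl coefZ coefXnM; have le : (size (f i) <= size (f N))%N by apply: sle; exact: ltnW.
case: ltnP => // h1; first by rewrite mulr0.
by rewrite nth_default ?mulr0 // leq_subRL // subnK.
Qed.
End Hilbert.

Lemma noetherian_mpoly (k : fieldType) n : noetherian_seq {mpoly k[n]}.
Proof.
elim: n => [|n IH].
  apply: (noetherian_surj (phi := (@mpolyC 0 k : {rmorphism k -> {mpoly k[0]}}))).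
    by move=> x; exists x@_0%MM; exact: esym (nvar0_mpolyC x).
  exact: noetherian_field.
pose phi : {rmorphism {poly {mpoly k[n]}} -> {mpoly k[n.+1]}} :=
  horner_eval ('X_ord_max : {mpoly k[n.+1]}) \o map_poly (@mwiden n k).
apply: (noetherian_surj (phi := phi)); last exact: hilbert_basis.
pose im x := exists y, phi y = x.
have imD x y : im x -> im y -> im (x + y).
  by move=> [a <-] [b <-]; exists (a + b); rewrite rmorphD.
have imM x y : im x -> im y -> im (x * y).
  by move=> [a <-] [b <-]; exists (a * b); rewrite rmorphM.
have im0 : im 0 by exists 0; rewrite rmorph0.
have im1 : im 1 by exists 1; rewrite rmorph1.
have imC c : im c%:MP.
  exists (c%:MP)%:P; rewrite /phi /= map_polyC /horner_eval hornerC.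
  exact: mwidenC.
have imX i : im 'X_i.
  have [j ->|->] := unliftP ord_max i; last first.
    by exists 'X; rewrite /phi /= map_polyX /horner_eval hornerX.
  exists ('X_j)%:P; rewrite /phi /= map_polyC /horner_eval hornerC.
  rewrite -[LHS]/(mwiden 'X_j) mwidenX mnmwiden1; congr 'X_[U_( _)]; apply: val_inj.
  by rewrite /= /bump leqNgt ltn_ord.
move=> p; rewrite -/(im p) (mpolyE p); apply: (big_ind im) => // m _.
rewrite -mul_mpolyC; apply: (imM) => //; rewrite (mpolyXE_id _ m).
apply: (big_ind im) => // i _; elim: (m i) => [|e IHe]; first by rewrite expr0.
by rewrite exprS; exact: imM.
Qed.
End HilbertBasis.

(** * The Zariski topology of a curve *)
Module Curves.
Import Defs.
Export HilbertBasis.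
Import all_boot all_order all_algebra.
Import all_classical.
Import mpoly topology_structure subtype_topology separation_axioms initial_topology.
Import fingroup perm.
Import Order.TTheory GRing.Theory Num.Theory.
Local Open Scope classical_set_scope.
Local Open Scope ring_scope.

Section ProjectiveSets.
Variables (k : fieldType) (n : nat).
Local Notation PP := (pspace k n).

Definition pvec (l : PP) : 'I_n.+1 -> k := vpick (val l) ord0.

Lemma fvalE (f : {mpoly k[n.+1]}) l : fval f l = f.@[pvec l].
Proof. by []. Qed.

Lemma pvec_neq0 (l : PP) : exists i, pvec l i != 0.
Proof.
apply: contrapT => h; have : vpick (val l) == 0.
  apply/eqP/rowP => i; rewrite mxE; apply: contrapT => /eqP hi; apply: h.
  by exists i.
by rewrite vpick0 -dimv_eq0 (eqP (valP l)).
Qed.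

Lemma line_vpick (l : PP) : val l = <[vpick (val l)]>%VS.
Proof.
apply/eqP; rewrite eq_sym eqEdim -memvE memv_pick (eqP (valP l)) dim_vline.
by rewrite vpick0 -dimv_eq0 (eqP (valP l)).
Qed.

Lemma homogX1 (i : 'I_n.+1) : ('X_i : {mpoly k[n.+1]}) \is 1.-homog.
Proof. by rewrite dhomogX /= mdeg1. Qed.

Lemma separating_form (l m : PP) : l <> m -> exists f : {mpoly k[n.+1]},
  [/\ f \is 1.-homog, fval f l = 0 & fval f m != 0].
Proof.
move=> lm; pose F i j : {mpoly k[n.+1]} := pvec l j *: 'X_i - pvec l i *: 'X_j.
have FE i j x : fval (F i j) x = pvec l j * pvec x i - pvec l i * pvec x j.
  by rewrite fvalE mevalB !mevalZ !mevalXU.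
apply: contrapT => h.
have F0 i j : pvec l j * pvec m i = pvec l i * pvec m j.
  apply/eqP; rewrite -subr_eq0 -FE; apply: contrapT => /negP hf; apply: h.
  exists (F i j); split => //; first by rewrite rpredB ?dhomogZ ?homogX1.
  by rewrite FE mulrC subrr.
apply: lm; apply: val_inj; have [j lj] := pvec_neq0 l; have [j' mj'] := pvec_neq0 m.
rewrite (line_vpick l) (line_vpick m).
have e : vpick (val m) = (pvec m j / pvec l j) *: vpick (val l).
  apply/rowP => i; rewrite mxE -[vpick (val m) 0 i]/(pvec m i) -[vpick (val l) 0 i]/(pvec l i) mulrAC; apply: (mulfI lj).
  by rewrite mulrCA mulfV // mulr1 F0 mulrC.
apply/eqP; rewrite eq_sym eqEdim !dim_vline !vpick0 -!dimv_eq0 (eqP (valP l)) (eqP (valP m)) leqnn andbT.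
by rewrite e -memvE memvZ // memv_line.
Qed.

Lemma zclosedP (Z : set PP) : closed Z -> exists S : set {mpoly k[n.+1]},
  (forall f, S f -> exists d : nat, f \is d.-homog) /\
  Z = [set l | forall f, S f -> fval f l = 0].
Proof.
move=> /closed_openC[S [hS e]]; exists S; split => //.
by rewrite -[Z]setCK e setCK.
Qed.

Lemma zopen_form (f : {mpoly k[n.+1]}) d : f \is d.-homog ->
  open [set l : PP | fval f l != 0].
Proof.
move=> hf; exists [set f]; split; first by move=> _ ->; exists d.
apply/seteqP; split => l /=; first by move=> /eqP h; apply: contra_not h => /(_ f erefl).
by move=> h; apply/eqP => e; apply: h => _ ->.
Qed.

Lemma closed_point (l : PP) : closed [set l].
Proof.
rewrite -[X in closed X]setCK; apply: open_closedC.
have -> : ~` [set l] = \bigcup_(f in [set f : {mpoly k[n.+1]} | f \is 1.-homog /\ fval f l = 0])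
    [set m | fval f m != 0].
  apply/seteqP; split => m /=.
    move=> ml; have [|f [h1 h2 h3]] := @separating_form l m; first by move=> e; apply: ml.
    by exists f.
  by move=> [f [_ h1] /= h2] ml; rewrite ml h1 eqxx in h2.
by apply: bigcup_open => f [hf _]; exact: zopen_form hf.
Qed.

(* the descending chain condition for closed sets *)
Lemma zclosed_dcc (Z : nat -> set PP) : (forall i, closed (Z i)) ->
  (forall i, Z i.+1 `<=` Z i) -> exists i, Z i `<=` Z i.+1.
Proof.
move=> cZ dZ; apply: contrapT => h.
have /choice[f /all_and2[f1 f2]] : forall i, exists f : {mpoly k[n.+1]},
    (forall l, Z i.+1 l -> fval f l = 0) /\ exists l, Z i l /\ fval f l != 0.
  move=> i; have [S [hS eZ]] := zclosedP (cZ i.+1).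
  apply: contrapT => hf; apply: h; exists i => l Zl; rewrite eZ => f Sf.
  apply: contrapT => /eqP f0; apply: hf; exists f; split; last by exists l.
  by move=> m; rewrite eZ; apply.
have dec i j : (i <= j)%N -> Z j `<=` Z i.
  move=> /subnK <-; elim: (j - i)%N => // m IH; exact: subset_trans (dZ _) IH.
have [N [c e]] := @noetherian_mpoly k n.+1 f.
have [l [Zl]] := f2 N; rewrite fvalE e raddf_sum big1 ?eqxx // => i _ /=.
by rewrite mevalM -[(f i).@[_]]fvalE f1 ?mulr0 //; exact: dec Zl.
Qed.
End ProjectiveSets.

Section Curve.
Variables (k : fieldType) (n : nat) (X : set (pspace k n)) (hX : smooth_curve X).

Lemma proper_closed_finite (Z : set (pspace k n)) : closed Z -> Z `<=` X -> ~ X `<=` Z ->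
  finite_set Z.
Proof.
have [cX iX [_ dX] _] := hX.
move=> cZ ZX nXZ; apply: contrapT => iZ.
pose bad (Y : set (pspace k n)) := [/\ closed Y, Y `<=` X, ~ X `<=` Y & ~ finite_set Y].
have [Y [bY mY]] : exists Y, bad Y /\ forall Y', bad Y' -> Y' `<=` Y -> Y `<=` Y'.
  apply: contrapT => h.
  pose T := {Y | bad Y}.
  have /choice[nx hnx] : forall Y : T, exists Y' : T, sval Y' `<=` sval Y /\ ~ sval Y `<=` sval Y'.
    move=> [Y bY] /=; apply: contrapT => hY; apply: h; exists Y; split => // Y' bY' sY.
    by apply: contrapT => nY; apply: hY; exists (exist _ Y' bY').
  pose z i := iter i nx (exist bad Z (And4 cZ ZX nXZ iZ)).
  have [|i|i hi] := @zclosed_dcc k n (fun i => sval (z i)).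
  - by move=> i; case: (svalP (z i)).
  - by case: (hnx (z i)).
  - by case: (hnx (z i)).
have [cY YX nXY iY] := bY.
have [p Yp] : Y !=set0.
  by apply/set0P; apply: contra_notN iY => /eqP ->.
apply: dX; exists (fun i => if i is 0 then [set p] else if i is 1 then Y else X).
split => [[|[|i]] _|[|[|i]] //].
- split; [exact: closed_point| |by move=> _ ->; exact: YX].
  split; first by exists p.
  by move=> A B _ _ h; have [|] := h p erefl; [left|right] => _ ->.
- split => //; split; first by exists p.
  move=> A B cA cB h.
  have key C : closed C -> ~ finite_set (Y `&` C) -> Y `<=` C.
    move=> cC iC; apply: subset_trans (@subIsetr _ Y C); apply: mY; last exact: subIsetl.
    split => //; [exact: closedI|by move=> y [/YX]|by move=> h'; apply: nXY => y /h'[]].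
  have [fA|iA] := pselect (finite_set (Y `&` A)); last by left; exact: key.
  right; apply: (key _ cB) => fB; apply: iY.
  apply: (@sub_finite_set _ _ ((Y `&` A) `|` (Y `&` B))).
    by move=> y Yy; have [|] := h y Yy; [left|right].
  by rewrite finite_setU.
- by split.
- split; first by move=> _ ->.
  by move=> h; apply: iY; exact: sub_finite_set h (finite_set1 p).
Qed.

Lemma open_subtype (U : set X) : open U -> exists W : set (pspace k n),
  open W /\ set_val @^-1` W = U.
Proof. by case=> W oW e; exists W. Qed.

Lemma subtype_open (W : set (pspace k n)) : open W -> open (set_val @^-1` W : set X).
Proof. by move=> oW; exists W. Qed.

Lemma open_cofinite (U : set X) : open U -> U !=set0 -> finite_set (~` U).
Proof.
have [cX _ _ _] := hX.
move=> /open_subtype[W [oW <-]] [x Wx].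
have : finite_set (X `&` ~` W).
  apply: proper_closed_finite; [apply: closedI => //; exact: open_closedC|by move=> ? []|].
  by move=> h; have [_] := h _ (set_valP x); apply.
move=> /(@finite_preimage X _ _ set_val) h.
apply: (sub_finite_set _ (h _)); last by move=> ? ? _ _; exact: val_inj.
by move=> y /= nW; split => //; exact: set_valP.
Qed.

Lemma cofinite_open (A : set X) : finite_set A -> open (~` A).
Proof.
move=> fA; apply: closed_openC; apply: (accessible_finite_set_closed.1 _ _ fA) => x y xy.
have xy' : set_val x <> set_val y by move=> e; move/eqP: xy; apply; exact: val_inj.
exists (set_val @^-1` (~` [set set_val y])); split.
- by apply: subtype_open; apply: closed_openC; exact: closed_point.
- exact: mem_set.
- by apply: mem_set => h; exact: h.
Qed.

Lemma open_meet (U V : set X) : open U -> open V -> U !=set0 -> V !=set0 -> U `&` V !=set0.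
Proof.
have [cX [_ iX] _ _] := hX.
move=> /open_subtype[W [oW <-]] /open_subtype[W' [oW' <-]] [x Wx] [y Wy].
apply: contrapT => h.
have [|||h1|h1] := iX (~` W) (~` W').
- exact: open_closedC.
- exact: open_closedC.
- move=> z Xz; apply: contrapT => /not_orP[/contrapT h1 /contrapT h2]; apply: h.
  by exists (SigSub (mem_set Xz)).
- by have := h1 _ (set_valP x); apply.
- by have := h1 _ (set_valP y); apply.
Qed.

Lemma other_point (p : X) : exists q : X, q <> p.
Proof.
have [_ _ [[Z [hZ /(_ 0%N isT)[sZ nZ]]] _] _] := hX.
have [_ [[a Za] _] Z0X] := hZ 0%N isT; have [_ _ Z1X] := hZ 1%N isT.
have /existsNP[b /not_implyP[Z1b nZb]] := nZ.
have Xa := Z0X _ Za; have Xb := Z1X _ Z1b.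
have [e|e] := pselect (p = SigSub (mem_set Xa)); last by exists (SigSub (mem_set Xa)) => h; apply: e.
exists (SigSub (mem_set Xb)) => h; apply: nZb; rewrite e in h.
by have -> : b = a by have := congr1 val h.
Qed.

(* a homogeneous form that vanishes on a nonempty open set vanishes on the curve *)
Lemma form_vanish (f : {mpoly k[n.+1]}) d (U : set X) : f \is d.-homog -> open U -> U !=set0 ->
  (forall x, U x -> fval f (val x) = 0) -> forall x : X, fval f (val x) = 0.
Proof.
move=> hf oU U0 fU x; apply: contrapT => /eqP fx.
have oV := subtype_open (zopen_form hf).
have [y [Uy /= /eqP]] := open_meet oU oV U0 (ex_intro _ x fx).
by apply; exact: fU.
Qed.

Lemma regfun_vanish (U : opens X) (f : regfun U) (W : set X) : open W -> W !=set0 -> W `<=` U ->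
  (forall y : U, W (val y) -> f y = 0) -> f = 0.
Proof.
move=> oW W0 WU fW; apply/val_inj/funext => x.
have /asboolP/(_ x)[V [Vx [d [g [h [hg hh H]]]]]] := valP f.
have [_ fx] := H _ Vx; rewrite fx (_ : fval g _ = 0) ?mul0r //.
apply: (@form_vanish g d (W `&` V) hg); first exact: openI (opensP V).
  by apply: open_meet => //; [exact: opensP|exists (val x)].
move=> y [Wy Vy]; have [h0 /esym] := H (point_in (WU _ Wy)) Vy.
have -> : \val f (point_in (WU _ Wy)) = 0 := fW (point_in (WU _ Wy)) Wy.
by move=> /eqP; rewrite mulf_eq0 invr_eq0 (negPf h0) orbF => /eqP.
Qed.
End Curve.
End Curves.

(** * The function field and its local rings *)
Module FunctionField.
Import Defs.
Export Curves.
Import Geo.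
Import Order.TTheory GRing.Theory Num.Theory.
Local Open Scope classical_set_scope.
Local Open Scope ring_scope.

(** All that is used of a curve: a field of germs at the generic point, in which each local
ring is a discrete valuation ring with residue field k and every element is integral at
almost all points. *)
Record funfield (k : fieldType) (n : nat) (X : set (pspace k n)) := FunField {
  ffK : fieldType;
  ffD : dvrs k ffK (set_type X);
  germ : forall U : opens X, regfun U -> ffK;
  germ_restr : forall (U V : opens X) (VU : V `<=` U) (f : regfun U),
    oset V !=set0 -> germ (restr VU f) = germ f;
  germ_inj : forall (U : opens X) (f g : regfun U), oset U !=set0 -> germ f = germ g -> f = g;
  germB : forall (U : opens X) (f g : regfun U), germ (f - g) = germ f - germ g;
  germM : forall (U : opens X) (f g : regfun U), germ (f * g) = germ f * germ g;
  germ1 : forall U : opens X, oset U !=set0 -> germ (1 : regfun U) = 1;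
  germ_cst : forall (U : opens X) c, oset U !=set0 -> germ (cstf U c) = kinc ffD c;
  germ_O : forall p x, dO ffD p x <-> exists (U : opens X) (f : regfun U), oset U p /\ germ f = x;
  germ_glue : forall (U : opens X) x, oset U !=set0 -> (forall p, oset U p -> dO ffD p x) ->
    exists f : regfun U, germ f = x;
  germ_unit : forall (U : opens X) (f : regfun U) (p : X) (Up : oset U p),
    f (point_in Up) != 0 -> dO ffD p (germ f)^-1;
  germ_zero : forall (U : opens X) (f : regfun U) (p : X) (Up : oset U p),
    f (point_in Up) = 0 -> exists2 y, dO ffD p y & germ f = unif ffD p * y;
  ff_cofinite : forall U : opens X, oset U !=set0 -> finite_set (~` U);
  ff_open : forall A : set X, finite_set A -> open (~` A);
  ff_meet : forall U V : opens X, oset U !=set0 -> oset V !=set0 -> oset (opensI U V) !=set0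
}.

Lemma quotient_of_powers (F : fieldType) (u v t : F) (l m : nat) : u != 0 -> t != 0 ->
  v * t ^+ l = u * t ^+ m * (v * u^-1 * t ^ (l%:Z - m%:Z)).
Proof.
move=> u0 t0; rewrite expfzDr // -exprnN -exprnP.
by field; rewrite u0 expf_neq0.
Qed.

Section FunctionField.
Variables (k : fieldType) (n : nat) (X : set (pspace k n)) (hX : smooth_curve X).

Lemma curve_point : exists p : X, True.
Proof. by have [_ [[x Xx] _] _ _] := hX; exists (SigSub (mem_set Xx)). Qed.

Definition opensT : opens X := Opens (@openT X).
Lemma opensT0 : oset opensT !=set0.
Proof. by have [p _] := curve_point; exists p. Qed.
Lemma opens_meet (U V : opens X) : oset U !=set0 -> oset V !=set0 -> oset (opensI U V) !=set0.
Proof. by apply: open_meet => //; exact: opensP. Qed.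

Definition ext (U : opens X) (r : regfun U) (y : X) : k :=
  match pselect (oset U y) with left Uy => r (point_in Uy) | right _ => 0 end.

Lemma ext_in (U : opens X) (r : regfun U) (y : X) (Uy : oset U y) : ext r y = r (point_in Uy).
Proof.
by rewrite /ext; case: pselect => // Uy'; congr (rf r _); exact: val_inj.
Qed.
Lemma ext_out (U : opens X) (r : regfun U) (y : X) : ~ oset U y -> ext r y = 0.
Proof. by rewrite /ext; case: pselect. Qed.
Lemma ext_val (U : opens X) (r : regfun U) (y : U) : ext r (val y) = r y.
Proof. by rewrite (ext_in r (set_valP y)); congr (rf r _); exact: val_inj. Qed.
Lemma ext_restr (U V : opens X) (VU : V `<=` U) (r : regfun U) y : oset V y ->
  ext (restr VU r) y = ext r y.
Proof.
move=> Vy; rewrite (ext_in _ Vy) (ext_in _ (VU _ Vy)) /=; congr (rf r _); exact: val_inj.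
Qed.

Definition ratb : {pred X -> k} := fun f =>
  `[< exists (U : opens X) (r : regfun U), oset U !=set0 /\ forall y, oset U y -> f y = ext r y >].

Lemma ratb_subring : subring_closed ratb.
Proof.
split.
- apply/asboolP; exists opensT, 1; split; first exact: opensT0.
  by move=> y Uy; rewrite (ext_in _ Uy).
- move=> f g /asboolP[U [r [U0 hr]]] /asboolP[V [s [V0 hs]]]; apply/asboolP.
  exists (opensI U V), (restr (@opensIl _ U V) r - restr (@opensIr _ U V) s).
  split=> [|y Wy]; first exact: opens_meet.
  have [Uy Vy] := Wy; transitivity (f y - g y) => //; rewrite hr // hs //.
  rewrite -(ext_restr (@opensIl _ U V) r Wy) -(ext_restr (@opensIr _ U V) s Wy).
  by rewrite !(ext_in _ Wy).
- move=> f g /asboolP[U [r [U0 hr]]] /asboolP[V [s [V0 hs]]]; apply/asboolP.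
  exists (opensI U V), (restr (@opensIl _ U V) r * restr (@opensIr _ U V) s).
  split=> [|y Wy]; first exact: opens_meet.
  have [Uy Vy] := Wy; transitivity (f y * g y) => //; rewrite hr // hs //.
  rewrite -(ext_restr (@opensIl _ U V) r Wy) -(ext_restr (@opensIr _ U V) s Wy).
  by rewrite !(ext_in _ Wy).
Qed.

Record ratfun := RatFun { rfn :> X -> k; _ : rfn \in ratb }.
HB.instance Definition _ := [isSub for rfn].
HB.instance Definition _ := [Choice of ratfun by <:].
HB.instance Definition _ := GRing.SubChoice_isSubComPzRing.Build (X -> k) ratb ratfun ratb_subring.

Lemma ratfun1_neq0 : (1 : ratfun) != 0.
Proof.
have [p _] := curve_point; apply/eqP => /(congr1 (fun f : ratfun => f p)) /eqP.
by rewrite -[X in X == _]/(1 : k) -[X in _ == X]/(0 : k) oner_eq0.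
Qed.
HB.instance Definition _ := GRing.PzSemiRing_isNonZero.Build ratfun ratfun1_neq0.

Definition zerob : {pred ratfun} := fun f =>
  `[< exists U : opens X, oset U !=set0 /\ forall y, oset U y -> f y = 0 >].

Lemma zerob_ideal : idealr_closed zerob.
Proof.
split.
- by apply/asboolP; exists opensT; split; first exact: opensT0.
- apply/asboolP => -[U [[p Up] /(_ p Up) /eqP]].
  by rewrite -[X in X == _]/(1 : k) oner_eq0.
- move=> a u v /asboolP[U [U0 hu]] /asboolP[V [V0 hv]]; apply/asboolP.
  exists (opensI U V); split; first exact: opens_meet.
  move=> y [Uy Vy]; transitivity (a y * u y + v y) => //.
  by rewrite hu // hv // mulr0 addr0.
Qed.
HB.instance Definition _ := isIdealr.Build ratfun zerob zerob_ideal.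

Definition fracK := {ideal_quot (zerob : idealr ratfun)}.
HB.instance Definition _ := GRing.ComNzRing.on fracK.

Local Open Scope quotient_scope.
Definition toK (f : ratfun) : fracK := \pi_fracK f.
Lemma toKB f g : toK (f - g) = toK f - toK g. Proof. exact: (rmorphB \pi_fracK). Qed.
Lemma toKM f g : toK (f * g) = toK f * toK g. Proof. exact: (rmorphM \pi_fracK). Qed.
Lemma toK1 : toK 1 = 1. Proof. exact: (rmorph1 \pi_fracK). Qed.
Lemma toK0 : toK 0 = 0. Proof. exact: (rmorph0 \pi_fracK). Qed.
Lemma toK_eq0 f : (toK f == 0) = (f \in zerob).
Proof.
by rewrite -[in RHS](subr0 f) (Quotient.idealrBE (zerob : idealr ratfun)) -toK0.
Qed.
Lemma toK_surj (x : fracK) : exists f, toK f = x.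
Proof. by exists (generic_quotient.repr x); rewrite /toK reprK. Qed.
Local Close Scope quotient_scope.

Lemma frac_subproof (W : opens X) (g h : {mpoly k[n.+1]}) d :
  g \is d.-homog -> h \is d.-homog -> (forall y, oset W y -> fval h (val y) != 0) ->
  (fun y : W => fval g (val (val y)) / fval h (val (val y))) \in @regularb _ _ _ W.
Proof.
move=> hg hh h0; apply/asboolP => x; exists W; split; first exact: set_valP.
by exists d, g, h; split => // y Wy; split => //; exact: h0.
Qed.

Lemma ext_rat (U : opens X) (r : regfun U) : ext r \in ratb.
Proof.
apply/asboolP; have [U0|U0] := pselect (oset U !=set0); first by exists U, r.
exists opensT, 0; split; first exact: opensT0.
move=> y Uy; rewrite ext_out; first by rewrite (ext_in _ Uy).
by move=> h; apply: U0; exists y.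
Qed.

Definition gm (U : opens X) (r : regfun U) : fracK := toK (RatFun (ext_rat r)).

Lemma gm_surj (x : fracK) : exists (U : opens X) (r : regfun U), oset U !=set0 /\ gm r = x.
Proof.
have [f <-] := toK_surj x; have /asboolP[U [r [U0 hr]]] := valP f.
exists U, r; split => //; apply/eqP; rewrite -subr_eq0 -toKB toK_eq0.
apply/asboolP; exists U; split => // y Uy.
by transitivity (ext r y - f y) => //; rewrite -hr ?subrr.
Qed.

Lemma gm_eq (U V W : opens X) (r : regfun U) (s : regfun V) : oset W !=set0 ->
  (forall y, oset W y -> ext r y = ext s y) -> gm r = gm s.
Proof.
move=> W0 h; apply/eqP; rewrite -subr_eq0 -toKB toK_eq0; apply/asboolP; exists W.
by split => // y Wy; transitivity (ext r y - ext s y) => //; rewrite h ?subrr.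
Qed.

Lemma gm_inj (U V : opens X) (r : regfun U) (s : regfun V) : gm r = gm s ->
  forall y, oset U y -> oset V y -> ext r y = ext s y.
Proof.
move=> /eqP; rewrite -subr_eq0 -toKB toK_eq0 => /asboolP[W [W0 hW]] y Uy Vy.
have UV0 : oset (opensI U V) !=set0 by exists y.
suff : restr (@opensIl _ U V) r - restr (@opensIr _ U V) s = 0.
  move=> /(congr1 (fun f : regfun (opensI U V) => f (point_in (conj Uy Vy : oset (opensI U V) y)))).
  set a := (X in X = _ -> _); rewrite (_ : a = ext r y - ext s y).
    by move/eqP; rewrite -[X in _ == X]/(0 : k) subr_eq0 => /eqP.
  rewrite -(ext_restr (@opensIl _ U V) r (conj Uy Vy)).
  by rewrite -(ext_restr (@opensIr _ U V) s (conj Uy Vy)) !(ext_in _ (conj Uy Vy : oset (opensI U V) y)).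
have WUV := opens_meet W0 UV0.
apply: (regfun_vanish hX (opensP (opensI W (opensI U V))) WUV) => [z [_ //]|z [Wz UVz]].
have := hW _ Wz; set a := (X in X = _ -> _); rewrite (_ : a = ext r (val z) - ext s (val z)) //.
rewrite -(ext_restr (@opensIl _ U V) r UVz) -(ext_restr (@opensIr _ U V) s UVz).
by rewrite !ext_val.
Qed.

Lemma gm_frac (x : fracK) : exists (W : opens X) (d : nat) (g h : {mpoly k[n.+1]})
    (hg : g \is d.-homog) (hh : h \is d.-homog) (h0 : forall y, oset W y -> fval h (val y) != 0),
  oset W !=set0 /\ x = gm (RegFun (frac_subproof hg hh h0)).
Proof.
have [U [r [[p Up] <-]]] := gm_surj x.
have /asboolP/(_ (point_in Up))[V [Vp [d [g [h [hg hh H]]]]]] := valP r.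
have h0 : forall y, oset (opensI U V) y -> fval h (val y) != 0.
  by move=> y [Uy Vy]; have [] := H (point_in Uy) Vy.
exists (opensI U V), d, g, h, hg, hh, h0; split; first by exists p.
apply: (@gm_eq _ _ (opensI U V)); first by exists p.
move=> y Wy; have [Uy Vy] := Wy; rewrite (ext_in _ Uy) (ext_in _ Wy) /=.
by have [_ ->] := H (point_in Uy) Vy.
Qed.

Lemma fracK_inv (x : fracK) : exists y, (x != 0 -> y * x = 1) /\ (x = 0 -> y = 0).
Proof.
have [->|x0] := eqVneq x 0; first by exists 0.
have [W [d [g [h [hg [hh [h0 [W0 ex]]]]]]]] := gm_frac x.
pose W' := opensI W (Opens (subtype_open X (zopen_form hg))).
have W'0 : oset W' !=set0.
  apply: contrapT => hW; move/eqP: x0; apply; rewrite ex; apply/eqP; rewrite toK_eq0.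
  apply/asboolP; exists W; split => // y Wy /=; rewrite (ext_in _ Wy) /=.
  suff -> : fval g (val y) = 0 by rewrite mul0r.
  by apply: contrapT => /eqP gy; apply: hW; exists y.
have g0 y : oset W' y -> fval g (val y) != 0 by case.
exists (gm (RegFun (frac_subproof hh hg g0))); split; last by move/eqP: x0.
move=> _; rewrite ex /gm -toKM -toK1; apply/eqP; rewrite -subr_eq0 -toKB toK_eq0.
apply/asboolP; exists W'; split => // y Wy.
set a := (X in X = _); transitivity (ext (RegFun (frac_subproof hh hg g0)) y *
  ext (RegFun (frac_subproof hg hh h0)) y - 1) => //.
have [Wy1 _] := Wy; rewrite (ext_in _ Wy) (ext_in _ Wy1) /=.
by rewrite mulrA mulfVK ?mulfV ?subrr //; [exact: (h0 y)|exact: (g0 y)].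
Qed.

Definition fracKinv (x : fracK) : fracK := projT1 (cid (fracK_inv x)).
Lemma fracK_mulVf x : x != 0 -> fracKinv x * x = 1.
Proof. by rewrite /fracKinv; case: cid => y /= []. Qed.
Lemma fracK_inv0 : fracKinv 0 = 0.
Proof. by rewrite /fracKinv; case: cid => y /= [] _ ->. Qed.
HB.instance Definition _ := GRing.ComNzRing_isField.Build fracK fracK_mulVf fracK_inv0.

Lemma gmB (U : opens X) (f g : regfun U) : gm (f - g) = gm f - gm g.
Proof.
rewrite /gm -toKB; congr toK; apply/val_inj/funext => y /=.
transitivity (ext f y - ext g y) => //.
have [Uy|nU] := pselect (oset U y); first by rewrite !(ext_in _ Uy).
by rewrite !ext_out ?subr0.
Qed.
Lemma gmM (U : opens X) (f g : regfun U) : gm (f * g) = gm f * gm g.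
Proof.
rewrite /gm -toKM; congr toK; apply/val_inj/funext => y /=.
transitivity (ext f y * ext g y) => //.
have [Uy|nU] := pselect (oset U y); first by rewrite !(ext_in _ Uy).
by rewrite !ext_out ?mulr0.
Qed.
Lemma gm1 (U : opens X) : oset U !=set0 -> gm (1 : regfun U) = 1.
Proof.
move=> U0; apply/eqP; rewrite -subr_eq0 -toK1 -toKB toK_eq0; apply/asboolP; exists U.
split => // y Uy; transitivity (ext (1 : regfun U) y - 1) => //.
by rewrite (ext_in _ Uy) subrr.
Qed.
Lemma gm_restr (U V : opens X) (VU : V `<=` U) (f : regfun U) :
  oset V !=set0 -> gm (restr VU f) = gm f.
Proof. by move=> V0; apply: (@gm_eq _ _ V) => // y Vy; rewrite ext_restr. Qed.
Lemma gm0 (U : opens X) : gm (0 : regfun U) = 0.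
Proof. by rewrite -(subrr 0) gmB subrr. Qed.
Lemma gmD (U : opens X) (f g : regfun U) : gm (f + g) = gm f + gm g.
Proof.
by rewrite -[g in LHS]opprK gmB -[- g]sub0r gmB gm0 sub0r opprK.
Qed.

Definition kfrac (c : k) : fracK := gm (cstf opensT c).
Lemma gm_cst (U : opens X) c : oset U !=set0 -> gm (cstf U c) = kfrac c.
Proof.
move=> U0; apply: (@gm_eq _ _ U) => // y Uy.
by rewrite (ext_in _ Uy) (ext_in (U := opensT) _ (I : oset opensT y)).
Qed.
Lemma kfracB : zmod_morphism kfrac.
Proof.
by move=> c d; rewrite /kfrac -gmB; congr gm; apply/val_inj/funext.
Qed.
Lemma kfracM : monoid_morphism kfrac.
Proof.
split; first by rewrite /kfrac -(gm1 opensT0); congr gm; apply/val_inj/funext.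
by move=> c d; rewrite /kfrac -gmM; congr gm; apply/val_inj/funext.
Qed.
HB.instance Definition _ := GRing.isZmodMorphism.Build k fracK kfrac kfracB.
HB.instance Definition _ := GRing.isMonoidMorphism.Build k fracK kfrac kfracM.

Definition lO (p : X) (x : fracK) := exists (U : opens X) (f : regfun U), oset U p /\ gm f = x.

Lemma lO2 p x y : lO p x -> lO p y -> exists (U : opens X) (f g : regfun U),
  [/\ oset U p, gm f = x & gm g = y].
Proof.
move=> [U [f [Up <-]]] [V [g [Vp <-]]].
exists (opensI U V), (restr (@opensIl _ U V) f), (restr (@opensIr _ U V) g).
by split => //; rewrite gm_restr //; exists p.
Qed.
Lemma lOB p x y : lO p x -> lO p y -> lO p (x - y).
Proof. by move=> hx hy; have [U [f [g [Up <- <-]]]] := lO2 hx hy; exists U, (f - g); rewrite gmB. Qed.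
Lemma lOM p x y : lO p x -> lO p y -> lO p (x * y).
Proof. by move=> hx hy; have [U [f [g [Up <- <-]]]] := lO2 hx hy; exists U, (f * g); rewrite gmM. Qed.
Lemma lO1 p : lO p 1.
Proof. by exists opensT, 1; split => //; rewrite gm1 //; exact: opensT0. Qed.
Lemma lO_k p c : lO p (kfrac c).
Proof. by exists opensT, (cstf opensT c). Qed.

Lemma gm_unit (U : opens X) (f : regfun U) (p : X) (Up : oset U p) :
  f (point_in Up) != 0 -> lO p (gm f)^-1.
Proof.
move=> fp; have /asboolP/(_ (point_in Up))[V [Vp [d [g [h [hg hh H]]]]]] := valP f.
pose W := opensI (opensI U V) (Opens (subtype_open X (zopen_form hg))).
have g0 y : oset W y -> fval g (val y) != 0 by case.
have [hp fpE] := H (point_in Up) Vp.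
have Wp : oset W p.
  split => //=; apply: contraNneq fp => gp; have := fpE => /= ->; rewrite gp mul0r //.
exists W, (RegFun (frac_subproof hh hg g0)); split => //.
have W0 : oset W !=set0 by exists p.
have WU : W `<=` U by move=> y [[]].
suff e : gm (RegFun (frac_subproof hh hg g0)) * gm f = 1.
  have f0 : gm f != 0 by apply: contra_eq_neq e => ->; rewrite mulr0 eq_sym oner_neq0.
  by rewrite -[LHS](mulfK f0) e mul1r.
rewrite -(gm_restr WU f W0) -gmM -(gm1 W0); congr gm; apply/val_inj/funext => y /=.
transitivity (fval h (val (val y)) / fval g (val (val y)) * f (subfun WU y)) => //.
have [[_ Vy] gy] := set_valP y.
have [hy ->] := H (subfun WU y) Vy.
by rewrite /= mulrA mulfVK ?mulfV //; exact: (g0 _ (set_valP y)).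
Qed.

Lemma local_param p : exists t : fracK, exists (V : opens X) (Vp : oset V p) (pi : regfun V),
  local_parameter Vp pi /\ gm pi = t.
Proof.
have [_ _ _ /(_ p)[V [Vp [pi h]]]] := hX.
by exists (gm pi), V, Vp, pi.
Qed.
Definition upar (p : X) : fracK := projT1 (cid (local_param p)).
Lemma uparP p : exists (V : opens X) (Vp : oset V p) (pi : regfun V),
  local_parameter Vp pi /\ gm pi = upar p.
Proof. by rewrite /upar; case: cid. Qed.

Lemma gm_zero (U : opens X) (f : regfun U) (p : X) (Up : oset U p) :
  f (point_in Up) = 0 -> exists2 y, lO p y & gm f = upar p * y.
Proof.
move=> fp; have [V [Vp [pi [[pi0 h] <-]]]] := uparP p.
have [W [WV [WU [z [Wp e]]]]] := h U Up f fp.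
have W0 : oset W !=set0 by exists p.
exists (gm z); first by exists W, z.
by rewrite -(gm_restr WU f W0) e gmM gm_restr // mulrC.
Qed.

Lemma lO_upar p : lO p (upar p).
Proof. by have [V [Vp [pi [_ <-]]]] := uparP p; exists V, pi. Qed.

Lemma upar_nunit p y : lO p y -> upar p * y <> 1.
Proof.
move=> [U [f [Up <-]]] e; have [V [Vp [pi [[pi0 _] e1]]]] := uparP p.
pose W := opensI U V; have Wp : oset W p by [].
have W0 : oset W !=set0 by exists p.
move: e; rewrite -e1 -(gm_restr (@opensIl _ U V) f W0) -(gm_restr (@opensIr _ U V) pi W0).
rewrite -gmM -(gm1 W0) => /gm_inj/(_ p Wp Wp); rewrite !(ext_in _ Wp) /=.
set a := (X in X = _); rewrite (_ : a = pi (point_in Vp) * f (point_in Up)).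
  by rewrite pi0 mul0r => /esym/eqP; rewrite -[X in X == _]/(1 : k) oner_eq0.
by congr (rf pi _ * rf f _); exact: val_inj.
Qed.

(* Dehomogenization at a point. *)
Section Affine.
Variables (p : X) (i0 : 'I_n.+1) (pi0 : pvec (val p) i0 != 0).
Let oU := subtype_open X (zopen_form (homogX1 k i0)).
Definition aff : opens X := Opens oU.
Lemma affP q : oset aff q <-> pvec (val q) i0 != 0.
Proof. by rewrite /aff /= fvalE mevalXU. Qed.
Definition nv (q : pspace k n) j := pvec q j / pvec q i0.

Lemma homog_nv (f : {mpoly k[n.+1]}) d q : f \is d.-homog -> pvec q i0 != 0 ->
  f.@[nv q] = fval f q / pvec q i0 ^+ d.
Proof.
move=> /dhomogP hf q0; rewrite fvalE !mevalE mulr_suml; apply: eq_big_seq => m /hf hm.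
rewrite -mulrA; congr (_ * _); rewrite -hm /= mdegE -prodrXr.
by rewrite -prodf_div; apply: eq_bigr => j _; rewrite expr_div_n.
Qed.

Lemma flat_ex (c : {mpoly k[n.+1]}) : exists r : regfun aff,
  forall y : aff, r y = c.@[nv (val (val y))].
Proof.
pose im c := exists r : regfun aff, forall y : aff, r y = c.@[nv (val (val y))].
have imD a b : im a -> im b -> im (a + b).
  move=> [r hr] [s hs]; exists (r + s) => y; rewrite mevalD -hr -hs //.
have imM a b : im a -> im b -> im (a * b).
  move=> [r hr] [s hs]; exists (r * s) => y; rewrite mevalM -hr -hs //.
have imC a : im a%:MP by exists (cstf aff a) => y; rewrite mevalC.
have imX j : im 'X_j.
  have h0 y : oset aff y -> fval ('X_i0 : {mpoly k[n.+1]}) (val y) != 0 by [].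
  exists (RegFun (frac_subproof (homogX1 k j) (homogX1 k i0) h0)) => y /=.
  by rewrite !fvalE !mevalXU.
rewrite -/(im c) (mpolyE c); apply: (big_ind im) => [|a b|m _]; first 1 last.
- exact: imD.
- rewrite -mul_mpolyC; apply: (imM) => //; rewrite (mpolyXE_id _ m).
  apply: (big_ind im) => [|a b|j _]; first 1 last.
  + exact: imM.
  + elim: (m j) => [|e IHe]; first by rewrite expr0; exact: (imC 1).
    by rewrite exprS; exact: imM.
  exact: (imC 1).
- by rewrite -mpolyC0; exact: imC.
Qed.
Definition flat c : fracK := gm (projT1 (cid (flat_ex c))).
Lemma flatP c : exists r : regfun aff, (forall y : aff, r y = c.@[nv (val (val y))]) /\ gm r = flat c.
Proof. by rewrite /flat; case: cid => r hr; exists r. Qed.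
Lemma flat_of c (r : regfun aff) : (forall y : aff, r y = c.@[nv (val (val y))]) -> gm r = flat c.
Proof.
move=> hr; have [s [hs <-]] := flatP c; congr gm; apply/val_inj/funext => y.
by rewrite -[LHS]/(r y) hr -hs.
Qed.
Lemma flatD a b : flat (a + b) = flat a + flat b.
Proof.
have [r [hr <-]] := flatP a; have [s [hs <-]] := flatP b; rewrite -gmD; apply/esym/flat_of.
by move=> y; rewrite mevalD -hr -hs.
Qed.
Lemma flatM a b : flat (a * b) = flat a * flat b.
Proof.
have [r [hr <-]] := flatP a; have [s [hs <-]] := flatP b; rewrite -gmM; apply/esym/flat_of.
by move=> y; rewrite mevalM -hr -hs.
Qed.
Lemma flat0 : flat 0 = 0.
Proof. by apply: (addrI (flat 0)); rewrite -flatD !addr0. Qed.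
Lemma aff_p : oset aff p. Proof. exact/affP. Qed.
Lemma lO_flat c : lO p (flat c).
Proof. by have [r [_ <-]] := flatP c; exists aff, r; split => //; exact: aff_p. Qed.

Lemma flat_frac (W : opens X) (f : regfun W) d g h : g \is d.-homog -> h \is d.-homog ->
  oset W !=set0 -> (forall y : W, fval h (val (val y)) != 0 /\
    f y = fval g (val (val y)) / fval h (val (val y))) -> flat h * gm f = flat g.
Proof.
move=> hg hh W0 H; have [r [hr <-]] := flatP g; have [s [hs <-]] := flatP h.
have A0 : oset aff !=set0 by exists p; exact: aff_p.
have WA0 := opens_meet W0 A0.
rewrite -(gm_restr (@opensIl _ W aff) f WA0) -(gm_restr (@opensIr _ W aff) s WA0) -gmM.
rewrite -(gm_restr (@opensIr _ W aff) r WA0); congr gm; apply/val_inj/funext => y /=.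
have [Wy Ay] := set_valP y.
transitivity (s (subfun (@opensIr _ W aff) y) * f (subfun (@opensIl _ W aff) y)) => //.
have [h0 ->] := H (subfun (@opensIl _ W aff) y).
have /affP y0 := Ay.
rewrite hs hr !(homog_nv (d := d)) //= -mulrA [_^-1 * _]mulrC !mulrA; congr (_ * _).
by rewrite mulrAC mulfV ?mul1r // mulrC.
Qed.

Lemma flat_unit c : c.@[nv (val p)] != 0 -> lO p (flat c)^-1.
Proof.
move=> c0; have [r [hr <-]] := flatP c.
by apply: (gm_unit (Up := aff_p)); rewrite hr.
Qed.

Lemma flat_neq0 c (q : X) (Aq : oset aff q) : c.@[nv (val q)] != 0 -> flat c != 0.
Proof.
have [r [hr <-]] := flatP c; apply: contraNneq => e.
have : gm r = gm (0 : regfun aff) by rewrite e gm0.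
by move=> /gm_inj/(_ q Aq Aq); rewrite !(ext_in _ Aq) hr => ->.
Qed.

Lemma flat_lO y : lO p y -> exists a b, [/\ flat b * y = flat a, lO p (flat b)^-1 & flat b != 0].
Proof.
move=> [U [f [Up <-]]].
have /asboolP/(_ (point_in Up))[V [Vp [d [g [h [hg hh H]]]]]] := valP f.
have UVp : oset (opensI U V) p by [].
have UV0 : oset (opensI U V) !=set0 by exists p.
exists g, h; split.
  rewrite -(gm_restr (@opensIl _ U V) f UV0); apply: (flat_frac hg hh) => // z.
  have [Uz Vz] := set_valP z; exact: (H (subfun (@opensIl _ U V) z) Vz).
all: have hp : h.@[nv (val p)] != 0.
1,3: by rewrite (homog_nv hh) // mulf_neq0 ?invr_eq0 ?expf_neq0 //;
  have [] := H (point_in Up) Vp.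
  exact: flat_unit.
exact: (flat_neq0 aff_p).
Qed.

Lemma upar_neq0 : upar p != 0.
Proof.
have [q qp] := other_point hX p.
have [|f [hf fp fq]] := @separating_form k n (val p) (val q).
  by move=> e; apply: qp; apply: val_inj.
have [r [hr er]] := flatP f.
have [y _ e] : exists2 y, lO p y & gm r = upar p * y.
  by apply: (gm_zero (Up := aff_p)); rewrite hr (homog_nv hf) // fp mul0r.
apply: contraNneq fq => u0; rewrite u0 mul0r in e.
have A0 : oset aff !=set0 by exists p; exact: aff_p.
apply/eqP; apply: (form_vanish hX hf (opensP aff) A0) => z Az.
have := gm_inj (s := (0 : regfun aff)) (r := r) _ Az Az.
have -> : gm r = gm (0 : regfun aff) by rewrite e gm0.
move=> /(_ erefl); rewrite !(ext_in _ Az) hr (homog_nv hf) //=; last exact/affP.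
move/eqP; rewrite -[X in _ == X]/(0 : k) mulf_eq0 invr_eq0 expf_eq0 /=.
by have /affP/negPf e0 := Az; rewrite e0 orbF => /eqP.
Qed.

Lemma krull x : lO p x -> x != 0 -> exists u m, [/\ lO p u, lO p u^-1 & x = u * upar p ^+ m].
Proof.
move=> hx x0; apply: contrapT => nu; have u0 := upar_neq0.
have /choice[y /all_and2[hy ey]] : forall m, exists y, lO p y /\ x = upar p ^+ m * y.
  elim=> [|m [y [[U [f [Up ef]]] ey]]]; first by exists x; rewrite expr0 mul1r.
  have [f0|f0] := eqVneq (f (point_in Up)) 0.
    by have [z hz e] := gm_zero f0; exists z; split => //; rewrite ey -ef e exprSr mulrA.
  case: nu; exists y, m; split; [by exists U, f|by rewrite -ef; exact: gm_unit f0|].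
  by rewrite ey mulrC.
have /choice[a /choice[b hab]] := fun m => flat_lO (hy m).
have [N [c e]] := @noetherian_mpoly k n.+1 a.
have yN i : (i <= N)%N -> y i = upar p ^+ (N - i) * y N.
  move=> iN; apply: (mulfI (expf_neq0 i u0)).
  by rewrite mulrA -exprD subnKC // -!ey.
have flat_sum (I : Type) (r : seq I) F : flat (\sum_(i <- r) F i) = \sum_(i <- r) flat (F i).
  by apply: (big_morph flat flatD flat0).
have yN0 : y N != 0 by apply: contraNneq x0 => y0; rewrite (ey N) y0 mulr0.
have [eN hbN bN0] := hab N.
have key : flat (b N) = upar p * \sum_(i < N) flat (c i) * flat (b i) * upar p ^+ (N - i).-1.
  apply: (mulIf yN0); rewrite eN e flat_sum mulr_sumr mulr_suml; apply: eq_bigr => i _.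
  have [ei _ _] := hab i; rewrite flatM -ei yN; last exact: ltnW.
  rewrite -[in upar p ^+ (N - i)](prednK (_ : 0 < N - i)%N) ?subn_gt0 // exprS; ring.
apply: (@upar_nunit p ((flat (b N))^-1 * \sum_(i < N) flat (c i) * flat (b i) * upar p ^+ (N - i).-1)).
  apply: lOM => //; apply: (big_ind (lO p)) => [|u v hu hv|i _].
  - by rewrite -(subrr 1); apply: lOB; exact: lO1.
  - by rewrite -[v]opprK -[- v]sub0r; apply: lOB => //; apply: lOB => //; rewrite -(subrr 1); apply: lOB; exact: lO1.
  - apply: lOM; first by apply: lOM; exact: lO_flat.
    by elim: (_.-1) => [|m IH]; rewrite ?expr0 ?exprS; [exact: lO1|apply: lOM => //; exact: lO_upar].
by rewrite mulrCA -key mulVf.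
Qed.
End Affine.

Lemma lO_fact p x : x != 0 ->
  exists (u : fracK) (m : int), [/\ lO p u, lO p u^-1 & x = u * upar p ^ m].
Proof.
move=> x0; have [i0 pi0] := pvec_neq0 (val p); have u0 := upar_neq0 pi0.
have [W [d [g [h [hg [hh [h0 [W0 ex]]]]]]]] := gm_frac x.
have e : flat i0 h * x = flat i0 g.
  by rewrite ex; apply: (flat_frac pi0 hg hh W0) => y; split => //; exact: h0 (set_valP y).
have A0 : oset (aff i0) !=set0 by exists p; exact: aff_p.
have [y [Wy Ay]] := opens_meet W0 A0.
have hf0 : flat i0 h != 0.
  apply: (flat_neq0 Ay); rewrite (homog_nv hh); last exact/affP.
  by rewrite mulf_neq0 ?h0 // invr_eq0 expf_neq0 //; exact/affP.
have gf0 : flat i0 g != 0 by rewrite -e mulf_neq0.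
have [u [m [hu hu' eu]]] := krull pi0 (lO_flat pi0 h) hf0.
have [v [l [hv hv' ev]]] := krull pi0 (lO_flat pi0 g) gf0.
have u00 : u != 0 by apply: contraNneq hf0 => z; rewrite eu z mul0r.
exists (v * u^-1), (l%:Z - m%:Z); split; first exact: lOM.
  by rewrite invfM invrK; exact: lOM.
by apply: (mulfI hf0); rewrite e ev eu; exact: quotient_of_powers.
Qed.

Lemma lO_res p x : lO p x -> exists (c : k) (y : fracK), lO p y /\ x = kfrac c + upar p * y.
Proof.
move=> [U [f [Up <-]]]; pose c := f (point_in Up).
have U0 : oset U !=set0 by exists p.
have [y hy e] : exists2 y, lO p y & gm (f - cstf U c) = upar p * y.
  by apply: (gm_zero (Up := Up)); rewrite -[LHS]/(f (point_in Up) - c) subrr.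
by exists c, y; split => //; rewrite -e gmB gm_cst // addrC subrK.
Qed.

Lemma lO_fin x : finite_set [set p : X | ~ lO p x].
Proof.
have [U [r [U0 <-]]] := gm_surj x.
apply: sub_finite_set (open_cofinite hX (opensP U) U0) => p /= h Up.
by apply: h; exists U, r.
Qed.

Lemma upar_nunit' p : ~ lO p (upar p)^-1.
Proof.
have [i0 pi0] := pvec_neq0 (val p); have u0 := upar_neq0 pi0.
by move=> /upar_nunit; apply; rewrite mulfV.
Qed.

Lemma upar_neq0' p : upar p != 0.
Proof. by have [i0 pi0] := pvec_neq0 (val p); exact: (upar_neq0 pi0). Qed.

Definition curve_dvrs : dvrs k fracK (set_type X) :=
  @Dvrs k fracK (set_type X) kfrac lO upar lO1 lOB lOM lO_k upar_neq0' lO_upar upar_nunit'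
    lO_fact lO_res lO_fin.

Lemma gm_inj' (U : opens X) (f g : regfun U) : oset U !=set0 -> gm f = gm g -> f = g.
Proof.
move=> U0 e; apply/val_inj/funext => y.
by have := gm_inj e (set_valP y) (set_valP y); rewrite !ext_val.
Qed.

Lemma gm_glue (U : opens X) x : oset U !=set0 -> (forall p, oset U p -> lO p x) ->
  exists f : regfun U, gm f = x.
Proof.
move=> U0 h; have /choice[C hC] : forall p : U, exists V : opens X,
    [/\ V `<=` U, oset V (val p) & exists f : regfun V, gm f = x].
  move=> p; have [V [f [Vp e]]] := h _ (set_valP p).
  exists (opensI U V); split; [exact: subIsetl|by split => //; exact: set_valP|].
  by exists (restr (@opensIr _ U V) f); rewrite gm_restr //; exists (val p); split => //; exact: set_valP.
have CU p : C p `<=` U by case: (hC p).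
have H p : exists f : regfun (C p), gm f = x by case: (hC p).
pose f p := projT1 (cid (H p)); have hf p : gm (f p) = x := projT2 (cid (H p)).
have [||g hg] := @restr_glue k n X U U C CU _ f.
- by move=> y Uy; exists (point_in Uy) => //; have [_ + _] := hC (point_in Uy).
- move=> i j W Wi Wj; apply/val_inj/funext => y.
  have W0 : oset W !=set0 by exists (val y); exact: set_valP.
  congr (rf _ y); apply: gm_inj' => //; by rewrite !gm_restr // !hf.
exists g; have [y Uy] := U0; rewrite -(hf (point_in Uy)) -hg gm_restr //.
by exists y; have [_ + _] := hC (point_in Uy).
Qed.

Definition curve_funfield : funfield X :=
  @FunField k n X fracK curve_dvrs gm gm_restr gm_inj' gmB gmM gm1
    gm_cst (fun p x => iff_refl _) gm_glue gm_unit gm_zero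
    (fun U U0 => open_cofinite hX (opensP U) U0) (@cofinite_open k n X) opens_meet.
End FunctionField.
End FunctionField.

(** * Extension of morphisms of sheaves *)
Module Injectives.
Import Defs.
Export FunctionField.
Import Geo.
Import Defs.
Import Order.TTheory GRing.Theory Num.Theory.
Local Open Scope classical_set_scope.
Local Open Scope ring_scope.

Section Generalities.
Variables (k : fieldType) (n : nat) (X : set (pspace k n)).
Local Notation omod := (omod X).

Definition mklin (R : pzRingType) (A B : lmodType R) (f : A -> B) (h : linear f) :
  {linear A -> B} := HB.pack f (GRing.isLinear.Build R A B *:%R f h).

Definition mkhom (F G : omod) (f : forall U, sec F U -> sec G U)
    (lin : forall U, linear (f U))
    (fres : forall (U V : opens X) (VU : V `<=` U) (s : sec F U), f V (res VU s) = res VU (f U s)) :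
  hom F G := @Hom k n X F G (fun U => mklin (lin U)) fres.

Section Res.
Variables (F : omod) (U V : opens X) (VU : V `<=` U).
Lemma res0 : res VU (0 : sec F U) = 0.
Proof. by rewrite -[0]subr0 resB subrr. Qed.
Lemma resN (s : sec F U) : res VU (- s) = - res VU s.
Proof. by rewrite -[- s]sub0r resB res0 sub0r. Qed.
Lemma resD (s t : sec F U) : res VU (s + t) = res VU s + res VU t.
Proof. by rewrite -[t in LHS]opprK resB resN opprK. Qed.
Lemma res_sum (I : Type) (r : seq I) (Q : pred I) (f : I -> sec F U) :
  res VU (\sum_(i <- r | Q i) f i) = \sum_(i <- r | Q i) res VU (f i).
Proof. by apply: (big_morph _ resD res0). Qed.
End Res.

Lemma res_eq (F : omod) (U V : opens X) (VU VU' : V `<=` U) (s : sec F U) : res VU s = res VU' s.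
Proof. by congr res; exact: Prop_irrelevance. Qed.

Lemma sec_empty (F : omod) (U : opens X) (s t : sec F U) : ~ (oset U !=set0) -> s = t.
Proof.
move=> U0; apply: (@sec_separated _ _ _ F U False (fun f => match f with end) (fun f => match f with end)).
  by move=> x Ux; case: U0; exists x.
by case.
Qed.

Section Graphs.
Variables (B I : omod).
Definition graph := forall U : opens X, sec B U -> sec I U -> Prop.
Definition pgraph (G : graph) :=
  [/\ forall U, G U 0 0,
      forall U b y b' y', G U b y -> G U b' y' -> G U (b - b') (y - y'),
      forall U (a : regfun U) b y, G U b y -> G U (a *: b) (a *: y),
      forall (U V : opens X) (VU : V `<=` U) b y, G U b y -> G V (res VU b) (res VU y) &
      forall U y, G U 0 y -> y = 0].
End Graphs.

(** Baer's criterion in the form adapted to sheaves on a curve: only extensions by one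
section at a time are needed. *)
Definition baer (I : omod) := forall (U : opens X)
  (H : forall V : opens X, regfun V -> sec I V -> Prop),
  (forall (V : opens X) (a : regfun V) x a' x', V `<=` U -> H V a x -> H V a' x' -> H V (a - a') (x - x')) ->
  (forall (V : opens X) (c a : regfun V) x, V `<=` U -> H V a x -> H V (c * a) (c *: x)) ->
  (forall (V W : opens X) (WV : W `<=` V) (a : regfun V) x, V `<=` U -> H V a x -> H W (restr WV a) (res WV x)) ->
  (forall (V : opens X) x, V `<=` U -> H V 0 x -> x = 0) ->
  exists y : sec I U, forall (V : opens X) (VU : V `<=` U) (a : regfun V) x, H V a x -> x = a *: res VU y.

(** By Zorn's lemma a partial morphism has a maximal extension, and Baer's property makes
the maximal one total. *)
Theorem ext_graph (B I : omod) (G : graph B I) : baer I -> pgraph G ->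
  exists g : hom B I, forall U b y, G U b y -> g U b = y.
Proof.
move=> bI pG.
pose T := {U : opens X & (sec B U * sec I U)%type}.
pose gr (A : set T) : graph B I := fun U b y => A (existT _ U (b, y)).
pose G0 : set T := fun t => G (projT1 t) (projT2 t).1 (projT2 t).2.
have [|A [hA maxA]] := @Zorn_bigcup T (fun A => A = set0 \/ (G0 `<=` A /\ pgraph (gr A))).
  move=> F hF tF; have [[A0 [FA0 [GA0 _]]]|h] :=
    pselect (exists A, F A /\ (G0 `<=` A /\ pgraph (gr A))); last first.
    left; rewrite -subset0 => x [A FA Ax].
    by have [e|sA] := hF A FA; [rewrite e in Ax|case: h; exists A].
  right; split; first by move=> t /GA0 At; exists A0.
  have hF' A t : F A -> A t -> pgraph (gr A).
    by move=> /hF[->|[]].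
  have [g0 _ _ _ _] := pG.
  split.
  - by move=> U; exists A0 => //; apply: GA0; exact: g0.
  - move=> U b y b' y' [A FA Ab] [A' FA' Ab'].
    have [AA|AA] := tF _ _ FA FA'.
      exists A' => //; have [_ s _ _ _] := hF' _ _ FA' Ab'.
      by apply: s => //; exact: AA.
    exists A => //; have [_ s _ _ _] := hF' _ _ FA Ab.
    by apply: s => //; exact: AA.
  - by move=> U a b y [A FA Ab]; exists A => //; have [_ _ s _ _] := hF' _ _ FA Ab; exact: s.
  - by move=> U V VU b y [A FA Ab]; exists A => //; have [_ _ _ s _] := hF' _ _ FA Ab; exact: s.
  - by move=> U y [A FA Ab]; have [_ _ _ _ s] := hF' _ _ FA Ab; exact: s.
have {hA}[GA [A0 AB AZ AR Af]] : G0 `<=` A /\ pgraph (gr A).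
  case: hA => // e; case: (maxA G0); last by right; split.
  rewrite e; split => // h; have [g0 _ _ _ _] := pG.
  by apply: (h (existT _ (Opens openT) (0, 0))); exact: g0.
have AN U b y : gr A U b y -> gr A U (- b) (- y).
  by move=> h; have := AB _ _ _ _ _ (A0 U) h; rewrite !sub0r.
have AD U b y b' y' : gr A U b y -> gr A U b' y' -> gr A U (b + b') (y + y').
  by move=> h h'; have := AB _ _ _ _ _ h (AN _ _ _ h'); rewrite !opprK.
have total U b : exists y, gr A U b y.
  pose H (V : opens X) (a : regfun V) (x : sec I V) := exists VU : V `<=` U, gr A V (a *: res VU b) x.
  have [| | | |y hy] := bI U H.
  - move=> V a x a' x' VU [h1 h] [h2 h']; exists VU; rewrite scalerBl.
    by apply: AB; [rewrite (res_eq VU h1)|rewrite (res_eq VU h2)].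
  - by move=> V c a x VU [h1 h]; exists h1; rewrite -scalerA; exact: AZ.
  - move=> V W WV a x VU [h1 h]; exists (subset_trans WV VU).
    by have := AR _ _ WV _ _ h; rewrite resZ (res_comp h1 WV (subset_trans WV VU)).
  - by move=> V x VU [h1]; rewrite scale0r => /Af.
  pose A' : set T := fun t => A t \/ exists (VU : projT1 t `<=` U) (a : regfun (projT1 t)) g h,
    [/\ gr A (projT1 t) g h, (projT2 t).1 = g + a *: res VU b & (projT2 t).2 = h + a *: res VU y].
  have A'P (V : opens X) (VU : V `<=` U) b' y' : gr A' V b' y' -> exists a g h,
      [/\ gr A V g h, b' = g + a *: res VU b & y' = h + a *: res VU y].
    move=> [h|[VU' [a [g [h [h1 /= -> ->]]]]]].
      by exists 0, b', y'; rewrite !scale0r !addr0.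
    by exists a, g, h; rewrite (res_eq VU VU') (res_eq (F := I) VU VU').
  exists y; apply: contrapT => nA; apply: (maxA A').
    split; first by move=> t At; left.
    move=> h; apply: nA; apply: h; right => /=; exists (@subset_refl _ _), 1, 0, 0.
    by rewrite !add0r !scale1r !res_id; split => //; exact: A0.
  right; split; first by move=> t /GA At; left.
  split.
  - by move=> V; left; exact: A0.
  - move=> V b1 y1 b2 y2 h1 h2.
    have [VU|nV] := pselect (V `<=` U); last first.
      by case: h1 => [h1|[? _]] //; case: h2 => [h2|[? _]] //; left; exact: AB.
    have [a1 [g1 [e1 [k1 -> ->]]]] := A'P _ VU _ _ h1.
    have [a2 [g2 [e2 [k2 -> ->]]]] := A'P _ VU _ _ h2.
    right; exists VU, (a1 - a2), (g1 - g2), (e1 - e2); split; first exact: AB.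
      by rewrite /= scalerBl opprD addrACA.
    by rewrite /= scalerBl opprD addrACA.
  - move=> V a b1 y1 [h|[VU [a1 [g1 [e1 [k1 /= -> ->]]]]]]; first by left; exact: AZ.
    right; exists VU, (a * a1), (a *: g1), (a *: e1); split; first exact: AZ.
      by rewrite /= scalerDr scalerA.
    by rewrite /= scalerDr scalerA.
  - move=> V W WV b1 y1 [h|[VU [a1 [g1 [e1 [k1 /= -> ->]]]]]]; first by left; exact: AR.
    right; exists (subset_trans WV VU), (restr WV a1), (res WV g1), (res WV e1).
    split; first exact: AR.
      by rewrite /= resD resZ (res_comp VU WV (subset_trans WV VU)).
    by rewrite /= resD resZ (res_comp VU WV (subset_trans WV VU)).
  - move=> V y1 [h|[VU [a1 [g1 [e1 [k1 /= e ->]]]]]]; first exact: Af h.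
    have h1 : H V a1 (- e1).
      exists VU; have -> : a1 *: res VU b = - g1 by apply/eqP; rewrite -addr_eq0 addrC -e.
      exact: AN.
    by rewrite -(hy _ VU _ _ h1) subrr.
have uniq U b y y' : gr A U b y -> gr A U b y' -> y = y'.
  by move=> h h'; apply/eqP; rewrite -subr_eq0; apply/eqP/Af; rewrite -(subrr b); exact: AB.
pose f U b := projT1 (cid (total U b)).
have fP U b : gr A U b (f U b) := projT2 (cid (total U b)).
have flin U : linear (f U).
  by move=> a b c; apply: uniq (fP _ _) _; apply: AD => //; exact: AZ.
have fres (U V : opens X) (VU : V `<=` U) (s : sec B U) : f V (res VU s) = res VU (f U s).
  by apply: uniq (fP _ _) _; exact: AR.
exists (mkhom flin fres) => U b y Gby; apply: uniq (fP _ _) _.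
exact: (GA (existT _ U (b, y))).
Qed.

Lemma baer_injective (I : omod) : baer I -> injective_omod I.
Proof.
move=> bI A B i f mi.
pose G : graph B I := fun U b y => exists a, b = i U a /\ y = f U a.
have [|g hg] := @ext_graph B I G bI; last by exists g => U s; apply: hg; exists s.
split.
- by move=> U; exists 0; rewrite !linear0.
- by move=> U b y b' y' [a [-> ->]] [a' [-> ->]]; exists (a - a'); rewrite !linearB.
- by move=> U c b y [a [-> ->]]; exists (c *: a); rewrite !linearZ.
- by move=> U V VU b y [a [-> ->]]; exists (res VU a); rewrite !hom_res.
- by move=> U y [a [e ->]]; rewrite (mi _ a) ?linear0.
Qed.
End Generalities.
End Injectives.

(** * Sheaves of lattices and of principal parts *)
Module LatticeSheaves.
Import Defs.
Export Injectives.
Import Geo.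
Import Defs.
Import Order.TTheory GRing.Theory Num.Theory.
Local Open Scope classical_set_scope.
Local Open Scope ring_scope.

Lemma ifT_p (P : Prop) (T : Type) (a b : T) : P -> (if pselect P then a else b) = a.
Proof. by move=> h; case: pselect. Qed.
Lemma ifF_p (P : Prop) (T : Type) (a b : T) : ~ P -> (if pselect P then a else b) = b.
Proof. by move=> h; case: pselect. Qed.

Section Sheaves.
Variables (k : fieldType) (n : nat) (X : set (pspace k n)) (FF : funfield X).
Local Notation K := (ffK FF).
Local Notation D := (ffD FF).
Local Notation O := (dO D).
Local Notation germ := (germ FF).
Local Notation omod := (omod X).

Lemma germ0 (U : opens X) : germ (0 : regfun U) = 0.
Proof. by rewrite -(subrr 0) germB subrr. Qed.
Lemma germN (U : opens X) (f : regfun U) : germ (- f) = - germ f.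
Proof. by rewrite -sub0r germB germ0 sub0r. Qed.
Lemma germD (U : opens X) (f g : regfun U) : germ (f + g) = germ f + germ g.
Proof. by rewrite -[g in LHS]opprK germB germN opprK. Qed.
Lemma germ_in (U : opens X) (f : regfun U) p : oset U p -> O p (germ f).
Proof. by move=> Up; apply/germ_O; exists U, f. Qed.
Lemma germ_eq0 (U : opens X) (f : regfun U) : oset U !=set0 -> germ f = 0 -> f = 0.
Proof. by move=> U0 e; apply: (germ_inj (f0 := FF)) => //; rewrite germ0. Qed.

Record lfam r := LFam {
  fm :> X -> 'rV[K]_r -> Prop;
  fm0 : forall p, fm p 0;
  fmB : forall p x y, fm p x -> fm p y -> fm p (x - y);
  fmZ : forall p a x, O p a -> fm p x -> fm p (a *: x)
}.

Section Slat.
Variables (r : nat) (M : lfam r).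
Implicit Types U V W : opens X.

Lemma fmN p x : M p x -> M p (- x).
Proof. by move=> h; rewrite -sub0r; apply: fmB => //; exact: fm0. Qed.
Lemma fmD p x y : M p x -> M p y -> M p (x + y).
Proof. by move=> h h'; rewrite -[y]opprK; apply: fmB => //; exact: fmN. Qed.

Definition inU U : {pred 'rV[K]_r} := fun x =>
  `[< (oset U !=set0 \/ x = 0) /\ forall p, oset U p -> M p x >].
Lemma inU_zmod U : zmod_closed (inU U).
Proof.
split; first by apply/asboolP; split; [right|move=> p _; exact: fm0].
move=> x y /asboolP[h1 h2] /asboolP[h3 h4]; apply/asboolP; split.
  by case: h1 => [|->]; [left|case: h3 => [|->]; [left|right; rewrite subrr]].
by move=> p Up; apply: fmB; [exact: h2|exact: h4].
Qed.
Record lsec U := LSec { lval :> 'rV[K]_r; _ : lval \in inU U }.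
HB.instance Definition _ U := [isSub for @lval U].
HB.instance Definition _ U := [Choice of lsec U by <:].
HB.instance Definition _ U := GRing.SubChoice_isSubZmodule.Build 'rV[K]_r (inU U) (lsec U) (inU_zmod U).

Lemma lsecP U (s : lsec U) p : oset U p -> M p (lval s).
Proof. by case: s => s /= /asboolP[_]; apply. Qed.
Lemma lsec0 U (s : lsec U) : ~ (oset U !=set0) -> lval s = 0.
Proof. by case: s => s /= /asboolP[[]]. Qed.

Lemma lscale_sub U (a : regfun U) (s : lsec U) : germ a *: lval s \in inU U.
Proof.
case: s => s /= /asboolP[h1 h2]; apply/asboolP; split.
  by case: h1 => [|->]; [left|right; rewrite scaler0].
by move=> p Up; apply: fmZ; [exact: germ_in|exact: h2].
Qed.
Definition lscale U (a : regfun U) (s : lsec U) : lsec U := LSec (lscale_sub a s).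
Lemma lscaleA U (a b : regfun U) (s : lsec U) : lscale a (lscale b s) = lscale (a * b) s.
Proof. by apply/val_inj; rewrite /= germM scalerA. Qed.
Lemma lscale1 U : left_id 1 (@lscale U).
Proof.
move=> s; apply/val_inj => /=; have [U0|U0] := pselect (oset U !=set0).
  by rewrite germ1 // scale1r.
by rewrite lsec0 // scaler0.
Qed.
Lemma lscaleDr U : right_distributive (@lscale U) +%R.
Proof. by move=> a s t; apply/val_inj; rewrite /= scalerDr. Qed.
Lemma lscaleDl U (s : lsec U) : {morph (@lscale U)^~ s : a b / a + b}.
Proof. by move=> a b; apply/val_inj; rewrite /= germD scalerDl. Qed.
HB.instance Definition _ U := GRing.Zmodule_isLmodule.Build (regfun U) (lsec U)
  (@lscaleA U) (@lscale1 U) (@lscaleDr U) (@lscaleDl U).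

Lemma lres_sub U V (VU : V `<=` U) (s : lsec U) :
  (if pselect (oset V !=set0) then lval s else 0) \in inU V.
Proof.
case: pselect => V0; last by have [] := inU_zmod V.
by apply/asboolP; split; [left|move=> p /VU; exact: lsecP].
Qed.
Definition lres U V (VU : V `<=` U) (s : lsec U) : lsec V := LSec (lres_sub VU s).
Lemma lresE U V (VU : V `<=` U) (s : lsec U) : oset V !=set0 -> lval (lres VU s) = lval s.
Proof. by rewrite /lres /=; case: pselect. Qed.
Lemma lsec_eq U (s t : lsec U) : (oset U !=set0 -> lval s = lval t) -> s = t.
Proof.
move=> h; apply/val_inj => /=; have [U0|U0] := pselect (oset U !=set0); first exact: h.
by rewrite !lsec0.
Qed.

Lemma lvalB U (s t : lsec U) : lval (s - t) = lval s - lval t. Proof. by []. Qed.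
Lemma lvalZ U (a : regfun U) (s : lsec U) : lval (a *: s) = germ a *: lval s. Proof. by []. Qed.

Lemma lresB U V (VU : V `<=` U) (s t : lsec U) : lres VU (s - t) = lres VU s - lres VU t.
Proof. by apply: lsec_eq => V0; rewrite lvalB !lresE // lvalB. Qed.
Lemma lresZ U V (VU : V `<=` U) (a : regfun U) (s : lsec U) :
  lres VU (a *: s) = restr VU a *: lres VU s.
Proof. by apply: lsec_eq => V0; rewrite lvalZ !lresE // lvalZ germ_restr. Qed.
Lemma lres_id U (UU : U `<=` U) (s : lsec U) : lres UU s = s.
Proof. by apply: lsec_eq => V0; rewrite lresE. Qed.
Lemma lres_comp U V W (VU : V `<=` U) (WV : W `<=` V) (WU : W `<=` U) (s : lsec U) :
  lres WV (lres VU s) = lres WU s.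
Proof.
apply: lsec_eq => W0; rewrite !lresE //.
by case: W0 => x Wx; exists x; exact: WV.
Qed.
Lemma lseparated U (I : Type) (C : I -> opens X) (CU : forall i, C i `<=` U) :
  U `<=` \bigcup_i C i ->
  forall s t : lsec U, (forall i, lres (CU i) s = lres (CU i) t) -> s = t.
Proof.
move=> cov s t h; apply: lsec_eq => -[x Ux]; have [i _ Cx] := cov x Ux.
have C0 : oset (C i) !=set0 by exists x.
by have := congr1 (@lval _) (h i); rewrite !lresE.
Qed.
Lemma lglue U (I : Type) (C : I -> opens X) (CU : forall i, C i `<=` U) :
  U `<=` \bigcup_i C i -> forall s : forall i, lsec (C i),
  (forall i j (W : opens X) (Wi : W `<=` C i) (Wj : W `<=` C j), lres Wi (s i) = lres Wj (s j)) ->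
  exists t : lsec U, forall i, lres (CU i) t = s i.
Proof.
move=> cov s ss; have [U0|U0] := pselect (oset U !=set0); last first.
  by exists 0 => i; apply: lsec_eq => -[x /CU Ux]; case: U0; exists x.
have [x0 Ux0] := U0; have [i0 _ Cx0] := cov _ Ux0.
have C00 : oset (C i0) !=set0 by exists x0.
have key i : oset (C i) !=set0 -> lval (s i) = lval (s i0).
  move=> C0; have W0 := ff_meet FF C0 C00.
  by have := congr1 (@lval _) (ss i i0 _ (@opensIl _ _ _) (@opensIr _ _ _)); rewrite !lresE.
have xU : lval (s i0) \in inU U.
  apply/asboolP; split; first by left.
  move=> p Up; have [i _ Cp] := cov _ Up; rewrite -(key i); last by exists p.
  exact: lsecP.
exists (LSec xU) => i; apply: lsec_eq => C0; rewrite lresE //= key //.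
Qed.

Definition slat : omod := OMod (sec := fun U => lsec U) lresB lresZ lres_id lres_comp lseparated lglue.

(** Choosing one representative per class avoids quotient types over a varying family of
submodules. *)
Definition nf (p : X) (x : 'rV[K]_r) : 'rV[K]_r :=
  if pselect (M p x) then 0 else xget 0 [set y | M p (x - y)].
Lemma nfP p x : M p (x - nf p x).
Proof.
rewrite /nf; case: pselect => h; first by rewrite subr0.
by have := @xgetPex _ 0 [set y | M p (x - y)] (ex_intro _ x _); apply; rewrite /= subrr; exact: fm0.
Qed.
Lemma nf_eq p x y : M p (x - y) -> nf p x = nf p y.
Proof.
move=> h; have e z : M p (x - z) <-> M p (y - z).
  split=> hz; last by rewrite -(subrK y x) -addrA; exact: fmD.
  by rewrite -[y](subKr x) addrAC; apply: fmB.
have e0 : M p x <-> M p y by have := e 0; rewrite !subr0.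
rewrite /nf; case: pselect => h1; case: pselect => h2 //; try by case: h1 || case: h2; apply/e0.
by congr xget; apply/funext => z; apply/propext; exact: e.
Qed.
Lemma nf0 p x : M p x -> nf p x = 0.
Proof. by rewrite /nf; case: pselect. Qed.
Lemma nf_idem p x : nf p (nf p x) = nf p x.
Proof. by apply: nf_eq; rewrite -opprB; apply: fmN; exact: nfP. Qed.

Definition qU U : {pred X -> 'rV[K]_r} := fun a =>
  `[< (forall p, oset U p -> nf p (a p) = a p) /\ (forall p, ~ oset U p -> a p = 0) /\
      finite_set [set p | a p != 0] >].
Record qsec U := QSec { qval :> X -> 'rV[K]_r; _ : qval \in qU U }.
HB.instance Definition _ U := [isSub for @qval U].
HB.instance Definition _ U := [Choice of qsec U by <:].

Lemma qsec_nf U (a : qsec U) p : oset U p -> nf p (a p) = a p.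
Proof. by case: a => a /= /asboolP[h _]; exact: h. Qed.
Lemma qsec_out U (a : qsec U) p : ~ oset U p -> a p = 0.
Proof. by case: a => a /= /asboolP[_ [h _]]; exact: h. Qed.
Lemma qsec_fin U (a : qsec U) : finite_set [set p | a p != 0].
Proof. by case: a => a /= /asboolP[_ []]. Qed.
Lemma qsec_eq U (a b : qsec U) : (forall p, oset U p -> M p (a p - b p)) -> a = b.
Proof.
move=> h; apply/val_inj/funext => p /=; have [Up|nU] := pselect (oset U p).
  by rewrite -[LHS](qsec_nf a Up) -[RHS](qsec_nf b Up); apply: nf_eq; exact: h.
by rewrite !qsec_out.
Qed.

Lemma mkq_sub U (f : X -> 'rV[K]_r) : finite_set [set p | oset U p /\ ~ M p (f p)] ->
  (fun p => if pselect (oset U p) then nf p (f p) else 0) \in qU U.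
Proof.
move=> fin; apply/asboolP; split; [|split].
- by move=> p Up; rewrite ifT_p //; exact: nf_idem.
- by move=> p nU; rewrite ifF_p.
- apply: sub_finite_set fin => p /= e; have [Up|nU] := pselect (oset U p); last by rewrite ifF_p ?eqxx in e.
  rewrite ifT_p // in e; move/eqP: e => h; split => // h'; apply: h; exact: nf0.
Qed.
Definition mkq U f (fin : finite_set [set p | oset U p /\ ~ M p (f p)]) : qsec U :=
  QSec (mkq_sub fin).
Lemma mkqE U f fin p : oset U p -> M p ((@mkq U f fin) p - f p).
Proof.
move=> Up; rewrite /= ifT_p //.
by rewrite -opprB; apply: fmN; exact: nfP.
Qed.

Lemma fin_of U (a : qsec U) f : (forall p, oset U p -> M p (a p) -> M p (f p)) ->
  finite_set [set p | oset U p /\ ~ M p (f p)].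
Proof.
move=> h; apply: sub_finite_set (qsec_fin a) => p /= [Up nM]; apply/eqP => e.
by apply: nM; apply: h => //; rewrite e; exact: fm0.
Qed.
Lemma fin_of2 U (a b : qsec U) f : (forall p, oset U p -> M p (a p) -> M p (b p) -> M p (f p)) ->
  finite_set [set p | oset U p /\ ~ M p (f p)].
Proof.
move=> h; apply: (@sub_finite_set _ _ ([set p | a p != 0] `|` [set p | b p != 0])).
  move=> p /= [Up nM]; apply: contrapT => /not_orP[/negP/negPn/eqP e1 /negP/negPn/eqP e2].
  by apply: nM; apply: h => //; rewrite ?e1 ?e2; exact: fm0.
by rewrite finite_setU; split; exact: qsec_fin.
Qed.

Definition qadd U (a b : qsec U) : qsec U := mkq (fin_of2 (a := a) (b := b)
  (f := fun p => a p + b p) (fun p _ h h' => fmD h h')).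
Definition qopp U (a : qsec U) : qsec U := mkq (fin_of (a := a)
  (f := fun p => - a p) (fun p _ h => fmN h)).
Lemma q0_fin U : finite_set [set p | oset U p /\ ~ M p (0 : 'rV[K]_r)].
Proof. by apply: (@sub_finite_set _ _ set0) => // p /= [_ h]; apply: h; exact: fm0. Qed.
Definition q0 U : qsec U := mkq (@q0_fin U).

Lemma qsec_trans U (a b : qsec U) f : (forall p, oset U p -> M p (a p - f p)) ->
  (forall p, oset U p -> M p (b p - f p)) -> a = b.
Proof.
move=> h h'; apply: qsec_eq => p Up; have := fmB (h p Up) (h' p Up).
by rewrite opprB addrA subrK.
Qed.
Lemma qaddE U (a b : qsec U) p : oset U p -> M p (qadd a b p - (a p + b p)).
Proof. exact: mkqE. Qed.
Lemma modD p (x y x' y' : 'rV[K]_r) : M p (x - x') -> M p (y - y') -> M p (x + y - (x' + y')).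
Proof. by move=> h h'; rewrite opprD addrACA; exact: fmD. Qed.
Lemma modT p (y x z : 'rV[K]_r) : M p (x - y) -> M p (y - z) -> M p (x - z).
Proof. by move=> h h'; rewrite -(subrK y x) -addrA; exact: fmD. Qed.
Lemma modR p (x : 'rV[K]_r) : M p (x - x).
Proof. by rewrite subrr; exact: fm0. Qed.

Lemma qaddA U : associative (@qadd U).
Proof.
move=> a b c; apply: (qsec_trans (f := fun p => a p + b p + c p)) => p Up.
  apply: modT (qaddE a (qadd b c) Up) _; rewrite -[a p + b p + c p]addrA; apply: modD; first exact: modR.
  exact: qaddE.
apply: modT (qaddE (qadd a b) c Up) _; apply: modD; last exact: modR.
exact: qaddE.
Qed.
Lemma qaddC U : commutative (@qadd U).
Proof.
move=> a b; apply: (qsec_trans (f := fun p => a p + b p)) => p Up; first exact: qaddE.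
by rewrite [a p + b p]addrC; exact: qaddE.
Qed.
Lemma qadd0 U : left_id (@q0 U) (@qadd U).
Proof.
move=> a; apply: (qsec_trans (f := a)) => p Up; last exact: modR.
apply: modT (qaddE _ _ Up) _; rewrite -[X in M p (_ - X)]add0r.
by apply: modD; [exact: mkqE|exact: modR].
Qed.
Lemma qaddN U : left_inverse (@q0 U) (@qopp U) (@qadd U).
Proof.
move=> a; apply: (qsec_trans (f := fun=> 0)) => p Up; last exact: mkqE.
apply: modT (qaddE _ _ Up) _; rewrite -[X in M p (_ - X)](addNr (a p)).
by apply: modD; [exact: mkqE|exact: modR].
Qed.
HB.instance Definition _ U := GRing.isZmodule.Build (qsec U) (@qaddA U) (@qaddC U) (@qadd0 U) (@qaddN U).

Definition qscale U (f : regfun U) (a : qsec U) : qsec U := mkq (fin_of (a := a)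
  (f := fun p => germ f *: a p) (fun p Up h => fmZ (germ_in f Up) h)).
Lemma qscaleE U (f : regfun U) (a : qsec U) p : oset U p -> M p (qscale f a p - germ f *: a p).
Proof. exact: mkqE. Qed.
Lemma modZ U (f : regfun U) p x y : oset U p -> M p (x - y) -> M p (germ f *: x - germ f *: y).
Proof. by move=> Up h; rewrite -scalerBr; apply: fmZ => //; exact: germ_in. Qed.
Lemma qscaleA U (f g : regfun U) (a : qsec U) : qscale f (qscale g a) = qscale (f * g) a.
Proof.
apply: (qsec_trans (f := fun p => germ (f * g) *: a p)) => p Up; last exact: qscaleE.
apply: modT (qscaleE _ _ Up) _; rewrite germM -scalerA; apply: modZ => //.
exact: qscaleE.
Qed.
Lemma qscale1 U : left_id 1 (@qscale U).
Proof.
move=> a; apply: (qsec_trans (f := a)) => p Up; last exact: modR.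
apply: modT (qscaleE _ _ Up) _; rewrite germ1; last by exists p.
by rewrite scale1r; exact: modR.
Qed.
Lemma qscaleDr U : right_distributive (@qscale U) +%R.
Proof.
move=> f a b; apply: (qsec_trans (f := fun p => germ f *: a p + germ f *: b p)) => p Up.
  apply: modT (qscaleE _ _ Up) _; rewrite -scalerDr; apply: modZ => //; exact: qaddE.
by apply: modT (qaddE _ _ Up) _; apply: modD; exact: qscaleE.
Qed.
Lemma qscaleDl U (a : qsec U) : {morph (@qscale U)^~ a : f g / f + g}.
Proof.
move=> f g; apply: (qsec_trans (f := fun p => germ f *: a p + germ g *: a p)) => p Up.
  by apply: modT (qscaleE _ _ Up) _; rewrite germD scalerDl; exact: modR.
by apply: modT (qaddE _ _ Up) _; apply: modD; exact: qscaleE.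
Qed.
HB.instance Definition _ U := GRing.Zmodule_isLmodule.Build (regfun U) (qsec U)
  (@qscaleA U) (@qscale1 U) (@qscaleDr U) (@qscaleDl U).

Lemma qres_fin U V (a : qsec U) : V `<=` U -> finite_set [set p | oset V p /\ ~ M p (a p)].
Proof.
move=> VU; apply: sub_finite_set (fin_of (a := a) (f := a) (fun p _ h => h)) => p /= [Vp h].
by split => //; exact: VU.
Qed.
Definition qres U V (VU : V `<=` U) (a : qsec U) : qsec V := mkq (qres_fin a VU).
Lemma qresE U V (VU : V `<=` U) (a : qsec U) p : oset V p -> qres VU a p = a p.
Proof. by move=> Vp; rewrite /= ifT_p // qsec_nf //; exact: VU. Qed.

Lemma qresB U V (VU : V `<=` U) (a b : qsec U) : qres VU (a - b) = qres VU a - qres VU b.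
Proof.
apply: (qsec_trans (f := fun p => a p - b p)) => p Vp.
  rewrite qresE //; apply: modT (qaddE _ _ (VU _ Vp)) _; apply: modD; first exact: modR.
  exact: mkqE (VU _ Vp).
apply: modT (qaddE _ _ Vp) _; apply: modD; first by rewrite qresE //; exact: modR.
by apply: modT (mkqE _ Vp) _; rewrite qresE //; exact: modR.
Qed.
Lemma qresZ U V (VU : V `<=` U) (f : regfun U) (a : qsec U) :
  qres VU (f *: a) = restr VU f *: qres VU a.
Proof.
apply: (qsec_trans (f := fun p => germ f *: a p)) => p Vp.
  by rewrite qresE //; exact: qscaleE (VU _ Vp).
apply: modT (qscaleE _ _ Vp) _; rewrite qresE // germ_restr; first exact: modR.
by exists p.
Qed.
Lemma qsec_pt U (a b : qsec U) : (forall p, oset U p -> a p = b p) -> a = b.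
Proof. by move=> h; apply: qsec_eq => p /h ->; exact: modR. Qed.
Lemma qres_id U (UU : U `<=` U) (a : qsec U) : qres UU a = a.
Proof. by apply: qsec_pt => p Up; rewrite qresE. Qed.
Lemma qres_comp U V W (VU : V `<=` U) (WV : W `<=` V) (WU : W `<=` U) (a : qsec U) :
  qres WV (qres VU a) = qres WU a.
Proof. by apply: qsec_pt => p Wp; rewrite !qresE //; exact: WV. Qed.
Lemma qseparated U (I : Type) (C : I -> opens X) (CU : forall i, C i `<=` U) :
  U `<=` \bigcup_i C i ->
  forall a b : qsec U, (forall i, qres (CU i) a = qres (CU i) b) -> a = b.
Proof.
move=> cov a b h; apply: qsec_pt => p Up; have [i _ Cp] := cov p Up.
by have := congr1 (fun c : qsec (C i) => c p) (h i); rewrite !qresE.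
Qed.
Lemma qglue U (I : Type) (C : I -> opens X) (CU : forall i, C i `<=` U) :
  U `<=` \bigcup_i C i -> forall a : forall i, qsec (C i),
  (forall i j (W : opens X) (Wi : W `<=` C i) (Wj : W `<=` C j), qres Wi (a i) = qres Wj (a j)) ->
  exists t : qsec U, forall i, qres (CU i) t = a i.
Proof.
move=> cov a aa; have [U0|U0] := pselect (oset U !=set0); last first.
  by exists 0 => i; apply: qsec_pt => p /CU Up; case: U0; exists p.
have [x0 Ux0] := U0; have [i0 _ Cx0] := cov _ Ux0.
have /choice[ix hix] : forall p, exists i, oset U p -> oset (C i) p.
  move=> p; have [Up|nU] := pselect (oset U p); last by exists i0.
  by have [i _ Cp] := cov _ Up; exists i.
have key i j p : oset (C i) p -> oset (C j) p -> a i p = a j p.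
  move=> Ci Cj.
  have := congr1 (fun c : qsec _ => c p) (aa i j _ (@opensIl _ _ _) (@opensIr _ _ _)).
  by rewrite !qresE.
have fin : finite_set [set p | oset U p /\ ~ M p (a (ix p) p)].
  have C00 : oset (C i0) !=set0 by exists x0.
  apply: (@sub_finite_set _ _ ((~` C i0) `|` [set p | a i0 p != 0])).
    move=> p /= [Up nM]; apply: contrapT => /not_orP[/contrapT Cp /negP/negPn/eqP e].
    by apply: nM; rewrite (key _ i0) ?e //; [exact: fm0|exact: hix].
  by rewrite finite_setU; split; [exact: (ff_cofinite FF)|exact: qsec_fin].
exists (mkq fin) => i; apply: qsec_pt => p Cp; rewrite qresE // /=.
have Up := CU _ _ Cp; rewrite ifT_p //.
by rewrite (key _ i) ?qsec_nf //; exact: hix.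
Qed.

Definition qsh : omod := OMod (sec := fun U => qsec U) qresB qresZ qres_id qres_comp qseparated qglue.
End Slat.
End Sheaves.
End LatticeSheaves.

(** * Independence of Ext from the resolution *)
Module ExtComparison.
Import Defs.
Export Injectives.
Import all_boot all_order all_algebra.
Import all_classical.
Import mpoly topology_structure subtype_topology.
Import Defs.
Import Order.TTheory GRing.Theory Num.Theory.
Local Open Scope classical_set_scope.
Local Open Scope ring_scope.

Section Homs.
Variables (k : fieldType) (n : nat) (X : set (pspace k n)).
Local Notation omod := (omod X).

Lemma hcomp_lin (F G H : omod) (f : hom F G) (g : hom G H) U : linear (fun s => g U (f U s)).
Proof. by move=> a s t; rewrite !linearP. Qed.
Lemma hcomp_res (F G H : omod) (f : hom F G) (g : hom G H) (U V : opens X) (VU : V `<=` U) s :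
  g V (f V (res VU s)) = res VU (g U (f U s)).
Proof. by rewrite !hom_res. Qed.
Definition hcomp (F G H : omod) (f : hom F G) (g : hom G H) : hom F H :=
  mkhom (@hcomp_lin F G H f g) (@hcomp_res F G H f g).

Lemma hid_lin (F : omod) U : linear (fun s : sec F U => s).
Proof. by []. Qed.
Definition hid (F : omod) : hom F F := mkhom (@hid_lin F) (fun U V VU s => erefl).

Lemma hlin_lin (F G : omod) (c : k) (f g : hom F G) U : linear (fun s => cstf U c *: f U s + g U s).
Proof.
by move=> a s t; rewrite (linearP (f U)) (linearP (g U)) /= !scalerDr !scalerA [_ * a]mulrC addrACA.
Qed.
Lemma hlin_res (F G : omod) (c : k) (f g : hom F G) (U V : opens X) (VU : V `<=` U) s :
  cstf V c *: f V (res VU s) + g V (res VU s) = res VU (cstf U c *: f U s + g U s).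
Proof. by rewrite resD resZ !hom_res; congr (_ *: _ + _); exact: val_inj. Qed.
Definition hlin (F G : omod) c (f g : hom F G) : hom F G :=
  mkhom (@hlin_lin F G c f g) (@hlin_res F G c f g).

Lemma h0_lin (F G : omod) U : linear (fun _ : sec F U => 0 : sec G U).
Proof. by move=> a s t; rewrite scaler0 addr0. Qed.
Definition h0 (F G : omod) : hom F G :=
  mkhom (@h0_lin F G) (fun U V VU s => esym (res0 G VU)).

Lemma cst1 (U : opens X) : cstf U 1 = 1. Proof. exact: val_inj. Qed.
Lemma cst0 (U : opens X) : cstf U 0 = 0. Proof. exact: val_inj. Qed.
Lemma cstN (U : opens X) c : cstf U (- c) = - cstf U c. Proof. exact: val_inj. Qed.
Lemma cstD (U : opens X) c c' : cstf U (c + c') = cstf U c + cstf U c'. Proof. exact: val_inj. Qed.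
Lemma cstM (U : opens X) c c' : cstf U (c * c') = cstf U c * cstf U c'. Proof. exact: val_inj. Qed.
Lemma restr_cst (U V : opens X) (VU : V `<=` U) c : restr VU (cstf U c) = cstf V c.
Proof. exact: val_inj. Qed.

Lemma local_eq (F : omod) (U : opens X) (s t : sec F U) :
  (forall x, oset U x -> exists (V : opens X) (VU : V `<=` U), oset V x /\ res VU s = res VU t) ->
  s = t.
Proof.
move=> h; pose T := {x : X | oset U x}.
pose V (x : T) : opens X := projT1 (cid (h _ (projT2 x))).
pose hV (x : T) := cid (projT2 (cid (h _ (projT2 x)))).
apply: (sec_separated (C := V) (CU := fun x => projT1 (hV x))) => [x Ux|x].
  by exists (exist _ x Ux) => //; have [] := projT2 (hV (exist _ x Ux)).
by have [] := projT2 (hV x).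
Qed.

Section LocalHom.
Variables (F G : omod) (R : forall U : opens X, sec F U -> sec G U -> Prop).
Hypothesis Rex : forall U s x, oset U x ->
  exists (V : opens X) (VU : V `<=` U), oset V x /\ exists t, R (res VU s) t.
Hypothesis R0 : forall U (t : sec G U), R 0 t -> t = 0.
Hypothesis RP : forall U a s t s' t', @R U s t -> @R U s' t' -> R (a *: s + s') (a *: t + t').
Hypothesis Rres : forall (U V : opens X) (VU : V `<=` U) s t, R s t -> R (res VU s) (res VU t).

Let Runiq U s t t' : @R U s t -> @R U s t' -> t = t'.
Proof.
move=> h h'; have := RP (-1) h h'; rewrite !scaleN1r addNr => /R0 /eqP.
by rewrite addrC subr_eq0 => /eqP.
Qed.

Let R' (U : opens X) (s : sec F U) (t : sec G U) := forall x, oset U x ->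
  exists (V : opens X) (VU : V `<=` U), oset V x /\ R (res VU s) (res VU t).

Let two U s t s' t' x : @R' U s t -> R' s' t' -> oset U x ->
  exists (V : opens X) (VU : V `<=` U), [/\ oset V x, R (res VU s) (res VU t) & R (res VU s') (res VU t')].
Proof.
move=> h h' Ux; have [V [VU [Vx hV]]] := h _ Ux; have [W [WU [Wx hW]]] := h' _ Ux.
pose VW := opensI V W; exists VW, (subset_trans (@opensIl _ _ _) VU); split; first by [].
  by have := Rres (@opensIl _ V W) hV; rewrite !(res_comp _ _ (subset_trans (@opensIl _ V W) VU)).
by have := Rres (@opensIr _ V W) hW; rewrite !(res_comp _ _ (subset_trans (@opensIl _ V W) VU)).
Qed.

Lemma local_hom : exists f : hom F G, forall U s t, @R U s t -> f U s = t.
Proof.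
have total U s : exists t, @R' U s t.
  pose T := {x : X | oset U x}.
  pose V (x : T) : opens X := projT1 (cid (Rex s (projT2 x))).
  pose hV (x : T) := cid (projT2 (cid (Rex s (projT2 x)))).
  pose VU x : V x `<=` U := projT1 (hV x).
  have Vx (x : T) : oset (V x) (sval x) by have [] := projT2 (hV x).
  have ht x : exists t, R (res (VU x) s) t by have [] := projT2 (hV x).
  pose t x := projT1 (cid (ht x)); have tP x : R (res (VU x) s) (t x) := projT2 (cid (ht x)).
  have [||y hy] := sec_glue VU _ (s := t); first by move=> x Ux; exists (exist _ x Ux) => //; exact: (Vx (exist _ x Ux)).
    move=> i j W Wi Wj; have h1 := Rres Wi (tP i); have h2 := Rres Wj (tP j).
    rewrite (res_comp _ _ (subset_trans Wi (VU i))) in h1.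
    rewrite (res_comp _ _ (subset_trans Wi (VU i))) in h2; exact: Runiq h1 h2.
  exists y => x Ux; exists (V (exist _ x Ux)), (VU _); split; first exact: (Vx (exist _ x Ux)).
  by rewrite hy; exact: tP.
have uniq' U s t t' : @R' U s t -> R' s t' -> t = t'.
  move=> h h'; apply: local_eq => x Ux; have [V [VU [Vx k1 k2]]] := two h h' Ux.
  by exists V, VU; split => //; exact: Runiq k1 k2.
pose f U s := projT1 (cid (@total U s)).
have fP U s : R' s (f U s) := projT2 (cid (@total U s)).
have flin U : linear (f U).
  move=> a s s'; apply: uniq' (fP _ _) _ => x Ux.
  have [V [VU [Vx k1 k2]]] := two (fP _ s) (fP _ s') Ux; exists V, VU; split => //.
  by rewrite !resD !resZ; exact: RP.
have fres (U V : opens X) (VU : V `<=` U) (s : sec F U) : f V (res VU s) = res VU (f U s).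
  apply: uniq' (fP _ _) _ => x Vx; have [W [WU [Wx hW]]] := fP U s x (VU _ Vx).
  exists (opensI W V), (@opensIr _ _ _); split; first by [].
  have := Rres (@opensIl _ W V) hW.
  by rewrite !(res_comp _ _ (subset_trans (@opensIl _ W V) WU)).
exists (mkhom flin fres) => U s t h; apply: uniq' (fP _ _) _ => x Ux.
by exists U, (@subset_refl _ _); rewrite !res_id.
Qed.
End LocalHom.

Lemma factor_epi (A B C : omod) (p : hom A B) (f : hom A C) : epi p ->
  (forall U a, p U a = 0 -> f U a = 0) -> exists g : hom B C, forall U a, g U (p U a) = f U a.
Proof.
move=> ep hf; pose R U b c := exists a, b = p U a /\ c = f U a.
have [||||g hg] := @local_hom B C R.
- move=> U s x Ux; have [V [VU [Vx [a ha]]]] := ep U s x Ux.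
  by exists V, VU; split => //; exists (f V a), a.
- by move=> U t [a [e ->]]; exact: hf.
- by move=> U c s t s' t' [a [-> ->]] [a' [-> ->]]; exists (c *: a + a'); rewrite !linearP.
- by move=> U V VU s t [a [-> ->]]; exists (res VU a); rewrite !hom_res.
by exists g => U a; apply: hg; exists a.
Qed.

Lemma epi_ext (A B C : omod) (p : hom A B) (f g : hom B C) : epi p ->
  (forall U a, f U (p U a) = g U (p U a)) -> forall U b, f U b = g U b.
Proof.
move=> ep h U b; apply: local_eq => x Ux; have [V [VU [Vx [a ha]]]] := ep U b x Ux.
by exists V, VU; split => //; rewrite -!hom_res -ha h.
Qed.

Lemma iso_mono_epi (A B : omod) (p : hom A B) : mono p -> epi p -> iso A B.
Proof.
move=> mp ep; have [|g hg] := @factor_epi A B A p (hid A) ep.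
  by move=> U a /mp.
exists p, g; split => // U b.
exact: (@epi_ext _ _ _ p (hcomp g p) (hid B) ep (fun U a => congr1 (p U) (hg U a))).
Qed.

Lemma corestr_kval (F G : omod) (f : hom F G) U (s : kersec f U) : f U (kval s) = 0.
Proof. by case: s => s /= /eqP. Qed.
Lemma kincl_lin (F G : omod) (f : hom F G) U : linear (fun s : sec (ker f) U => kval s).
Proof. by []. Qed.
Definition kincl (F G : omod) (f : hom F G) : hom (ker f) F :=
  mkhom (@kincl_lin F G f) (fun U V VU s => erefl).
Lemma kincl_mono (F G : omod) (f : hom F G) : mono (kincl f).
Proof. by move=> U s e; apply: val_inj. Qed.

Lemma corestr (A F G : omod) (g : hom F G) (f : hom A F) : (forall U a, g U (f U a) = 0) ->
  exists f' : hom A (ker g), forall U a, kval (f' U a) = f U a.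
Proof.
move=> h; have hk U a : f U a \in @kerb _ _ _ _ _ g U by apply/eqP/h.
have lin U : linear (fun a => KerSec (hk U a) : sec (ker g) U).
  by move=> c a b; apply: val_inj; rewrite /= linearP.
have rs (U V : opens X) (VU : V `<=` U) (a : sec A U) :
  (KerSec (hk V (res VU a)) : sec (ker g) V) = res VU (KerSec (hk U a) : sec (ker g) U).
  by apply: val_inj; rewrite /= hom_res.
by exists (mkhom lin rs).
Qed.

Lemma exactL (F G H : omod) (f : hom F G) (g : hom G H) U t : exact_at f g -> g U t = 0 ->
  locally_in_image f t.
Proof. by move=> h /h. Qed.
Lemma exactR (F G H : omod) (f : hom F G) (g : hom G H) U t : exact_at f g ->
  locally_in_image f t -> g U t = 0.
Proof. by move=> h /h. Qed.

Section Comparison.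
Variables (F : omod).

(** The map factors through the image of the differential, which is a subobject of the next
term, and then injectivity applies. *)
Lemma extend_d (I : injres F) (J : omod) (f : hom (I 0%N) J) : injective_omod J ->
  (forall U s, f U (inj_aug I U s) = 0) ->
  exists g : hom (I 1%N) J, forall U x, g U (inj_d I 0%N U x) = f U x.
Proof.
move=> iJ hf; have [|c hc] := @corestr _ _ _ (inj_d I 1%N) (inj_d I 0%N).
  move=> U a; apply: (exactR (@inj_exact _ _ _ _ I 0%N)) => x Ux; exists U, (@subset_refl _ _); split => //.
  by exists a; rewrite res_id.
have [||g hg] := @factor_epi _ _ _ c f.
- move=> U t x Ux; have := exactL (@inj_exact _ _ _ _ I 0%N) (corestr_kval t).
  move=> /(_ x Ux)[V [VU [Vx [s hs]]]]; exists V, VU; split => //; exists s.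
  by apply: val_inj => /=; rewrite -hs; exact: hc.
- move=> U a ea; have /(exactL (@inj_aug_exact _ _ _ _ I)) h : inj_d I 0%N U a = 0 by rewrite -hc ea.
  apply: local_eq => x Ux; have [V [VU [Vx [s hs]]]] := h x Ux.
  by exists V, VU; split => //; rewrite res0 -hom_res -hs hf.
have [g' hg'] := iJ _ _ _ g (@kincl_mono _ _ (inj_d I 1%N)).
by exists g' => U x; rewrite -hc -hg -hg'.
Qed.

Lemma extend_aug (I J : injres F) : exists f : hom (I 0%N) (J 0%N),
  forall U s, f U (inj_aug I U s) = inj_aug J U s.
Proof. by have [g hg] := @inj_objP _ _ _ _ J 0%N _ _ _ (inj_aug J) (@inj_aug_mono _ _ _ _ I); exists g. Qed.

Lemma dd0 (I : injres F) U x : inj_d I 1%N U (inj_d I 0%N U x) = 0.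
Proof.
apply: (exactR (@inj_exact _ _ _ _ I 0%N)) => y Uy; exists U, (@subset_refl _ _); split => //.
by exists x; rewrite res_id.
Qed.
Lemma daug0 (I : injres F) U x : inj_d I 0%N U (inj_aug I U x) = 0.
Proof.
apply: (exactR (@inj_aug_exact _ _ _ _ I)) => y Uy; exists U, (@subset_refl _ _); split => //.
by exists x; rewrite res_id.
Qed.

Definition homotopic (I J : injres F) (f : hom (I 1%N) (J 1%N)) (g : hom (J 1%N) (I 1%N)) :=
  exists s : hom (I 1%N) (I 0%N), forall U x, inj_d I 1%N U x = 0 -> g U (f U x) - x = inj_d I 0%N U (s U x).
Definition chain (I J : injres F) (f0 : hom (I 0%N) (J 0%N)) (f : hom (I 1%N) (J 1%N)) :=
  (forall U x, f U (inj_d I 0%N U x) = inj_d J 0%N U (f0 U x)) /\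
  (forall U x, inj_d I 1%N U x = 0 -> inj_d J 1%N U (f U x) = 0).

(** The usual construction, term by term, of maps and homotopies between two resolutions;
only the low degrees are needed. *)
Lemma comparison (I J : injres F) :
  exists f0 f g0 g, [/\ @chain I J f0 f, @chain J I g0 g, homotopic f g & homotopic g f].
Proof.
have ext (I' J' : injres F) : exists f0 f, @chain I' J' f0 f /\ forall U s, f0 U (inj_aug I' U s) = inj_aug J' U s.
  have [f0 hf0] := extend_aug I' J'.
  have [|f hf] := @extend_d I' (J' 1%N) (hcomp f0 (inj_d J' 0%N)) (@inj_objP _ _ _ _ J' 1%N).
    by move=> U s; rewrite /= hf0 daug0.
  exists f0, f; split => //; split => // U x /(exactL (@inj_exact _ _ _ _ I' 0%N)) h; apply: local_eq => y Uy.
  have [V [VU [Vy [a ha]]]] := h y Uy; exists V, VU; split => //.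
  by rewrite -!hom_res -ha hf /= dd0 res0.
have hom1 (I' J' : injres F) f0 f g0 g : @chain I' J' f0 f -> @chain J' I' g0 g ->
    (forall U s, f0 U (inj_aug I' U s) = inj_aug J' U s) ->
    (forall U s, g0 U (inj_aug J' U s) = inj_aug I' U s) -> homotopic f g.
  move=> [hf _] [hg _] af ag.
  have [|s hs] := @extend_d I' (I' 0%N) (hlin (-1) (hid _) (hcomp f0 g0)) (@inj_objP _ _ _ _ I' 0%N).
    by move=> U s; rewrite /= af ag cstN cst1 scaleN1r addNr.
  exists s => U x /(exactL (@inj_exact _ _ _ _ I' 0%N)) h; apply: local_eq => y Uy.
  have [V [VU [Vy [a ha]]]] := h y Uy; exists V, VU; split => //.
  by rewrite resB -!hom_res -ha hf hg hs /= cstN cst1 scaleN1r linearD linearN addrC.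
have [f0 [f [cf af]]] := ext I J; have [g0 [g [cg ag]]] := ext J I.
by exists f0, f, g0, g; split => //; [exact: (hom1 I J f0 f g0 g)|exact: (hom1 J I g0 g f0 f)].
Qed.

(** Transport along the comparison of resolutions turns a statement about one resolution
into one about any other. *)
Lemma ext1_zero (E : omod) (J : injres F) : ext_dim E F 1 0 ->
  forall z : hom E (J 1%N), cocycle z -> coboundary (I := J) (j := 1) (fun U s => z U s).
Proof.
move=> [I [b [_ hI]]] z cz; have [f0 [f [g0 [g [[hf cf] [hg _] [s hs] _]]]]] := comparison J I.
have [|c [[w hw] _]] := hI (hcomp z f); first by move=> U t /=; apply: cf; exact: cz.
exists (hlin (-1) (hcomp z s) (hcomp w g0)) => U t /=.
have := hw U t; rewrite big_ord0 subr0 /= => e.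
have := hs U (z U t) (cz U t); rewrite e hg => e'.
by rewrite cstN cst1 scaleN1r linearD linearN /= -e' opprB addrNK.
Qed.
End Comparison.

Lemma iso_sym (E F : omod) : iso E F -> iso F E.
Proof. by move=> [f [g [h1 h2]]]; exists g, f. Qed.

Definition injres_iso (F F' : omod) (I : injres F) (a : hom F' F) (ma : mono a)
  (ea : forall U t, exists s, a U s = t) : injres F'.
Proof.
apply: (@InjRes _ _ _ F' I (inj_d I) (hcomp a (inj_aug I)) (@inj_objP _ _ _ _ I) _ _ (@inj_exact _ _ _ _ I)).
- by move=> U s /= /(@inj_aug_mono _ _ _ _ I); exact: ma.
- move=> U t; split.
    move=> /(exactL (@inj_aug_exact _ _ _ _ I)) h x Ux; have [V [VU [Vx [s hs]]]] := h x Ux.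
    by have [s' es'] := ea V s; exists V, VU; split => //; exists s'; rewrite /= es'.
  move=> h; apply: (exactR (@inj_aug_exact _ _ _ _ I)) => x Ux; have [V [VU [Vx [s hs]]]] := h x Ux.
  by exists V, VU; split => //; exists (a V s).
Defined.

Lemma ext_dim_iso (E E' F F' : omod) j m : iso E E' -> iso F F' -> ext_dim E F j m -> ext_dim E' F' j m.
Proof.
move=> [e [e' [k1 k2]]] [f [f' [h1 h2]]].
have mf : mono f' by move=> U s es; rewrite -(h2 U s) es linear0.
pose J (I : injres F) : injres F' := injres_iso I mf (fun U t => ex_intro _ (f U t) (h1 U t)).
case: j => [|j] [I [b [cb hb]]]; exists (J I), (fun i => hcomp e' (b i)); split;
  try (by move=> i U s /=; exact: cb); move=> z cz;
  (have [|c [hc uc]] := hb (hcomp e z); first by move=> U s; exact: cz); exists c; split.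
- by move=> U s; have := hc U (e' U s); rewrite /= k2.
- by move=> c' hc'; apply: uc => U s; have := hc' U (e U s); rewrite /= k1.
- by have [w hw] := hc; exists (hcomp e' w) => U s; have := hw U (e' U s); rewrite /= k2.
- move=> c' hc'; apply: uc; have [w hw] := hc'; exists (hcomp e w) => U s.
  by have := hw U (e U s); rewrite /= k1.
Qed.

Lemma pairing_iso (E E' F : omod) : iso E E' -> pairing_nondegenerate E F -> pairing_nondegenerate E' F.
Proof.
move=> [f [f' [h1 h2]]] [I [p1 p2]].
have mf : mono f' by move=> U s es; rewrite -(h2 U s) es linear0.
exists (injres_iso I mf (fun U t => ex_intro _ (f U t) (h1 U t))); split.
  move=> g hg U s; have := p1 (hcomp f g) _ U (f' U s); rewrite /= h2; apply.
  move=> z cz; have [w hw] := hg z cz; exists (hcomp f w) => V t /=; exact: hw.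
move=> z cz hz; apply: p2 => // g; have [w hw] := hz (hcomp f' g); exists (hcomp f w) => V t /=.
by rewrite -hw /= h1.
Qed.
End Homs.
End ExtComparison.

(** * The resolution by principal parts *)
Module PrincipalParts.
Import Defs.
Export LatticeSheaves ExtComparison.
Import Geo.
Import Defs.
Import Order.TTheory GRing.Theory Num.Theory.
Local Open Scope classical_set_scope.
Local Open Scope ring_scope.

Lemma dO_nat (k K : fieldType) (P : choiceType) (D : dvrs k K P) p x : x != 0 -> dO D p x ->
  exists (u : K) (m : nat), [/\ dO D p u, dO D p u^-1 & x = u * unif D p ^+ m].
Proof.
move=> x0 Ox; have [u [m [hu hu' e]]] := dO_fact D p x0.
case: m => m in e; first by exists u, m.
have u0 : u != 0 by apply: contraNneq x0 => z; rewrite e z mul0r.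
case: (unif_nunit (d := D) (p := p)).
have -> : (unif D p)^-1 = u^-1 * x * unif D p ^+ m.
  rewrite e mulKf // NegzE -exprnN exprS invfM -mulrA mulVf ?mulr1 //.
  by rewrite expf_neq0 // unif_neq0.
by apply: dOM; [exact: dOM|apply: dOX; exact: dO_unif].
Qed.

Section Resolution.
Variables (k : fieldType) (n : nat) (X : set (pspace k n)) (FF : funfield X).
Local Notation K := (ffK FF).
Local Notation D := (ffD FF).
Local Notation O := (dO D).
Local Notation germ := (germ FF).
Local Notation omod := (omod X).

Definition topfam r : lfam FF r := @LFam k n X FF r (fun _ _ => True) (fun _ => I)
  (fun _ _ _ _ _ => I) (fun _ _ _ _ _ => I).

Lemma top_in r (U : opens X) (x : 'rV[K]_r) : oset U !=set0 -> x \in inU (topfam r) U.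
Proof. by move=> U0; apply/asboolP; split; [left|]. Qed.

Lemma germ_near (U : opens X) p x : oset U p -> O p x -> exists (V : opens X) (VU : V `<=` U) (f : regfun V),
  oset V p /\ germ f = x.
Proof.
move=> Up /germ_O[W [f [Wp hf]]]; exists (opensI U W), (@opensIl _ _ _), (restr (@opensIr _ U W) f).
by split; [split|rewrite germ_restr //; exists p].
Qed.

Lemma baer_top r : baer (slat (topfam r)).
Proof.
move=> U H HB HZ HR H0.
have [[V [a [x [VU [V0 [Hx a0]]]]]]|none] := pselect (exists (V : opens X) (a : regfun V) x,
  V `<=` U /\ oset V !=set0 /\ H V a x /\ germ a != 0); last first.
  exists 0 => V VU a x Hx; apply: lsec_eq => V0.
  have a0 : a = 0.
    apply: (germ_eq0 (FF := FF)) => //; apply: contrapT => a0; apply: none.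
    by exists V, a, x; split => //; split => //; split => //; apply/eqP.
  by rewrite a0 in Hx *; rewrite (H0 _ _ VU Hx) scale0r.
have U0 : oset U !=set0 by case: V0 => y /VU; exists y.
exists (LSec (top_in ((germ a)^-1 *: lval x) U0)) => V' V'U a' x' Hx'; apply: lsec_eq => V'0.
pose W := opensI V V'; have W0 : oset W !=set0 := ff_meet FF V0 V'0.
have WU : W `<=` U := subset_trans (@opensIl _ _ _) VU.
have h1 := HZ W (restr (@opensIr _ V V') a') _ _ WU (HR _ _ (@opensIl _ V V') _ _ VU Hx).
have h2 := HZ W (restr (@opensIl _ V V') a) _ _ WU (HR _ _ (@opensIr _ V V') _ _ V'U Hx').
have := HB W _ _ _ _ WU h1 h2; rewrite [X in X - _]mulrC subrr => /(H0 _ _ WU).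
move=> /(congr1 (@lval _ _ _ _ _ _ _)); rewrite lvalB !lvalZ !germ_restr // !lresE // => /eqP.
rewrite subr_eq0 => /eqP e; rewrite /= scalerA mulrC -scalerA e scalerA mulVf ?scale1r //.
Qed.

Section Q.
Variables (r : nat) (M : lfam FF r).

Lemma baer_qsh : baer (qsh M).
Proof.
move=> U H HB HZ HR H0.
pose ok (p : X) (y : 'rV[K]_r) := forall (V : opens X) (a : regfun V) (x : qsec M V), V `<=` U -> oset V p ->
  H V a x -> M p (x p - germ a *: y).
have [[V0 [a0 [x0 [V0U [V00 [Hx0 a00]]]]]]|none] := pselect (exists (V : opens X) (a : regfun V) x,
  V `<=` U /\ oset V !=set0 /\ H V a x /\ germ a != 0); last first.
  exists 0 => V VU a x Hx; have [V0|V0] := pselect (oset V !=set0); last exact: sec_empty.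
  have a0 : a = 0.
    apply: (germ_eq0 (FF := FF)) => //; apply: contrapT => a0; apply: none.
    by exists V, a, x; split => //; split => //; split => //; apply/eqP.
  by rewrite a0 in Hx *; rewrite (H0 _ _ VU Hx) scale0r.
have /choice[y hy] : forall p, exists y, oset U p -> ok p y.
  move=> p; have [Up|] := pselect (oset U p); last by exists 0.
  pose Q m := `[< exists (V : opens X) (a : regfun V) (x : qsec M V) (u : K),
    [/\ V `<=` U, oset V p, H V a x & [/\ O p u, O p u^-1, u != 0 & germ a = u * unif D p ^+ m]] >].
  have mk (V : opens X) (a : regfun V) (x : qsec M V) : V `<=` U -> oset V p -> H V a x -> germ a != 0 ->
      exists u m, [/\ O p u, u != 0, germ a = u * unif D p ^+ m & Q m].
    move=> VU Vp Hx a0'; have [u [m [hu hu' e]]] := dO_nat a0' (germ_in FF a Vp).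
    have u0 : u != 0 by apply: contraNneq a0' => z; rewrite e z mul0r.
    by exists u, m; split => //; apply/asboolP; exists V, a, x, u.
  have [exQ|nQ] := pselect (exists m, Q m); last first.
    exists 0 => _ V a x VU Vp Hx; have a0' : a = 0.
      apply: (germ_eq0 (FF := FF)); first by exists p.
      apply: contrapT => /eqP z; have [u [m [_ _ _ Qm]]] := mk _ _ _ VU Vp Hx z.
      by apply: nQ; exists m.
    rewrite a0' in Hx *; rewrite (H0 _ _ VU Hx) scaler0 subr0.
    have -> : (0 : qsec M V) = q0 M V by [].
    by have := mkqE (@q0_fin _ _ _ _ _ M V) Vp; rewrite subr0.
  case: (ex_minnP exQ) => m /asboolP[V [a [x [u [VU Vp Hx [hu hu' u0 e]]]]]] mmin.
  have a0' : germ a != 0 by rewrite e mulf_neq0 // expf_neq0 // unif_neq0.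
  exists ((germ a)^-1 *: x p) => _ V' a' x' V'U V'p Hx'.
  have [c hc ec] : exists2 c, O p c & germ a' = c * germ a.
    have [z|nz] := eqVneq (germ a') 0; first by exists 0; [exact: dO0|rewrite z mul0r].
    have [u' [m' [hu1 hu2 e' /mmin mm]]] := mk _ _ _ V'U V'p Hx' nz.
    exists (u' * u^-1 * unif D p ^+ (m' - m)).
      by apply: dOM; [exact: dOM|apply: dOX; exact: dO_unif].
    by rewrite e' e mulrACA mulfVK // -exprD subnK.
  have [W1 [W1V' [f [W1p ef]]]] := germ_near V'p hc.
  pose W := opensI W1 V; have W0 : oset W !=set0 by exists p.
  have Wp : oset W p by [].
  have WV : W `<=` V := @opensIr _ W1 V; have WV' := subset_trans (@opensIl _ W1 V) W1V'.
  have WU := subset_trans WV VU.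
  have h1 := HZ W (restr (@opensIl _ W1 V) f) _ _ WU (HR _ _ WV _ _ VU Hx).
  have h2 := HR _ _ WV' _ _ V'U Hx'.
  have ea : restr (@opensIl _ W1 V) f * restr WV a = restr WV' a'.
    by apply: (germ_inj (f0 := FF)) => //; rewrite germM !germ_restr // ef ec.
  have := HB _ _ _ _ _ WU h2 h1; rewrite ea subrr => /(H0 _ _ WU) /eqP; rewrite subr_eq0 => /eqP ex.
  have := congr1 (fun s : qsec M W => s p) ex; rewrite qresE // => ->.
  apply: modT (qscaleE _ _ Wp) _; rewrite qresE // germ_restr // ef ec scalerA mulfK //.
  exact: modR.
have fin : finite_set [set p | oset U p /\ ~ M p (y p)].
  apply: (@sub_finite_set _ _ ((~` V0) `|` ([set p | x0 p != 0] `|` [set p | ~ O p (germ a0)^-1]))).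
    move=> p /= [Up nM]; apply: contrapT => /not_orP[/contrapT V0p /not_orP[/negP/negPn/eqP e /contrapT Oa]].
    apply: nM; have := hy p Up _ _ _ V0U V0p Hx0; rewrite e sub0r => /fmN; rewrite opprK.
    by move=> /(fmZ Oa); rewrite scalerA mulVf // scale1r.
  rewrite !finite_setU; split; first exact: (ff_cofinite FF).
  by split; [exact: qsec_fin|exact: dO_fin].
exists (mkq fin) => V VU a x Hx; apply: (qsec_trans (f := fun p => germ a *: y p)) => p Vp.
  exact: hy (VU _ Vp) _ _ _ VU Vp Hx.
apply: modT (qscaleE _ _ Vp) _; apply: modZ => //; rewrite qresE //; exact: mkqE (VU _ Vp).
Qed.

Hypothesis finM : forall x, finite_set [set p | ~ M p x].

Lemma incl_sub U (s : lsec M U) : lval s \in inU (topfam r) U.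
Proof. by case: s => s /= /asboolP[h _]; apply/asboolP; split. Qed.
Lemma incl_lin U : linear (fun s : sec (slat M) U => LSec (incl_sub s) : sec (slat (topfam r)) U).
Proof. by move=> a s t; apply: val_inj. Qed.
Lemma incl_res (U V : opens X) (VU : V `<=` U) (s : sec (slat M) U) :
  (LSec (incl_sub (res VU s)) : sec (slat (topfam r)) V) = res VU (LSec (incl_sub s) : sec (slat (topfam r)) U).
Proof. by apply: lsec_eq => V0; transitivity (lval s); [exact: lresE|symmetry; exact: lresE]. Qed.
Definition lincl : hom (slat M) (slat (topfam r)) := mkhom incl_lin incl_res.

Lemma quo_fin U (s : lsec (topfam r) U) : finite_set [set p | oset U p /\ ~ M p (lval s)].
Proof. by apply: sub_finite_set (finM (lval s)) => p []. Qed.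
Lemma quo_lin U : linear (fun s : sec (slat (topfam r)) U => mkq (quo_fin s) : sec (qsh M) U).
Proof.
move=> a s t; apply: (qsec_trans (f := fun p => germ a *: lval s + lval t)) => p Up.
  exact: mkqE Up.
apply: modT (qaddE _ _ Up) _; apply: modD; last exact: mkqE Up.
apply: modT (qscaleE _ _ Up) _; apply: modZ => //; exact: mkqE Up.
Qed.
Lemma quo_res (U V : opens X) (VU : V `<=` U) (s : sec (slat (topfam r)) U) :
  (mkq (quo_fin (res VU s)) : sec (qsh M) V) = res VU (mkq (quo_fin s) : sec (qsh M) U).
Proof.
apply: (qsec_trans (f := fun p => lval s)) => p Vp.
  by apply: modT (mkqE _ Vp) _; rewrite lresE; [exact: modR|exists p].
by rewrite qresE //; apply: mkqE; exact: VU.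
Qed.
Definition quo : hom (slat (topfam r)) (qsh M) := mkhom quo_lin quo_res.

Lemma quoE U (s : lsec (topfam r) U) p : oset U p -> M p ((quo U s : qsec M U) p - lval s).
Proof. exact: mkqE. Qed.

Lemma top0 U (s : sec (slat (topfam 0)) U) : s = 0.
Proof. by apply: val_inj; exact: thinmx0. Qed.

Definition lres_obj (j : nat) : omod :=
  match j with 0 => slat (topfam r) | 1 => qsh M | _ => slat (topfam 0) end.
Definition lres_d (j : nat) : hom (lres_obj j) (lres_obj j.+1) :=
  match j with 0 => quo | _ => h0 _ _ end.

Lemma lres_inj j : injective_omod (lres_obj j).
Proof. by apply: baer_injective; case: j => [|[|j]]; [exact: baer_top|exact: baer_qsh|exact: baer_top]. Qed.

Lemma incl_mono : mono lincl.
Proof. by move=> U s e; apply: lsec_eq => U0; have := congr1 (@lval _ _ _ _ _ _ _) e. Qed.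

Lemma incl_exact : exact_at lincl quo.
Proof.
move=> U t; split.
  move=> e x Ux; have tM : lval t \in inU M U.
    apply/asboolP; split; first by left; exists x.
    move=> p Up; have := quoE t Up; rewrite e.
    have -> : (0 : qsec M U) = q0 M U by [].
    by have := mkqE (@q0_fin _ _ _ _ _ M U) Up; rewrite subr0 => h1 /(fmB h1); rewrite opprB addrC subrK.
  exists U, (@subset_refl _ _); split => //; exists (LSec tM).
  by rewrite res_id; exact: val_inj.
move=> h; apply: (qsec_trans (f := fun=> 0)) => p Up; last first.
  by have -> : (0 : qsec M U) = q0 M U by []; exact: mkqE Up.
apply: modT (quoE t Up) _; rewrite subr0; have [V [VU [Vp [s hs]]]] := h p Up.
have := congr1 (@lval _ _ _ _ _ _ _) hs; rewrite lresE; last by exists p.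
by move=> <-; exact: lsecP.
Qed.

Lemma quo_exact : exact_at quo (lres_d 1).
Proof.
move=> U t; split; last by [].
move=> _ x Ux; pose A : set X := ([set p | t p != 0] `|` [set p | ~ M p (t x)]) `\ x.
have finA : finite_set A.
  apply: (@sub_finite_set _ _ ([set p | t p != 0] `|` [set p | ~ M p (t x)])); first by move=> p [].
  by rewrite finite_setU; split; [exact: qsec_fin|exact: finM].
pose V := opensI U (Opens (ff_open FF finA)).
have Vx : oset V x by split => // -[_ h]; exact: h.
exists V, (@opensIl _ _ _); split => //.
have V0 : oset V !=set0 by exists x.
exists (LSec (top_in (t x) V0)); apply: (qsec_trans (f := t)) => p Vp; last first.
  by rewrite qresE //; exact: modR.
apply: modT (quoE _ Vp) _ => /=; have [->|px] := eqVneq p x; first exact: modR.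
have [_ nA] := Vp; have /not_orP[/negP/negPn/eqP -> /contrapT h] : ~ ([set p | t p != 0] p \/ ~ M p (t x)).
  by move=> h; apply: nA; split => // e; rewrite e eqxx in px.
by rewrite subr0.
Qed.

Lemma lres_exact j : exact_at (lres_d j) (lres_d j.+1).
Proof.
case: j => [|[|j]]; first exact: quo_exact.
  move=> U t; split=> // _ x Ux; exists U, (@subset_refl _ _); split=> //; exists 0.
  by rewrite (top0 (res _ t)).
move=> U t; split=> // _ x Ux; exists U, (@subset_refl _ _); split=> //; exists 0.
by rewrite (top0 (res _ t)).
Qed.

(** Constant sheaves and sheaves of principal parts are injective, since K is divisible as a
module over each local ring. *)
Definition lres_of : injres (slat M) := @InjRes _ _ _ (slat M) lres_obj lres_d lincl lres_inj
  incl_mono incl_exact lres_exact.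
End Q.
End Resolution.
End PrincipalParts.

(** * Sheaves of finite type at the generic point *)
Module GenericFibre.
Import Defs.
Export PrincipalParts.
Import Geo.
Import Defs.
Import Order.TTheory GRing.Theory Num.Theory.
Local Open Scope classical_set_scope.
Local Open Scope ring_scope.

Section Duality.
Variables (k : fieldType) (n : nat) (X : set (pspace k n)) (FF : funfield X).
Local Notation K := (ffK FF).
Local Notation D := (ffD FF).
Local Notation O := (dO D).
Local Notation intm := (intm D).
Local Notation germ := (germ FF).
Local Notation omod := (omod X).
Local Notation lattice := (lattice D).

Lemma germ_sum (U : opens X) (I : finType) (f : I -> regfun U) : germ (\sum_i f i) = \sum_i germ (f i).
Proof. by apply: (big_morph _ (@germD _ _ _ FF U) (@germ0 _ _ _ FF U)). Qed.

Lemma srE r (M : lfam FF r) (U V : opens X) (VU : V `<=` U) (s : sec (slat M) U) : oset V !=set0 ->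
  lval (res VU s : lsec M V) = lval (s : lsec M U).
Proof. exact: lresE. Qed.

Section Fam.
Variable (A : lattice).
Lemma Lfam0 p : intm p (0 *m invmx (lg A p) : 'M_(1, _)).
Proof. by rewrite mul0mx; exact: intm0. Qed.
Lemma LfamB p (x y : 'rV_(lr A)) : intm p (x *m invmx (lg A p)) -> intm p (y *m invmx (lg A p)) ->
  intm p ((x - y) *m invmx (lg A p)).
Proof. by rewrite mulmxBl; exact: intmB. Qed.
Lemma LfamZ p a (x : 'rV_(lr A)) : O p a -> intm p (x *m invmx (lg A p)) ->
  intm p ((a *: x) *m invmx (lg A p)).
Proof. by rewrite -scalemxAl; exact: intmZ. Qed.
Definition Lfam : lfam FF (lr A) := @LFam _ _ _ FF _ (fun p x => intm p (x *m invmx (lg A p)))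
  Lfam0 LfamB LfamZ.
Lemma Lfin x : finite_set [set p | ~ Lfam p x].
Proof.
apply: finite_imp (finite_or (lg_fin A) (intm_fin D x)) => p [[_ h] hx]; exact: intmM.
Qed.
Lemma Lrow p i : Lfam p (row i (lg A p)).
Proof. by rewrite /= -row_mul mulmxV ?lg_unit // => a b; rewrite mxE; exact: intm1. Qed.
End Fam.

Lemma Lhomp (A B : lattice) p f x : homp A B p f -> Lfam A p x -> Lfam B p (x *m f).
Proof.
rewrite /= => hf hx; have -> : x *m f *m invmx (lg B p) = (x *m invmx (lg A p)) *m (lg A p *m f *m invmx (lg B p)).
  by rewrite !mulmxA mulmxKV ?lg_unit.
exact: intmM.
Qed.

(** The generic fibre modulo torsion, with the lattice that the sections span. The local
bases t lift to sections, which is what allows homomorphisms of lattices to be lifted to the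
sheaf. *)
Record ft (F : omod) := Ft {
  ftG : lattice;
  ftk : hom F (slat (Lfam ftG));
  ftV : opens X;
  ftV0 : oset ftV !=set0;
  ft_inj : forall U (s : sec F U), U `<=` ftV -> ftk U s = 0 -> s = 0;
  ft_basis : forall p, exists (V : opens X) (t : 'I_(lr ftG) -> sec F V) (T : 'M[K]_(lr ftG)),
    [/\ oset V p, T \in unitmx, forall i, lval (ftk V (t i)) = row i T &
        forall q, oset V q -> intm q (T *m invmx (lg ftG q)) /\ intm q (lg ftG q *m invmx T)]
}.

Section Ft.
Variables (F : omod) (ff : ft F).
Local Notation G := (ftG ff).
Local Notation κ := (ftk ff).

Lemma ftkD U (s t : sec F U) : lval (κ U (s + t)) = lval (κ U s) + lval (κ U t).
Proof. by rewrite linearD. Qed.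
Lemma ftkZ U a (s : sec F U) : lval (κ U (a *: s)) = germ a *: lval (κ U s).
Proof. by rewrite linearZ. Qed.
Lemma ftk0 U : lval (κ U 0) = 0.
Proof. by rewrite linear0. Qed.
Lemma ftk_sum U m (a : 'I_m -> regfun U) (s : 'I_m -> sec F U) :
  lval (κ U (\sum_i a i *: s i)) = \sum_i germ (a i) *: lval (κ U (s i)).
Proof.
rewrite (big_morph (fun s => lval (κ U s)) (@ftkD U) (ftk0 U)).
by apply: eq_bigr => i _; rewrite ftkZ.
Qed.
Lemma ftk_res (U V : opens X) (VU : V `<=` U) (s : sec F U) : oset V !=set0 ->
  lval (κ V (res VU s)) = lval (κ U s).
Proof. by move=> V0; rewrite hom_res /=; exact: lresE. Qed.
Lemma ftk_mem (U : opens X) (s : sec F U) p : oset U p -> intm p (lval (κ U s) *m invmx (lg G p)).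
Proof. exact: (@lsecP _ _ _ _ _ (Lfam G) U (κ U s) p). Qed.

(** The coordinates of x lie in every local ring over a neighbourhood, and such elements of
K are functions there. *)
Lemma ft_coord (U : opens X) p (x : 'rV[K]_(lr G)) (V : opens X) (T : 'M[K]_(lr G)) : oset U p -> oset V p ->
  (forall q, oset V q -> intm q (T *m invmx (lg G q)) /\ intm q (lg G q *m invmx T)) -> T \in unitmx ->
  (forall q, oset U q -> intm q (x *m invmx (lg G q))) ->
  exists a : 'I_(lr G) -> regfun (opensI U V), x = \sum_i germ (a i) *: row i T.
Proof.
move=> Up Vp hT uT hx; have W0 : oset (opensI U V) !=set0 by exists p.
have /choice[a ha] : forall i, exists f : regfun (opensI U V), germ f = (x *m invmx T) 0 i.
  move=> i; apply: germ_glue => // q [Uq Vq].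
  have -> : x *m invmx T = (x *m invmx (lg G q)) *m (lg G q *m invmx T) by rewrite mulmxA mulmxKV ?lg_unit.
  by apply: intmM; [exact: hx|exact: (hT q Vq).2].
exists a; rewrite -{1}(mulmxKV uT x) mulmx_sum_row; apply: eq_bigr => i _; by rewrite ha.
Qed.

Lemma ft_local (U : opens X) (s : sec F U) p (V : opens X) (t : 'I_(lr G) -> sec F V) (T : 'M[K]_(lr G)) :
  oset U p -> oset V p -> T \in unitmx -> (forall i, lval (κ V (t i)) = row i T) ->
  (forall q, oset V q -> intm q (T *m invmx (lg G q)) /\ intm q (lg G q *m invmx T)) ->
  exists a : 'I_(lr G) -> regfun (opensI U V),
    lval (κ U s) = \sum_i germ (a i) *: row i T /\
    κ (opensI U V) (res (@opensIl _ U V) s) = κ (opensI U V) (\sum_i a i *: res (@opensIr _ U V) (t i)).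
Proof.
move=> Up Vp uT ht hT; have [a ha] := ft_coord (x := lval (κ U s)) Up Vp hT uT (fun q => @ftk_mem U s q).
exists a; split => //; apply: lsec_eq => W0; rewrite ftk_res // ftk_sum ha.
by apply: eq_bigr => i _; rewrite ftk_res // ht.
Qed.

Definition kills_torsion (H : omod) (z : hom F H) := forall U s, κ U s = 0 -> z U s = 0.

Section Qrep.
Variables (r : nat) (M : lfam FF r).
Lemma qvalD U (a b : qsec M U) p : oset U p -> M p ((a + b) p - (a p + b p)).
Proof. exact: qaddE. Qed.
Lemma qvalZ U c (a : qsec M U) p : oset U p -> M p ((c *: a) p - germ c *: a p).
Proof. exact: qscaleE. Qed.
Lemma qval0 U p : oset U p -> M p ((0 : qsec M U) p).
Proof. by move=> Up; have := mkqE (@q0_fin _ _ _ _ _ M U) Up; rewrite subr0. Qed.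
Lemma qval_sum U m (c : 'I_m -> regfun U) (a : 'I_m -> qsec M U) p : oset U p ->
  M p ((\sum_i c i *: a i) p - \sum_i germ (c i) *: a i p).
Proof.
move=> Up; apply: (big_rec2 (fun (x : qsec M U) y => M p (x p - y))).
  by rewrite subr0; exact: qval0.
move=> i x y _ h; apply: modT (qvalD _ _ Up) _; apply: modD => //; exact: qvalZ.
Qed.
Lemma qval_eq0 U (a : qsec M U) : (forall p, oset U p -> M p (a p)) -> a = 0.
Proof.
move=> h; apply: (qsec_trans (f := fun=> 0)) => p Up; rewrite subr0; first exact: h.
exact: qval0.
Qed.
Lemma qvalr (U V : opens X) (VU : V `<=` U) (a : sec (qsh M) U) p : oset V p ->
  (res VU a : qsec M V) p = (a : qsec M U) p.
Proof. exact: qresE. Qed.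

(** Near p the basis of sections determines the matrix modulo the principal parts; torsion
has to be killed because it is invisible in the generic fibre. *)
Lemma q_rep (z : hom F (qsh M)) : kills_torsion z -> exists v : X -> 'M[K]_(lr G, r),
  finite_set [set p | ~ forall x, Lfam G p x -> M p (x *m v p)] /\
  forall U s p, oset U p -> M p ((z U s : qsec M U) p - lval (κ U s) *m v p).
Proof.
move=> kz.
have /choice[v hv] : forall p, exists v : 'M[K]_(lr G, r), forall U s, oset U p ->
    M p ((z U s : qsec M U) p - lval (κ U s) *m v).
  move=> p; have [V [t [T [Vp uT ht hT]]]] := ft_basis ff p.
  exists (invmx T *m \matrix_i (z V (t i) : qsec M V) p) => U s Up.
  have [a [e1 e2]] := ft_local s Up Vp uT ht hT.
  have Wp : oset (opensI U V) p by [].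
  have : z _ (res (@opensIl _ U V) s) = \sum_i a i *: res (@opensIr _ U V) (z V (t i)).
    apply/eqP; rewrite -subr_eq0; apply/eqP.
    have -> : \sum_i a i *: res (@opensIr _ U V) (z V (t i)) = z _ (\sum_i a i *: res (@opensIr _ U V) (t i)).
      by rewrite linear_sum; apply: eq_bigr => i _; rewrite linearZ hom_res.
    by rewrite -linearB; apply: kz; rewrite linearB e2 subrr.
  rewrite hom_res => /(congr1 (fun s : qsec M _ => s p)); rewrite qvalr // => ->.
  apply: modT (qval_sum _ _ Wp) _; rewrite e1 mulmxA.
  have -> : (\sum_i germ (a i) *: row i T) *m invmx T = \row_i germ (a i).
    rewrite mulmx_suml -[RHS]mulmx1 mulmx_sum_row; apply: eq_bigr => i _.
    by rewrite -scalemxAl -row_mul mulmxV // mxE.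
  rewrite mulmx_sum_row; set L := \sum_i _; suff -> : L = \sum_i (\row_i0 germ (a i0)) 0 i *: row i (\matrix_i0 (z V (t i0) : qsec M V) p).
    exact: modR.
  by apply: eq_bigr => i _; rewrite mxE rowK qvalr.
exists v; split; last by move=> U s p Up; exact: hv.
have [p0 _] := ftV0 ff; have [V [t [T [Vp uT ht hT]]]] := ft_basis ff p0.
have h1 : finite_set [set p | ~ forall i, (z V (t i) : qsec M V) p = 0].
  by apply: finite_forall => i; apply: sub_finite_set (qsec_fin (z V (t i))) => p /= /eqP.
have h2 : finite_set [set p | ~ oset V p] by apply: (ff_cofinite FF); exists p0.
apply: finite_imp (finite_or h1 h2) => p [e Vp'] x hx.
have -> : x *m v p = \sum_i (x *m invmx T) 0 i *: (row i T *m v p).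
  by rewrite -{1}(mulmxKV uT x) [_ *m T]mulmx_sum_row mulmx_suml; apply: eq_bigr => i _; rewrite -scalemxAl.
apply: (big_ind (M p)) => [|? ?|i _]; [exact: fm0|exact: fmD|].
apply: fmZ.
  have -> : x *m invmx T = (x *m invmx (lg G p)) *m (lg G p *m invmx T) by rewrite mulmxA mulmxKV ?lg_unit.
  by apply: intmM; [exact: hx|exact: (hT p Vp').2].
have := hv p V (t i) Vp'; rewrite e sub0r ht => /fmN; by rewrite opprK.
Qed.
End Qrep.

(** A constant sheaf has no torsion, so that the morphism is determined by its effect on the
generic fibre, where it is linear over K. *)
Lemma hom_mx r (M : lfam FF r) (w : hom F (slat M)) : exists x : 'M[K]_(lr G, r),
  forall U s, oset U !=set0 -> lval (w U s) = lval (κ U s) *m x.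
Proof.
have wk U s : oset U !=set0 -> κ U s = 0 -> lval (w U s) = 0.
  move=> U0 e; have W0 := ff_meet FF U0 (ftV0 ff).
  have e' : res (@opensIl _ U (ftV ff)) s = 0.
    by apply: (ft_inj (f := ff)); [exact: opensIr|rewrite hom_res e res0].
  by rewrite -(srE (@opensIl _ U (ftV ff)) (w U s) W0) -hom_res e' linear0.
have wD U (s1 s2 : sec F U) : lval (w U (s1 + s2)) = lval (w U s1) + lval (w U s2) by rewrite linearD.
have w0 U : lval (w U 0) = 0 by rewrite linear0.
have wr (U V : opens X) (VU : V `<=` U) s : oset V !=set0 -> lval (w V (res VU s)) = lval (w U s).
  by move=> V0; rewrite hom_res srE.
have [p0 _] := ftV0 ff; have [V [t [T [Vp uT ht hT]]]] := ft_basis ff p0.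
exists (invmx T *m \matrix_i lval (w V (t i))) => U s U0.
have W0 : oset (opensI U V) !=set0 by apply: (ff_meet FF) => //; exists p0.
have [q [Uq Vq]] := W0.
have [a [e1 e2]] := ft_local s Uq Vq uT ht hT.
have : lval (w _ (res (@opensIl _ U V) s - \sum_i a i *: res (@opensIr _ U V) (t i))) = 0.
  by apply: wk => //; rewrite linearB e2 subrr.
rewrite linearB lvalB wr // => /eqP; rewrite subr_eq0 => /eqP ->.
rewrite (big_morph (fun s => lval (w _ s)) (@wD _) (w0 _)) e1 !mulmx_suml; apply: eq_bigr => i _.
rewrite linearZ lvalZ wr // -scalemxAl mulmxA -row_mul mulmxV // row1.
by congr (_ *: _); rewrite -rowE rowK.
Qed.

Section Split.
Variables (B : lattice).
Local Notation quoB := (quo (M := Lfam B) (@Lfin B)).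

Definition mx_app r (M : lfam FF r) (x : 'M[K]_(lr G, r))
  (h : forall p y, Lfam G p y -> M p (y *m x)) U (s : sec F U) : lval (κ U s) *m x \in inU M U.
Proof.
apply/asboolP; split; last by move=> p Up; apply: h; exact: ftk_mem.
have [U0|U0] := pselect (oset U !=set0); [by left|right].
by rewrite lsec0 // mul0mx.
Qed.

Lemma mx_hom r (M : lfam FF r) (x : 'M[K]_(lr G, r)) (h : forall p y, Lfam G p y -> M p (y *m x)) :
  exists w : hom F (slat M), forall U s, lval (w U s) = lval (κ U s) *m x.
Proof.
have lin U : linear (fun s => LSec (mx_app h s) : sec (slat M) U).
  by move=> a s t; apply: val_inj; rewrite /= ftkD ftkZ mulmxDl -scalemxAl.
have rs (U V : opens X) (VU : V `<=` U) (s : sec F U) :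
  (LSec (mx_app h (res VU s)) : sec (slat M) V) = res VU (LSec (mx_app h s) : sec (slat M) U).
  apply: lsec_eq => V0; transitivity (lval (κ U s) *m x); first by rewrite /= ftk_res.
  by symmetry; exact: lresE.
by exists (mkhom lin rs).
Qed.

Lemma split_of_cob (z : hom F (qsh (Lfam B))) (v : X -> 'M[K]_(lr G, lr B)) :
  (forall U s p, oset U p -> Lfam B p ((z U s : qsec (Lfam B) U) p - lval (κ U s) *m v p)) ->
  (exists w : hom F (slat (topfam FF (lr B))), forall U s, z U s = quoB U (w U s)) ->
  exists x, forall p, homp G B p (v p - x).
Proof.
move=> hv [w hw]; have [x hx] := hom_mx w; exists x => p.
have [V [t [T [Vp uT ht hT]]]] := ft_basis ff p; have V0 : oset V !=set0 by exists p.
have key : intm p (T *m (v p - x) *m invmx (lg B p)).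
  apply: intm_row => i; rewrite !row_mul -ht.
  have h1 := hv V (t i) p Vp; have h2 := quoE (@Lfin B) (w V (t i)) Vp; rewrite -hw hx // in h2.
  have := @fmB _ _ _ _ _ (Lfam B) p _ _ h2 h1.
  by rewrite opprB addrC addrA subrK -mulmxBr.
have -> : v p - x = invmx T *m (T *m (v p - x)) by rewrite mulKmx.
by rewrite /homp mulmxA -[_ *m invmx (lg B p)]mulmxA; apply: intmM; [exact: (hT p Vp).2|].
Qed.

Lemma cob_of_split (z : hom F (qsh (Lfam B))) (v : X -> 'M[K]_(lr G, lr B)) :
  (forall U s p, oset U p -> Lfam B p ((z U s : qsec (Lfam B) U) p - lval (κ U s) *m v p)) ->
  (exists x, forall p, homp G B p (v p - x)) ->
  exists w : hom F (slat (topfam FF (lr B))), forall U s, z U s = quoB U (w U s).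
Proof.
move=> hv [x hx]; have [w hw] := @mx_hom _ (topfam FF (lr B)) x (fun _ _ _ => I).
exists w => U s; apply: (qsec_trans (f := fun p => lval (κ U s) *m v p)) => p Up; first exact: hv.
apply: modT (quoE _ _ Up) _; rewrite hw -mulmxBr -[x - v p]opprB mulmxN; apply: fmN.
by apply: Lhomp (hx p) _; exact: ftk_mem.
Qed.
End Split.
End Ft.
End Duality.
End GenericFibre.

(** * Standard frames and local lifting *)
Module LocalBases.
Import Defs.
Export GenericFibre.
Import Geo.
Import Defs.
Import Order.TTheory GRing.Theory Num.Theory.
Local Open Scope classical_set_scope.
Local Open Scope ring_scope.

Section Pairing.
Variables (k : fieldType) (n : nat) (X : set (pspace k n)) (FF : funfield X).
Local Notation K := (ffK FF).
Local Notation D := (ffD FF).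
Local Notation O := (dO D).
Local Notation intm := (intm D).
Local Notation germ := (germ FF).
Local Notation omod := (omod X).
Local Notation lattice := (lattice D).

Section Standard.
Variable (A : lattice).
Lemma std_fin p : finite_set [set q | ~ (intm q (lg A p *m invmx (lg A q)) /\ intm q (lg A q *m invmx (lg A p)))].
Proof.
apply: finite_imp (finite_or (lg_fin A) (finite_or (intm_fin D (lg A p)) (intm_fin D (invmx (lg A p))))).
by move=> q [[h1 h2] [h3 h4]]; split; exact: intmM.
Qed.
Definition std_open p : opens X := Opens (ff_open FF (std_fin p)).
Lemma std_openE p q : oset (std_open p) q ->
  intm q (lg A p *m invmx (lg A q)) /\ intm q (lg A q *m invmx (lg A p)).
Proof. by move=> /= /contrapT. Qed.
Lemma std_openp p : oset (std_open p) p.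
Proof. by apply; rewrite mulmxV ?lg_unit //; split; exact: intm1. Qed.
Lemma std_sub p i : row i (lg A p) \in inU (Lfam A) (std_open p).
Proof.
apply/asboolP; split; first by left; exists p; exact: std_openp.
by move=> q /std_openE[h _]; rewrite /= -row_mul => a b; rewrite mxE.
Qed.
Definition std p i : sec (slat (Lfam A)) (std_open p) := LSec (std_sub p i).

Lemma std_basis p : exists (V : opens X) (t : 'I_(lr A) -> sec (slat (Lfam A)) V) (T : 'M[K]_(lr A)),
    [/\ oset V p, T \in unitmx, forall i, lval (hid (slat (Lfam A)) V (t i)) = row i T &
        forall q, oset V q -> intm q (T *m invmx (lg A q)) /\ intm q (lg A q *m invmx T)].
Proof.
exists (std_open p), (std p), (lg A p); split => //; [exact: std_openp|exact: lg_unit|].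
exact: std_openE.
Qed.

(* Nonemptiness comes from the point p0. *)
Definition ft_slat (p0 : X) : ft FF (slat (Lfam A)) := @Ft k n X FF (slat (Lfam A)) A (hid _)
  (Opens openT) (ex_intro _ p0 I) (fun U s _ e => e) std_basis.
End Standard.

Variable (G : genus1 D).
Local Notation ω := (om G).
Local Notation quoA A := (quo (M := Lfam A) (@Lfin _ _ _ FF A)).
Definition cob (F : omod) (A : lattice) (z : hom F (qsh (Lfam A))) :=
  exists w : hom F (slat (topfam FF (lr A))), forall U s, z U s = quoA A U (w U s).

(** A splitting gives a matrix over K that is a homomorphism away from p, hence its trace is
an adele on which om vanishes. *)
Lemma point_cob (A : lattice) (z : hom (slat (Lfam A)) (qsh (Lfam A))) p (N : 'M[K]_(lr A)) :
  (forall U x q, oset U q -> q <> p -> Lfam A q ((z U x : qsec (Lfam A) U) q)) ->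
  (forall U x, oset U p -> Lfam A p ((z U x : qsec (Lfam A) U) p - lval x *m N)) ->
  cob z -> ω (at_ p (\tr N)) = 0.
Proof.
move=> h1 h2 cz; have [|x hx] := @split_of_cob _ _ _ _ _ (ft_slat A p) A z (at_ p N) _ cz.
  move=> U s q Uq; rewrite /at_; case: eqP => [e|np]; first by rewrite e in Uq *; exact: h2.
  by rewrite mulmx0 subr0; exact: h1.
apply/(om_split G (adele_at _ _ _)); exists (\tr x) => q; have := homp_tr (hx q).
by rewrite linearB /= /at_; case: eqP => // _; rewrite mxtrace0.
Qed.

Section Ft.
Variables (F : omod) (ff : ft FF F).
Local Notation Gf := (ftG ff).
Local Notation κ := (ftk ff).

Definition lbase := {V : opens X & (('I_(lr Gf) -> sec F V) * 'M[K]_(lr Gf))%type}.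
Definition is_lbase (p : X) (d : lbase) := let V := projT1 d in let t := (projT2 d).1 in let T := (projT2 d).2 in
  [/\ oset V p, T \in unitmx, forall i, lval (κ V (t i)) = row i T,
      forall q, oset V q -> intm q (T *m invmx (lg Gf q)) /\ intm q (lg Gf q *m invmx T) &
      forall q, oset V q -> q <> p -> oset (ftV ff) q].

Lemma lbase_ex p : exists d, is_lbase p d.
Proof.
have [V [t [T [Vp uT ht hT]]]] := ft_basis ff p.
have fin : finite_set (~` ftV ff `\ p).
  by apply: sub_finite_set (ff_cofinite FF (ftV0 ff)) => q [].
pose W := opensI V (Opens (ff_open FF fin)).
have Wp : oset W p by split => // -[_ h]; exact: h.
exists (existT _ W (fun i => res (@opensIl _ _ _) (t i), T)); split => //=.
- by move=> i; rewrite ftk_res ?ht //; exists p.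
- by move=> q [Vq _]; exact: hT.
- by move=> q [_ nq] qp; apply: contrapT => nV; apply: nq.
Qed.

(** Near each point it lifts along the basis, and two lifts agree away from the finitely
many points that carry torsion. *)
Lemma lift_hom (A : lattice) (h : 'M[K]_(lr A, lr Gf)) : lhom A Gf h ->
  exists f : hom (slat (Lfam A)) F, forall U s, lval (κ U (f U s)) = lval s *m h.
Proof.
move=> hh; have /choice[d hd] := lbase_ex.
pose V p := projT1 (d p); pose t p := (projT2 (d p)).1; pose T p := (projT2 (d p)).2.
have Vp p : oset (V p) p by have [] := hd p.
have uT p : T p \in unitmx by have [] := hd p.
have ht p i : lval (κ (V p) (t p i)) = row i (T p) by have [_ _ h1 _ _] := hd p; exact: h1.
have hT p : forall q, oset (V p) q -> intm q (T p *m invmx (lg Gf q)) /\ intm q (lg Gf q *m invmx (T p)) by have [_ _ _ h1 _] := hd p; exact: h1.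
have hV p : forall q, oset (V p) q -> q <> p -> oset (ftV ff) q by have [_ _ _ _ h1] := hd p; exact: h1.
pose near p U (y : sec F U) := exists (W : opens X) (WU : W `<=` U) (WV : W `<=` V p),
  oset W p /\ exists a : 'I_(lr Gf) -> regfun W, res WU y = \sum_i a i *: res WV (t p i).
pose R (U : opens X) (x : sec (slat (Lfam A)) U) (y : sec F U) :=
  lval (κ U y) = lval (x : lsec _ U) *m h /\ forall p, oset U p -> near p U y.
have Rex U (x : sec (slat (Lfam A)) U) p : oset U p ->
    exists (W : opens X) (WU : W `<=` U), oset W p /\ exists y, R W (res WU x) y.
  move=> Up.
  have [|a ha] := @ft_coord _ _ _ _ _ ff U p (lval (x : lsec _ U) *m h) (V p) (T p) Up (Vp p) (hT p) (uT p).
    by move=> q Uq; apply: (@Lhomp _ _ _ _ A Gf q h) => //; exact: lsecP.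
  pose W := opensI U (V p); exists W, (@opensIl _ _ _); split; first by split.
  have W0 : oset W !=set0 by exists p; split.
  pose y := \sum_i a i *: res (@opensIr _ U (V p)) (t p i).
  have ey : lval (κ W y) = lval (x : lsec _ U) *m h.
    by rewrite ftk_sum ha; apply: eq_bigr => i _; rewrite ftk_res // ht.
  exists y; split; first by rewrite srE.
  move=> q [Uq Vq]; have [<-|/eqP qp] := eqVneq p q.
    by exists W, (@subset_refl _ _), (@opensIr _ _ _); split; [split|exists a; rewrite res_id].
  have Wq : oset W q by split.
  have [b [e1 e2]] := ft_local y Wq (Vp q) (uT q) (ht q) (hT q).
  pose Z := opensI (opensI W (V q)) (ftV ff).
  have Zq : oset Z q by split => //; apply: hV Vq _ => e; apply: qp.
  have Z1 : Z `<=` opensI W (V q) := @opensIl _ _ _.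
  exists Z, (subset_trans Z1 (@opensIl _ _ _)), (subset_trans Z1 (@opensIr _ _ _)); split => //.
  exists (fun i => restr Z1 (b i)); apply/eqP; rewrite -subr_eq0; apply/eqP.
  apply: (ft_inj (f := ff)); first exact: opensIr.
  rewrite -(res_comp (@opensIl _ W (V q)) Z1) linearB hom_res e2 -hom_res res_sum -linearB.
  rewrite -sumrB big1 ?linear0 // => i _; by rewrite resZ (res_comp _ _ (subset_trans Z1 (@opensIr _ _ _))) subrr.
have [||| f hf] := @local_hom _ _ _ (slat (Lfam A)) F R Rex.
- move=> U y [e hy]; apply: local_eq => p Up; have [W [WU [WV [Wp [a ha]]]]] := hy p Up.
  exists W, WU; split => //; rewrite res0 ha; have W0 : oset W !=set0 by exists p.
  have e2 : \sum_i germ (a i) *: row i (T p) = 0.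
    have e1 := ftk_res ff WU y W0; rewrite e mul0mx ha ftk_sum in e1.
    by apply: etrans e1; apply: eq_bigr => i _; rewrite ftk_res // ht.
  have e3 : \row_i germ (a i) = 0.
    rewrite -(mulmxK (uT p) (\row_i _)) [_ *m T p]mulmx_sum_row -[RHS](mul0mx _ (invmx (T p))); congr (_ *m _).
    by apply: etrans e2; apply: eq_bigr => i _; rewrite mxE.
  rewrite big1 // => i _; have -> : a i = 0; last by rewrite scale0r.
  by apply: (germ_eq0 (FF := FF)) => //; have := congr1 (fun M : 'rV__ => M 0 i) e3; rewrite !mxE.
- move=> U c x y x' y' [e1 h1] [e2 h2]; split.
    by rewrite ftkD ftkZ e1 e2 /= mulmxDl -scalemxAl.
  move=> p Up; have [W [WU [WV [Wp [a ha]]]]] := h1 p Up.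
  have [W' [WU' [WV' [Wp' [a' ha']]]]] := h2 p Up.
  pose Z := opensI W W'; have Z1 : Z `<=` W := @opensIl _ _ _; have Z2 : Z `<=` W' := @opensIr _ _ _.
  exists Z, (subset_trans Z1 WU), (subset_trans Z1 WV); split; first by split.
  exists (fun i => restr (subset_trans Z1 WU) c * restr Z1 (a i) + restr Z2 (a' i)).
  rewrite resD resZ -(res_comp WU Z1) -[res _ y'](res_comp WU' Z2) ha ha' !res_sum scaler_sumr -big_split.
  apply: eq_bigr => i _ /=; rewrite !resZ !(res_comp _ _ (subset_trans Z1 WV)) scalerDl scalerA.
  by [].
- move=> U U' UU x y [e hy]; have [U0|U0] := pselect (oset U' !=set0); last first.
    have z0 (x1 : sec (slat (Lfam A)) U') (y1 : sec F U') : R U' x1 y1.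
      rewrite (sec_empty y1 0 U0) (sec_empty x1 0 U0); split; first by rewrite ftk0 mul0mx.
      by move=> p Up; case: U0; exists p.
    exact: z0.
  split; first by rewrite ftk_res // srE.
  move=> p Up; have [W [WU [WV [Wp [a ha]]]]] := hy p (UU _ Up).
  pose Z := opensI W U'; have Z1 : Z `<=` W := @opensIl _ _ _.
  exists Z, (@opensIr _ _ _), (subset_trans Z1 WV); split; first by split.
  exists (fun i => restr Z1 (a i)); rewrite (res_comp UU _ (subset_trans Z1 WU)) -(res_comp WU Z1) ha res_sum.
  by apply: eq_bigr => i _; rewrite resZ (res_comp WV Z1 (subset_trans Z1 WV)).
exists f => U s; have [U0|U0] := pselect (oset U !=set0); last first.
  by rewrite (sec_empty s 0 U0) linear0 ftk0 mul0mx.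
have [p Up] := U0; have [W [WU [Wp [y hy]]]] := Rex U s p Up; have W0 : oset W !=set0 by exists p.
rewrite -(ftk_res ff WU) // -hom_res (hf _ _ _ hy) (proj1 hy) srE //.
Qed.
End Ft.
End Pairing.
End LocalBases.

(** * Nondegeneracy of the Ext pairing *)
Module LocalExtensions.
Import Defs.
Export LocalBases.
Import Geo.
Import Defs.
Import Order.TTheory GRing.Theory Num.Theory.
Local Open Scope classical_set_scope.
Local Open Scope ring_scope.

Section Duality.
Variables (k : fieldType) (n : nat) (X : set (pspace k n)) (FF : funfield X).
Local Notation K := (ffK FF).
Local Notation D := (ffD FF).
Local Notation O := (dO D).
Local Notation intm := (intm D).
Local Notation germ := (germ FF).
Local Notation omod := (omod X).
Local Notation lattice := (lattice D).
Variable (G : genus1 D).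
Local Notation ω := (om G).
Variables (F : omod) (ff : ft FF F) (A : lattice).
Local Notation Gf := (ftG ff).
Local Notation κ := (ftk ff).
Local Notation E := (slat (Lfam (FF := FF) A)).
Local Notation Q := (qsh (Lfam (FF := FF) A)).
Local Notation M := (Lfam (FF := FF) A).

Lemma not_intm p (w : 'rV[K]_(lr A)) : ~ M p w -> exists i, ~ O p ((w *m invmx (lg A p)) 0 i).
Proof.
move=> h; apply: contrapT => h'; apply: h => i j; rewrite ord1; apply: contrapT => h.
by apply: h'; exists j.
Qed.

Lemma tr_point p (w : 'rV[K]_(lr A)) i a :
  \tr (a *: (col i (invmx (lg A p)) *m w)) = a * (w *m invmx (lg A p)) 0 i.
Proof. by rewrite linearZ /= mxtrace_mulC colE mulmxA -colE /mxtrace big_ord1 mxE. Qed.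

Lemma app_point p (x w : 'rV[K]_(lr A)) i a :
  x *m (a *: (col i (invmx (lg A p)) *m w)) = (a * (x *m invmx (lg A p)) 0 i) *: w.
Proof.
rewrite -scalemxAr mulmxA colE mulmxA -colE -scalerA; congr (_ *: _).
by rewrite [col _ _]mx11_scalar mul_scalar_mx mxE.
Qed.

Lemma beta_torsion (z : hom F Q) : (forall f : hom E F, cob (hcomp f z)) -> kills_torsion ff z.
Proof.
move=> hz U s ks; apply: qval_eq0 => p Up; apply: contrapT => nM.
set w := (z U s : qsec M U) p in nM *; have [i hi] := not_intm nM.
have [a Oa wa] := om_nondeg G hi.
have fin : finite_set (~` ftV ff `\ p).
  by apply: sub_finite_set (ff_cofinite FF (ftV0 ff)) => q [].
pose V := opensI U (Opens (ff_open FF fin)).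
have Vp : oset V p by split => // -[_ h]; exact: h.
have VU : V `<=` U := @opensIl _ _ _.
have [s' es'] : exists s', s' = res VU s by exists (res VU s).
have zs' (q : X) : oset V q -> q <> p -> exists (W : opens X) (WV : W `<=` V), oset W q /\ res WV s' = 0.
  move=> Vq qp; exists (opensI V (ftV ff)), (@opensIl _ _ _); split.
    by split => //; apply: contrapT => nV; case: Vq => _; apply.
  by apply: (ft_inj (f := ff)); [exact: opensIr|rewrite es' !hom_res ks !res0].
pose c (x : 'rV[K]_(lr A)) : K := (x *m invmx (lg A p)) 0 i.
pose R (W : opens X) (x : sec E W) (y : sec F W) :=
  (forall q : X, oset W q -> q <> p -> exists (W' : opens X) (W'W : W' `<=` W), oset W' q /\ res W'W y = 0) /\
  (oset W p -> exists (W' : opens X) (W'W : W' `<=` W) (W'V : W' `<=` V), oset W' p /\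
    exists b : regfun W', germ b = a * c (lval (x : lsec M W)) /\ res W'W y = b *: res W'V s').
have Rex W (x : sec E W) (q : X) : oset W q ->
    exists (W' : opens X) (W'W : W' `<=` W), oset W' q /\ exists y, R W' (res W'W x) y.
  move=> Wq; have [e|/eqP qp] := eqVneq q p.
    rewrite e in Wq *; have Oc : O p (a * c (lval (x : lsec M W))).
      by apply: dOM => //; exact: (lsecP (x : lsec M W) Wq).
    have WVp : oset (opensI W V) p by split.
    have [W1 [W1W [b [W1p hb]]]] := germ_near WVp Oc.
    have W1V := subset_trans W1W (@opensIr _ W V); have W10 : oset W1 !=set0 by exists p.
    exists W1, (subset_trans W1W (@opensIl _ W V)); split => //; exists (b *: res W1V s'); split.
      move=> q' W1q' q'p; have [W2 [W2V [W2q e2]]] := zs' _ (W1V _ W1q') q'p.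
      exists (opensI W1 W2), (@opensIl _ _ _); split => //.
      rewrite resZ (res_comp W1V _ (subset_trans (@opensIr _ W1 W2) W2V)).
      by rewrite -(res_comp W2V (@opensIr _ W1 W2)) e2 res0 scaler0.
    move=> _; exists W1, (@subset_refl _ _), W1V; split => //; exists b.
    by rewrite srE // hb res_id.
  have fp : finite_set [set p] by exact: finite_set1.
  pose W1 := opensI W (Opens (ff_open FF fp)); exists W1, (@opensIl _ _ _); split; first by split.
  exists 0; split; last by case=> _; case.
  by move=> q' W1q _; exists W1, (@subset_refl _ _); rewrite res0.
have [||| f hf] := @local_hom _ _ _ E F R Rex.
- move=> W y [h1 h2]; apply: local_eq => q Wq; have [e|/eqP qp] := eqVneq q p.
    rewrite e in Wq *; have [W' [W'W [W'V [W'p [b [eb ey]]]]]] := h2 Wq.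
    exists W', W'W; split => //; rewrite ey res0.
    have -> : b = 0; last by rewrite scale0r.
    apply: (germ_eq0 (FF := FF)); first by exists p.
    by rewrite eb /c mul0mx mxE mulr0.
  by have [W' [W'W [W'q e]]] := h1 _ Wq qp; exists W', W'W; rewrite e res0.
- move=> W r x y x' y' [h1 h2] [h1' h2']; split.
    move=> q Wq qp; have [W1 [W1W [W1q e1]]] := h1 _ Wq qp.
    have [W2 [W2W [W2q e2]]] := h1' _ Wq qp.
    have S1 : opensI W1 W2 `<=` W1 := @opensIl _ _ _; have S2 : opensI W1 W2 `<=` W2 := @opensIr _ _ _.
    exists (opensI W1 W2), (subset_trans S1 W1W); split => //.
    rewrite resD resZ -(res_comp W1W S1) -[res _ y'](res_comp W2W S2) e1 e2 !res0.
    by rewrite scaler0 addr0.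
  move=> Wp; have [W1 [W1W [W1V [W1p [b1 [eb1 e1]]]]]] := h2 Wp.
  have [W2 [W2W [W2V [W2p [b2 [eb2 e2]]]]]] := h2' Wp.
  have S1 : opensI W1 W2 `<=` W1 := @opensIl _ _ _; have S2 : opensI W1 W2 `<=` W2 := @opensIr _ _ _.
  exists (opensI W1 W2), (subset_trans S1 W1W), (subset_trans S1 W1V); split => //.
  have W0 : oset (opensI W1 W2) !=set0 by exists p.
  exists (restr (subset_trans S1 W1W) r * restr S1 b1 + restr S2 b2); split.
    rewrite germD germM !germ_restr // eb1 eb2 /= /c mulmxDl -scalemxAl !mxE mulrDr.
    by congr (_ + _); rewrite mulrCA.
  rewrite resD resZ -(res_comp W1W S1) -[res _ y'](res_comp W2W S2) e1 e2 !resZ scalerA.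
  by rewrite !(res_comp _ _ (subset_trans S1 W1V)) -scalerA [RHS]scalerDl scalerA.
- move=> W W1 W1W x y [h1 h2]; split.
    move=> q Wq qp; have [W' [W'W [W'q e1]]] := h1 _ (W1W _ Wq) qp.
    have S1 : opensI W' W1 `<=` W' := @opensIl _ _ _.
    exists (opensI W' W1), (@opensIr _ _ _); split => //.
    by rewrite (res_comp W1W _ (subset_trans S1 W'W)) -(res_comp W'W S1) e1 res0.
  move=> W1p; have [W' [W'W [W'V [W'p [b [eb e1]]]]]] := h2 (W1W _ W1p).
  have S1 : opensI W' W1 `<=` W' := @opensIl _ _ _.
  exists (opensI W' W1), (@opensIr _ _ _), (subset_trans S1 W'V); split => //.
  exists (restr S1 b); rewrite germ_restr; last by exists p.
  rewrite srE; last by exists p.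
  split => //; rewrite (res_comp W1W _ (subset_trans S1 W'W)) -(res_comp W'W S1) e1 resZ.
  by rewrite (res_comp W'V S1 (subset_trans S1 W'V)).
move/eqP: wa; apply; rewrite -tr_point; apply: (@point_cob _ _ _ _ G A (hcomp f z)) (hz f).
- move=> W x q Wq qp; have [W' [W'W [W'q [y hy]]]] := Rex W x q Wq.
  have [W2 [W2W [W2q e]]] := hy.1 q W'q qp.
  have -> : (hcomp f z W x : qsec M W) q = (z W' (f W' (res W'W x)) : qsec M W') q.
    by rewrite !hom_res qvalr.
  have -> : (z W' (f W' (res W'W x)) : qsec M W') q = (z W2 (res W2W (f W' (res W'W x))) : qsec M W2) q.
    by rewrite !(hom_res z) qvalr.
  rewrite (hf _ _ _ hy) e linear0.
  exact: qval0.
- move=> W x Wp; have [W' [W'W [W'p [y hy]]]] := Rex W x p Wp.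
  have [W2 [W2W [W2V [W2p [b [eb e]]]]]] := hy.2 W'p.
  have zw : (z V s' : qsec M V) p = w by rewrite es' hom_res qvalr.
  have -> : (hcomp f z W x : qsec M W) p = (z W' (f W' (res W'W x)) : qsec M W') p.
    by rewrite !hom_res qvalr.
  have -> : (z W' (f W' (res W'W x)) : qsec M W') p = (z W2 (res W2W (f W' (res W'W x))) : qsec M W2) p.
    by rewrite !(hom_res z) qvalr.
  rewrite (hf _ _ _ hy) e linearZ hom_res.
  have := qvalZ b (res W2V (z V s') : qsec M W2) W2p; rewrite qvalr // zw eb srE; last by exists p.
  by rewrite app_point.
Qed.

(** Test morphisms E -> F are lifted from the lattice of F. Serre duality controls the
torsion-free part of the class, and the torsion part is detected at single points. *)
Theorem beta (z : hom F Q) : (forall f : hom E F, cob (hcomp f z)) -> cob z.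
Proof.
move=> hz; have [v [vfin hv]] := q_rep (beta_torsion hz).
apply: (cob_of_split hv); apply: (@serre _ _ _ _ G Gf A v).
  apply: finite_imp vfin => p h; apply: intm_row => i.
  rewrite row_mul row_mul; apply: h; exact: Lrow.
move=> h hh; have [f hf] := lift_hom hh.
have [p0 _] := ftV0 ff.
have [|x hx] := @split_of_cob _ _ _ _ _ (ft_slat A p0) A (hcomp f z) (fun p => h *m v p) _ (hz f).
  by move=> U s p Up /=; have := hv U (f U s) p Up; rewrite hf mulmxA.
apply/(om_split G).
  apply: (adele_tr (A := Gf)); apply: (madeleM (B := A)); last exact: madele_cst.
  apply: finite_imp vfin => p h'; apply: intm_row => i.
  by rewrite row_mul row_mul; apply: h'; exact: Lrow.
by exists (\tr x) => p; rewrite mxtrace_mulC -linearB; exact: (homp_tr (hx p)).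
Qed.

Lemma std_local (U : opens X) (s : sec E U) p : oset U p ->
  exists a : 'I_(lr A) -> regfun (opensI U (std_open A p)),
    lval (s : lsec M U) = \sum_i germ (a i) *: row i (lg A p) /\
    res (@opensIl _ U (std_open A p)) s = \sum_i a i *: res (@opensIr _ U (std_open A p)) (std p i).
Proof.
move=> Up; exact: (@ft_local _ _ _ _ _ (ft_slat A p) U s p _ (std p) (lg A p) Up (@std_openp _ _ _ _ A p)
  (lg_unit A p) (fun i => erefl) (@std_openE _ _ _ _ A p)).
Qed.

Lemma zero_near (f : hom E F) : (forall p i, exists (V : opens X) (VU : V `<=` std_open A p), oset V p /\
  res VU (f _ (std p i)) = 0) -> forall U s, f U s = 0.
Proof.
move=> h U s; apply: local_eq => p Up.
have /choice[V hV] : forall i, exists V : opens X, exists (VU : V `<=` std_open A p), oset V p /\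
  res VU (f _ (std p i)) = 0 by move=> i; have [V [VU h1]] := h p i; exists V, VU.
have fin : finite_set [set q | ~ forall i, oset (V i) q].
  apply: finite_forall => i; apply: (ff_cofinite FF); have [VU [Vp _]] := hV i; by exists p.
pose W0 : opens X := Opens (ff_open FF fin).
have [a [e1 e2]] := std_local s Up.
pose W := opensI (opensI U (std_open A p)) W0; have S1 : W `<=` opensI U (std_open A p) := @opensIl _ _ _.
exists W, (subset_trans S1 (@opensIl _ _ _)); split.
  by split; [split => //; exact: std_openp|move=> h'; apply: h' => i; have [? []] := hV i].
rewrite res0 -hom_res -(res_comp (@opensIl _ U _) S1) e2 hom_res linear_sum res_sum big1 // => i _.
rewrite linearZ resZ hom_res (res_comp _ _ (subset_trans S1 (@opensIr _ _ _))).
have [VU [Vp e]] := hV i; have WV : W `<=` V i by move=> q [_ /contrapT].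
by rewrite -(res_comp VU WV) e res0 scaler0.
Qed.

Lemma ofam0 p : O p ((0 : 'rV[K]_1) 0 0).
Proof. by rewrite mxE; exact: dO0. Qed.
Lemma ofamB p (x y : 'rV[K]_1) : O p (x 0 0) -> O p (y 0 0) -> O p ((x - y) 0 0).
Proof. by move=> hx hy; rewrite !mxE; exact: dOB. Qed.
Lemma ofamZ p a (x : 'rV[K]_1) : O p a -> O p (x 0 0) -> O p ((a *: x) 0 0).
Proof. by move=> ha hx; rewrite mxE; exact: dOM. Qed.
Definition ofam : lfam FF 1 := @LFam _ _ _ FF 1 (fun p x => O p (x 0 0)) ofam0 ofamB ofamZ.

Section Spread.
Variables (p : X) (i : 'I_(lr A)) (φ : hom F (qsh ofam)).
Definition spread U (s : sec F U) (q : X) : 'rV[K]_(lr A) :=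
  if q == p then (φ U s : qsec ofam U) p 0 0 *: row i (lg A p) else 0.
Lemma spread_fin U (s : sec F U) : finite_set [set q | oset U q /\ ~ M q (spread s q)].
Proof.
apply: sub_finite_set (finite_set1 p) => q [_ h] /=; apply: contrapT => /eqP/negPf e.
by apply: h; rewrite /spread e; exact: fm0.
Qed.
Lemma spread_lin U : linear (fun s : sec F U => mkq (spread_fin s) : sec Q U).
Proof.
move=> a s t; apply: (qsec_trans (f := fun q => germ a *: spread s q + spread t q)) => q Uq; last first.
  apply: modT (qaddE _ _ Uq) _; apply: modD; last exact: mkqE.
  by apply: modT (qscaleE _ _ Uq) _; apply: modZ => //; exact: mkqE.
apply: modT (mkqE _ Uq) _; rewrite /spread; case: eqP => [e|_]; last first.
  by rewrite scaler0 addr0 subrr; exact: fm0.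
rewrite e in Uq *; rewrite scalerA -scalerDl -scalerBl; apply: fmZ; last exact: Lrow.
have h : ofam p ((φ U (a *: s + t) : qsec ofam U) p - (germ a *: (φ U s : qsec ofam U) p + (φ U t : qsec ofam U) p)).
  rewrite linearP; apply: modT (qvalD _ _ Uq) _; apply: modD; [exact: qvalZ|exact: modR].
by move: h; rewrite /= !mxE.
Qed.
Lemma spread_res (U V : opens X) (VU : V `<=` U) (s : sec F U) :
  (mkq (spread_fin (res VU s)) : sec Q V) = res VU (mkq (spread_fin s) : sec Q U).
Proof.
apply: (qsec_trans (f := spread s)) => q Vq; last by rewrite qvalr //; exact: mkqE (VU _ Vq).
apply: modT (mkqE _ Vq) _; suff -> : spread (res VU s) q = spread s q by exact: modR.
by rewrite /spread; case: eqP => // e; rewrite e in Vq; rewrite hom_res qvalr.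
Qed.
Definition spread_hom : hom F Q := mkhom spread_lin spread_res.
End Spread.

Lemma spread_cob (f : hom E F) p i φ : cob (hcomp f (spread_hom p i φ)) ->
  ω (at_ p ((φ _ (f _ (std p i)) : qsec ofam _) p 0 0)) = 0.
Proof.
move=> cz; pose c := \col_j ((φ _ (f _ (std p j)) : qsec ofam _) p 0 0).
have := @point_cob _ _ _ _ G A (hcomp f (spread_hom p i φ)) p (invmx (lg A p) *m (c *m row i (lg A p))) _ _ cz.
rewrite mxtrace_mulC -mulmxA -row_mul mulmxV ?lg_unit // mxtrace_mulC /mxtrace big_ord1.
rewrite row1 -rowE !mxE; apply.
  move=> U x q Uq qp; have h := mkqE (spread_fin p i φ (f U x)) Uq.
  by move: h; rewrite /spread; case: eqP => // _; rewrite subr0.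
move=> U x Up; have h := mkqE (spread_fin p i φ (f U x)) Up.
apply: modT h _; rewrite /spread eqxx !mulmxA.
have [a [e1 e2]] := std_local x Up.
have -> : lval (x : lsec M U) *m invmx (lg A p) = \row_j germ (a j).
  transitivity ((\sum_j germ (a j) *: row j (lg A p)) *m invmx (lg A p)); first by rewrite -e1.
  rewrite mulmx_suml -[RHS]mulmx1 mulmx_sum_row; apply: eq_bigr => j _.
  by rewrite -scalemxAl -row_mul mulmxV ?lg_unit // mxE.
rewrite [_ *m c]mx11_scalar mul_scalar_mx -scalerBl; apply: fmZ; last exact: Lrow.
have Wp : oset (opensI U (std_open A p)) p by split => //; exact: std_openp.
have -> : (φ U (f U x) : qsec ofam U) p = (\sum_j a j *: res (@opensIr _ U (std_open A p)) (φ _ (f _ (std p j))) : qsec ofam _) p.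
  rewrite -(qvalr (@opensIl _ U (std_open A p)) _ Wp) -!hom_res e2 !linear_sum.
  by congr (qval _ p); apply: eq_bigr => j _; rewrite !linearZ /= !hom_res.
have h : O p ((_ - _ : 'rV[K]_1) 0 0) := @qval_sum _ _ _ _ _ ofam _ _ a
  (fun j => res (@opensIr _ U (std_open A p)) (φ _ (f _ (std p j)))) p Wp.
rewrite mxE [X in _ + X]mxE summxE in h; move: h; congr (O p (_ - _)); rewrite mxE; apply: eq_bigr => j _.
by rewrite mxE qvalr // !mxE.
Qed.

(** If f is nonzero at p, a principal part at p on which om does not vanish extends to a
morphism from F whose product with f is a nonzero class. *)
Theorem alpha (f : hom E F) : (forall z : hom F Q, cob (hcomp f z)) -> forall U s, f U s = 0.
Proof.
move=> hf; apply: zero_near => p i; set V := std_open A p; set t := f _ (std p i).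
apply: contrapT => nt.
have Vp : oset V p by exact: std_openp.
have nO : ~ O p (unif D p)^-1 by exact: unif_nunit.
have [a Oa wa] := om_nondeg G nO.
pose ζ := a * (unif D p)^-1.
pose zf (q : X) : 'rV[K]_1 := if q == p then ζ%:M else 0.
have zfin : finite_set [set q | oset (Opens (@openT X)) q /\ ~ ofam q (zf q)].
  apply: sub_finite_set (finite_set1 p) => q [_ h] /=; apply: contrapT => /eqP/negPf e.
  by apply: h; rewrite /zf e; exact: fm0.
pose Z : sec (qsh ofam) (Opens openT) := mkq zfin.
have zres (W : opens X) : W `<=` Opens (@openT X) by [].
pose Gr : graph F (qsh ofam) := fun W b y => (b = 0 /\ y = 0) \/
  exists (WV : W `<=` V) (c : regfun W), b = c *: res WV t /\ y = c *: res (zres W) Z.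
have gr W b y : Gr W b y -> W `<=` V -> exists (WV : W `<=` V) (c : regfun W),
    b = c *: res WV t /\ y = c *: res (zres W) Z.
  by move=> [[-> ->]|//] WV; exists WV, 0; rewrite !scale0r.
have [|φ hφ] := @ext_graph _ _ _ F (qsh ofam) Gr (@baer_qsh _ _ _ _ _ _).
  split.
  - by move=> W; left.
  - move=> W b y b' y' h h'; have [WV|nWV] := pselect (W `<=` V); last first.
      case: h => [[-> ->]|[] //]; case: h' => [[-> ->]|[] //]; left; by rewrite !subrr.
    have [WV1 [c [-> ->]]] := gr _ _ _ h WV; have [WV2 [c' [-> ->]]] := gr _ _ _ h' WV.
    by right; exists WV, (c - c'); rewrite !scalerBl (res_eq WV1 WV) (res_eq WV2 WV).
  - move=> W c b y [[-> ->]|[WV [c' [-> ->]]]]; first by left; rewrite !scaler0.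
    by right; exists WV, (c * c'); rewrite !scalerA.
  - move=> W W' W'W b y [[-> ->]|[WV [c' [-> ->]]]]; first by left; rewrite !res0.
    right; exists (subset_trans W'W WV), (restr W'W c').
    by rewrite !resZ (res_comp WV W'W (subset_trans W'W WV)) (res_comp (zres W) W'W (zres W')).
  - move=> W y [[]//|[WV [c [e ->]]]]; apply: qval_eq0 => q Wq.
    have := qvalZ c (res (zres W) Z : qsec ofam W) Wq => h.
    rewrite -(subrK (germ c *: (res (zres W) Z : qsec ofam W) q) (_ q)); apply: fmD => //.
    rewrite qvalr //; have hz := mkqE zfin (I : oset (Opens openT) q).
    rewrite -(subrK (zf q) ((Z : qsec ofam _) q)) scalerDr; apply: fmD; first by apply: fmZ => //; exact: germ_in.
    rewrite /zf; case: eqP => [eq|_]; last by rewrite scaler0; exact: fm0.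
    rewrite eq in Wq *; rewrite /= !mxE mulr1n.
    have [c0|c0] := eqVneq (c (point_in Wq)) 0.
      have [y' hy' ->] := germ_zero FF c0.
      rewrite mulrC -mulrA [_^-1 * _]mulrA mulVf ?unif_neq0 // mul1r; exact: dOM.
    have Oc := germ_unit FF c0.
    case: nt; have [V1 [V1W [g [V1p eg]]]] := germ_near Wq Oc.
    exists V1, (subset_trans V1W WV); split => //.
    have V10 : oset V1 !=set0 by exists p.
    have e1 : g * restr V1W c = 1.
      apply: (germ_inj (f0 := FF)) => //; rewrite germM eg germ_restr // germ1 // mulVf //.
      apply: contraNneq c0 => /(germ_eq0 (FF := FF)) e0; rewrite e0 //; by exists p.
    rewrite -[LHS]scale1r -e1 -scalerA -(res_comp WV V1W (subset_trans V1W WV)) -resZ -e.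
    by rewrite res0 scaler0.
have := spread_cob (hf (spread_hom p i φ)).
have -> : φ _ (f _ (std p i)) = res (zres V) Z.
  by apply: hφ; right; exists (@subset_refl _ _), 1; rewrite !scale1r res_id.
rewrite qvalr // => h; move/eqP: wa; apply; rewrite -h; apply: om_at_int.
have h1 : O p ((_ - _ : 'rV[K]_1) 0 0) := mkqE zfin (I : oset (Opens openT) p).
rewrite mxE [X in _ + X]mxE in h1; move/dON: h1; rewrite opprB; congr (O p (_ - _)).
by rewrite /zf eqxx mxE mulr1n.
Qed.
End Duality.
End LocalExtensions.

(** * Maximal independent families of sections *)
Module GenericFrames.
Import Defs.
Export LocalExtensions.
Import Geo.
Import Defs.
Import Order.TTheory GRing.Theory Num.Theory.
Local Open Scope classical_set_scope.
Local Open Scope ring_scope.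

Section FiniteType.
Variables (k : fieldType) (n : nat) (X : set (pspace k n)) (FF : funfield X).
Local Notation K := (ffK FF).
Local Notation D := (ffD FF).
Local Notation O := (dO D).
Local Notation intm := (intm D).
Local Notation germ := (germ FF).
Local Notation omod := (omod X).
Local Notation lattice := (lattice D).

Definition finite_type (F : omod) := forall x : X, exists (U : opens X) (m : nat) (s : 'I_m -> sec F U),
  oset U x /\ generates s.

Variables (F : omod) (p0 : X).

Section Frame.
Variables (U1 : opens X).
Definition indep h (e : 'I_h -> sec F U1) := forall (W : opens X) (WU : W `<=` U1) (a : 'I_h -> regfun W),
  oset W !=set0 -> \sum_i a i *: res WU (e i) = 0 -> forall i, a i = 0.

Definition genval h (e : 'I_h -> sec F U1) (U : opens X) (s : sec F U) (x : 'rV[K]_h) :=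
  exists (W : opens X) (WU : W `<=` U) (WU1 : W `<=` U1) (a : 'I_h -> regfun W),
  [/\ oset W !=set0, res WU s = \sum_i a i *: res WU1 (e i) & forall i, germ (a i) = x 0 i].

(* A nonzero relation can be solved on a smaller open set. *)
Lemma invert (W : opens X) (c : regfun W) : oset W !=set0 -> germ c <> 0 ->
  exists (W' : opens X) (W'W : W' `<=` W) (c' : regfun W'), oset W' !=set0 /\ c' * restr W'W c = 1.
Proof.
move=> W0 c0; pose Z : opens X := Opens (ff_open FF (dO_fin D (germ c)^-1)).
have [y [Wy hy]] : exists (y : X) (Wy : oset W y), c (point_in Wy) != 0.
  apply: contrapT => h; apply: c0; rewrite (_ : c = 0) ?germ0 //.
  apply/val_inj/funext => y; apply: contrapT => cy; apply: h; exists (val y), (set_valP y).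
  apply/eqP => e; apply: cy; apply: etrans e; congr (rf c _); exact: val_inj.
have Oy := germ_unit FF hy; pose W' := opensI W Z.
have W'0 : oset W' !=set0 by exists y; split => //= h; apply: h.
have [|c' ec'] := @germ_glue _ _ _ FF W' (germ c)^-1 W'0; first by move=> q [_ /= /contrapT].
exists W', (@opensIl _ _ _), c'; split => //.
apply: (germ_inj (f0 := FF)) => //; rewrite germM ec' germ_restr // germ1 // mulVf //.
exact/eqP.
Qed.

Lemma bigmeet (I : finType) (W : I -> opens X) : (forall i, oset (W i) !=set0) ->
  exists V : opens X, oset V !=set0 /\ forall i, V `<=` W i.
Proof.
move=> W0; suff [V [V0 hV]] : exists V : opens X, oset V !=set0 /\ forall i, i \in enum I -> V `<=` W i.
  by exists V; split => // i; apply: hV; rewrite mem_enum.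
elim: (enum I) => [|i r [V [V0 hV]]]; first by exists (Opens openT); split => //; exists p0.
exists (opensI V (W i)); split; first exact: ff_meet.
move=> j; rewrite inE => /orP[/eqP -> |/hV h]; first exact: opensIr.
exact: subset_trans (@opensIl _ _ _) h.
Qed.

Section Gval.
Variables (h : nat) (e : 'I_h -> sec F U1).
Hypothesis ie : indep e.

Lemma gval_uniq U (s : sec F U) x y : genval e s x -> genval e s y -> x = y.
Proof.
move=> [W [WU [WU1 [a [W0 ea ha]]]]] [Z [ZU [ZU1 [b [Z0 eb hb]]]]].
pose V := opensI W Z; have V0 : oset V !=set0 := ff_meet FF W0 Z0.
have VW : V `<=` W := @opensIl _ _ _; have VZ : V `<=` Z := @opensIr _ _ _.
have VU := subset_trans VW WU; have VU1 := subset_trans VW WU1.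
have := congr1 (res VW) ea; rewrite (res_comp WU VW VU) res_sum => e1.
have := congr1 (res VZ) eb; rewrite (res_comp ZU VZ VU) res_sum e1 => e2.
have : \sum_i (restr VW (a i) - restr VZ (b i)) *: res VU1 (e i) = 0.
  apply/eqP; under eq_bigr do rewrite scalerBl; rewrite sumrB subr_eq0; apply/eqP.
  apply: etrans (etrans e2 _); apply: eq_bigr => i _; rewrite resZ.
    by rewrite (res_comp WU1 VW VU1).
  by rewrite (res_comp ZU1 VZ VU1).
move/(ie V0) => e3; apply/rowP => i; rewrite -ha -hb.
by rewrite -(germ_restr FF VW) // -(germ_restr FF VZ (b i)) //; congr germ; apply/eqP; rewrite -subr_eq0 e3.
Qed.

Lemma gval_res (U V : opens X) (VU : V `<=` U) (s : sec F U) x : oset V !=set0 -> genval e s x -> genval e (res VU s) x.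
Proof.
move=> V0 [W [WU [WU1 [a [W0 ea ha]]]]]; pose Z := opensI W V.
have Z0 : oset Z !=set0 := ff_meet FF W0 V0; have ZW : Z `<=` W := @opensIl _ _ _.
exists Z, (@opensIr _ _ _), (subset_trans ZW WU1), (fun i => restr ZW (a i)); split => //.
  rewrite (res_comp VU _ (subset_trans ZW WU)) -(res_comp WU ZW) ea res_sum.
  by apply: eq_bigr => i _; rewrite resZ (res_comp WU1 ZW (subset_trans ZW WU1)).
by move=> i; rewrite germ_restr.
Qed.
Lemma gval_unres (U V : opens X) (VU : V `<=` U) (s : sec F U) x : genval e (res VU s) x -> genval e s x.
Proof.
move=> [W [WV [WU1 [a [W0 ea ha]]]]]; exists W, (subset_trans WV VU), WU1, a; split => //.
by rewrite -(res_comp VU WV).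
Qed.

Lemma gval_lin U (c : regfun U) (s t : sec F U) x y : oset U !=set0 -> genval e s x -> genval e t y ->
  genval e (c *: s + t) (germ c *: x + y).
Proof.
move=> U0 [W [WU [WU1 [a [W0 ea ha]]]]] [Z [ZU [ZU1 [b [Z0 eb hb]]]]].
pose V := opensI W Z; have V0 : oset V !=set0 := ff_meet FF W0 Z0.
have VW : V `<=` W := @opensIl _ _ _; have VZ : V `<=` Z := @opensIr _ _ _.
have VU := subset_trans VW WU; have VU1 := subset_trans VW WU1.
exists V, VU, VU1, (fun i => restr VU c * restr VW (a i) + restr VZ (b i)); split => //.
  rewrite resD resZ -(res_comp WU VW) -[res _ t](res_comp ZU VZ) ea eb !res_sum scaler_sumr -big_split.
  apply: eq_bigr => i _ /=; rewrite !resZ (res_comp WU1 VW VU1) (res_comp ZU1 VZ VU1).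
  by rewrite [RHS]scalerDl scalerA.
by move=> i; rewrite germD germM !germ_restr // ha hb !mxE.
Qed.

Hypothesis U10 : oset U1 !=set0.
Lemma gval0 U : oset U !=set0 -> genval e (0 : sec F U) 0.
Proof.
move=> U0; exists (opensI U U1), (@opensIl _ _ _), (@opensIr _ _ _), (fun=> 0); split.
- exact: (ff_meet FF).
- by rewrite res0 big1 // => i _; rewrite scale0r.
- by move=> i; rewrite germ0 mxE.
Qed.

Lemma gval_sum U m (c : 'I_m -> regfun U) (s : 'I_m -> sec F U) (x : 'I_m -> 'rV_h) : oset U !=set0 ->
  (forall i, genval e (s i) (x i)) -> genval e (\sum_i c i *: s i) (\sum_i germ (c i) *: x i).
Proof.
move=> U0 hs; apply: (big_rec2 (fun (s : sec F U) x => genval e s x)); first exact: gval0.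
by move=> i y1 y2 _ h1; exact: gval_lin.
Qed.

Lemma gval_e i : genval e (e i) (row i 1%:M).
Proof.
exists U1, (@subset_refl _ _), (@subset_refl _ _), (fun j => (i == j)%:R); split => //.
  rewrite (bigD1 i) //= eqxx scale1r big1 ?addr0 // => j ji.
  by rewrite eq_sym (negPf ji) scale0r.
by move=> j; rewrite !mxE; case: eqP => _; rewrite ?germ0 ?germ1.
Qed.
End Gval.

Lemma frame_exists m (s : 'I_m -> sec F U1) : oset U1 !=set0 ->
  exists h (f : 'I_h -> 'I_m), indep (s \o f) /\ forall j, exists x, genval (s \o f) (s j) x.
Proof.
move=> U10; pose Q h := `[< exists f : 'I_h -> 'I_m, indep (s \o f) >].
have Q0 : Q 0%N by apply/asboolP; exists (widen_ord (leq0n m)) => W WU a W0 _ [].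
have one0 (W : opens X) : oset W !=set0 -> (1 : regfun W) != 0.
  by move=> W0; apply/eqP => /(congr1 (fun f => germ f)); rewrite germ1 // germ0 => /eqP; rewrite oner_eq0.
have Qm h : Q h -> (h <= m)%N.
  move=> /asboolP[f hf]; rewrite -[h]card_ord -[m]card_ord; apply: (@leq_card _ _ f) => i j eij.
  apply/eqP/negPn/negP => nij.
  have := hf U1 (@subset_refl _ _) (fun l => (l == i)%:R - (l == j)%:R) U10.
  have -> : \sum_l ((l == i)%:R - (l == j)%:R) *: res (@subset_refl _ U1) ((s \o f) l) = 0 :> sec F U1.
    rewrite (bigD1 i) //= (bigD1 j) 1?eq_sym //= big1 => [|l /andP[li lj]]; last first.
      by rewrite (negPf li) (negPf lj) subrr scale0r.
    by rewrite !eqxx [j == i]eq_sym (negPf nij) subr0 sub0r scale1r scaleN1r addr0 eij subrr.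
  move=> /(_ erefl i); rewrite eqxx (negPf nij) subr0 => /eqP; apply/negP; exact: one0.
case: (ex_maxnP (ex_intro _ 0%N Q0) Qm) => h /asboolP[f hf] hmax.
exists h, f; split => // j.
have nQ : ~ indep (s \o (fun i : 'I_h.+1 => if unlift ord0 i is Some i' then f i' else j)).
  by move=> hi; have := hmax h.+1; rewrite ltnn => H; apply: notF; apply: H; apply/asboolP; eexists; exact: hi.
have [W [WU [a [W0 [ea [i0 ai0]]]]]] : exists (W : opens X) (WU : W `<=` U1) (a : 'I_h.+1 -> regfun W),
   oset W !=set0 /\ \sum_i a i *: res WU (s (if unlift ord0 i is Some i' then f i' else j)) = 0 /\ exists i, a i <> 0.
  apply: contrapT => h'; apply: nQ => W WU a W0 ea i; apply: contrapT => ai; apply: h'.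
  by exists W, WU, a; split => //; split => //; exists i.
rewrite big_ord_recl unlift_none in ea.
have {}ea : a ord0 *: res WU (s j) + \sum_i a (lift ord0 i) *: res WU (s (f i)) = 0.
  by apply: etrans ea; congr (_ + _); apply: eq_bigr => i _; rewrite liftK.
have a0 : germ (a ord0) <> 0.
  move=> /(germ_eq0 (FF := FF)) e0; rewrite e0 // scale0r add0r in ea.
  have := hf W WU (fun i => a (lift ord0 i)) W0 ea => hz; apply: ai0.
  by case: (unliftP ord0 i0) => [i ->|->]; [exact: hz|exact: e0].
have [W' [W'W [c [W'0 ec]]]] := invert W0 a0.
exists (\row_i germ (- (c * restr W'W (a (lift ord0 i))))).
exists W', (subset_trans W'W WU), (subset_trans W'W WU), (fun i => - (c * restr W'W (a (lift ord0 i)))).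
split => //; last by move=> i; rewrite mxE.
rewrite -[LHS]scale1r -ec -scalerA -(res_comp WU W'W) -resZ.
move/eqP: ea; rewrite addr_eq0 => /eqP ->.
rewrite resN res_sum -sumrN scaler_sumr; apply: eq_bigr => i _.
by rewrite resZ scalerN scalerA (res_comp WU W'W (subset_trans W'W WU)) scaleNr.
Qed.
End Frame.
End FiniteType.
End GenericFrames.

(** * The lattice of a sheaf of finite type *)
Module FiniteType.
Import Defs.
Export GenericFrames.
Import Geo.
Import Defs.
Import Order.TTheory GRing.Theory Num.Theory.
Local Open Scope classical_set_scope.
Local Open Scope ring_scope.

Section FtExists.
Variables (k : fieldType) (n : nat) (X : set (pspace k n)) (FF : funfield X).
Local Notation K := (ffK FF).
Local Notation D := (ffD FF).
Local Notation O := (dO D).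
Local Notation intm := (intm D).
Local Notation germ := (germ FF).
Local Notation omod := (omod X).
Local Notation lattice := (lattice D).
Variables (F : omod) (p0 : X).

Record pdata h := PData { pU : opens X; pm : nat; ps : 'I_pm -> sec F pU; pS : 'M[K]_(pm, h);
  pg : 'M[K]_pm; pT : 'M[K]_h; pV : opens X; pt : 'I_h -> sec F pV }.
Arguments ps {h} p _.
Arguments pt {h} p _.

Section Frame.
Variables (U1 : opens X) (U10 : oset U1 !=set0) (m1 : nat) (s1 : 'I_m1 -> sec F U1).
Hypothesis gen1 : generates s1.
Variables (h : nat) (f : 'I_h -> 'I_m1).
Hypothesis ind : indep (s1 \o f).
Hypothesis val1 : forall j, exists x, genval (FF:=FF) (s1 \o f) (s1 j) x.
Local Notation gv := (genval (FF:=FF) (s1 \o f)).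

Lemma gval_ex U (s : sec F U) : oset U !=set0 -> exists x, gv s x.
Proof.
move=> U0; have [y [Uy U1y]] := ff_meet FF U0 U10.
have Wy : oset (opensI U U1) y by [].
have [Z [ZW [ZU1 [Zy [b eb]]]]] := gen1 (@opensIr _ U U1) (res (@opensIl _ U U1) s) Wy.
have /choice[x hx] := val1; have Z0 : oset Z !=set0 by exists y.
exists (\sum_j germ (b j) *: x j); apply: gval_unres (subset_trans ZW (@opensIl _ _ _)) _ _ _.
rewrite -(res_comp (@opensIl _ U U1) ZW) eb; apply: gval_sum => // j.
exact: gval_res.
Qed.

Definition pspec (p : X) (d : pdata h) := [/\ [/\ generates (ps d), oset (pV d) p, pV d `<=` pU d &
   forall i, gv (ps d i) (row i (pS d))],
   forall q, oset (pV d) q -> unimod D q (pg d), pT d \in unitmx,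
   pg d *m pS d = pid_mx h *m pT d & forall i, gv (pt d i) (row i (pT d))].

Lemma pdata_ex p : finite_type F -> exists d, pspec p d.
Proof.
move=> ft; have [U [m [s [Up gs]]]] := ft p; have U0 : oset U !=set0 by exists p.
have /choice[x hx] : forall i, exists x, gv (s i) x by move=> i; exact: gval_ex.
pose S := \matrix_i x i; have hS i : gv (s i) (row i S) by rewrite rowK.
have /choice[L hL] : forall i : 'I_h, exists L : 'rV[K]_m, row i 1%:M = L *m S.
  move=> i; have [y [Uy U1y]] := ff_meet FF U0 U10.
  have Wy : oset (opensI U U1) y by [].
  have [Z [ZW [ZU [Zy [b eb]]]]] := gs _ (@opensIl _ U U1) (res (@opensIr _ U U1) ((s1 \o f) i)) _ Wy.
  have Z0 : oset Z !=set0 by exists y.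
  exists (\row_j germ (b j)); apply: (gval_uniq ind (s := res ZW (res (@opensIr _ U U1) ((s1 \o f) i)))).
    by do 2!apply: gval_res => //; [exists y|exact: gval_e].
  rewrite eb mulmx_sum_row; have -> : \sum_j (\row_j0 germ (b j0)) 0 j *: row j S = \sum_j germ (b j) *: row j S.
    by apply: eq_bigr => j _; rewrite mxE.
  by apply: gval_sum => // j; exact: gval_res.
have LS : (\matrix_i L i) *m S = 1%:M by apply/row_matrixP => i; rewrite row_mul rowK -hL.
have [g [l [B [ug fB lm e]]]] := echelon D p S.
have rS : \rank S = h.
  apply/eqP; rewrite eqn_leq rank_leq_col /= -{1}(mxrank1 K h) -LS; exact: mxrankM_maxr.
have el : l = h.
  case: ug => ug _ _; have e1 : \rank (pid_mx l *m B : 'M_(m, h)) = l by rewrite mxrankMfree // rank_pid_mx.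
  have e2 : \rank (g *m S) = h by rewrite -[RHS]rS (eqmxMfull S) // row_full_unit.
  by rewrite -e1 -e e2.
subst l.
have fin : finite_set [set q | ~ (intm q g /\ intm q (invmx g))] by apply: finite_or; exact: intm_fin.
pose V := opensI U (Opens (ff_open FF fin)).
have uV q : oset V q -> unimod D q g by case: ug => ug _ _ [_ /= /contrapT[]].
have Vp : oset V p by split => //=; case: ug => _ h1 h2; apply.
have V0 : oset V !=set0 by exists p.
have /choice[b hb] : forall ij : 'I_m * 'I_m, exists b : regfun V, germ b = g ij.1 ij.2.
  by move=> [i j]; apply: germ_glue => // q /uV[_ hg _]; exact: hg.
exists (PData s S g B (fun i => \sum_j b (widen_ord lm i, j) *: res (@opensIl _ _ _ : V `<=` U) (s j))).
split => /=; [by split => //; exact: opensIl|exact: uV|by rewrite -row_free_unit|by []|].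
move=> i; have -> : row i B = row (widen_ord lm i) (g *m S).
  rewrite e row_mul [LHS]rowE; congr (_ *m B); apply/rowP => j; rewrite !mxE /= ltn_ord andbT eq_sym.
  by [].
rewrite row_mul mulmx_sum_row.
have -> : \sum_j (row (widen_ord lm i) g) 0 j *: row j S = \sum_j germ (b (widen_ord lm i, j)) *: row j S.
  by apply: eq_bigr => j _; rewrite hb mxE.
by apply: gval_sum => // j; exact: gval_res.
Qed.

Lemma pdata_int p d U (s : sec F U) q x : pspec p d -> oset U q -> oset (pV d) q -> gv s x ->
  intm q (x *m invmx (pT d)).
Proof.
move=> [[gs Vp VU hS] uV uT e _] Uq Vq gx.
have Wq : oset (opensI U (pU d)) q by split => //; exact: VU.
have [Z [ZW [ZU [Zq [b eb]]]]] := gs _ (@opensIr _ U (pU d)) (res (@opensIl _ U (pU d)) s) _ Wq.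
have Z0 : oset Z !=set0 by exists q.
have -> : x = (\row_j germ (b j)) *m pS d.
  apply: (gval_uniq ind (s := res ZW (res (@opensIl _ U (pU d)) s))).
    by do 2!apply: gval_res => //; exists q.
  rewrite eb mulmx_sum_row; have -> : \sum_j (\row_j0 germ (b j0)) 0 j *: row j (pS d) = \sum_j germ (b j) *: row j (pS d).
    by apply: eq_bigr => j _; rewrite mxE.
  by apply: gval_sum => // j; exact: gval_res.
have [ug hg hg'] := uV _ Vq.
have -> : pS d = invmx (pg d) *m (pid_mx h *m pT d) by rewrite -e mulKmx.
rewrite -!mulmxA mulmxV // mulmx1; apply: intmM; first by move=> i j; rewrite mxE; exact: germ_in.
apply: intmM => //; exact: intm_pid.
Qed.

Lemma ft_frame : finite_type F -> inhabited (ft FF F).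
Proof.
move=> fF; have /choice[d hd] := fun p => pdata_ex p fF.
pose T p := pT (d p); have uT p : T p \in unitmx by have [_ _ h1 _ _] := hd p.
have TT p q : oset (pV (d p)) q -> intm q (T p *m invmx (T q)) /\ intm q (T q *m invmx (T p)).
  move=> Vq; have [[_ _ _ _] _ _ _ tp] := hd p; have [[_ Vqq _ _] _ _ _ tq] := hd q.
  split; apply: intm_row => i; rewrite row_mul.
    exact: pdata_int (hd q) Vq Vqq (tp i).
  exact: pdata_int (hd p) Vqq Vq (tq i).
have Vp p : oset (pV (d p)) p by have [[_ h1 _ _] _ _ _ _] := hd p.
have fin : finite_set [set q | ~ (intm q (T q) /\ intm q (invmx (T q)))].
  have h1 : finite_set [set q | ~ oset (pV (d p0)) q] by apply: (ff_cofinite FF); exists p0.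
  apply: finite_imp (finite_or h1 (finite_or (intm_fin D (T p0)) (intm_fin D (invmx (T p0))))) => q [Vq [h2 h3]].
  have [k1 k2] := TT _ _ Vq; split.
    by rewrite -(mulmxKV (uT p0) (T q)); exact: intmM.
  have -> : invmx (T q) = invmx (T p0) *m (T p0 *m invmx (T q)) by rewrite mulKmx.
  exact: intmM.
pose G := Lattice uT fin.
pose κ U (s : sec F U) : 'rV[K]_h := if pselect (oset U !=set0) is left U0 then projT1 (cid (gval_ex s U0)) else 0.
have κP U (s : sec F U) : oset U !=set0 -> gv s (κ U s).
  by rewrite /κ; case: pselect => // U0 _; exact: projT2 (cid (gval_ex s U0)).
have κ0 U (s : sec F U) : ~ (oset U !=set0) -> κ U s = 0 by rewrite /κ; case: pselect.
have κE U (s : sec F U) x : oset U !=set0 -> gv s x -> κ U s = x.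
  by move=> U0 hx; apply: (gval_uniq ind (s := s)) => //; exact: κP.
have κin U (s : sec F U) : κ U s \in inU (Lfam (FF := FF) G) U.
  apply/asboolP; split; first by have [U0|/κ0 h1] := pselect (oset U !=set0); [left|right].
  move=> q Uq; exact: (pdata_int (hd q) Uq (Vp q) (κP U s (ex_intro _ q Uq))).
have lin U : linear (fun s => LSec (κin U s) : sec (slat (Lfam (FF := FF) G)) U).
  move=> c s t; apply: lsec_eq => U0; apply: κE => //; apply: gval_lin => //; exact: κP.
have rs (U V : opens X) (VU : V `<=` U) (s : sec F U) :
  (LSec (κin V (res VU s)) : sec (slat (Lfam (FF := FF) G)) V) = res VU (LSec (κin U s) : sec (slat (Lfam (FF := FF) G)) U).
  apply: lsec_eq => V0; rewrite srE //=; apply: κE => //; apply: gval_res => //; apply: κP.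
  by have [y Vy] := V0; exists y; exact: VU.
have /choice[W hW] : forall j : 'I_m1, exists W : opens X, oset W !=set0 /\ exists (WU1 : W `<=` U1) (a : 'I_h -> regfun W),
    res WU1 (s1 j) = \sum_i a i *: res WU1 (s1 (f i)).
  move=> j; have [x [W [WU [WU1 [a [W0 ea _]]]]]] := val1 j; exists W; split => //.
  by exists WU1, a; rewrite -ea (res_eq WU1 WU).
have [V0 [V00 hV0]] := bigmeet FF p0 (fun j => (hW j).1).
pose V1 := opensI V0 U1; have V10 : oset V1 !=set0 := ff_meet FF V00 U10.
constructor; apply: (@Ft _ _ _ FF F G (mkhom lin rs) V1 V10).
- move=> U s UV e0; apply: local_eq => y Uy; have U1y := (UV _ Uy).2.
  have UU1 : U `<=` U1 := subset_trans UV (@opensIr _ _ _).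
  have [Z [ZU [ZU1 [Zy [b eb]]]]] := gen1 UU1 s Uy.
  exists Z, ZU; split => //; have Z0 : oset Z !=set0 by exists y.
  have U0 : oset U !=set0 by exists y.
  have : exists a : 'I_h -> regfun Z, res ZU s = \sum_i a i *: res ZU1 (s1 (f i)).
    have /choice[a ha] : forall j, exists a : 'I_h -> regfun Z, res ZU1 (s1 j) = \sum_i a i *: res ZU1 (s1 (f i)).
      move=> j; have [_ [WU1 [a ea]]] := hW j.
      have ZW : Z `<=` W j := subset_trans ZU (subset_trans UV (subset_trans (@opensIl _ _ _) (hV0 j))).
      exists (fun i => restr ZW (a i)); rewrite -(res_comp WU1 ZW) ea res_sum.
      by apply: eq_bigr => i _; rewrite resZ (res_comp WU1 ZW ZU1).
    exists (fun i => \sum_j b j * a j i); rewrite eb; under eq_bigr do rewrite ha scaler_sumr.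
    rewrite exchange_big; apply: eq_bigr => i _; rewrite scaler_suml; apply: eq_bigr => j _.
    by rewrite scalerA.
  move=> [a ea]; have gx : gv s (\row_i germ (a i)).
    by exists Z, ZU, ZU1, a; split => // i; rewrite mxE.
  have e1 : κ U s = 0 := congr1 (fun x : lsec _ _ => lval x) e0.
  rewrite res0 ea big1 // => i _; have -> : a i = 0; last by rewrite scale0r.
  apply: (germ_eq0 (FF := FF)) => //; have := κE _ _ _ U0 gx; rewrite e1.
  by move=> /rowP/(_ i); rewrite !mxE.
- move=> p; exists (pV (d p)), (pt (d p)), (T p); split => //.
    by move=> i; apply: κE; [exists p|have [_ _ _ _] := hd p].
  by move=> q /TT.
Qed.
End Frame.

(** Take a maximal independent family of local generators as a basis of the generic fibre;
at every point the stalk modulo torsion is a finitely generated torsion-free module over a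
valuation ring, hence free, and echelon forms supply its basis. *)
Theorem ft_exists : finite_type F -> inhabited (ft FF F).
Proof.
move=> fF; have [U1 [m1 [s1 [U1p g1]]]] := fF p0.
have U10 : oset U1 !=set0 by exists p0.
have [h [f [ie hv]]] := frame_exists FF s1 U10.
exact: (ft_frame U10 g1 ie hv fF).
Qed.
End FtExists.
End FiniteType.

(** * Genus one in terms of adeles *)
Module AdelicExt.
Import Defs.
Export FiniteType.
Import Geo.
Import Defs.
Import Order.TTheory GRing.Theory Num.Theory.
Local Open Scope classical_set_scope.
Local Open Scope ring_scope.

Section Elliptic.
Variables (k : fieldType) (n : nat) (X : set (pspace k n)) (FF : funfield X).
Local Notation K := (ffK FF).
Local Notation D := (ffD FF).
Local Notation O := (dO D).
Local Notation ι := (kinc D).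
Local Notation intm := (intm D).
Local Notation germ := (germ FF).
Local Notation omod := (omod X).
Local Notation lattice := (lattice D).
Local Notation L A := (slat (Lfam (FF := FF) A)).
Local Notation Q A := (qsh (Lfam (FF := FF) A)).
Local Notation resL A := (lres_of (M := Lfam (FF := FF) A) (@Lfin _ _ _ FF A)).

Section AdeleHom.
Variables (F : omod) (ff : ft FF F) (A : lattice) (v : X -> 'M[K]_(lr (ftG ff), lr A)).
Hypothesis hv : madele (ftG ff) A v.
Lemma ahom_fin U (s : sec F U) : finite_set [set p | oset U p /\ ~ Lfam A p (lval (ftk ff U s) *m v p)].
Proof.
apply: sub_finite_set hv => p [Up h] h'; apply: h; apply: Lhomp h' _; exact: ftk_mem.
Qed.
Lemma ahom_lin U : linear (fun s : sec F U => mkq (ahom_fin s) : sec (Q A) U).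
Proof.
move=> a s t; apply: (qsec_trans (f := fun p => germ a *: (lval (ftk ff U s) *m v p) + lval (ftk ff U t) *m v p)) => p Up.
  apply: modT (mkqE _ Up) _; rewrite ftkD ftkZ mulmxDl -scalemxAl; exact: modR.
apply: modT (qaddE _ _ Up) _; apply: modD; last exact: mkqE.
by apply: modT (qscaleE _ _ Up) _; apply: modZ => //; exact: mkqE.
Qed.
Lemma ahom_res (U V : opens X) (VU : V `<=` U) (s : sec F U) :
  (mkq (ahom_fin (res VU s)) : sec (Q A) V) = res VU (mkq (ahom_fin s) : sec (Q A) U).
Proof.
apply: (qsec_trans (f := fun p => lval (ftk ff U s) *m v p)) => p Vp.
  by apply: modT (mkqE _ Vp) _; rewrite ftk_res; [exact: modR|exists p].
by rewrite qvalr //; exact: mkqE (VU _ Vp).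
Qed.
Lemma adele_hom : exists z : hom F (Q A), forall U s p, oset U p ->
  Lfam A p ((z U s : qsec (Lfam A) U) p - lval (ftk ff U s) *m v p).
Proof. by exists (mkhom ahom_lin ahom_res) => U s p Up; exact: mkqE. Qed.
End AdeleHom.

Section Classes.
Variables (p0 : X) (A B : lattice).
Definition rep (z : hom (L A) (Q B)) (v : X -> 'M[K]_(lr A, lr B)) := forall U (s : sec (L A) U) p, oset U p ->
  Lfam B p ((z U s : qsec (Lfam B) U) p - lval (s : lsec (Lfam A) U) *m v p).
Lemma rep_ex (z : hom (L A) (Q B)) : exists v, madele A B v /\ rep z v.
Proof.
have [|v [vfin hv]] := @q_rep _ _ _ _ _ (ft_slat A p0) _ _ z.
  by move=> U s /= e; have -> : s = 0 := e; rewrite linear0.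
exists v; split; last exact: hv.
apply: finite_imp vfin => p h; apply: intm_row => i.
by rewrite !row_mul; apply: h; exact: Lrow.
Qed.
Lemma hom_ex v : madele A B v -> exists z, rep z v.
Proof. by move=> hv; exact: (@adele_hom _ (ft_slat A p0) B v hv). Qed.
Lemma rep_cob z v : rep z v -> cob z <-> exists x, forall p, homp A B p (v p - x).
Proof.
move=> hz; split; first by move=> cz; exact: (@split_of_cob _ _ _ _ _ (ft_slat A p0) B z v hz cz).
by move=> cz; exact: (@cob_of_split _ _ _ _ _ (ft_slat A p0) B z v hz cz).
Qed.
Lemma rep_lin c z v z' v' : rep z v -> rep z' v' -> rep (hlin c z z') (fun p => ι c *: v p + v' p).
Proof.
move=> h h' U s p Up; apply: modT (qvalD _ _ Up) _; rewrite mulmxDr; apply: modD; last exact: h'.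
apply: modT (qvalZ _ _ Up) _; rewrite germ_cst -?scalemxAr -?scalerBr; last by exists p.
by apply: fmZ; [exact: dO_inc|exact: h].
Qed.
End Classes.

Lemma one_fin : finite_set [set p : X | ~ (intm p (1%:M : 'M[K]_1) /\ intm p (invmx 1%:M : 'M[K]_1))].
Proof.
apply: (@sub_finite_set _ _ set0) => // p; apply; rewrite invmx1; split; exact: intm1.
Qed.
Definition trivlat : lattice := Lattice (fun p => unitmx1 K 1) one_fin.

Lemma osheaf_iso : iso (osheaf X) (L trivlat).
Proof.
have hin U (f : regfun U) : (germ f)%:M \in inU (Lfam (FF := FF) trivlat) U.
  apply/asboolP; split.
    have [U0|U0] := pselect (oset U !=set0); [by left|right].
    by rewrite (sec_empty (F := osheaf X) f 0 U0) germ0 raddf0.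
  by move=> p Up /=; rewrite invmx1 mulmx1; apply: intm_scalar; exact: germ_in.
have lin U : linear (fun f : sec (osheaf X) U => LSec (hin U f) : sec (L trivlat) U).
  move=> a s t; apply: val_inj => /=; rewrite germD raddfD; congr (_ + _).
  by rewrite scale_scalar_mx; congr (_%:M); exact: germM.
have rs (U V : opens X) (VU : V `<=` U) (s : sec (osheaf X) U) :
  (LSec (hin V (res VU s)) : sec (L trivlat) V) = res VU (LSec (hin U s) : sec (L trivlat) U).
  by apply: lsec_eq => V0; rewrite srE //= germ_restr.
apply: (@iso_mono_epi _ _ _ _ _ (mkhom lin rs)).
  move=> U s e; have [U0|U0] := pselect (oset U !=set0); last exact: sec_empty.
  apply: (germ_eq0 (FF := FF)) => //.
  have : lval (LSec (hin U s)) 0 0 = 0 by have -> : LSec (hin U s) = 0 := e; rewrite mxE.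
  by rewrite mxE mulr1n.
move=> U t x Ux; have U0 : oset U !=set0 by exists x.
have [|f hf] := @germ_glue _ _ _ FF U (lval (t : lsec _ U) 0 0) U0.
  move=> q Uq; have := lsecP (t : lsec (Lfam (FF := FF) trivlat) U) Uq 0 0.
  by rewrite /= invmx1 mulmx1.
exists U, (@subset_refl _ _); split => //; exists f; apply: lsec_eq => _.
by rewrite srE //= hf -mx11_scalar.
Qed.

(** Ext^1(O, O) computed with the resolution by principal parts is the space of adeles
modulo the integral ones and the constants, and om is a coordinate on this line. *)
Theorem genus1_ext (p0 : X) : ext_dim (osheaf X) (osheaf X) 1 1 -> inhabited (genus1 D).
Proof.
move=> /(ext_dim_iso osheaf_iso osheaf_iso)[I [b [cb hb]]].
pose J := resL trivlat.
have [f0 [f [g0 [g [[cf1 cf2] [cg1 cg2] [s hs] [s' hs']]]]]] := comparison I J.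
have ad v : madele trivlat trivlat v <-> adele D (fun p => v p 0 0).
  split=> h; apply: sub_finite_set h => p h h'; apply: h.
    by move: h'; rewrite /homp /= invmx1 mulmx1 mul1mx => /(_ 0 0).
  by rewrite /homp /= invmx1 mulmx1 mul1mx => i j; rewrite !ord1.
have sp v : (exists x, forall p, homp trivlat trivlat p (v p - x)) <-> Adeles.split D (fun p => v p 0 0).
  split=> -[x hx].
    by exists (x 0 0) => p; have := hx p; rewrite /homp /= invmx1 mulmx1 mul1mx => /(_ 0 0); rewrite !mxE.
  exists x%:M => p; rewrite /homp /= invmx1 mulmx1 mul1mx => i j; rewrite !ord1 !mxE mulr1n; exact: hx.
have [w [hw rw]] := rep_ex p0 (hcomp (b 0) f : hom (L trivlat) (Q trivlat)).
apply: (@genus1_of _ _ _ D (fun p => w p 0 0)); first exact/ad.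
move=> a ha; pose v (p : X) : 'M[K]_1 := (a p)%:M.
have hv : madele trivlat trivlat v by apply/ad; apply: sub_finite_set ha => p; rewrite /= mxE mulr1n.
have [z rz] := hom_ex p0 hv.
have diff c : cob (hlin (- c) (hcomp (b 0) f : hom (L trivlat) (Q trivlat)) z) <-> Adeles.split D (fun p => a p - ι c * w p 0 0).
  rewrite (rep_cob p0 (rep_lin (- c) rw rz)) sp; have -> // : (fun p => (ι (- c) *: w p + v p) 0 0) = (fun p => a p - ι c * w p 0 0).
  by apply/funext => p; rewrite !mxE mulr1n rmorphN mulNr addrC.
have [|c [[y hy] uc]] := hb (hcomp z g); first by move=> U t /=; apply: cg2.
pose qq := quo (M := Lfam (FF := FF) trivlat) (@Lfin _ _ _ FF trivlat).
exists (c 0); split.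
  apply/diff; exists (hlin (-1) (hcomp z s') (hcomp y f0)) => U t.
  have e : f U (g U (z U t)) - cstf U (c 0) *: f U (b 0 U t) = qq U (f0 U (y U t)).
    by have := congr1 (f U) (hy U t); rewrite big_ord1 linearB linearZ cf1.
  have e' : f U (g U (z U t)) - z U t = qq U (s' U (z U t)) := hs' U (z U t) erefl.
  change (cstf U (- c 0) *: f U (b 0 U t) + z U t = qq U (cstf U (-1) *: s' U (z U t) + f0 U (y U t))).
  rewrite linearD [X in _ = X + _]linearZZ -e -e' !cstN cst1 scaleN1r scaleNr.
  by rewrite opprB addrA subrK addrC.
move=> c' /diff[y' hy'].
suff h : c = [ffun=> c'] by rewrite h ffunE.
apply: uc.
exists (hlin c' (hcomp (b 0) s) (hcomp y' g0)) => U t.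
rewrite big_ord1 ffunE.
have e : cstf U (- c') *: f U (b 0 U t) + z U t = qq U (y' U t) := hy' U t.
have e1 : g U (qq U (y' U t)) = inj_d I 0%N U (g0 U (y' U t)) := cg1 U _.
have e2 := hs U (b 0 U t) (cb 0 U t).
change (g U (z U t) - cstf U c' *: b 0 U t = inj_d I 0%N U (cstf U c' *: s U (b 0 U t) + g0 U (y' U t))).
have e3 : g U (qq U (y' U t)) = - (cstf U c' *: g U (f U (b 0 U t))) + g U (z U t).
  by rewrite -e linearD linearZZ cstN scaleNr.
rewrite linearD [X in _ = X + _]linearZZ -e1 e3 -e2 scalerBr.
by rewrite addrACA subrr add0r addrC.
Qed.
End Elliptic.
End AdelicExt.

(** * Mutations as short exact sequences *)
Module Mutations.
Import Defs.
Export ExtComparison.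
Import all_boot all_order all_algebra.
Import all_classical.
Import mpoly topology_structure subtype_topology.
Import Defs.
Import Order.TTheory GRing.Theory Num.Theory.
Local Open Scope classical_set_scope.
Local Open Scope ring_scope.

Section Mutation.
Variables (k : fieldType) (n : nat) (X : set (pspace k n)).
Local Notation omod := (omod X).

Section Powh.
Variables (L E : omod) (m : nat) (a : 'I_m -> hom L E).
Lemma powh_lin U : linear (fun s : sec L U => [ffun i => a i U s] : sec (pow E m) U).
Proof. by move=> c s t; apply/ffunP => i; rewrite !ffunE linearP. Qed.
Lemma powh_res (U V : opens X) (VU : V `<=` U) (s : sec L U) :
  ([ffun i => a i V (res VU s)] : sec (pow E m) V) = res VU ([ffun i => a i U s] : sec (pow E m) U).
Proof. by apply/ffunP => i; rewrite !ffunE hom_res. Qed.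
Definition powh : hom L (pow E m) := mkhom powh_lin powh_res.
End Powh.

Lemma proj_lin (E : omod) m (i : 'I_m) U : linear (fun s : sec (pow E m) U => (s : {ffun _ -> _}) i).
Proof. by move=> c s t; rewrite !ffunE. Qed.
Lemma proj_res (E : omod) m (i : 'I_m) (U V : opens X) (VU : V `<=` U) (s : sec (pow E m) U) :
  (res VU s : {ffun _ -> _}) i = res VU ((s : {ffun _ -> _}) i).
Proof. by rewrite ffunE. Qed.
Definition proj (E : omod) m (i : 'I_m) : hom (pow E m) E := mkhom (@proj_lin E m i) (@proj_res E m i).

Lemma iso_ker (L M N : omod) (a : hom L M) (g : hom M N) : mono a -> exact_at a g -> iso L (ker g).
Proof.
move=> ma ex; have [|a' ha'] := @corestr _ _ _ L M N g a.
  move=> U s; apply: (exactR ex) => x Ux; exists U, (@subset_refl _ _); split => //.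
  by exists s; rewrite res_id.
apply: (@iso_mono_epi _ _ _ _ _ a').
  by move=> U s e; apply: ma; rewrite -ha' e.
move=> U t x Ux; have h := exactL ex (corestr_kval t); have [V [VU [Vx [s hs]]]] := h x Ux.
by exists V, VU; split => //; exists s; apply: val_inj; rewrite /= ha'.
Qed.

Lemma ker_iso (L M N : omod) (g : hom M N) : iso L (ker g) -> exists a : hom L M, mono a /\ exact_at a g.
Proof.
move=> [f [f' [h1 h2]]]; exists (hcomp f (kincl g)); split.
  by move=> U s /= e; rewrite -(h1 U s) (_ : f U s = 0) ?linear0 //; apply: val_inj.
move=> U t; split.
  move=> e x Ux; have kt : t \in @kerb _ _ _ _ _ g U by apply/eqP.
  exists U, (@subset_refl _ _); split => //; exists (f' U (KerSec kt)).
  by rewrite /= h2 res_id.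
move=> h; apply: local_eq => x Ux; have [V [VU [Vx [s hs]]]] := h x Ux.
by exists V, VU; split => //; rewrite -hom_res -hs res0 /= corestr_kval.
Qed.

(** Left mutation as a short exact sequence 0 -> L -> E^m -> F -> 0, in which no kernel
object is chosen. *)
Definition mutation (E F L : omod) := exists (m : nat) (b : 'I_m -> hom E F) (a : 'I_m -> hom L E),
  [/\ hom_basis b, epi (evalm b), mono (powh a) & exact_at (powh a) (evalm b)].

Lemma evalmE (E F : omod) m (b : 'I_m -> hom E F) U (s : sec (pow E m) U) :
  evalm b U s = \sum_i b i U ((s : {ffun _ -> _}) i).
Proof. by []. Qed.

(** Two bases give mutually inverse matrices over k. *)
Lemma basis_uniq (E F : omod) m m' (b : 'I_m -> hom E F) (b' : 'I_m' -> hom E F) : hom_basis b -> hom_basis b' -> m = m'.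
Proof.
move=> hb hb'.
have key p q (c : 'I_p -> hom E F) (c' : 'I_q -> hom E F) : hom_basis c -> hom_basis c' -> (p <= q)%N.
  move=> hc hc'; have /choice[x hx] : forall i, exists x : {ffun 'I_q -> k}, forall U s, c i U s = \sum_j cstf U (x j) *: c' j U s.
    by move=> i; have [x [hx _]] := hc' (c i); exists x.
  pose M : 'M[k]_(p, q) := \matrix_(i, j) x i j.
  suff : row_free M by rewrite /row_free => /eqP <-; exact: rank_leq_col.
  rewrite -kermx_eq0; apply/eqP/row_matrixP => i; rewrite row0; set v := row i _.
  have vM : v *m M = 0 by rewrite /v -row_mul mulmx_ker row0.
  have [z [hz uz]] := hc (h0 E F).
  have e (w : 'rV[k]_p) : w *m M = 0 -> z = [ffun i => w 0 i].
    move=> wM; apply: uz => U s; under eq_bigr do rewrite ffunE hx scaler_sumr.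
    rewrite exchange_big big1 // => j _.
    have : \sum_i w 0 i * x i j = 0.
      by have /rowP/(_ j) e0 := wM; rewrite !mxE in e0; apply: etrans e0; apply: eq_bigr => l _; rewrite mxE.
    move=> /(congr1 (cstf U)); rewrite cst0 => e1; rewrite -[RHS](scale0r (c' j U s)) -e1.
    rewrite (big_morph (cstf U) (@cstD _ _ _ U) (cst0 U)) scaler_suml; apply: eq_bigr => l _.
    by rewrite scalerA cstM.
  have := e v vM; rewrite (e 0 (mul0mx _ _)) => /ffunP h; apply/rowP => j.
  by have := h j; rewrite !ffunE => <-.
by apply/eqP; rewrite eqn_leq (key _ _ _ _ hb hb') (key _ _ _ _ hb' hb).
Qed.

Lemma mutation_of (E F L : omod) : left_mutable E F -> is_left_mutation E F L -> mutation E F L.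
Proof.
move=> [_ [m [b [hb eb]]]] [m' [b' [hb' /ker_iso[a [ma ea]]]]].
have e := basis_uniq hb' hb; subst m'.
exists m, b', (fun i => hcomp a (proj E i)); split => //.
- move=> U t x Ux; have [V [VU [Vx [s hs]]]] := eb U t x Ux.
  exists V, VU; split => //.
  have /choice[x' hx] : forall i, exists x : {ffun 'I_m -> k}, forall U s, b i U s = \sum_j cstf U (x j) *: b' j U s.
    by move=> i; have [x' [hx _]] := hb' (b i); exists x'.
  exists ([ffun j => \sum_i cstf V (x' i j) *: (s : {ffun _ -> _}) i] : sec (pow E m) V).
  rewrite -hs !evalmE; under [RHS]eq_bigr do rewrite hx; rewrite exchange_big; apply: eq_bigr => j _.
  by rewrite ffunE linear_sum; apply: eq_bigr => i _; rewrite linearZZ.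
- by move=> U s e; apply: ma; apply/ffunP => i; have /ffunP/(_ i) := e; rewrite !ffunE.
- have pa U s : powh (fun i => hcomp a (proj E i)) U s = a U s by apply/ffunP => i; rewrite ffunE.
  move=> U t; rewrite ea; split=> h x Ux; have [V [VU [Vx [s hs]]]] := h x Ux.
    by exists V, VU; split => //; exists s; rewrite pa.
  by exists V, VU; split => //; exists s; rewrite -pa.
Qed.

Lemma of_mutation (E F L : omod) : (forall j : nat, j <> 0%N -> ext_dim E F j 0) -> mutation E F L ->
  left_mutable E F /\ is_left_mutation E F L.
Proof.
move=> ex [m [b [a [hb eb ma ea]]]]; split; first by split => //; exists m, b.
by exists m, b; split => //; exact: iso_ker ma ea.
Qed.

Lemma hom_basis_iso (E E' F F' : omod) m (b : 'I_m -> hom E F) (e : hom E E') (e' : hom E' E)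
  (f : hom F F') (f' : hom F' F) : (forall U s, e' U (e U s) = s) -> (forall U s, e U (e' U s) = s) ->
  (forall U s, f' U (f U s) = s) -> (forall U s, f U (f' U s) = s) ->
  hom_basis b -> hom_basis (fun i => hcomp e' (hcomp (b i) f)).
Proof.
move=> k1 k2 h1 h2 hb z; have [c [hc uc]] := hb (hcomp e (hcomp z f')); exists c; split.
  move=> U s; have := hc U (e' U s); rewrite /= k2 => /(congr1 (f U)); rewrite h2 linear_sum => ->.
  by apply: eq_bigr => i _; rewrite linearZZ.
move=> c' hc'; apply: uc => U s /=; rewrite hc' linear_sum; apply: eq_bigr => i _.
by rewrite linearZZ /= k1 h1.
Qed.

Lemma mutation_iso (E E' F F' L L' : omod) : iso E E' -> iso F F' -> iso L L' -> mutation E F L -> mutation E' F' L'.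
Proof.
move=> [e [e' [k1 k2]]] [f [f' [h1 h2]]] [l [l' [j1 j2]]] [m [b [a [hb eb ma ea]]]].
pose b' i := hcomp e' (hcomp (b i) f); pose a' i := hcomp l' (hcomp (a i) e).
have bE U (s : sec (pow E' m) U) : evalm b' U s = f U (evalm b U [ffun i => e' U ((s : {ffun _ -> _}) i)]).
  by rewrite !evalmE linear_sum; apply: eq_bigr => i _; rewrite /= ffunE.
exists m, b', a'; split; first exact: (hom_basis_iso k1 k2 h1 h2).
- move=> U t x Ux; have [V [VU [Vx [s hs]]]] := eb U (f' U t) x Ux.
  exists V, VU; split => //; exists ([ffun i => e V ((s : {ffun _ -> _}) i)] : sec (pow E' m) V).
  rewrite bE (_ : [ffun i => _] = s); last by apply/ffunP => i; rewrite !ffunE k1.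
  by rewrite hs -hom_res h2.
- move=> U s es; rewrite -(j2 U s) (ma _ (l' U s)) ?linear0 //; apply/ffunP => i.
  have /ffunP/(_ i) := es; rewrite !ffunE /= => ei; by rewrite -(k1 U (a i U _)) ei linear0.
move=> U t; rewrite bE; split.
  move=> et; have : evalm b U [ffun i => e' U ((t : {ffun _ -> _}) i)] = 0.
    by rewrite -(h1 _ (evalm b U _)) et linear0.
  move=> /(exactL ea) h x Ux; have [V [VU [Vx [s hs]]]] := h x Ux; exists V, VU; split => //.
  exists (l V s); apply/ffunP => i; have /ffunP/(_ i) := hs; rewrite !ffunE /= j1 => ->.
  by rewrite -hom_res k2.
move=> h; rewrite (exactR ea) ?linear0 // => x Ux; have [V [VU [Vx [s hs]]]] := h x Ux.
exists V, VU; split => //; exists (l' V s); apply/ffunP => i; have /ffunP/(_ i) := hs.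
by rewrite !ffunE /= -hom_res => <-; rewrite k1.
Qed.
End Mutation.
End Mutations.

(** * Bundles as lattices *)
Module Bundles.
Import Defs.
Export AdelicExt Mutations.
Import Geo.
Import Defs.
Import Order.TTheory GRing.Theory Num.Theory.
Local Open Scope classical_set_scope.
Local Open Scope ring_scope.

Section Bundles.
Variables (k : fieldType) (n : nat) (X : set (pspace k n)) (FF : funfield X).
Local Notation K := (ffK FF).
Local Notation D := (ffD FF).
Local Notation O := (dO D).
Local Notation ι := (kinc D).
Local Notation intm := (intm D).
Local Notation germ := (germ FF).
Local Notation omod := (omod X).
Local Notation lattice := (lattice D).
Local Notation L A := (slat (Lfam (FF := FF) A)).
Local Notation Q A := (qsh (Lfam (FF := FF) A)).
Local Notation resL A := (lres_of (M := Lfam (FF := FF) A) (@Lfin _ _ _ FF A)).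

Lemma ft_epi (F : omod) (ff : ft FF F) : epi (ftk ff).
Proof.
move=> U t p Up; have [V [s [T [Vp uT hs hT]]]] := ft_basis ff p.
have [|a ha] := ft_coord (x := lval (t : lsec _ U)) Up Vp hT uT.
  by move=> q Uq; exact: (@lsecP _ _ _ _ _ (Lfam (FF := FF) (ftG ff)) U t q Uq).
have W0 : oset (opensI U V) !=set0 by exists p.
exists (opensI U V), (@opensIl _ _ _); split => //; exists (\sum_i a i *: res (@opensIr _ U V) (s i)).
apply: lsec_eq => _; rewrite srE // ftk_sum ha; apply: eq_bigr => i _.
by rewrite ftk_res // hs.
Qed.

Section Bundle.
Variables (F : omod) (r : nat).
Hypothesis bF : bundle F r.

Lemma bundle_finite_type : finite_type F.
Proof.
move=> x; have [U [e [Ux fe]]] := bF x; exists U, r, e; split => // V VU t y Vy.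
have [a [ha _]] := fe V VU t; exists V, (@subset_refl _ _), VU; split => //.
by exists a; rewrite res_id.
Qed.

Variable ff : ft FF F.
Lemma bundle_mono : mono (ftk ff).
Proof.
move=> U s es; apply: local_eq => y Uy; have [V [e [Vy fe]]] := bF y.
pose W := opensI U V; exists W, (@opensIl _ _ _); split => //; rewrite res0.
have W0 : oset W !=set0 by exists y.
have [a [ha _]] := fe W (@opensIr _ _ _) (res (@opensIl _ U V) s).
pose Z := opensI W (ftV ff); have Z0 : oset Z !=set0 := ff_meet FF W0 (ftV0 ff).
have ZW : Z `<=` W := @opensIl _ _ _; have ZV : Z `<=` V := subset_trans ZW (@opensIr _ _ _).
have [c [hc uc]] := fe Z ZV (res ZW (res (@opensIl _ U V) s)).
have e1 : c = [ffun i => restr ZW (a i)].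
  apply: uc; rewrite ha res_sum; apply: eq_bigr => i _.
  by rewrite ffunE resZ (res_comp _ ZW ZV).
have e2 : c = 0.
  apply: uc; rewrite big1 => [|i _]; last by rewrite ffunE scale0r.
  by apply: (ft_inj (f := ff)); [exact: opensIr|rewrite !hom_res es !res0].
rewrite ha big1 // => i _; have -> : a i = 0; last by rewrite scale0r.
apply: (germ_eq0 (FF := FF)) => //; rewrite -(germ_restr FF ZW) //.
by have /ffunP/(_ i) := e1; rewrite e2 !ffunE => <-; rewrite germ0.
Qed.

(** A bundle has no torsion, so that its sections embed into the generic fibre and are
recognized there point by point. *)
Lemma bundle_iso : iso F (L (ftG ff)).
Proof. exact: (iso_mono_epi bundle_mono (@ft_epi _ ff)). Qed.

Lemma frame_basis (r1 : nat) (U : opens X) (e : 'I_r1 -> sec F U) : oset U !=set0 -> frame e ->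
  lr (ftG ff) = r1 /\ row_free (\matrix_i lval (ftk ff U (e i))).
Proof.
move=> [p Up] fe; set M := \matrix_i _.
have fM : row_free M.
  rewrite -kermx_eq0; apply/eqP/row_matrixP => i0; rewrite row0; set x := row i0 _.
  have xM : x *m M = 0 by rewrite /x -row_mul mulmx_ker row0.
  have [N hN] := denominator D p (fun i => x 0 i).
  pose y := (unif D p ^+ N) *: x; have yM : y *m M = 0 by rewrite -scalemxAl xM scaler0.
  suff y0 : y = 0.
    by move/eqP: y0; rewrite scaler_eq0 expf_eq0 (negPf (unif_neq0 D p)) andbF => /eqP.
  have fin : finite_set [set q | ~ forall i, O q (y 0 i)].
    by apply: finite_forall => i; exact: dO_fin.
  pose W := opensI U (Opens (ff_open FF fin)); have W0 : oset W !=set0.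
    by exists p; split => //= h; apply: h => i; rewrite mxE; exact: hN.
  have /choice[a ha] : forall i, exists a : regfun W, germ a = y 0 i.
    by move=> i; apply: germ_glue => // q [_ /= /contrapT h]; exact: h.
  have WU : W `<=` U := @opensIl _ _ _.
  have s0 : \sum_i a i *: res WU (e i) = 0.
    apply: bundle_mono; apply: lsec_eq => _; rewrite ftk_sum.
    transitivity (y *m M); last by rewrite yM.
    by rewrite mulmx_sum_row; apply: eq_bigr => i _; rewrite ha rowK ftk_res.
  have [c [hc uc]] := fe W WU 0.
  have e1 : c = [ffun i => a i] by apply: uc; symmetry; apply: etrans s0; apply: eq_bigr => i _; rewrite ffunE.
  have e2 : c = 0 by apply: uc; rewrite big1 // => i _; rewrite ffunE scale0r.
  by apply/rowP => i; rewrite -ha mxE; have /ffunP/(_ i) := e1; rewrite e2 !ffunE => <-; rewrite germ0.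
split => //; apply/eqP; rewrite eqn_leq; apply/andP; split; last first.
  by move: fM; rewrite /row_free => /eqP <-; exact: rank_leq_col.
have [V [t [T [Vp uT ht hT]]]] := ft_basis ff p.
have W0 : oset (opensI V U) !=set0 by exists p.
have /choice[b hb] : forall j, exists b : {ffun 'I_r1 -> regfun (opensI V U)},
    res (@opensIl _ V U) (t j) = \sum_i b i *: res (@opensIr _ V U) (e i).
  by move=> j; have [b [hb _]] := fe _ (@opensIr _ V U) (res (@opensIl _ V U) (t j)); exists b.
have eT : T = (\matrix_(j, i) germ (b j i)) *m M.
  apply/row_matrixP => j; rewrite row_mul mulmx_sum_row -ht -(ftk_res ff (@opensIl _ V U)) // hb ftk_sum.
  by apply: eq_bigr => i _; rewrite ftk_res // rowK !mxE.
move: uT; rewrite -row_free_unit /row_free => /eqP <-; rewrite eT.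
exact: leq_trans (mxrankM_maxl _ _) (rank_leq_col _).
Qed.

Lemma bundle_rank (p0 : X) : lr (ftG ff) = r.
Proof. by have [U [e [Ux fe]]] := bF p0; apply: (proj1 (frame_basis _ fe)); exists p0. Qed.

(** A relation between sections is a row of the kernel of the matrix of their values, and
the echelon form at a point describes that kernel on a neighbourhood. *)
Lemma bundle_coherent : coherent F.
Proof.
split; first exact: bundle_finite_type.
move=> U m s x Ux; have U0 : oset U !=set0 by exists x.
pose S := \matrix_i lval (ftk ff U (s i)).
have [g [l [B [ug fB lm e]]]] := echelon D x S.
have fin : finite_set [set q | ~ (intm q g /\ intm q (invmx g))] by apply: finite_or; exact: intm_fin.
pose V := opensI U (Opens (ff_open FF fin)); have VU : V `<=` U := @opensIl _ _ _.
have Vx : oset V x by split => //=; case: ug => _ h1 h2; apply.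
have V0 : oset V !=set0 by exists x.
have gV q : oset V q -> intm q g /\ intm q (invmx g) by move=> [_ /= /contrapT].
have /choice[b hb] : forall ij : 'I_m * 'I_m, exists b : regfun V, germ b = g ij.1 ij.2.
  by move=> [i j]; apply: germ_glue => // q /gV[hg _]; exact: hg.
pose rr (j i : 'I_m) : regfun V := if (j < l)%N then 0 else b (j, i).
exists V, VU, m, rr; split => //; split.
  move=> j; rewrite /rr; case: ltnP => jl; first by rewrite big1 // => i _; rewrite scale0r.
  apply: bundle_mono; apply: lsec_eq => _; rewrite ftk_sum [RHS](_ : _ = 0) //.
  transitivity (row j (g *m S)).
    by rewrite row_mul mulmx_sum_row; apply: eq_bigr => i _; rewrite hb ftk_res // rowK !mxE.
  rewrite e row_mul; apply/rowP => i; rewrite !mxE big1 // => i' _; rewrite !mxE.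
  have -> : (j == i' :> nat) = false by apply/eqP => ji; have := ltn_ord i'; rewrite -ji ltnNge jl.
  by rewrite mul0r.
move=> W WV WU a ea y Wy; have W0 : oset W !=set0 by exists y.
pose α := \row_i germ (a i); pose c := α *m invmx g; case: (ug) => gu _ _.
have αS : α *m S = 0.
  have := congr1 (fun s : sec F W => lval (ftk ff W s)) ea; rewrite linear0 ftk_sum => h.
  by apply: etrans h; rewrite mulmx_sum_row; apply: eq_bigr => i _; rewrite ftk_res // rowK mxE.
have c0 (j : 'I_m) : (j < l)%N -> c 0 j = 0.
  have h : c *m pid_mx l = 0 :> 'rV_l.
    by apply: (row_free_inj fB); rewrite mul0mx -mulmxA -e mulmxA /c mulmxKV.
  move=> jl; have /rowP/(_ (Ordinal jl)) := h; rewrite !mxE (bigD1 j) //= big1 => [|j' jj].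
    by rewrite !mxE eqxx jl mulr1 addr0.
  by rewrite !mxE /= (_ : (j' == j :> nat) = false) ?mulr0 //; exact/negbTE.
have /choice[γ hγ] : forall j, exists γ : regfun W, germ γ = c 0 j.
  move=> j; apply: germ_glue => // q Wq; have [_ hg] := gV q (WV _ Wq).
  by apply: intmM => // i i'; rewrite mxE; exact: germ_in.
exists W, (@subset_refl _ _), WV; split => //; exists γ => i.
apply: (germ_inj (f0 := FF)) => //; rewrite germ_sum germ_restr //.
have -> : germ (a i) = (c *m g) 0 i by rewrite /c mulmxKV // mxE.
rewrite mxE; apply: eq_bigr => j _; rewrite germM hγ germ_restr // /rr; case: ltnP => jl.
  by rewrite c0 // mul0r germ0 mulr0.
by rewrite hb.
Qed.
End Bundle.

(** Homomorphisms of lattices are the morphisms of their sheaves. *)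
Section Homs.
Variables (p0 : X) (A B : lattice).
Lemma lhom_of (f : hom (L A) (L B)) : exists2 x, lhom A B x & forall U s, lval (f U s) = lval s *m x.
Proof.
have [x hx] := @hom_mx _ _ _ _ _ (ft_slat A p0) _ _ f; exists x.
  move=> p; apply: intm_row => i; have V0 : oset (std_open A p) !=set0 by exists p; exact: std_openp.
  have := lsecP (f _ (std p i) : lsec (Lfam (FF := FF) B) _) (@std_openp _ _ _ _ A p).
  by rewrite hx //= !row_mul.
move=> U s; have [U0|U0] := pselect (oset U !=set0); first exact: hx.
by rewrite (sec_empty s 0 U0) !linear0 mul0mx.
Qed.
Lemma of_lhom x : lhom A B x -> exists f : hom (L A) (L B), forall U s, lval (f U s) = lval s *m x.
Proof.
by move=> hx; apply: (@mx_hom _ _ _ _ _ (ft_slat A p0) _ (Lfam B) x) => p y; exact: Lhomp.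
Qed.
Lemma hom_mx_inj (x y : 'M[K]_(lr A, lr B)) : (forall U (s : sec (L A) U), lval (s : lsec _ U) *m x = lval (s : lsec _ U) *m y) -> x = y.
Proof.
move=> h; rewrite -(mulKmx (lg_unit A p0) x) -(mulKmx (lg_unit A p0) y); congr (_ *m _).
by apply/row_matrixP => i; rewrite !row_mul; exact: (h _ (std p0 i)).
Qed.

Lemma app_sum d (f : 'I_d -> hom (L A) (L B)) (b : 'I_d -> 'M[K]_(lr A, lr B)) (c : 'I_d -> k) U (s : sec (L A) U) :
  (forall j U s, lval (f j U s) = lval s *m b j) -> oset U !=set0 ->
  lval (\sum_j cstf U (c j) *: f j U s : lsec (Lfam (FF := FF) B) U) = lval (s : lsec _ U) *m (\sum_j ι (c j) *: b j).
Proof.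
move=> hf U0; rewrite mulmx_sumr (big_morph (fun s : lsec (Lfam (FF := FF) B) U => lval s)
  (id1 := 0) (op1 := +%R)) //; apply: eq_bigr => j _.
by rewrite lvalZ germ_cst // hf -scalemxAr.
Qed.

Lemma basis_of_lbasis d (b : 'I_d -> 'M[K]_(lr A, lr B)) (f : 'I_d -> hom (L A) (L B)) :
  (forall j U s, lval (f j U s) = lval s *m b j) -> lbasis b -> hom_basis f.
Proof.
move=> hf lb g; have [_ sp _] := lb; have [x hx gx] := lhom_of g.
have [c ec] := sp x hx; exists [ffun j => c j]; split.
  move=> U s; apply: lsec_eq => U0; rewrite gx ec -(app_sum _ _ hf U0).
  by congr lval; apply: eq_bigr => j _; rewrite ffunE.
move=> c' hc'; apply/ffunP => j; rewrite ffunE; apply: (lbasis_uniq lb).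
rewrite -ec; apply: hom_mx_inj => U s; have [U0|U0] := pselect (oset U !=set0); last first.
  by rewrite (sec_empty s 0 U0) !mul0mx.
by rewrite -gx hc' (app_sum _ _ hf U0).
Qed.

Lemma lbasis_of_basis d (f : 'I_d -> hom (L A) (L B)) : hom_basis f ->
  exists2 b : 'I_d -> 'M[K]_(lr A, lr B), (forall j U s, lval (f j U s) = lval s *m b j) & lbasis b.
Proof.
move=> hf; have /choice[b hb] : forall j, exists b, lhom A B b /\ forall U s, lval (f j U s) = lval s *m b.
  by move=> j; have [b h1 h2] := lhom_of (f j); exists b.
have hfb j := (hb j).2; exists b => //; split; first by move=> j; exact: (hb j).1.
  move=> x /of_lhom[g gx]; have [c [hc _]] := hf g; exists c; apply: hom_mx_inj => U s.
  have [U0|U0] := pselect (oset U !=set0); last by rewrite (sec_empty s 0 U0) !mul0mx.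
  by rewrite -gx hc (app_sum _ _ hfb U0).
move=> c e j; have [z [_ uz]] := hf (h0 _ _).
have h (c' : 'I_d -> k) : \sum_j ι (c' j) *: b j = 0 -> z = [ffun j => c' j].
  move=> e'; apply: uz => U s; apply: lsec_eq => U0.
  have -> : \sum_i cstf U ([ffun j => c' j] i) *: f i U s = \sum_i cstf U (c' i) *: f i U s.
    by apply: eq_bigr => i _; rewrite ffunE.
  by rewrite (app_sum _ _ hfb U0) e' mulmx0.
have := h c e; rewrite (h (fun=> 0)) => [/ffunP/(_ j)|]; first by rewrite !ffunE.
by rewrite big1 // => i _; rewrite rmorph0 scale0r.
Qed.
End Homs.
End Bundles.
End Bundles.

(** * Simple bundles are elliptically exceptional *)
Module Exceptional.
Import Defs.
Export Bundles.
Import Geo.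
Import Defs.
Import Order.TTheory GRing.Theory Num.Theory.
Local Open Scope classical_set_scope.
Local Open Scope ring_scope.

Section Exceptional.
Variables (k : fieldType) (n : nat) (X : set (pspace k n)) (FF : funfield X).
Local Notation K := (ffK FF).
Local Notation D := (ffD FF).
Local Notation O := (dO D).
Local Notation ι := (kinc D).
Local Notation intm := (intm D).
Local Notation germ := (germ FF).
Local Notation omod := (omod X).
Local Notation lattice := (lattice D).
Local Notation L A := (slat (Lfam (FF := FF) A)).
Local Notation Q A := (qsh (Lfam (FF := FF) A)).
Local Notation resL A := (lres_of (M := Lfam (FF := FF) A) (@Lfin _ _ _ FF A)).
Variables (p0 : X) (G : genus1 D).
Local Notation ω := (om G).

Lemma slat_bundle A : bundle (L A) (lr A).
Proof.
move=> p; exists (std_open A p), (std (A := A) p); split; first exact: std_openp.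
move=> V VU s; have [V0|V0] := pselect (oset V !=set0); last first.
  exists 0; split; first exact: sec_empty.
  by move=> c _; apply/ffunP => i; exact: (sec_empty (F := osheaf X)).
have /choice[a ha] : forall i, exists a : regfun V, germ a = (lval (s : lsec _ V) *m invmx (lg A p)) 0 i.
  move=> i; apply: germ_glue => // q Vq.
  have -> : lval (s : lsec _ V) *m invmx (lg A p) =
    (lval (s : lsec _ V) *m invmx (lg A q)) *m (lg A q *m invmx (lg A p)) by rewrite mulmxA mulmxKV ?lg_unit.
  by apply: intmM; [exact: (@lsecP _ _ _ _ _ (Lfam (FF := FF) A) V s q Vq)|exact: (std_openE (VU _ Vq)).2].
have sumE (c : {ffun 'I_(lr A) -> regfun V}) :
    lval (\sum_i c i *: res VU (std p i) : lsec (Lfam (FF := FF) A) V) = (\row_i germ (c i)) *m lg A p.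
  rewrite (big_morph (fun s : lsec (Lfam (FF := FF) A) V => lval s) (id1 := 0) (op1 := +%R)) // mulmx_sum_row.
  by apply: eq_bigr => i _; rewrite lvalZ srE // mxE.
have aE : lval (s : lsec _ V) = (\row_i germ (a i)) *m lg A p.
  have -> : \row_i germ (a i) = lval (s : lsec _ V) *m invmx (lg A p) by apply/rowP => i; rewrite mxE.
  by rewrite mulmxKV ?lg_unit.
exists [ffun i => a i]; split.
  apply: lsec_eq => _; rewrite sumE aE; congr (_ *m _); apply/rowP => i; by rewrite !mxE ffunE.
move=> c hc; apply/ffunP => i; rewrite ffunE; apply: (germ_inj (f0 := FF)) => //.
have : (\row_i germ (a i)) *m lg A p = (\row_i germ (c i)) *m lg A p by rewrite -aE -sumE -hc.
by move=> /(can_inj (mulmxK (lg_unit A p)))/rowP/(_ i); rewrite !mxE.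
Qed.

Lemma ext_big A B j : ext_dim (L A) (L B) j.+2 0.
Proof.
exists (resL B), (fun i : 'I_0 => match i with Ordinal _ h => False_rect _ (notF h) end).
split; first by case.
move=> z cz; exists [ffun=> 0]; split; last by move=> c _; apply/ffunP; case.
by exists (h0 _ _) => U s; rewrite big_ord0 subr0; exact: top0.
Qed.

Lemma ext1_slat A B : (forall f, lhom B A f -> f = 0) -> ext_dim (L A) (L B) 1 0.
Proof.
move=> hBA; exists (resL B), (fun i : 'I_0 => match i with Ordinal _ h => False_rect _ (notF h) end).
split; first by case.
move=> z cz; exists [ffun=> 0]; split; last by move=> c _; apply/ffunP; case.
have [v [hv rv]] := rep_ex p0 (z : hom (L A) (Q B)).
have [|w hw] := (rep_cob p0 rv).2; last by exists w => U s; rewrite big_ord0 subr0; exact: hw.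
apply: (serre (G := G)) => // h /hBA ->.
by rewrite -[RHS](om_cst G 0); apply: om_ext => p; rewrite mulmx0 mxtrace0.
Qed.

(** The two-term resolution leaves only degrees zero and one, and in degree one Serre
duality applies. *)
Lemma ext_slat A B : (forall f, lhom B A f -> f = 0) -> forall j : nat, j <> 0%N -> ext_dim (L A) (L B) j 0.
Proof. by move=> h [//|[|j]] _; [exact: ext1_slat|exact: ext_big]. Qed.

Lemma ffun1 (c : {ffun 'I_1 -> k}) x : c ord0 = x -> c = [ffun=> x].
Proof. by move=> <-; apply/ffunP => i; rewrite ffunE ord1. Qed.

Lemma simple_ext A : simple A -> forall j : nat, ext_dim (L A) (L A) j (j <= 1)%N.
Proof.
move=> [A0 sA] [|[|j]]; last exact: ext_big.
- exists (resL A), (fun=> lincl (Lfam (FF := FF) A)); split.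
    by move=> _ U s; exact: (exactR (@incl_exact _ _ _ _ _ _ (@Lfin _ _ _ FF A)) (fun x Ux => ex_intro _ U (ex_intro _ (@subset_refl _ _) (conj Ux (ex_intro _ s (esym (res_id _ _))))))).
  move=> z cz; have [x hx] := @hom_mx _ _ _ _ _ (ft_slat A p0) _ (topfam FF (lr A)) z.
  have hA : lhom A A x.
    move=> p; apply: intm_row => i; have pp := @std_openp _ _ _ _ A p.
    have S0 : oset (std_open A p) !=set0 by exists p.
    have := quoE (@Lfin _ _ _ FF A) (z _ (std p i)) pp.
    have -> : quo (@Lfin _ _ _ FF A) _ (z _ (std p i)) = 0 := cz _ (std p i).
    move=> h; have := fmB (qval0 _ pp) h; rewrite opprB addrC subrK hx // => h'.
    by rewrite !row_mul; exact: h'.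
  have [c ec] := sA x hA; exists [ffun=> c]; split.
    move=> U s; rewrite big_ord1 ffunE; apply/eqP; rewrite subr_eq0; apply/eqP; apply: lsec_eq => U0.
    by rewrite lvalZ germ_cst // (hx U s U0) ec mul_mx_scalar.
  move=> c' hc'; apply/esym/ffun1; pose i0 := Ordinal A0.
  have S0 : oset (std_open A p0) !=set0 by exists p0; exact: std_openp.
  have := hc' _ (std p0 i0); rewrite big_ord1 => /eqP; rewrite subr_eq0 => /eqP /(congr1 (fun s => lval s)).
  rewrite lvalZ germ_cst // (hx _ (std p0 i0) S0) ec mul_mx_scalar => /eqP.
  rewrite -subr_eq0 -scalerBl scaler_eq0 => /orP[|/eqP r0].
    by rewrite subr_eq0 => /eqP/fmorph_inj ->.
  have := lg_unit A p0; rewrite -row_free_unit -kermx_eq0 => /eqP k0.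
  have : delta_mx 0 i0 *m lg A p0 = 0 :> 'rV_(lr A) by rewrite -rowE; exact: r0.
  move=> /(congr1 (mulmx^~ (invmx (lg A p0)))); rewrite mulmxK ?lg_unit // mul0mx.
  by move=> /rowP/(_ i0); rewrite !mxE !eqxx => /eqP; rewrite oner_eq0.
- pose i0 := Ordinal A0; pose v0 := at_ p0 (delta_mx i0 i0 *m ((unif D p0)^-1)%:M : 'M[K]_(lr A)).
  have hv0 : madele A A v0 by exact: madele_at.
  pose τ (v : X -> 'M[K]_(lr A)) := ω (fun p => \tr (v p)).
  have t0 : τ v0 != 0.
    apply: contraNneq (om_pole G p0) => e; apply/eqP; apply: etrans e; apply: om_ext => p.
    rewrite /v0 /at_; case: eqP => _; last by rewrite mxtrace0.
    by rewrite tr_delta mxE eqxx mulr1n.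
  have crit v : madele A A v -> (exists x, forall p, homp A A p (v p - x)) <-> τ v = 0.
    move=> hv; split=> [[x hx]|e].
      apply/(om_split G (adele_tr hv)); exists (\tr x) => p; have := homp_tr (hx p).
      by rewrite linearB.
    apply: (serre (G := G)) => // h /sA[c ->].
    have -> : ω (fun p => \tr (v p *m (ι c)%:M)) = ω (fun p => ι c * \tr (v p)).
      by apply: om_ext => p; rewrite mul_mx_scalar linearZ.
    by rewrite omZ; [rewrite -/(τ v) e mulr0|exact: adele_tr].
  have [b hb] := hom_ex p0 hv0.
  exists (resL A), (fun=> b); split; first by [].
  move=> z cz; have [v [hv rv]] := rep_ex p0 (z : hom (L A) (Q A)).
  have mv c : madele A A (fun p => ι (- c) *: v0 p + v p).
    have := madeleB hv (madeleM (@madele_cst _ _ _ D A A (ι c)%:M) hv0).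
    by apply: finite_imp => p; rewrite mul_scalar_mx rmorphN scaleNr addrC.
  have tv c : τ (fun p => ι (- c) *: v0 p + v p) = τ v - c * τ v0.
    rewrite /τ; transitivity (ω (fun p => \tr (v p) - ι c * \tr (v0 p))).
      by apply: om_ext => p; rewrite linearD linearZ /= rmorphN mulNr addrC.
    have a0 := adele_tr hv0; rewrite omB ?omZ //; first exact: adele_tr.
    by apply: adeleM => //; exact: adele_cst.
  have key c : cob (hlin (- c) b (z : hom (L A) (Q A))) <-> τ v = c * τ v0.
    rewrite (rep_cob p0 (rep_lin (- c) hb rv)) crit // tv.
    by split=> [/eqP|->]; [rewrite subr_eq0 => /eqP|rewrite subrr].
  have eqv c : (fun U s => hlin (- c) b (z : hom (L A) (Q A)) U s) =
    (fun U (s : sec (L A) U) => z U s - \sum_(i < 1) cstf U ([ffun=> c] i) *: b U s).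
    apply/functional_extensionality_dep => U; apply/funext => s.
    by rewrite big_ord1 ffunE /= cstN scaleNr addrC.
  exists [ffun=> τ v / τ v0]; split.
    have /key[w hw] : τ v = (τ v / τ v0) * τ v0 by rewrite mulfVK.
    exists w => U s; have := hw U s; have := congr1 (fun f => f U s) (eqv (τ v / τ v0)) => /= e <-.
    by rewrite e.
  move=> c' [w hw]; apply/esym/ffun1; apply: (canRL (mulfK t0)); apply/esym/key.
  exists w => U s; have := hw U s; rewrite (@ffun1 c' _ erefl) => <-.
  by rewrite [in LHS]ffunE; exact: (congr1 (fun f => f U s) (eqv (c' ord0))).
Qed.

(** Serre duality turns simplicity into the one-dimensionality of Ext^1, and nondegeneracy
of the pairing holds against every coherent sheaf by the preceding results on principal
parts. *)
Theorem bundle_exceptional (E : omod) r A : bundle E r -> iso E (L A) -> simple A -> elliptically_exceptional E.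
Proof.
move=> bE iE sA.
have cE : coherent E by have [ff] := ft_exists FF p0 (bundle_finite_type bE); exact: (bundle_coherent bE ff).
split => //; first by move=> j; apply: (ext_dim_iso (iso_sym iE) (iso_sym iE)); exact: simple_ext.
move=> F [fF _]; apply: (pairing_iso (iso_sym iE)); have [ff] := ft_exists FF p0 fF.
exists (resL A); split.
  by move=> f hf; apply: (@alpha _ _ _ _ G F A f) => z; have [w hw] := hf z (fun U s => erefl); exists w => U s; exact: hw.
move=> z cz hz; have [|w hw] := @beta _ _ _ _ G F ff A z; last by exists w.
by move=> f; have [w hw] := hz f; exists w => U s; exact: hw.
Qed.
End Exceptional.
End Exceptional.

(** * From a good pair to a helix *)
Module Sufficiency.
Import Defs.
Export Exceptional.
Import Geo.
Import Defs.
Import Order.TTheory GRing.Theory Num.Theory.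
Local Open Scope classical_set_scope.
Local Open Scope ring_scope.

Section Converse.
Variables (k : fieldType) (n : nat) (X : set (pspace k n)) (FF : funfield X).
Local Notation K := (ffK FF).
Local Notation D := (ffD FF).
Local Notation ι := (kinc D).
Local Notation intm := (intm D).
Local Notation omod := (omod X).
Local Notation lattice := (lattice D).
Local Notation L A := (slat (Lfam (FF := FF) A)).
Variables (p0 : X) (G : genus1 D).

Lemma pw_mem d (B : lattice) p (y : 'rV[K]_(lr (pw d B))) :
  Lfam (FF := FF) (pw d B) p y <-> forall j, Lfam (FF := FF) B p (submxrow (y : 'rV_(\sum_(i < d) lr B)) j).
Proof.
rewrite /= pw_inv -{1}(submxrowK (y : 'rV_(\sum_(i < d) lr B))) mul_mxrow_mxdiag; exact: intm_mxrow.
Qed.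

Lemma triple_mutation d (A B C : lattice) : triple d A B C -> mutation (L B) (L C) (L A).
Proof.
move=> [na [cb [hn hc hs]]].
have /choice[b hb] : forall j, exists f : hom (L B) (L C), forall U s, lval (f U s) = lval s *m cb j.
  by move=> j; apply: (of_lhom p0); have [h _ _] := hc; exact: h.
have /choice[a ha] : forall j, exists f : hom (L A) (L B), forall U s, lval (f U s) = lval s *m na j.
  by move=> j; apply: (of_lhom p0); have [h _ _] := hn; exact: h.
pose N := \mxrow_(j < d) na j; pose M := \mxcol_(j < d) cb j.
pose row U (s : sec (pow (L B) d) U) : 'rV[K]_(\sum_(i < d) lr B) :=
  \mxrow_j lval ((s : {ffun _ -> _}) j : lsec _ U).
have evE U (s : sec (pow (L B) d) U) : lval (evalm b U s) = row U s *m M.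
  rewrite /row mul_mxrow_mxcol evalmE (big_morph (fun s : lsec (Lfam (FF := FF) C) U => lval s)
    (id1 := 0) (op1 := +%R)) //; apply: eq_bigr => j _; exact: hb.
have pwE U (s : sec (L A) U) : row U (powh a U s) = lval s *m N.
  by rewrite /row mul_mxrow; apply/eq_mxrow => j; rewrite ffunE ha.
have rowz U (s t : sec (pow (L B) d) U) : row U s = row U t -> s = t.
  move=> e; apply/ffunP => j; apply: val_inj => /=.
  by have := congr1 (fun y => submxrow y j) e; rewrite !mxrowK.
have near (p : X) (Z1 Z2 : lattice) (f : 'M[K]_(lr Z1, lr Z2)) (U : opens X) (x : 'rV[K]_(lr Z1)) : homp Z1 Z2 p f -> oset U p ->
    (forall q, oset U q -> Lfam (FF := FF) Z1 q x) -> exists (V : opens X) (VU : V `<=` U), oset V p /\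
    forall q, oset V q -> Lfam (FF := FF) Z2 q (x *m f).
  move=> hf Up hx; exists (opensI U (Opens (ff_open FF (homp_fin f)))), (@opensIl _ _ _).
  split; first by split => // /=; apply.
  by move=> q [Uq /= /contrapT h]; apply: Lhomp h _; exact: hx.
exists d, b, a; split.
- exact: (basis_of_lbasis p0 hb).
- move=> U t p Up; have [r [s [[_ _ _ hsp] [_ e2 _ _]]]] := hs p.
  have [|V [VU [Vp hV]]] := near p C (pw d B) s U (lval (t : lsec _ U)) hsp Up.
    by move=> q Uq; exact: (@lsecP _ _ _ _ _ (Lfam (FF := FF) C) U t q Uq).
  exists V, VU; split => //; have V0 : oset V !=set0 by exists p.
  have mem j : submxrow (lval (t : lsec _ U) *m s : 'rV_(\sum_(i < d) lr B)) j \in inU (Lfam (FF := FF) B) V.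
    by apply/asboolP; split; [left|move=> q Vq; have /pw_mem h := hV q Vq; exact: h].
  exists ([ffun j => LSec (mem j)] : sec (pow (L B) d) V).
  apply: lsec_eq => _; rewrite evE srE //.
  have -> : row V ([ffun j => LSec (mem j)] : sec (pow (L B) d) V) = lval (t : lsec _ U) *m s.
    by rewrite -[RHS]submxrowK; apply/eq_mxrow => j; rewrite ffunE.
  by rewrite -mulmxA -[M]/(\mxcol_(j < d) cb j : 'M_(lr (pw d B), _)) e2 mulmx1.
- move=> U s e; apply: val_inj => /=; have [r [_ [_ [e1 _ _ _]]]] := hs p0.
  have : lval s *m N = 0.
    by rewrite -pwE e; apply/rowP => j; rewrite mxE [in LHS]ffunE !mxE.
  by move=> /(congr1 (mulmx^~ r)); rewrite -mulmxA e1 mulmx1 mul0mx.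
- move=> U t; split.
    move=> e p Up; have [r [s [[_ _ hr _] [_ _ _ e4]]]] := hs p.
    have [|V [VU [Vp hV]]] := near p (pw d B) A r U (row U t) hr Up.
      move=> q Uq; apply/pw_mem => j; rewrite mxrowK.
      exact: (@lsecP _ _ _ _ _ (Lfam (FF := FF) B) U ((t : {ffun _ -> _}) j) q Uq).
    exists V, VU; split => //; have V0 : oset V !=set0 by exists p.
    have mem : row U t *m r \in inU (Lfam (FF := FF) A) V by apply/asboolP; split; [left|].
    exists (LSec mem); apply: rowz; rewrite pwE /=.
    have -> : row V (res VU t) = row U t.
      by apply/eq_mxrow => j; rewrite ffunE srE.
    have e0 : row U t *m M = 0 by rewrite -evE e.
    by rewrite -mulmxA -[RHS]mulmx1 -e4 mulmxDr [X in _ = _ + X]mulmxA e0 mul0mx addr0.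
  move=> h; apply: lsec_eq => -[p Up]; have [V [VU [Vp [s hs']]]] := h p Up; have V0 : oset V !=set0 by exists p.
  have [r [s0 [_ [_ _ e3 _]]]] := hs p.
  rewrite -(srE VU (evalm b U t) V0) -hom_res -hs' evE pwE -mulmxA e3 mulmx0.
  by [].
Qed.

(** The helix of lattices is transported to sheaves; the terms of index -1 and 0 are
replaced by the given bundles, which are isomorphic to those of the lattices. *)
Theorem converse (Em1 E0 : omod) rm1 r0 (A B : lattice) d (b : 'I_d -> 'M[K]_(lr A, lr B)) :
  bundle Em1 rm1 -> bundle E0 r0 -> iso Em1 (L A) -> iso E0 (L B) -> simple A -> simple B -> lbasis b ->
  numeric d (lr A) (lr B) ->
  exists E : int -> omod, two_periodic_helix E /\ E (-1) = Em1 /\ E 0 = E0.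
Proof.
move=> bm b0 im i0 sA sB hb num.
have gd := good_of_numeric G sA sB hb num.
have [H [Hm1 H0 hgood htrip]] := lattice_helix G gd.
pose E (i : int) : omod := if i == -1 then Em1 else if i == 0 then E0 else L (H i).
have iE i : iso (E i) (L (H i)).
  rewrite /E; case: eqP => [->|_]; first by rewrite Hm1.
  case: eqP => [->|_]; first by rewrite H0.
  by exists (hid _), (hid _).
have bE i : exists r, bundle (E i) r.
  rewrite /E; case: eqP => [_|_]; first by exists rm1.
  by case: eqP => [_|_]; [exists r0|exists (lr (H i)); exact: slat_bundle].
have h0' := helix_hom0 G hgood htrip.
have sH i : simple (H i) by have [[_ s _ _] _] := hgood i.
exists E; split; last by rewrite /E.
split.
- by move=> i; have [r br] := bE i; exact: (bundle_exceptional p0 G br (iE i) (sH i)).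
- move=> i j ij; apply: (ext_dim_iso (iso_sym (iE i)) (iso_sym (iE j))).
  by apply: (ext1_slat p0 G) => f; exact: h0' ij f.
- move=> i; have lt : i - 1 < i by lia.
  apply: of_mutation.
    move=> j j0; apply: (ext_dim_iso (iso_sym (iE _)) (iso_sym (iE _))).
    by apply: (ext_slat p0 G) => // f; exact: h0' lt f.
  apply: (mutation_iso (iso_sym (iE _)) (iso_sym (iE _)) (iso_sym (iE _))).
  exact: triple_mutation (htrip i).
Qed.

Lemma simple_of (E : omod) A r : (0 < r)%N -> lr A = r -> iso E (L A) -> simple_omod E -> simple A.
Proof.
move=> r_gt0 rA [f [f' [h1 h2]]] sE; split; first by rewrite rA.
move=> x /(of_lhom p0)[g hg]; have [c [hc _]] := sE (hcomp f (hcomp g f')); exists c.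
apply: (hom_mx_inj p0) => U s; rewrite -hg.
have [U0|U0] := pselect (oset U !=set0); last by rewrite (sec_empty s 0 U0) !linear0 mul0mx.
have := hc U (f' U s); rewrite /= h2 => /(congr1 (f U)); rewrite h2 linearZZ h2 => ->.
by rewrite lvalZ germ_cst // mul_mx_scalar.
Qed.

Lemma lattice_basis (E F : omod) A B d : iso E (L A) -> iso F (L B) -> hom_dim E F d ->
  exists b : 'I_d -> 'M[K]_(lr A, lr B), lbasis b.
Proof.
move=> [e [e' [k1 k2]]] [f [f' [h1 h2]]] [b hb].
by have [c _ hc] := lbasis_of_basis p0 (hom_basis_iso k1 k2 h1 h2 hb); exists c.
Qed.
End Converse.
End Sufficiency.

(** * Dimensions and ranks along a helix *)
Module HelixDimensions.
Import Defs.
Export Mutations.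
Import all_boot all_order all_algebra.
Import all_classical.
Import mpoly topology_structure subtype_topology.
Import Defs.
Import Order.TTheory GRing.Theory Num.Theory.
Local Open Scope classical_set_scope.
Local Open Scope ring_scope.

Section HelixDims.
Variables (k : fieldType) (n : nat) (X : set (pspace k n)).
Local Notation omod := (omod X).

Lemma exceptional_end (E : omod) : ext_dim E E 0 1 ->
  (forall f : hom E E, exists c, forall U s, f U s = cstf U c *: s) /\
  ~ (forall U (s : sec E U), s = 0).
Proof.
move=> [I [b [cb hb]]].
have nz : ~ (forall U (s : sec E U), s = 0).
  move=> z; have [c [_ uc]] := hb (h0 _ _) (fun U s => linear0 _).
  have h x : c = [ffun=> x].
    by apply: uc => U s; rewrite (z U s) linear0 big1 ?subr0 // => i _; rewrite linear0 scaler0.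
  have := congr1 (fun c : {ffun 'I_1 -> k} => c ord0) (etrans (esym (h 0)) (h 1)).
  by rewrite !ffunE => /eqP; rewrite eq_sym oner_eq0.
split => // f.
have [c1 [h1 _]] := hb (inj_aug I) (fun U s => daug0 I s).
have [c [hc _]] := hb (hcomp f (inj_aug I)) (fun U s => daug0 I (f U s)).
have e1 U s : inj_aug I U s = cstf U (c1 ord0) *: b ord0 U s.
  by have /eqP := h1 U s; rewrite big_ord1 subr_eq0 => /eqP.
have e U s : inj_aug I U (f U s) = cstf U (c ord0) *: b ord0 U s.
  by have /eqP := hc U s; rewrite big_ord1 subr_eq0 => /eqP.
have c10 : c1 ord0 != 0.
  apply/eqP => z; apply: nz => U s; apply: (@inj_aug_mono _ _ _ _ I).
  by rewrite e1 z cst0 scale0r.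
exists (c ord0 / c1 ord0) => U s; apply/eqP; rewrite -subr_eq0; apply/eqP.
apply: (@inj_aug_mono _ _ _ _ I); rewrite linearB linearZZ e e1 scalerA -cstM mulfVK // subrr.
by [].
Qed.

(** A map f with every product f w equal to zero vanishes by nondegeneracy, and all these
products vanish when there are no classes w. *)
Lemma pairing_hom0 (E F : omod) : pairing_nondegenerate E F -> ext_dim F E 1 0 ->
  forall (f : hom E F) U s, f U s = 0.
Proof.
move=> [I [p1 _]] e1 f U s; apply: p1 => z cz.
have [w hw] := ext1_zero (J := I) e1 cz.
by exists (hcomp f w) => V t; rewrite hw.
Qed.

Lemma inj_lin (E : omod) m (j : 'I_m) U : linear (fun s : sec E U => [ffun i => if i == j then s else 0] : sec (pow E m) U).
Proof. by move=> c s t; apply/ffunP => i; rewrite !ffunE; case: eqP => // _; rewrite scaler0 addr0. Qed.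
Lemma inj_res (E : omod) m (j : 'I_m) (U V : opens X) (VU : V `<=` U) (s : sec E U) :
  ([ffun i => if i == j then res VU s else 0] : sec (pow E m) V) = res VU ([ffun i => if i == j then s else 0] : sec (pow E m) U).
Proof. by apply/ffunP => i; rewrite !ffunE; case: eqP => // _; rewrite res0. Qed.
Definition inj_j (E : omod) m (j : 'I_m) : hom E (pow E m) := mkhom (@inj_lin E m j) (@inj_res E m j).

Lemma pow_dec (E : omod) m U (s : sec (pow E m) U) : s = \sum_j inj_j E j U ((s : {ffun _ -> _}) j).
Proof.
apply/ffunP => i; rewrite (big_morph (fun s : {ffun 'I_m -> sec E U} => s i) (id1 := 0) (op1 := +%R)).
- by rewrite (bigD1 i) //= ffunE eqxx big1 ?addr0 // => j ji; rewrite ffunE eq_sym (negPf ji).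
- by move=> x y; rewrite ffunE.
- by rewrite ffunE.
Qed.

(** Apply Hom(-, E) to 0 -> L -> E^m -> F -> 0. Independence follows from Hom(F, E) = 0, and
spanning from the duality between Hom(E, F) and Ext^1(F, E). *)
Lemma mutation_basis (E F L : omod) m (b : 'I_m -> hom E F) (a : 'I_m -> hom L E) :
  pairing_nondegenerate E F -> ext_dim E E 0 1 -> (forall (f : hom F E) U s, f U s = 0) ->
  hom_basis b -> epi (evalm b) -> mono (powh a) -> exact_at (powh a) (evalm b) -> hom_basis a.
Proof.
move=> [I [_ p2]] /exceptional_end[sE nzE] FE hb eb ma ea g.
have zev U s : evalm b U (powh a U s) = 0.
  apply: (exactR ea) => x Ux; exists U, (@subset_refl _ _); split => //.
  by exists s; rewrite res_id.
have bE j U s : evalm b U (inj_j E j U s) = b j U s.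
  rewrite evalmE (bigD1 j) //= ffunE eqxx big1 ?addr0 // => i ij.
  by rewrite ffunE (negPf ij) linear0.
have [w hw] := @inj_objP _ _ _ _ I 0%N _ _ (powh a) (hcomp g (inj_aug I)) ma.
have [|z hz] := @factor_epi _ _ _ _ _ _ (evalm b) (hcomp w (inj_d I 0%N)) eb.
  move=> U s /(exactL ea) h; apply: local_eq => x Ux; have [V [VU [Vx [t ht]]]] := h x Ux.
  by exists V, VU; split => //; rewrite -hom_res -ht /= hw res0 /= daug0.
have cz : cocycle z.
  move=> U s; apply: local_eq => x Ux; have [V [VU [Vx [t ht]]]] := eb U s x Ux.
  by exists V, VU; split => //; rewrite -!hom_res -ht hz /= dd0 res0.
have [u hu] : coboundary (I := I) (j := 1) (fun U s => z U s).
  apply: p2 => // f; have [c [hc _]] := hb f.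
  pose W U (s : sec E U) : sec (pow E m) U := [ffun j => cstf U (c j) *: s].
  have Wlin U : linear (@W U).
    by move=> r s t; apply/ffunP => j; rewrite !ffunE scalerDr !scalerA mulrC.
  have Wres (U V : opens X) (VU : V `<=` U) s : W V (res VU s) = res VU (W U s).
    by apply/ffunP => j; rewrite !ffunE resZ restr_cst.
  exists (hcomp (mkhom Wlin Wres) w) => U s /=.
  have -> : f U s = evalm b U (W U s).
    by rewrite hc evalmE; apply: eq_bigr => j _; rewrite ffunE linearZZ.
  by rewrite hz.
pose w' := hlin (-1) (hcomp (evalm b) u) w.
have w'E U s : w' U s = w U s - u U (evalm b U s).
  by rewrite /= cstN cst1 scaleN1r addrC.
have dw' U s : inj_d I 0%N U (w' U s) = 0.
  by rewrite w'E linearB -hu hz subrr.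
have [c [c' [k1 k2]]] := iso_ker (@inj_aug_mono _ _ _ _ I) (@inj_aug_exact _ _ _ _ I).
have [w2 hw2] := corestr dw'.
have [f [f' [j1 j2 af]]] : exists (f : hom E (ker (inj_d I 0%N))) (f' : hom (ker (inj_d I 0%N)) E),
   [/\ forall U s, f' U (f U s) = s, forall U s, f U (f' U s) = s & forall U s, kval (f U s) = inj_aug I U s].
  have [|a' ha'] := @corestr _ _ _ E _ _ (inj_d I 0%N) (inj_aug I); first by move=> U s; exact: daug0.
  have ma' : mono a' by move=> U s e; apply: (@inj_aug_mono _ _ _ _ I); rewrite -ha' e.
  have [|g' hg'] := @factor_epi _ _ _ _ _ _ a' (hid E) _ (fun U s => @ma' U s).
    move=> U t x Ux; have h := exactL (@inj_aug_exact _ _ _ _ I) (corestr_kval t).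
    have [V [VU [Vx [s hs]]]] := h x Ux.
    by exists V, VU; split => //; exists s; apply: val_inj; rewrite /= ha'.
  exists a', g'; split => // U t; apply: local_eq => x Ux.
  have h := exactL (@inj_aug_exact _ _ _ _ I) (corestr_kval t); have [V [VU [Vx [s hs]]]] := h x Ux.
  exists V, VU; split => //; have -> : res VU t = a' V s by apply: val_inj; rewrite /= ha'.
  rewrite -!hom_res; have -> : res VU t = a' V s by apply: val_inj; rewrite /= ha'.
  by rewrite hg'.
pose gh := hcomp w2 f'.
have ghE U s : inj_aug I U (gh U s) = w' U s by rewrite -af /= j2 hw2.
have gha U s : gh U (powh a U s) = g U s.
  apply/eqP; rewrite -subr_eq0; apply/eqP; apply: (@inj_aug_mono _ _ _ _ I).
  by rewrite linearB ghE w'E zev linear0 subr0 hw subrr.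
have /choice[x hx] : forall j, exists c, forall U s, gh U (inj_j E j U s) = cstf U c *: s.
  by move=> j; have [y hy] := sE (hcomp (inj_j E j) gh); exists y.
exists [ffun j => x j]; split.
  move=> U s; rewrite -gha (pow_dec (powh a U s)) linear_sum; apply: eq_bigr => j _.
  by rewrite hx !ffunE.
have indep (y : 'I_m -> k) : (forall U s, \sum_j cstf U (y j) *: a j U s = 0) -> forall j, y j = 0.
  move=> hy j.
  pose P U (s : sec (pow E m) U) : sec E U := \sum_j cstf U (y j) *: (s : {ffun _ -> _}) j.
  have Plin U : linear (@P U).
    move=> r s t; rewrite /P scaler_sumr -big_split; apply: eq_bigr => i _ /=.
    by rewrite !ffunE scalerDr !scalerA mulrC.
  have Pres (U V : opens X) (VU : V `<=` U) s : P V (res VU s) = res VU (P U s).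
    by rewrite /P res_sum; apply: eq_bigr => i _; rewrite ffunE resZ restr_cst.
  have [|f2 hf2] := @factor_epi _ _ _ _ _ _ (evalm b) (mkhom Plin Pres) eb.
    move=> U s /(exactL ea) h; apply: local_eq => p Up; have [V [VU [Vp [t ht]]]] := h p Up.
    exists V, VU; split => //; rewrite res0 -hom_res -ht; apply: etrans (hy V t).
    by apply: eq_bigr => i _; rewrite ffunE.
  apply: contrapT => /eqP yj; apply: nzE => U s.
  have : mkhom Plin Pres U (inj_j E j U s) = 0 by rewrite -hf2 FE.
  rewrite /= /P (bigD1 j) //= ffunE eqxx big1 ?addr0 => [|i ij]; last by rewrite ffunE (negPf ij) scaler0.
  by move=> /(congr1 (fun t => cstf U (y j)^-1 *: t)); rewrite scaler0 scalerA -cstM mulVf // cst1 scale1r.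
move=> c2 hc2; apply/ffunP => j; rewrite ffunE; apply/eqP; rewrite -subr_eq0; apply/eqP.
apply: (indep (fun j => x j - c2 j)) => U s.
have : g U s - g U s = 0 by rewrite subrr.
rewrite {1}hc2 => /(congr1 -%R); rewrite oppr0 opprB => e; apply: etrans e.
have -> : g U s = \sum_j cstf U (x j) *: a j U s.
  rewrite -gha (pow_dec (powh a U s)) linear_sum; apply: eq_bigr => i _; by rewrite hx !ffunE.
by rewrite -sumrB; apply: eq_bigr => i _; rewrite cstD cstN scalerBl.
Qed.

(** The mutation sequence of E i presents E (i - 2) inside a power of E (i - 1), and the
number of copies is at once the dimension on either side. *)
Lemma helix_step (E : int -> omod) : two_periodic_helix E -> forall i m m' (b : 'I_m -> hom (E (i - 1)) (E i))
  (b' : 'I_m' -> hom (E (i - 2)) (E (i - 1))), hom_basis b -> hom_basis b' -> m = m'.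
Proof.
move=> [ee ex mu] i m m' b b' hb hb'; have [lm im] := mu i.
have [m1 [c [a [hc ec ma ea]]]] := mutation_of lm im.
rewrite (basis_uniq hb hc); apply: basis_uniq hb'.
have [_ e1 p1] := ee (i - 1); have [ci _ p0] := ee i; have [c1 _ _] := ee (i - 1).
have lt : i - 1 < i by lia.
exact: (mutation_basis (p1 _ ci) (e1 0%N) (pairing_hom0 (p0 _ c1) (ex _ _ lt)) hc ec ma ea).
Qed.
End HelixDims.

Lemma int_spread (Z : int -> Prop) i0 : Z i0 -> (forall i, Z i -> Z (i - 1) /\ Z (i + 1)) -> forall i, Z i.
Proof.
move=> z0 h i.
have up (j : nat) : Z (i0 + j%:Z).
  elim: j => [|j IH]; first by rewrite addr0.
  rewrite (_ : i0 + j.+1%:Z = i0 + j%:Z + 1); last by lia.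
  exact: (h _ IH).2.
have down (j : nat) : Z (i0 - j%:Z).
  elim: j => [|j IH]; first by rewrite subr0.
  rewrite (_ : i0 - j.+1%:Z = i0 - j%:Z - 1); last by lia.
  exact: (h _ IH).1.
have [ij|ji] := leP i0 i.
  have -> : i = i0 + `|i - i0|%N%:Z by lia.
  exact: up.
have -> : i = i0 - `|i0 - i|%N%:Z by lia.
exact: down.
Qed.

(** A positive solution of x(i-1) + x(i+1) = d x(i) over all integers cannot be concave,
hence d is at least 2; it is constant for d = 2; for d > 2 the conserved quantity d x y -
x^2 - y^2 has to be positive, for otherwise the sequence is monotone and descends forever in
one direction. *)
Lemma helix_numbers (d : nat) (x : int -> nat) : (forall i : int, (x (i - 2)%R + x i = d * x (i - 1)%R)%N) ->
  (0 < x (-1)%R)%N -> (1 < d)%N /\ (d = 2%N -> x (-1)%R = x 0%R) /\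
  ((2 < d)%N -> (x (-1)%R * x (-1)%R + x 0%R * x 0%R < d * x (-1)%R * x 0%R)%N).
Proof.
move=> rec x1.
have rec' (i : int) : (x (i - 1)%R + x (i + 1)%R = d * x i)%N.
  have := rec (i + 1); rewrite (_ : i + 1 - 2 = i - 1); last by lia.
  by rewrite (_ : i + 1 - 1 = i); last by lia.
pose P v := `[< exists i, x i = v >].
have exP : exists v, P v by exists (x 0); apply/asboolP; exists 0.
case: (ex_minnP exP) => m /asboolP[i0 ei] mmin.
have le j : (m <= x j)%N by apply: mmin; apply/asboolP; exists j.
pose c i : int := (x i)%:Z.
have rc i : c (i - 1) + c (i + 1) = d%:Z * c i by rewrite /c -PoszD rec' PoszM.
pose q i := c i ^+ 2 + c (i - 1) ^+ 2 - d%:Z * c i * c (i - 1).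
have qs i : q (i + 1) = q i.
  rewrite /q; rewrite (_ : i + 1 - 1 = i); last by lia.
  have -> : c (i + 1) = d%:Z * c i - c (i - 1) by rewrite -rc [c (i - 1) + _]addrC addrK.
  ring.
have qn (j : nat) i : q (i + j%:Z) = q i.
  by elim: j => [|j IH]; rewrite ?addr0 // -IH -(qs (i + j%:Z)); congr q; lia.
have qc i j : q i = q j.
  have [ij|ji] := leP i j; [have := qn `|j - i|%N i|have := qn `|i - j|%N j].
    rewrite (_ : i + `|j - i|%N%:Z = j) //; lia.
  rewrite (_ : j + `|i - j|%N%:Z = i) //; lia.
have m0 : (0 < m)%N.
  rewrite lt0n; apply/eqP => z.
  have : x (-1) = 0%N; last by lia.
  apply: (@int_spread (fun i => x i = 0%N) i0); first by rewrite ei.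
  by move=> i xi; have := rec' i; rewrite xi muln0; lia.
have u1 := le (i0 - 1); have v1 := le (i0 + 1); have e := rec' i0; rewrite ei in e.
set u := x (i0 - 1) in u1 e; set v := x (i0 + 1) in v1 e.
split; first by nia.
split.
  move=> d2; have all i : x i = m.
    move: i; apply: (@int_spread (fun i => x i = m) i0) => // i xi.
    have h1 := le (i - 1); have h2 := le (i + 1); have := rec' i; rewrite xi d2.
    by lia.
  by rewrite !all.
move=> d3; have q0 := qc i0 0; rewrite /q sub0r in q0.
have eu : c (i0 - 1) = u%:Z by [].
have ec : c i0 = m%:Z by rewrite /c ei.
rewrite eu ec /c in q0.
have e' : u%:Z + v%:Z = d%:Z * m%:Z by rewrite -PoszD e PoszM.
have neg : m%:Z ^+ 2 + u%:Z ^+ 2 - d%:Z * m%:Z * u%:Z < 0.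
  rewrite -e'; nia.
rewrite q0 /c in neg; rewrite -ltz_nat PoszD !PoszM -subr_lt0; apply: le_lt_trans neg.
rewrite le_eqVlt; apply/orP; left; apply/eqP; ring.
Qed.
End HelixDimensions.

(** * Additivity of ranks *)
Module Ranks.
Import Defs.
Export Sufficiency HelixDimensions.
Import Geo.
Import Defs.
Import Order.TTheory GRing.Theory Num.Theory.
Local Open Scope classical_set_scope.
Local Open Scope ring_scope.

Section Ranks.
Variables (k : fieldType) (n : nat) (X : set (pspace k n)) (FF : funfield X).
Local Notation K := (ffK FF).
Local Notation D := (ffD FF).
Local Notation O := (dO D).
Local Notation germ := (germ FF).
Local Notation omod := (omod X).

Lemma ft_real (F : omod) (ff : ft FF F) m (x : 'I_m -> 'rV[K]_(lr (ftG ff))) (p : X) :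
  exists (U : opens X) (s : 'I_m -> sec F U) (c : K), [/\ oset U p, c != 0 & forall j, lval (ftk ff U (s j)) = c *: x j].
Proof.
have [V [t [T [Vp uT ht hT]]]] := ft_basis ff p.
have [N hN] := denominator D p (fun ji : 'I_m * 'I_(lr (ftG ff)) => (x ji.1 *m invmx T) 0 ji.2).
pose c := unif D p ^+ N; pose y ji := c * (x ji.1 *m invmx T) 0 ji.2.
have fin : finite_set [set q | ~ forall ji, O q (y ji)] by apply: finite_forall => ji; exact: dO_fin.
pose W := opensI V (Opens (ff_open FF fin)).
have Wp : oset W p by split => //= h; apply: h => ji; exact: hN.
have W0 : oset W !=set0 by exists p.
have /choice[a ha] : forall ji, exists a : regfun W, germ a = y ji.
  by move=> ji; apply: germ_glue => // q [_ /= /contrapT h]; exact: h.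
exists W, (fun j => \sum_i a (j, i) *: res (@opensIl _ _ _ : W `<=` V) (t i)), c; split => //.
  by rewrite expf_neq0 // unif_neq0.
move=> j; rewrite ftk_sum -[x j](mulmxKV uT) mulmx_sum_row scaler_sumr; apply: eq_bigr => i _.
by rewrite ftk_res // ht ha scalerA.
Qed.

Lemma ft_tors (F : omod) (ff : ft FF F) (U : opens X) (s : sec F U) : lval (ftk ff U s) = 0 ->
  res (@opensIl _ U (ftV ff)) s = 0.
Proof.
move=> e; apply: (ft_inj (f := ff)); first exact: opensIr.
by rewrite hom_res (_ : ftk ff U s = 0) ?res0 //; apply: val_inj.
Qed.

(** At the generic point the sequence 0 -> L -> E^m -> F -> 0 becomes a short exact sequence
of vector spaces over K. *)
Lemma rank_mutation (p : X) (E F L : omod) (fE : ft FF E) (fF : ft FF F) (fL : ft FF L) m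
  (b : 'I_m -> hom E F) (a : 'I_m -> hom L E) : epi (evalm b) -> mono (powh a) -> exact_at (powh a) (evalm b) ->
  (lr (ftG fL) + lr (ftG fF) = m * lr (ftG fE))%N.
Proof.
move=> eb ma ea.
have /choice[N hN] : forall j, exists N, forall U s, oset U !=set0 -> lval (ftk fE U (a j U s)) = lval (ftk fL U s) *m N.
  by move=> j; have [N hN] := hom_mx fL (hcomp (a j) (ftk fE)); exists N.
have /choice[M hM] : forall j, exists M, forall U s, oset U !=set0 -> lval (ftk fF U (b j U s)) = lval (ftk fE U s) *m M.
  by move=> j; have [M hM] := hom_mx fE (hcomp (b j) (ftk fF)); exists M.
set hL := lr (ftG fL) in N hN *; set hE := lr (ftG fE) in N M hN hM *; set hF := lr (ftG fF) in M hM *.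
pose NN : 'M[K]_(hL, \sum_(j < m) hE) := \mxrow_(j < m) N j.
pose MM : 'M[K]_(\sum_(j < m) hE, hF) := \mxcol_(j < m) M j.
have evE U (s : sec (pow E m) U) : oset U !=set0 ->
    lval (ftk fF U (evalm b U s)) = \sum_j lval (ftk fE U ((s : {ffun _ -> _}) j)) *m M j.
  move=> U0; rewrite evalmE (big_morph (fun s => lval (ftk fF U s)) (@ftkD _ _ _ _ _ fF U) (ftk0 fF U)).
  by apply: eq_bigr => j _; exact: hM.
have inj (x : 'rV[K]_hL) : x *m NN = 0 -> x = 0.
  rewrite mul_mxrow => e.
  have ej j : x *m N j = 0 by have := congr1 (fun y => submxrow y j) e; rewrite mxrowK => ->; apply/matrixP => i l; rewrite !mxE.
  have [U [s [c [Up c0 hs]]]] := ft_real (ff := fL) (fun _ : 'I_1 => x) p.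
  have U0 : oset U !=set0 by exists p.
  have W0 := ff_meet FF U0 (ftV0 fE).
  have s0 : res (@opensIl _ U (ftV fE)) (s ord0) = 0.
    apply: ma; apply/ffunP => j; rewrite !ffunE hom_res; apply: ft_tors.
    by rewrite hN // hs -scalemxAl ej scaler0.
  have := ftk_res fL (@opensIl _ U (ftV fE)) (s ord0) W0; rewrite s0 ftk0 hs => /esym/eqP.
  by rewrite scaler_eq0 (negPf c0) => /eqP.
have fN : row_free NN.
  rewrite -kermx_eq0; apply/eqP/row_matrixP => i; rewrite row0; apply: inj.
  by rewrite -row_mul mulmx_ker row0.
have surj (y : 'rV[K]_hF) : exists x : 'rV[K]_(\sum_(j < m) hE), y = x *m MM.
  have [U [t [c [Up c0 ht]]]] := ft_real (ff := fF) (fun _ : 'I_1 => y) p.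
  have [V [VU [Vp [s hs]]]] := eb U (t ord0) p Up; have V0 : oset V !=set0 by exists p.
  exists (c^-1 *: \mxrow_j lval (ftk fE V ((s : {ffun _ -> _}) j))).
  rewrite -scalemxAl mul_mxrow_mxcol -evE // hs ftk_res // ht scalerA mulVf // scale1r.
  by [].
have fM : row_full MM.
  rewrite -sub1mx; apply/row_subP => i; have [x ->] := surj (row i 1%:M); exact: submxMl.
have kerN (x : 'rV[K]_(\sum_(j < m) hE)) : x *m MM = 0 -> (x <= NN)%MS.
  move=> e; have [U [s [c [Up c0 hs]]]] := ft_real (ff := fE) (fun j : 'I_m => submxrow x j) p.
  have U0 : oset U !=set0 by exists p.
  have e0 : lval (ftk fF U (evalm b U ([ffun j => s j] : sec (pow E m) U))) = 0.
    rewrite evE //; transitivity (c *: (x *m MM)); last by rewrite e scaler0.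
    rewrite -[x in RHS]submxrowK mul_mxrow_mxcol scaler_sumr; apply: eq_bigr => j _.
    by rewrite ffunE hs scalemxAl.
  have := ft_tors e0; rewrite -hom_res => /(exactL ea) h.
  have [q Wq] := ff_meet FF U0 (ftV0 fF).
  have [V [VW [Vq [t ht]]]] := h q Wq; have V0 : oset V !=set0 by exists q.
  have ex : c *: x = lval (ftk fL V t) *m NN.
    rewrite -[LHS]submxrowK mul_mxrow; apply/eq_mxrow => j.
    rewrite -mul_scalar_mx -mul_submxrow mul_scalar_mx -hs -hN //; have /ffunP/(_ j) := ht; rewrite !ffunE => ->.
    by rewrite !ftk_res //; exists q.
  have -> : x = (c^-1 *: lval (ftk fL V t)) *m NN.
    by rewrite -scalemxAl -ex scalerA mulVf // scale1r.
  exact: submxMl.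
have NM : NN *m MM = 0.
  apply/row_matrixP => i; rewrite row0 row_mul.
  have [U [t [c [Up c0 ht]]]] := ft_real (ff := fL) (fun _ : 'I_1 => row i (1%:M : 'M[K]_hL)) p.
  have U0 : oset U !=set0 by exists p.
  have z : evalm b U (powh a U (t ord0)) = 0.
    by apply: (exactR ea) => y Uy; exists U, (@subset_refl _ _); split => //; exists (t ord0); rewrite res_id.
  have := evE U (powh a U (t ord0)) U0; rewrite z ftk0.
  under eq_bigr do rewrite ffunE hN // ht; rewrite -mul_mxrow_mxcol -mul_mxrow -scalemxAl -scalemxAl.
  move=> /esym/eqP; rewrite scaler_eq0 (negPf c0) => /eqP e.
  by rewrite -row_mul -[NN]mul1mx -mulmxA row_mul mulmxA.
have rk : \rank NN = (m * hE - hF)%N.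
  have -> : \rank NN = \rank (kermx MM).
    apply/eqmx_rank/andP; split; first exact/sub_kermxP.
    apply/row_subP => i; apply: kerN; by rewrite -row_mul mulmx_ker row0.
  rewrite mxrank_ker; move: fM; rewrite /row_full => /eqP ->.
  by rewrite sum_nat_const card_ord.
have le : (hF <= m * hE)%N.
  move: fM; rewrite /row_full => /eqP <-; apply: leq_trans (rank_leq_row _) _.
  by rewrite sum_nat_const card_ord.
by move: fN; rewrite /row_free rk => /eqP <-; rewrite subnK.
Qed.
End Ranks.
End Ranks.

(** * Orders and residues *)
Module Residues.
Import Defs.
Export LatticeMutations.
Import Alg.
Import Order.TTheory GRing.Theory Num.Theory.
Local Open Scope classical_set_scope.
Local Open Scope ring_scope.

Section LinearAlgebra.
Variables (k K : fieldType) (ι : {rmorphism k -> K}) (V : lmodType K).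
Definition kb (S : V -> Prop) m (b : 'I_m -> V) :=
  [/\ forall j, S (b j), forall x, S x -> exists c : 'I_m -> k, x = \sum_j ι (c j) *: b j &
      forall c : 'I_m -> k, \sum_j ι (c j) *: b j = 0 -> forall j, c j = 0].

Variables (S S0 : V -> Prop) (r : nat) (φ : V -> 'rV[k]_r).
Hypothesis Szero : S 0.
Hypothesis Slin : forall c x y, S x -> S y -> S (ι c *: x + y).
Hypothesis φlin : forall c x y, S x -> S y -> φ (ι c *: x + y) = c *: φ x + φ y.
Hypothesis S0E : forall x, S0 x <-> S x /\ φ x = 0.

Lemma kb_in m (b : 'I_m -> V) (c : 'I_m -> k) : (forall j, S (b j)) -> S (\sum_j ι (c j) *: b j).
Proof. by move=> hb; elim/big_rec: _ => // j x _ Sx; exact: Slin. Qed.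
Lemma φ0 : φ 0 = 0.
Proof. by have := φlin (-1) Szero Szero; rewrite scaler0 addr0 scaleN1r addNr. Qed.
Lemma kb_phi m (b : 'I_m -> V) (c : 'I_m -> k) : (forall j, S (b j)) ->
  φ (\sum_j ι (c j) *: b j) = (\row_j c j) *m (\matrix_j φ (b j)).
Proof.
move=> hb; rewrite mulmx_sum_row.
have [] : S (\sum_j ι (c j) *: b j) /\ φ (\sum_j ι (c j) *: b j) = \sum_j c j *: φ (b j).
  elim/big_rec2: _ => [|j y x _ [Sx e]]; first by rewrite φ0.
  by split; [exact: Slin|rewrite φlin // e].
by move=> _ ->; apply: eq_bigr => j _; rewrite mxE rowK.
Qed.

(** Rank and nullity for a map from a space with a basis in the sense of kb to row vectors
over k; spaces of homomorphisms are not bundled as vector spaces, so that bases carry the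
dimension. *)
Lemma kb_ker m (b : 'I_m -> V) : kb S b ->
  exists b0 : 'I_(m - \rank (\matrix_j φ (b j))) -> V, kb S0 b0.
Proof.
move=> [hb sp fr]; set Ψ := \matrix_j φ (b j); rewrite -mxrank_ker.
pose B := row_base (kermx Ψ); exists (fun i => \sum_j ι (B i j) *: b j).
have BΨ : B *m Ψ = 0 by apply/sub_kermxP; rewrite eq_row_base.
have comb (c : 'I__ -> k) : \sum_i ι (c i) *: \sum_j ι (B i j) *: b j = \sum_j ι (((\row_i c i) *m B) 0 j) *: b j.
  under eq_bigr do rewrite scaler_sumr; rewrite exchange_big; apply: eq_bigr => j _.
  rewrite mxE rmorph_sum scaler_suml; apply: eq_bigr => i _.
  by rewrite scalerA !mxE rmorphM.
split.
- move=> i; apply/S0E; split; first exact: kb_in.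
  rewrite kb_phi //; have -> : \row_j B i j = row i B by apply/rowP => j; rewrite !mxE.
  by rewrite -row_mul BΨ row0.
- move=> x /S0E[/sp[c ->]]; rewrite kb_phi // => /sub_kermxP h0.
  have /submxP[a ea] : (\row_j c j <= B)%MS by rewrite eq_row_base.
  exists (fun i => a 0 i); rewrite comb; apply: eq_bigr => j _; congr (ι _ *: _).
  have -> : \row_i a 0 i = a by apply/rowP => i; rewrite mxE.
  by rewrite -ea mxE.
- move=> c; rewrite comb => /fr h i.
  have : (\row_i c i) *m B = 0 by apply/rowP => j; rewrite h mxE.
  move=> /eqP; rewrite mulmx_free_eq0 ?row_base_free // => /eqP/rowP/(_ i); by rewrite !mxE.
Qed.

Lemma kb_ext m (b : 'I_m -> V) l (Z : 'M[k]_(l, r)) : kb S0 b -> row_free Z ->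
  (forall x, S x -> (φ x <= Z)%MS) -> (forall i, exists2 x, S x & φ x = row i Z) ->
  exists b' : 'I_(m + l) -> V, kb S b'.
Proof.
move=> [hb sp fr] fZ hZ hx.
have /choice[x hx'] : forall i, exists x, S x /\ φ x = row i Z by move=> i; have [x h1 h2] := hx i; exists x.
have Sb j : S (b j) by have /S0E[] := hb j.
have φb j : φ (b j) = 0 by have /S0E[] := hb j.
have Sx i : S (x i) := (hx' i).1.
pose b' (i : 'I_(m + l)) := match fintype.split i with inl j => b j | inr j => x j end.
have bl j : b' (lshift l j) = b j by rewrite /b'; case: fintype.splitP => j' /= e; [congr b; exact: val_inj|have := ltn_ord j; rewrite e ltnNge leq_addr].
have br j : b' (rshift m j) = x j by rewrite /b'; case: fintype.splitP => j' /= e; [have := ltn_ord j'; rewrite -e ltnNge leq_addr|congr x; apply: val_inj; move/addnI: e].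
have sumE (c : 'I_(m + l) -> k) : \sum_i ι (c i) *: b' i =
    \sum_j ι (c (lshift l j)) *: b j + \sum_j ι (c (rshift m j)) *: x j.
  by rewrite big_split_ord /=; congr (_ + _); apply: eq_bigr => j _; rewrite ?bl ?br.
have φx (c : 'I_l -> k) : φ (\sum_j ι (c j) *: x j) = (\row_j c j) *m Z.
  rewrite kb_phi //; congr (_ *m _); apply/row_matrixP => i; by rewrite rowK (hx' i).2.
have φs (c : 'I_m -> k) : φ (\sum_j ι (c j) *: b j) = 0.
  by rewrite kb_phi // (_ : \matrix_j _ = 0) ?mulmx0 //; apply/row_matrixP => i; rewrite rowK row0.
exists b'; split.
- by move=> i; rewrite /b'; case: fintype.split => j.
- move=> y Sy; have /submxP[a ea] := hZ y Sy.
  pose y2 := \sum_j ι (a 0 j) *: x j.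
  have S2 : S y2 by exact: kb_in.
  have e2 : φ y2 = φ y by rewrite φx ea; congr (_ *m _); apply/rowP => j; rewrite mxE.
  have : S0 (ι (-1) *: y2 + y) by apply/S0E; rewrite φlin // e2 scaleN1r addNr; split => //; exact: Slin.
  move=> /sp[c ec]; exists (fun i => match fintype.split i with inl j => c j | inr j => a 0 j end).
  rewrite sumE.
  have -> : \sum_j ι (match fintype.split (lshift l j) with inl j => c j | inr j => a 0 j end) *: b j = ι (-1) *: y2 + y.
    rewrite ec; apply: eq_bigr => j _; congr (ι _ *: _).
    by case: fintype.splitP => j' /= e; [congr c; exact: val_inj|have := ltn_ord j; rewrite e ltnNge leq_addr].
  have -> : \sum_j ι (match fintype.split (rshift m j) with inl j => c j | inr j => a 0 j end) *: x j = y2.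
    apply: eq_bigr => j _; congr (ι _ *: _).
    by case: fintype.splitP => j' /= e; [have := ltn_ord j'; rewrite -e ltnNge leq_addr|congr (a 0 _); apply: val_inj; move/addnI: e].
  by rewrite rmorphN rmorph1 scaleN1r addrAC addNr add0r.
- move=> c; rewrite sumE => e.
  have e1 : \row_j c (rshift m j) = 0.
    have : φ (ι 1 *: \sum_j ι (c (lshift l j)) *: b j + \sum_j ι (c (rshift m j)) *: x j) = 0.
      by rewrite rmorph1 scale1r e φ0.
    rewrite (φlin 1 (kb_in _ Sb) (kb_in _ Sx)) (φs (fun j => c (lshift l j))) (φx (fun j => c (rshift m j))) scaler0 add0r => /eqP; rewrite mulmx_free_eq0 // => /eqP.
    by [].
  have cr j : c (rshift m j) = 0 by have /rowP/(_ j) := e1; rewrite !mxE.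
  have cl : forall j, c (lshift l j) = 0.
    apply: fr; apply: etrans e; rewrite [X in _ = _ + X]big1 ?addr0 // => j _.
    by rewrite cr rmorph0 scale0r.
  by move=> i; rewrite -(splitK i); case: (fintype.split i) => j /=.
Qed.
End LinearAlgebra.

Section Ord.
Variables (k K : fieldType) (P : choiceType) (D : dvrs k K P).
Local Notation O := (dO D).
Local Notation ι := (kinc D).
Local Notation π := (unif D).

(** The order is a relation because the valuation is given through uniformizers. *)
Definition isord p x (m : int) := exists u, [/\ O p u, O p u^-1, u != 0 & x = u * π p ^ m].
Lemma unif_pow p (m : int) : O p (π p ^ m) -> 0 <= m.
Proof.
case: m => // m h; case: (unif_nunit (d := D) (p := p)).
have -> : (π p)^-1 = π p ^ (Negz m) * π p ^+ m.
  by rewrite NegzE -exprnN exprS invfM -mulrA mulVf ?mulr1 // expf_neq0 // unif_neq0.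
by apply: dOM => //; apply: dOX; exact: dO_unif.
Qed.
Lemma isord_ge p x m : isord p x m -> O p x <-> 0 <= m.
Proof.
move=> [u [hu hu' u0 ->]]; split.
  by move=> h; apply: (@unif_pow p); rewrite -[_ ^ m](mulKf u0); exact: dOM.
by case: m => // m _; apply: dOM => //; apply: dOX; exact: dO_unif.
Qed.
Lemma isordM p x y m m' : isord p x m -> isord p y m' -> isord p (x * y) (m + m').
Proof.
move=> [u [hu hu' u0 ->]] [v [hv hv' v0 ->]]; exists (u * v); split; rewrite ?invfM ?mulf_neq0 //; try exact: dOM.
by rewrite expfzDr ?unif_neq0 // mulrACA.
Qed.
Lemma isordV p x m : isord p x m -> isord p x^-1 (- m).
Proof.
move=> [u [hu hu' u0 ->]]; exists u^-1; rewrite invrK invr_eq0; split => //.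
by rewrite invfM invr_expz.
Qed.
Lemma isord_ex p x : x != 0 -> exists m, isord p x m.
Proof.
move=> x0; have [u [m [hu hu' e]]] := dO_fact D p x0; exists m, u; split => //.
by apply: contraNneq x0 => u0; rewrite e u0 mul0r.
Qed.
Lemma isord0 p x : O p x -> O p x^-1 -> x != 0 -> isord p x 0.
Proof. by move=> h h' x0; exists x; rewrite expr0z mulr1. Qed.
Lemma isord_neq0 p x m : isord p x m -> x != 0.
Proof. by move=> [u [_ _ u0 ->]]; rewrite mulf_neq0 // expfz_neq0 // unif_neq0. Qed.
Lemma isord_uniq p x m m' : isord p x m -> isord p x m' -> m = m'.
Proof.
move=> h h'; have x0 := isord_neq0 h.
have O1 : O p (x * x^-1) by rewrite mulfV //; exact: dO1.
have O2 : O p (x^-1 * x) by rewrite mulVf //; exact: dO1.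
have /(isord_ge (isordM h (isordV h'))) a := O1; have /(isord_ge (isordM (isordV h) h')) b := O2.
by lia.
Qed.
Lemma isord_unif p : isord p (π p) 1.
Proof. by exists 1; rewrite invr1 oner_neq0 expr1z mul1r; split => //; exact: dO1. Qed.

Lemma inc_unit p c : O p ((π p)^-1 * ι c) -> c = 0.
Proof.
move=> h; apply: contrapT => /eqP c0; case: (unif_nunit (d := D) (p := p)).
rewrite -(mulfK (_ : ι c != 0) (π p)^-1) ?fmorph_eq0 // -fmorphV; apply: dOM => //; exact: dO_inc.
Qed.

Definition resid p x : k := if pselect (O p x) is left h then projT1 (cid (dO_res h)) else 0.
Lemma residP p x : O p x -> O p ((π p)^-1 * (x - ι (resid p x))).
Proof.
move=> Ox; rewrite /resid; case: pselect => // h; case: cid => c /= [y [Oy e]].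
by rewrite {1}e addrC addKr mulKf ?unif_neq0.
Qed.
Lemma resid_eq p x c : O p x -> O p ((π p)^-1 * (x - ι c)) -> resid p x = c.
Proof.
move=> Ox h; apply/eqP; rewrite -subr_eq0; apply/eqP/(@inc_unit p).
have := dOB h (residP Ox); rewrite -mulrBr opprB addrC addrA subrK rmorphB.
by [].
Qed.
Lemma resid0 p x : O p x -> (resid p x = 0 <-> O p ((π p)^-1 * x)).
Proof.
move=> Ox; split=> [e|h]; first by have := residP Ox; rewrite e rmorph0 subr0.
by apply: resid_eq => //; rewrite rmorph0 subr0.
Qed.
Lemma resid_lin p c x y : O p x -> O p y -> resid p (ι c * x + y) = c * resid p x + resid p y.
Proof.
move=> Ox Oy; apply: resid_eq; first by apply: dOD => //; apply: dOM => //; exact: dO_inc.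
have := dOD (dOM (dO_inc D p c) (residP Ox)) (residP Oy).
by rewrite mulrCA -mulrDr rmorphD rmorphM mulrBr addrACA -opprD.
Qed.
Lemma residM p x y : O p x -> O p y -> resid p (x * y) = resid p x * resid p y.
Proof.
move=> Ox Oy; apply: resid_eq; first exact: dOM.
have := dOD (dOM (residP Ox) Oy) (dOM (dO_inc D p (resid p x)) (residP Oy)).
by rewrite mulrBr mulrBl mulrCA -[_ * x * y]mulrA -[_ * _ * y]mulrA -mulrBr -mulrDr rmorphM mulrBr addrA subrK.
Qed.
Lemma resid_inc p c : resid p (ι c) = c.
Proof. by apply: resid_eq; [exact: dO_inc|rewrite subrr mulr0; exact: dO0]. Qed.
Lemma resid_sum p (I : finType) (F : I -> K) : (forall i, O p (F i)) -> resid p (\sum_i F i) = \sum_i resid p (F i).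
Proof.
move=> h; have [] : O p (\sum_i F i) /\ resid p (\sum_i F i) = \sum_i resid p (F i); last by [].
elim/big_rec2: _ => [|i y x _ [Ox e]].
  by split; [exact: dO0|apply: resid_eq; [exact: dO0|rewrite rmorph0 subrr mulr0; exact: dO0]].
split; first exact: dOD.
by have := resid_lin 1 (h i) Ox; rewrite rmorph1 !mul1r => ->; rewrite e.
Qed.
End Ord.
End Residues.

(** * Elementary modifications *)
Module Modifications.
Import Defs.
Export Residues.
Import Alg.
Import Order.TTheory GRing.Theory Num.Theory.
Local Open Scope classical_set_scope.
Local Open Scope ring_scope.

Section Modification.
Variables (k K : fieldType) (P : choiceType) (D : dvrs k K P) (G : genus1 D).
Local Notation O := (dO D).
Local Notation ι := (kinc D).
Local Notation π := (unif D).
Local Notation intm := (intm D).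
Local Notation lattice := (lattice D).
Local Notation ω := (om G).

Definition hd (A B : lattice) m := exists b : 'I_m -> 'M[K]_(lr A, lr B), lbasis b.

Section Lmod.
Variables (B : lattice) (p : P) (h : 'M[K]_(lr B)).
Definition lmod_fun q := if q == p then h *m lg B q else lg B q.
Hypothesis uh : h \in unitmx.
Lemma lmod_unit q : lmod_fun q \in unitmx.
Proof. by rewrite /lmod_fun; case: eqP => _; rewrite ?unitmx_mul ?uh lg_unit. Qed.
Lemma lmod_fin : finite_set [set q | ~ (intm q (lmod_fun q) /\ intm q (invmx (lmod_fun q)))].
Proof.
apply: (@sub_finite_set _ _ ([set q | ~ (intm q (lg B q) /\ intm q (invmx (lg B q)))] `|` [set p])).
  by move=> q /=; rewrite /lmod_fun; case: eqP => [->|_] hq; [right|left].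
by rewrite finite_setU; split; [exact: lg_fin|exact: finite_set1].
Qed.
(** An elementary modification multiplies the lattice at one point by a matrix; a diagonal
matrix with one entry a uniformizer changes the degree by one. *)
Definition lmod : lattice := Lattice lmod_unit lmod_fin.
Lemma lmodp : lg lmod p = h *m lg B p.
Proof. by rewrite /= /lmod_fun eqxx. Qed.
Lemma lmodq q : q <> p -> lg lmod q = lg B q.
Proof. by rewrite /= /lmod_fun; case: eqP. Qed.
End Lmod.

Section Up.
Variables (A B : lattice) (p : P) (i0 : 'I_(lr B)).
Definition Ed (x : K) : 'M[K]_(lr B) := diag_mx (\row_j if j == i0 then x else 1).
Lemma Ed_mul x y : Ed x *m Ed y = Ed (x * y).
Proof.
rewrite /Ed mulmx_diag; congr diag_mx; apply/rowP => j; rewrite !mxE.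
by case: eqP => _; rewrite ?mulr1.
Qed.
Lemma Ed1 : Ed 1 = 1%:M.
Proof. by rewrite /Ed -diag_const_mx; congr diag_mx; apply/rowP => j; rewrite !mxE; case: eqP. Qed.
Lemma Ed_unit x : x != 0 -> Ed x \in unitmx /\ invmx (Ed x) = Ed x^-1.
Proof.
move=> x0; have e : Ed x *m Ed x^-1 = 1%:M by rewrite Ed_mul mulfV // Ed1.
have [u _] := mulmx1_unit e; split => //.
by rewrite -[RHS](mulKmx u) e mulmx1.
Qed.
Lemma Ed_l x m (M : 'M[K]_(lr B, m)) i j : (Ed x *m M) i j = (if i == i0 then x else 1) * M i j.
Proof. by rewrite /Ed mul_diag_mx !mxE. Qed.
Lemma Ed_r x m (M : 'M[K]_(m, lr B)) i j : (M *m Ed x) i j = M i j * (if j == i0 then x else 1).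
Proof. by rewrite /Ed mul_mx_diag !mxE. Qed.

Let uE := (Ed_unit (unif_neq0 D p)).1.
Let iE := (Ed_unit (unif_neq0 D p)).2.
Let C := lmod p uE.
Let R := lg A p.
Let S := lg B p.
Let lgC : lg C p = Ed (π p) *m S. Proof. exact: lmodp. Qed.
Let lgCi : invmx (lg C p) = invmx S *m Ed (π p)^-1.
Proof.
have uC := lg_unit C p; have uS := lg_unit B p.
have e : lg C p *m (invmx S *m Ed (π p)^-1) = 1%:M.
  by rewrite lgC mulmxA -[_ *m S *m _]mulmxA mulmxV // mulmx1 Ed_mul mulfV ?Ed1 // unif_neq0.
by rewrite -[RHS](mulKmx uC) e mulmx1.
Qed.

Definition colres (f : 'M[K]_(lr A, lr B)) := \row_j resid D p ((R *m f *m invmx S) j i0).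
Definition rowres (h : 'M[K]_(lr B, lr A)) := \row_j resid D p ((Ed (π p) *m S *m h *m invmx R) i0 j).

Lemma colresE f j : colres f 0 j = resid D p ((R *m f *m invmx S) j i0).
Proof. by rewrite mxE. Qed.
Lemma rowresE h j : rowres h 0 j = resid D p ((Ed (π p) *m S *m h *m invmx R) i0 j).
Proof. by rewrite mxE. Qed.
Lemma colres0 f : colres f = 0 <-> forall j, resid D p ((R *m f *m invmx S) j i0) = 0.
Proof.
split=> [/rowP h j|h]; first by have := h j; rewrite mxE => ->; rewrite mxE.
by apply/rowP => j; rewrite mxE h mxE.
Qed.
Lemma rowres0 h : rowres h = 0 <-> forall j, resid D p ((Ed (π p) *m S *m h *m invmx R) i0 j) = 0.
Proof.
split=> [/rowP e j|e]; first by have := e j; rewrite mxE => ->; rewrite mxE.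
by apply/rowP => j; rewrite mxE e mxE.
Qed.

Lemma off_A (f : 'M[K]_(lr A, lr B)) q : q <> p -> homp A C q f <-> homp A B q f.
Proof. by move=> qp; rewrite /homp lmodq. Qed.
Lemma off_C (h : 'M[K]_(lr B, lr A)) q : q <> p -> homp C A q h <-> homp B A q h.
Proof. by move=> qp; rewrite /homp lmodq. Qed.
Lemma homC (h : 'M[K]_(lr B, lr A)) : homp C A p h <-> intm p (Ed (π p) *m S *m h *m invmx R).
Proof. by rewrite /homp lgC. Qed.
Lemma hom_AC (f : 'M[K]_(lr A, lr B)) : homp A C p f <-> homp A B p f /\ colres f = 0.
Proof.
have eF : R *m f *m invmx (lg C p) = (R *m f *m invmx S) *m Ed (π p)^-1 by rewrite lgCi mulmxA.
rewrite /homp eF; set F := R *m f *m invmx S; split.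
  move=> hF; have iF : intm p F.
    move=> i j; have := hF i j; rewrite Ed_r; case: eqP => _; last by rewrite mulr1.
    by move=> /(dOM (dO_unif D p)); rewrite mulrCA mulfV ?mulr1 // unif_neq0.
  split => //; apply/colres0 => j; apply/resid0; first exact: iF.
  by have := hF j i0; rewrite Ed_r eqxx mulrC.
move=> [iF /colres0 r0] i j; rewrite Ed_r; case: eqP => [->|_]; last by rewrite mulr1.
by rewrite mulrC; apply/resid0; [exact: iF|exact: r0].
Qed.
Lemma hom_BA (h : 'M[K]_(lr B, lr A)) : homp B A p h <-> homp C A p h /\ rowres h = 0.
Proof.
rewrite homC rowres0; have eH : Ed (π p) *m S *m h *m invmx R = Ed (π p) *m (S *m h *m invmx R) by rewrite !mulmxA.
rewrite eH; set H := S *m h *m invmx R; split.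
  move=> hH; have iH : intm p (Ed (π p) *m H).
    by move=> i j; rewrite Ed_l; apply: dOM; [case: eqP => _; [exact: dO_unif|exact: dO1]|exact: hH].
  split => // j; apply/resid0; first exact: iH.
  by rewrite Ed_l eqxx mulKf ?unif_neq0 //; exact: hH.
move=> [iH r0] i j; have [->|ni] := eqVneq i i0.
  have := r0 j => /(resid0 (iH _ _)).
  by rewrite Ed_l eqxx mulKf ?unif_neq0.
by have := iH i j; rewrite Ed_l (negPf ni) mul1r.
Qed.
Lemma lhom_AC f : lhom A C f <-> lhom A B f /\ colres f = 0.
Proof.
split=> [h|[h r0] q].
  split; last by have [] := (hom_AC f).1 (h p).
  by move=> q; have [->|/eqP qp] := eqVneq q p; [have [] := (hom_AC f).1 (h p)|apply/(off_A f qp)].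
by have [->|/eqP qp] := eqVneq q p; [apply/hom_AC|apply/(off_A f qp)].
Qed.
Lemma lhom_BA h : lhom B A h <-> lhom C A h /\ rowres h = 0.
Proof.
split=> [hh|[hh r0] q].
  split; last by have [] := (hom_BA h).1 (hh p).
  by move=> q; have [->|/eqP qp] := eqVneq q p; [have [] := (hom_BA h).1 (hh p)|apply/(off_C h qp)].
by have [->|/eqP qp] := eqVneq q p; [apply/hom_BA|apply/(off_C h qp)].
Qed.

Lemma colres_lin c f g : lhom A B f -> lhom A B g -> colres (ι c *: f + g) = c *: colres f + colres g.
Proof.
move=> hf hg; apply/rowP => j; rewrite [RHS]mxE [X in _ = X + _]mxE !colresE -resid_lin; [|exact: hf|exact: hg].
by congr resid; rewrite mulmxDr mulmxDl -scalemxAr -scalemxAl mxE [X in X + _]mxE.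
Qed.
Lemma rowres_lin c f g : lhom C A f -> lhom C A g -> rowres (ι c *: f + g) = c *: rowres f + rowres g.
Proof.
move=> hf hg; apply/rowP => j; rewrite [RHS]mxE [X in _ = X + _]mxE !rowresE -resid_lin; [|exact: (homC f).1 (hf p) _ _|exact: (homC g).1 (hg p) _ _].
by congr resid; rewrite mulmxDr mulmxDl -scalemxAr -scalemxAl mxE [X in X + _]mxE.
Qed.

(** The trace of f h is regular away from p and has at most a simple pole at p; om kills
constants, so the residue of this pole is zero. *)
Lemma res_orth f h : lhom A B f -> lhom C A h -> \sum_j colres f 0 j * rowres h 0 j = 0.
Proof.
move=> hf hh; pose F := R *m f *m invmx S; pose H := Ed (π p) *m S *m h *m invmx R.
have iF : intm p F := hf p; have iH : intm p H by apply/homC.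
have eT : \tr (f *m h) = \sum_i (\sum_j F j i * H i j) * (if i == i0 then (π p)^-1 else 1).
  transitivity (\tr (F *m (Ed (π p)^-1 *m H))).
    rewrite /F /H !mulmxA -[_ *m Ed (π p)^-1 *m Ed (π p)]mulmxA Ed_mul mulVf ?unif_neq0 // Ed1 mulmx1.
    rewrite -[_ *m invmx S *m S]mulmxA mulVmx ?lg_unit // mulmx1 [RHS]mxtrace_mulC !mulmxA.
    by rewrite mulVmx ?lg_unit // mul1mx.
  rewrite /mxtrace; under eq_bigr do rewrite mxE; rewrite exchange_big; apply: eq_bigr => i _.
  rewrite mulr_suml; apply: eq_bigr => j _; by rewrite Ed_l mulrCA mulrC.
pose T := \sum_j F j i0 * H i0 j.
have iT : O p T by apply: dO_sum => j _; exact: dOM.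
pose rest := \sum_(i | i != i0) (\sum_j F j i * H i j).
have eT' : \tr (f *m h) = (π p)^-1 * T + rest.
  rewrite eT (bigD1 i0) //= eqxx mulrC; congr (_ + _); apply: eq_bigr => i ni.
  by rewrite (negPf ni) mulr1.
have irest : O p rest by apply: dO_sum => i _; apply: dO_sum => j _; exact: dOM.
have tO : O p (\tr (f *m h)).
  apply: (no_simple_pole G).
    move=> q /eqP qp; apply: (@homp_tr _ _ _ _ A); apply: hompM (hf q) _.
    exact: (off_C h qp).1 (hh q).
  rewrite eT' mulrDr mulVKf ?unif_neq0 //; apply: dOD => //; apply: dOM => //; exact: dO_unif.
have /(resid0 iT) : O p ((π p)^-1 * T).
  by have := dOB tO irest; rewrite eT' addrK.
rewrite resid_sum; last by move=> j; exact: dOM.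
move=> e; apply: etrans e; apply: eq_bigr => j _; by rewrite residM // colresE rowresE.
Qed.

(** The converse of orthogonality is Serre duality: a row orthogonal to all residues is a
class supported at p that vanishes, hence is the residue of a homomorphism. *)
Lemma res_full (v : 'rV[k]_(lr A)) : (forall h, lhom C A h -> \sum_j v 0 j * rowres h 0 j = 0) ->
  exists2 f, lhom A B f & colres f = v.
Proof.
move=> hv; pose V0 : 'M[K]_(lr A, lr B) := \matrix_(j, i) if i == i0 then ι (v 0 j) else 0.
pose X := invmx R *m V0 *m S.
have RX : R *m X *m invmx S = V0 by rewrite /X !mulmxA mulmxV ?lg_unit // mul1mx mulmxK ?lg_unit.
have iV : intm p V0 by move=> i j; rewrite mxE; case: eqP => _; [exact: dO_inc|exact: dO0].
have [|x hx] := @serre _ _ _ _ G A C (at_ p X) (@madele_at _ _ _ _ A C p X).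
  move=> h hh; pose H := Ed (π p) *m S *m h *m invmx R; have iH : intm p H by apply/homC.
  have -> : ω (fun q => \tr (at_ p X q *m h)) = ω (at_ p (\tr (X *m h))).
    by apply: om_ext => q; rewrite /at_; case: eqP => // _; rewrite mul0mx mxtrace0.
  rewrite -[RHS](om_cst G 0) (@om_at_int _ _ _ _ G p _ 0); first by apply: om_ext => q; rewrite /at_; case: eqP.
  rewrite subr0; have -> : \tr (X *m h) = (π p)^-1 * \sum_j ι (v 0 j) * H i0 j.
    transitivity (\tr (V0 *m (Ed (π p)^-1 *m H))).
      rewrite /H !mulmxA -[_ *m Ed (π p)^-1 *m Ed (π p)]mulmxA Ed_mul mulVf ?unif_neq0 // Ed1 mulmx1.
      by rewrite [RHS]mxtrace_mulC /X !mulmxA.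
    rewrite /mxtrace mulr_sumr; apply: eq_bigr => j _; rewrite mxE (bigD1 i0) //= big1 => [|i ni].
      by rewrite addr0 Ed_l eqxx mulrCA; congr (_ * (_ * _)); rewrite mxE eqxx.
    by rewrite [V0 _ _]mxE (negPf ni) mul0r.
  have iT : O p (\sum_j ι (v 0 j) * H i0 j) by apply: dO_sum => j _; apply: dOM => //; exact: dO_inc.
  apply/(resid0 iT); rewrite resid_sum; last by move=> j; apply: dOM => //; exact: dO_inc.
  apply: etrans (hv h hh); apply: eq_bigr => j _; rewrite residM //; last exact: dO_inc.
  by rewrite resid_inc rowresE.
have hp := hx p; rewrite /at_ eqxx in hp; have [hp1 hp2] := (hom_AC _).1 hp.
have hX : homp A B p X by rewrite /homp RX.
have hfx : lhom A B x.
  move=> q; have [->|/eqP qp] := eqVneq q p; first by rewrite -[x](subKr X); exact: hompB.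
  by have := hx q; rewrite /at_; case: eqP => // _; rewrite sub0r => /(off_A _ qp)/hompN; rewrite opprK.
exists x => //; apply/rowP => j; rewrite mxE; apply: resid_eq; first exact: hfx.
have /colres0/(_ j)/(resid0 (hp1 _ _))/dON := hp2.
have -> : (R *m (X - x) *m invmx S) j i0 = ι (v 0 j) - (R *m x *m invmx S) j i0.
  by rewrite mulmxBr mulmxBl RX; set M := R *m x *m invmx S; rewrite !mxE eqxx.
by rewrite -mulrN opprB.
Qed.

(** Let C be obtained from B by an elementary modification at p. The residues of Hom(A, B)
and of Hom(C, A) are orthogonal complements in k^(lr A), so that the two jumps in dimension
add up to lr A. *)
Theorem up m m' : hd A C m -> hd C A m' ->
  exists m1 m1', [/\ hd A B m1, hd B A m1' & m1%:Z - m1'%:Z = m%:Z - m'%:Z + (lr A)%:Z].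
Proof.
move=> [b hb] [c hc].
have Sl (Z1 Z2 : lattice) x (f g : 'M[K]_(lr Z1, lr Z2)) : lhom Z1 Z2 f -> lhom Z1 Z2 g -> lhom Z1 Z2 (ι x *: f + g).
  by move=> hf hg q; apply: hompD => //; apply: hompZ => //; exact: dO_inc.
have S0 (Z1 Z2 : lattice) : lhom Z1 Z2 0 by move=> q; exact: homp0.
have [b0 hb0] := @kb_ker _ _ ι _ (lhom C A) (lhom B A) _ rowres (S0 C A) (@Sl C A) rowres_lin lhom_BA _ c hc.
set Ψ := \matrix_j rowres (c j) in b0 hb0.
pose Z := row_base (kermx Ψ^T).
have ZE (v : 'rV_(lr A)) : (v <= Z)%MS <-> v *m Ψ^T = 0.
  by rewrite eq_row_base; split=> [/sub_kermxP|h]; [|apply/sub_kermxP].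
have entry (v : 'rV_(lr A)) j : (v *m Ψ^T) 0 j = \sum_a v 0 a * rowres (c j) 0 a.
  by rewrite mxE; apply: eq_bigr => a _; rewrite !mxE.
have [||b' hb'] := @kb_ext _ _ ι _ (lhom A B) (lhom A C) _ colres (S0 A B) (@Sl A B) colres_lin lhom_AC _ b _ Z hb (row_base_free _).
- move=> f hf; apply/ZE/rowP => j; rewrite entry mxE; apply: res_orth => //; by have [] := hc.
- move=> i; have /ZE vZ := row_sub i Z; have [|f hf ef] := @res_full (row i Z); last by exists f.
  move=> h hh; have [_ sp _] := hc; have [a ->] := sp h hh.
  rewrite (@kb_phi _ _ ι _ (lhom C A) _ rowres (S0 C A) (@Sl C A) rowres_lin) => [|j]; last by have [] := hc.
  transitivity ((row i Z *m (\row_j a j *m Ψ)^T) 0 0).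
    by rewrite [RHS]mxE; apply: eq_bigr => j _; rewrite [_^T j 0]mxE.
  by rewrite trmx_mul mulmxA vZ mul0mx mxE.
exists (m + \rank (kermx Ψ^T))%N, (m' - \rank Ψ)%N; split; [by exists b'|by exists b0|].
rewrite mxrank_ker mxrank_tr; have h1 := rank_leq_row Ψ; have h2 := rank_leq_col Ψ.
move: h1 h2; move: (\rank Ψ) => ρ; lia.
Qed.
End Up.
End Modification.
End Modifications.

(** * Riemann-Roch *)
Module RiemannRoch.
Import Defs.
Export Modifications.
Import Alg.
Import Order.TTheory GRing.Theory Num.Theory.
Local Open Scope classical_set_scope.
Local Open Scope ring_scope.

Section ResidDet.
Variables (k K : fieldType) (P : choiceType) (D : dvrs k K P).
Local Notation O := (dO D).
Local Notation ι := (kinc D).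
Lemma resid_prod p (I : finType) (F : I -> K) : (forall i, O p (F i)) -> resid D p (\prod_i F i) = \prod_i resid D p (F i).
Proof.
move=> h; have [] : O p (\prod_i F i) /\ resid D p (\prod_i F i) = \prod_i resid D p (F i); last by [].
elim/big_rec2: _ => [|i y x _ [Ox e]].
  by split; [exact: dO1|rewrite -(rmorph1 ι) resid_inc].
by split; [exact: dOM|rewrite residM // e].
Qed.
Lemma resid_det p n (h : 'M[K]_n) : intm D p h -> resid D p (\det h) = \det (map_mx (resid D p) h).
Proof.
move=> ih; have Op (s : 'S_n) : O p (\prod_i h i (s i)) by apply: dO_prod => i _; exact: ih.
have Os (s : 'S_n) : O p ((-1) ^+ s) by rewrite -(rmorph_sign ι); exact: dO_inc.
rewrite /determinant resid_sum => [|s]; last exact: dOM.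
apply: eq_bigr => s _; rewrite residM // -{1}(rmorph_sign ι) resid_inc resid_prod //.
by congr (_ * _); apply: eq_bigr => i _; rewrite mxE.
Qed.
Lemma unimod_det p n (h : 'M[K]_n) : intm D p h -> isord D p (\det h) 0 -> intm D p (invmx h).
Proof.
move=> ih o; have d0 := isord_neq0 o; have uh : h \in unitmx by rewrite unitmxE unitfE.
rewrite /invmx uh; apply: intmZ; last exact: intm_adj.
by have := (isord_ge (isordV o)).2; apply; rewrite oppr0.
Qed.
Lemma ord_unimod p n (h : 'M[K]_n) : h \in unitmx -> intm D p h -> intm D p (invmx h) -> isord D p (\det h) 0.
Proof.
move=> uh ih ih'; apply: isord0; first exact: intm_det; last by rewrite -unitfE -unitmxE.
by rewrite -det_inv; exact: intm_det.
Qed.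
End ResidDet.

Section RR.
Variables (k K : fieldType) (P : choiceType) (D : dvrs k K P) (G : genus1 D).
Local Notation O := (dO D).
Local Notation ι := (kinc D).
Local Notation π := (unif D).
Local Notation intm := (intm D).
Local Notation lattice := (lattice D).

(** The Euler characteristic of the pair: by Serre duality the second term is the dimension
of Ext^1(A, B). *)
Definition RR (A B : lattice) (z : int) := exists m m', [/\ hd A B m, hd B A m' & m%:Z - m'%:Z = z].

Lemma rr_same A B (g : P -> 'M[K]_(lr B)) u f z :
  (forall q, intm q (lg B q *m invmx (g q)) /\ intm q (g q *m invmx (lg B q))) ->
  RR A B z <-> RR A (@Lattice _ _ _ D (lr B) g u f) z.
Proof.
move=> h; set C := Lattice u f.
have hC (x : 'M[K]_(lr A, lr B)) : lhom A B x <-> lhom A C x.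
  split=> hx q; have [h1 h2] := h q.
    have : homp B C q 1%:M by rewrite /homp mulmx1.
    by move=> /(hompM (hx q)); rewrite mulmx1.
  have : homp C B q 1%:M by rewrite /homp mulmx1.
  by move=> /(hompM (hx q)); rewrite mulmx1.
have hC' (x : 'M[K]_(lr B, lr A)) : lhom B A x <-> lhom C A x.
  split=> hx q; have [h1 h2] := h q.
    have : homp C B q 1%:M by rewrite /homp mulmx1.
    by move=> h3; have := hompM h3 (hx q); rewrite mul1mx.
  have : homp B C q 1%:M by rewrite /homp mulmx1.
  by move=> h3; have := hompM h3 (hx q); rewrite mul1mx.
have tr (Z1 Z2 Z1' Z2' : P -> Prop) : True by [].
split=> -[m [m' [[b [b1 b2 b3]] [c [c1 c2 c3]] e]]]; exists m, m'; split=> //.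
- by exists b; split => // [j|x /hC]; [apply/hC|exact: b2].
- by exists c; split => // [j|x /hC']; [apply/hC'|exact: c2].
- by exists b; split => // [j|x /hC]; [apply/hC|exact: b2].
- by exists c; split => // [j|x /hC']; [apply/hC'|exact: c2].
Qed.

Lemma rr_dual A B z : RR A B z -> RR (dual A) (dual B) (- z).
Proof.
move=> [m [m' [[b hb] [c hc] e]]]; exists m', m; split; last by rewrite -e opprB.
  by eexists; exact: lbasis_dual hc.
by eexists; exact: lbasis_dual hb.
Qed.

Lemma rr_up A B p i0 u z : RR A (@lmod _ _ _ D B p (@Ed _ _ _ D B i0 (π p)) u) z -> RR A B (z + (lr A)%:Z).
Proof.
move=> [m [m' [h1 h2 <-]]]; move: h1 h2; rewrite (Prop_irrelevance u (Ed_unit i0 (unif_neq0 D p)).1) => h1 h2.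
by have [m1 [m1' [k1 k2 e]]] := up G h1 h2; exists m1, m1'.
Qed.

Lemma rr_down A B p i0 u z : RR A B z -> RR A (@lmod _ _ _ D B p (@Ed _ _ _ D B i0 (π p)) u) (z - (lr A)%:Z).
Proof.
set C := lmod p u => /rr_dual h.
have uE : @Ed _ _ _ D (dual C) i0 (π p) \in unitmx := (Ed_unit i0 (unif_neq0 D p)).1.
have eE : @Ed _ _ _ D (dual C) i0 (π p) = @Ed _ _ _ D B i0 (π p) by [].
have eq : lmod p uE = dual B.
  apply: lattice_ext => q; rewrite /lmod_fun; case: eqP => [->|qp]; last by rewrite /= /lmod_fun; case: eqP.
  rewrite /= /lmod_fun eqxx eE; have uB := lg_unit B p.
  have sE : (Ed i0 (π p) : 'M_(lr B))^T = Ed i0 (π p) by rewrite /Ed tr_diag_mx.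
  set N := invmx (Ed i0 (π p) *m lg B p).
  have uM : Ed i0 (π p) *m lg B p \in unitmx by rewrite unitmx_mul u.
  have e1 : lg B p *m N *m Ed i0 (π p) = 1%:M by apply: mulmx1C; rewrite mulmxA mulmxV.
  have -> : invmx (lg B p) = N *m Ed i0 (π p) by rewrite -[RHS](mulKmx uB) [lg B p *m (N *m _)]mulmxA e1 mulmx1.
  by rewrite trmx_mul sE.
rewrite -eq in h; have := rr_up h => /rr_dual; rewrite !ddE.
by have -> : - (- z + (lr (dual A))%:Z) = z - (lr A)%:Z by rewrite opprD opprK.
Qed.

Lemma rr_iff A B p i0 u z : RR A B z <-> RR A (@lmod _ _ _ D B p (@Ed _ _ _ D B i0 (π p)) u) (z - (lr A)%:Z).
Proof. by split=> [|/rr_up]; [exact: rr_down|rewrite subrK]. Qed.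

Lemma singular_row p n (h : 'M[K]_n) : intm p h -> resid D p (\det h) = 0 ->
  exists2 c : 'rV[k]_n, c != 0 & forall j, O p ((π p)^-1 * (map_mx ι c *m h) 0 j).
Proof.
move=> ih; rewrite resid_det // => /eqP/det0P[c c0 e]; exists c => // j.
apply/resid0; first by rewrite mxE; apply: dO_sum => i _; apply: dOM; [rewrite mxE; exact: dO_inc|exact: ih].
rewrite mxE resid_sum => [|i]; last by apply: dOM; [rewrite mxE; exact: dO_inc|exact: ih].
have /rowP/(_ j) := e; rewrite !mxE => e'; apply: etrans e'; apply: eq_bigr => i _.
by rewrite [(map_mx ι c) 0 i]mxE residM; [rewrite resid_inc [(map_mx _ h) i j]mxE|exact: dO_inc|exact: ih].
Qed.

(** Induction on the order of the determinant: if it is positive, a row combination vanishes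
at p, and dividing it by a uniformizer is an elementary modification that lowers the order
by one. *)
Lemma rr_int A p (m : nat) : forall (B : lattice) (h : 'M[K]_(lr B)) (u : h \in unitmx) z,
  intm p h -> isord D p (\det h) m%:Z -> RR A B z <-> RR A (lmod p u) (z - (lr A)%:Z * m%:Z).
Proof.
elim: m => [|m IH] B h u z ih oh.
  rewrite mulr0 subr0; apply: rr_same => q; rewrite /lmod_fun; case: eqP => [->|_]; last first.
    by rewrite mulmxV ?lg_unit //; split; exact: intm1.
  have i1 := unimod_det ih oh; have uB := lg_unit B p.
  split; last by rewrite mulmxK.
  have -> : invmx (h *m lg B p) = invmx (lg B p) *m invmx h.
    have uM : h *m lg B p \in unitmx by rewrite unitmx_mul u.
    by rewrite -[RHS](mulKmx uM) -[X in _ = _ *m X]mulmxA (mulKVmx uB) mulmxV // mulmx1.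
  by rewrite mulKVmx.
have d0 : resid D p (\det h) = 0.
  have Od : O p (\det h) by exact: intm_det.
  apply/(resid0 Od); have := isordM (isordV (isord_unif D p)) oh.
  by move=> o; apply/(isord_ge o); lia.
have [c c0 hc] := singular_row ih d0.
have /rV0Pn[i0 ci0] := c0.
pose c' : 'rV[K]_(lr B) := (ι (c 0 i0))^-1 *: map_mx ι c - delta_mx 0 i0.
have ic : ι (c 0 i0) != 0 by rewrite fmorph_eq0.
have c'0 : c' 0 i0 = 0 by rewrite !mxE !eqxx mulVf // subrr.
pose N : 'M[K]_(lr B) := delta_mx i0 0 *m c'.
have NN : N *m N = 0.
  rewrite /N mulmxA -[_ *m c' *m _]mulmxA [c' *m _](_ : _ = 0) ?mulmx0 ?mul0mx //.
  by rewrite -colE; apply/matrixP => i j; rewrite !ord1 mxE c'0 mxE.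
have iN : intm p N.
  have idel a b (i : 'I_a) (j : 'I_b) : intm p (delta_mx i j : 'M[K]_(a, b)).
    by move=> x y; rewrite mxE; case: (_ && _); [exact: dO1|exact: dO0].
  apply: intmM => //; apply: intmB => //; apply: intmZ; first by rewrite -fmorphV; exact: dO_inc.
  by move=> x y; rewrite mxE; exact: dO_inc.
have e1 : (1%:M + N) *m (1%:M - N) = 1%:M.
  by rewrite mulmxDl mul1mx mulmxBr mulmx1 NN subr0 subrK.
have [uu uu'] := mulmx1_unit e1.
have iu : intm p (1%:M + N) by apply: intmD => //; exact: intm1.
have eiu : invmx (1%:M + N) = 1%:M - N by rewrite -[RHS](mulKmx uu) e1 mulmx1.
have iu' : intm p (invmx (1%:M + N)) by rewrite eiu; apply: intmB => //; exact: intm1.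
pose w := (1%:M + N) *m h; have iw : intm p w by exact: intmM.
have roww j : O p ((π p)^-1 * w i0 j).
  have -> : w i0 j = (ι (c 0 i0))^-1 * (map_mx ι c *m h) 0 j.
    have : row i0 w = (ι (c 0 i0))^-1 *: (map_mx ι c *m h).
      have rN : row i0 N = c' by apply/rowP => j'; rewrite mxE [N i0 j']mxE big_ord1 [delta_mx _ _ _ _]mxE !eqxx mul1r.
      by rewrite row_mul linearD /= rN row1 addrC subrK scalemxAl.
    by move=> /rowP/(_ j); rewrite mxE [RHS]mxE.
  by rewrite mulrCA; apply: dOM => //; rewrite -fmorphV; exact: dO_inc.
have [uEd eEd] := @Ed_unit _ _ _ D B i0 (π p) (unif_neq0 D p).
have [uEd' _] := @Ed_unit _ _ _ D B i0 (π p)^-1 (ltac:(by rewrite invr_eq0 unif_neq0)).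
pose h' := Ed i0 (π p)^-1 *m w.
have uw : w \in unitmx by rewrite unitmx_mul uu.
have uh' : h' \in unitmx by rewrite unitmx_mul uEd'.
have ih' : intm p h'.
  by move=> i j; rewrite Ed_l; case: eqP => [->|_]; [exact: roww|rewrite mul1r].
have ew : w = Ed i0 (π p) *m h' by rewrite /h' mulmxA Ed_mul mulfV ?unif_neq0 // Ed1 mul1mx.
have oEd : isord D p (\det (Ed i0 (π p) : 'M_(lr B))) 1.
  rewrite /Ed det_diag (bigD1 i0) //= mxE eqxx big1 ?mulr1; first exact: isord_unif.
  by move=> j ji; rewrite mxE (negPf ji).
have oh' : isord D p (\det h') m%:Z.
  have : isord D p (\det w) m.+1%:Z.
    by rewrite /w det_mulmx -[m.+1%:Z]add0r; apply: isordM => //; exact: ord_unimod.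
  rewrite ew det_mulmx => o; have := isordM (isordV oEd) o; rewrite mulKf; last exact: isord_neq0 oEd.
  by have -> : -1 + m.+1%:Z = m%:Z by lia.
rewrite (IH B h' uh' z ih' oh') (@rr_iff A (lmod p uh') p i0 uEd).
have -> : z - (lr A)%:Z * m.+1%:Z = z - (lr A)%:Z * m%:Z - (lr A)%:Z by rewrite -[m.+1]addn1 PoszD mulrDr mulr1 opprD addrA.
refine (@rr_same A (@lmod _ _ _ D (lmod p uh') p _ uEd) (lmod_fun p h) _ _ _ _).
move=> q; have -> : lg (@lmod _ _ _ D (lmod p uh') p _ uEd) q = if q == p then w *m lg B p else lg B q.
  by have [->|/negPf qp] := eqVneq q p; rewrite /= /lmod_fun ?eqxx ?qp /= /lmod_fun ?eqxx ?qp // mulmxA -ew.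
rewrite /lmod_fun; case: eqP => [->|_]; last by rewrite (mulmxV (lg_unit B q)); split; exact: intm1.
have uB := lg_unit B p; have inv_mul (x : 'M[K]_(lr B)) : x \in unitmx -> invmx (x *m lg B p) = invmx (lg B p) *m invmx x.
  move=> ux; have uM : x *m lg B p \in unitmx by rewrite unitmx_mul ux.
  by rewrite -[RHS](mulKmx uM) -[X in _ = _ *m X]mulmxA (mulKVmx uB) mulmxV // mulmx1.
have -> : w *m lg B p *m invmx (h *m lg B p) = 1%:M + N by rewrite (inv_mul h u) mulmxA (mulmxK uB) /w (mulmxK u).
have -> : h *m lg B p *m invmx (w *m lg B p) = invmx (1%:M + N); last by split.
rewrite (inv_mul w uw) mulmxA (mulmxK uB) -[RHS](mulmxK uw); congr (_ *m _).
by rewrite /w mulKmx.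
Qed.

Lemma isord_pow p n : isord D p (π p ^+ n) n%:Z.
Proof. by exists 1; rewrite invr1 oner_neq0 mul1r; split => //; exact: dO1. Qed.

(** Multiplication by a power of a uniformizer makes the matrix integral, and the integral
case is used twice. *)
Lemma rr_step A p (B : lattice) (h : 'M[K]_(lr B)) (u : h \in unitmx) z m :
  isord D p (\det h) m -> RR A B z <-> RR A (lmod p u) (z - (lr A)%:Z * m).
Proof.
move=> oh; have [N hN] := denominator D p (fun ij : 'I_(lr B) * 'I_(lr B) => h ij.1 ij.2).
pose c := π p ^+ N; have c0 : c != 0 by rewrite expf_neq0 // unif_neq0.
have us : (c%:M : 'M[K]_(lr B)) \in unitmx by rewrite unitmxE det_scalar unitfE expf_neq0.
have os : isord D p (\det (c%:M : 'M[K]_(lr B))) (N * lr B)%N%:Z.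
  by rewrite det_scalar /c -exprM; exact: isord_pow.
have u1 : c%:M *m h \in unitmx by rewrite unitmx_mul us.
have i1 : intm p (c%:M *m h) by move=> i j; rewrite mul_scalar_mx mxE; exact: (hN (i, j)).
have is' : intm p (c%:M : 'M[K]_(lr B)) by apply: intm_scalar; apply: dOX; exact: dO_unif.
have o1 : isord D p (\det (c%:M *m h)) ((N * lr B)%N%:Z + m) by rewrite det_mulmx; exact: isordM.
have ge0 : 0 <= (N * lr B)%N%:Z + m by apply/(isord_ge o1); exact: intm_det.
have [m1 em1] : exists m1 : nat, (N * lr B)%N%:Z + m = m1%:Z by exists (absz ((N * lr B)%N%:Z + m)); lia.
rewrite em1 in o1; rewrite (rr_int A u1 z i1 o1).
rewrite (@rr_int A p _ (lmod p u) c%:M us (z - (lr A)%:Z * m) is' os).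
have -> : z - (lr A)%:Z * m - (lr A)%:Z * (N * lr B)%N%:Z = z - (lr A)%:Z * m1%:Z.
  by rewrite -em1 mulrDr opprD addrA addrAC.
apply: iff_sym; refine (@rr_same A (@lmod _ _ _ D (lmod p u) p _ us) (lmod_fun p (c%:M *m h)) _ _ _ _).
move=> q; have -> : lmod_fun p (c%:M *m h) q = lg (@lmod _ _ _ D (lmod p u) p _ us) q.
  by have [->|/negPf qp] := eqVneq q p; rewrite /= /lmod_fun ?eqxx ?qp /= /lmod_fun ?eqxx ?qp // mulmxA.
by rewrite mulmxV ?lg_unit //; split; exact: intm1.
Qed.

(** Two lattices of the same rank differ at finitely many points; modify one point after the
other. *)
Lemma rr_chain A (o : P -> int) (L : seq P) : forall (B : lattice) (g : P -> 'M[K]_(lr B)) (ug : forall q, g q \in unitmx)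
  (fg : finite_set [set q | ~ (intm q (g q) /\ intm q (invmx (g q)))]) z, uniq L ->
  (forall q, q \notin L -> intm q (lg B q *m invmx (g q)) /\ intm q (g q *m invmx (lg B q))) ->
  (forall q, q \in L -> isord D q (\det (g q *m invmx (lg B q))) (o q)) ->
  RR A B z <-> RR A (@Lattice _ _ _ D (lr B) g ug fg) (z - (lr A)%:Z * \sum_(q <- L) o q).
Proof.
elim: L => [|p L IH] B g ug fg z.
  by move=> _ h _; rewrite big_nil mulr0 subr0; apply: rr_same => q; exact: h.
move=> /= /andP[pL uL] hout hin; rewrite big_cons.
have uh : g p *m invmx (lg B p) \in unitmx by rewrite unitmx_mul ug unitmx_inv lg_unit.
rewrite (rr_step A uh z (hin p (mem_head _ _))).
have lgp : lg (lmod p uh) p = g p by rewrite lmodp mulmxKV ?lg_unit.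
rewrite (IH (lmod p uh) g ug fg _ uL) => [|q qL|q qL].
- by have -> : z - (lr A)%:Z * o p - (lr A)%:Z * \sum_(q <- L) o q = z - (lr A)%:Z * (o p + \sum_(q <- L) o q)
    by rewrite mulrDr opprD addrA.
- have [->|/eqP qp] := eqVneq q p; first by rewrite lgp mulmxV //; split; exact: intm1.
  by rewrite lmodq //; apply: hout; rewrite inE negb_or qL andbT; exact/eqP.
- have qp : q <> p by move=> e; rewrite e (negPf pL) in qL.
  by rewrite lmodq //; apply: hin; rewrite inE qL orbT.
Qed.

(** The chain of modifications starts at A itself, where simplicity gives the Euler
characteristic 1 - 1 = 0. *)
Theorem rr_simple A (o : P -> int) (L : seq P) (g : P -> 'M[K]_(lr A)) (ug : forall q, g q \in unitmx)
  (fg : finite_set [set q | ~ (intm q (g q) /\ intm q (invmx (g q)))]) : simple A -> uniq L ->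
  (forall q, q \notin L -> intm q (lg A q *m invmx (g q)) /\ intm q (g q *m invmx (lg A q))) ->
  (forall q, q \in L -> isord D q (\det (g q *m invmx (lg A q))) (o q)) ->
  RR A (@Lattice _ _ _ D (lr A) g ug fg) (- ((lr A)%:Z * \sum_(q <- L) o q)).
Proof.
move=> [A0 sA] uL h1 h2; rewrite -[- _]add0r.
apply: (proj1 (@rr_chain A o L A g ug fg 0 uL h1 h2)).
have hA : hd A A 1.
  exists (fun=> 1%:M); split => [_ q|x /sA[c ->]|c]; first exact: homp_id.
    by exists (fun=> c); rewrite big_ord1 scalemx1.
  rewrite big_ord1 scalemx1 => e j; rewrite ord1; pose i0 := Ordinal A0.
  by have := congr1 (fun M : 'M__ => M i0 i0) e; rewrite !mxE eqxx mulr1n => /eqP; rewrite fmorph_eq0 => /eqP.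
by exists 1%N, 1%N; split => //; rewrite subrr.
Qed.
End RR.
End RiemannRoch.

(** * Simple lattices of rank two *)
Module Parity.
Import Defs.
Export RiemannRoch.
Import Alg.
Import Order.TTheory GRing.Theory Num.Theory.
Local Open Scope classical_set_scope.
Local Open Scope ring_scope.

Section Parity.
Variables (k K : fieldType) (P : choiceType) (D : dvrs k K P) (G : genus1 D).
Local Notation O := (dO D).
Local Notation ι := (kinc D).
Local Notation π := (unif D).
Local Notation intm := (intm D).
Local Notation lattice := (lattice D).

Lemma fin_at n (p : P) (x : K) : finite_set [set q | ~ (intm q ((if q == p then x else 1)%:M : 'M[K]_n) /\
  intm q (invmx ((if q == p then x else 1)%:M : 'M[K]_n)))].
Proof.
apply: sub_finite_set (finite_set1 p) => q h /=; apply: contrapT => /eqP/negPf e; apply: h.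
by rewrite e invmx1; split; exact: intm1.
Qed.
Lemma unit_at n (p : P) (x : K) : x != 0 -> forall q, ((if q == p then x else 1)%:M : 'M[K]_n) \in unitmx.
Proof.
by move=> x0 q; rewrite unitmxE det_scalar unitfE expf_neq0 //; case: (q =P p); rewrite ?oner_neq0.
Qed.

(** If no nonzero map vanished at p0, the values at p0 of a space of dimension at least (lr
B)^2 would be all matrices. The map F whose value is the identity is invertible over K; it
is not an isomorphism, since B has nonscalar endomorphisms and E is simple, hence its
determinant vanishes at some p, and a combination of the rows of F vanishes there. *)
Lemma vanishing (B E : lattice) (l : P -> K) (p0 : P) b : (1 < lr B)%N -> simple E -> (lr E = lr B) ->
  (forall q, lg B q = (l q)%:M) -> hd B E b -> (lr B * lr E <= b)%N ->
  exists p (M : 'M[K]_(lr B, lr E)), [/\ M != 0, lhom B E M & intm p ((π p)^-1 *: (lg B p *m M *m invmx (lg E p)))].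
Proof.
case: B => n gB uB fB /=; set B := Lattice uB fB; case: E => n' gE uE fE /= n1 sE en; subst n'.
set E := Lattice uE fE in sE * => hl [c hc] le.
pose W p (M : 'M[K]_n) := gB p *m M *m invmx (gE p).
pose φ (M : 'M[K]_n) : 'rV[k]_(n * n) := mxvec (map_mx (resid D p0) (W p0 M)).
have S0 : lhom B E 0 by move=> q; exact: homp0.
have Sl x f g : lhom B E f -> lhom B E g -> lhom B E (ι x *: f + g).
  by move=> hf hg q; apply: hompD => //; apply: hompZ => //; exact: dO_inc.
have φl x f g : lhom B E f -> lhom B E g -> φ (ι x *: f + g) = x *: φ f + φ g.
  move=> hf hg; rewrite /φ -linearZ -linearD; congr mxvec; apply/matrixP => i j.
  rewrite [LHS]mxE [RHS]mxE [X in _ = X + _]mxE [X in _ = _ * X + _]mxE [X in _ = _ + X]mxE -resid_lin; [|exact: (hf p0)|exact: (hg p0)].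
  by congr resid; rewrite /W mulmxDr mulmxDl -scalemxAr -scalemxAl mxE [X in X + _]mxE.
pose Z M := lhom B E M /\ φ M = 0.
have hZ x : Z x <-> lhom B E x /\ φ x = 0 by [].
have [b0 [k1 k2 k3]] := @kb_ker _ _ ι _ (lhom B E) Z _ φ S0 Sl φl hZ b c hc.
set Ψ := \matrix_j φ (c j) in b0 k1 k2 k3.
have [lt|ge] := ltnP (\rank Ψ) b.
  have i0 : 'I_(b - \rank Ψ) by apply: (@Ordinal _ 0); rewrite subn_gt0.
  have [hM φM] := k1 i0; exists p0, (b0 i0); split => //.
    apply/eqP => z.
    by move/eqP: (oner_neq0 k); apply; have := k3 (fun i => (i == i0)%:R) _ i0; rewrite eqxx; apply;
      rewrite (bigD1 i0) //= eqxx rmorph1 scale1r z add0r big1 // => i /negPf ->; rewrite rmorph0 scale0r.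
  move=> i j; rewrite mxE; apply/resid0; first exact: (hM p0).
  by have := congr1 (fun v => (vec_mx v) i j) φM; rewrite /φ mxvecK linear0 !mxE.
have rf : row_full Ψ.
  rewrite /row_full eqn_leq rank_leq_col /=; apply: leq_trans ge; exact: le.
have /submxP[a ea] : (mxvec (1%:M : 'M[k]_n) <= Ψ)%MS by apply: submx_full.
pose F := \sum_j ι (a 0 j) *: c j.
have hcj j : lhom B E (c j) by have [] := hc.
have hF : lhom B E F by exact: (@kb_in _ _ ι _ (lhom B E) S0 Sl _ c (fun j => a 0 j) hcj).
have φF : φ F = mxvec 1%:M.
  rewrite /F (@kb_phi _ _ ι _ (lhom B E) _ φ S0 Sl φl _ c (fun j => a 0 j) hcj) -/Ψ ea; congr (_ *m _).
  by apply/rowP => j; rewrite mxE.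
have rF : map_mx (resid D p0) (W p0 F) = 1%:M by apply: (can_inj mxvecK).
have dW : \det (W p0 F) != 0.
  apply: contra_neq (oner_neq0 k) => d0; have := resid_det (hF p0); rewrite -/(W p0 F) d0 rF det1 => <-.
  by rewrite -(rmorph0 ι) resid_inc.
have uF : F \in unitmx.
  move: dW; rewrite unitmxE unitfE /W !det_mulmx; apply: contraNneq => ->; by rewrite mulr0 mul0r.
have WU q : W q F \in unitmx by rewrite !unitmx_mul uB uF unitmx_inv uE.
have [p hp] : exists p, ~ intm p (invmx (W p F)).
  apply: contrapT => nn; have all q : intm q (invmx (W q F)) by apply: contrapT => h; apply: nn; exists q.
  have iFE : lhom E B (invmx F).
    move=> q; suff e2 : gE q *m invmx F *m invmx (gB q) = invmx (W q F) by have := all q; rewrite -e2.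
    have e : W q F *m (gE q *m invmx F *m invmx (gB q)) = 1%:M.
      by rewrite /W !mulmxA mulmxKV ?uE // mulmxK // mulmxV.
    by rewrite -[LHS](mulKmx (WU q)) e mulmx1.
  pose i0 := Ordinal (ltnW n1); pose i1 := Ordinal n1.
  have hδ : lhom B B (delta_mx i0 i0).
    move=> q; rewrite /homp /= hl -scalar_mxC mulmxK; last by rewrite -hl uB.
    by move=> i j; rewrite mxE; case: (_ && _); [exact: dO1|exact: dO0].
  have [_ /(_ (invmx F *m delta_mx i0 i0 *m F))] := sE; case.
    by move=> q; apply: hompM (hF q); apply: hompM (iFE q) (hδ q).
  move=> x ex; have : delta_mx i0 i0 = (ι x)%:M :> 'M[K]_n.
    rewrite -(mulmxK uF (delta_mx i0 i0)) -(mulKVmx uF (delta_mx i0 i0 *m F)) [invmx F *m _]mulmxA ex.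
    by rewrite scalar_mxC mulmxK.
  move=> e; have e0 := congr1 (fun M : 'M[K]_n => M i0 i0) e; have e1 := congr1 (fun M : 'M[K]_n => M i1 i1) e.
  have i10 : (i1 == i0) = false by [].
  by move: e0 e1; rewrite !mxE !eqxx i10 /= !mulr1n => <- /eqP; rewrite eq_sym oner_eq0.
have r0 : resid D p (\det (W p F)) = 0.
  apply: contrapT => /eqP nz; apply: hp; apply: unimod_det; first exact: (hF p).
  have d0 : \det (W p F) != 0 by rewrite -unitfE -unitmxE.
  have [m om] := isord_ex D p d0; have Od : O p (\det (W p F)) by apply: intm_det; exact: (hF p).
  have m0 : 0 <= m by apply/(isord_ge om).
  have [mz|mn] := eqVneq m 0; first by rewrite -mz.
  case/eqP: nz; apply/(resid0 Od).
  by apply/(isord_ge (isordM (isordV (isord_unif D p)) om)); lia.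
have [v v0 hv] := singular_row (hF p) r0.
pose i0 : 'I_n := Ordinal (ltnW n1); pose M : 'M[K]_n := delta_mx i0 0 *m (map_mx ι v *m F).
have idel q a' b' (i : 'I_a') (j : 'I_b') : intm q (delta_mx i j : 'M[K]_(a', b')).
  by move=> x y; rewrite mxE; case: (_ && _); [exact: dO1|exact: dO0].
have WM q : gB q *m M *m invmx (gE q) = delta_mx i0 0 *m (map_mx ι v *m W q F).
  rewrite /M /W hl !mulmxA -scalar_mxC -!mulmxA; congr (_ *m _); rewrite !mulmxA -scalar_mxC.
  by rewrite -!mulmxA.
exists p, M; split.
- apply/eqP => M0; case/eqP: v0; have : map_mx ι v *m F = 0.
    have := congr1 (row i0) M0; rewrite row0 /M row_mul => <-.
    have -> : row i0 (delta_mx i0 0 : 'M[K]_(n, 1)) = 1%:M by apply/matrixP => x y; rewrite !ord1 !mxE !eqxx.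
    by rewrite mul1mx.
  move=> /(congr1 (mulmx^~ (invmx F))); rewrite mulmxK // mul0mx => e.
  by apply/rowP => j; have /rowP/(_ j) := e; rewrite !mxE => /eqP; rewrite fmorph_eq0 => /eqP.
- move=> q; rewrite /homp WM; apply: intmM => //; apply: intmM; last exact: (hF q).
  by move=> x y; rewrite mxE; exact: dO_inc.
- rewrite WM scalemxAr; apply: intmM => // x y; rewrite ord1 mxE; exact: hv.
Qed.

(** Let B be a sum of two copies of a line bundle whose degree is chosen so that Hom(B, E)
has dimension at least 4. Some nonzero map B -> E vanishes at a point p, so that it extends
to the twist B(p). If the degree of E were even, Riemann-Roch would give a nonzero map E ->
B(p) as well, and joining the two by an endomorphism of rank one of B(p) would give an
endomorphism of E of rank one. *)
Theorem no_even (E : lattice) (p0 : P) (L : seq P) (o : P -> int) (s : int) : simple E -> lr E = 2%N -> uniq L -> p0 \in L ->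
  (forall q, isord D q (\det (lg E q)) (o q)) ->
  (forall q, q \notin L -> intm q (lg E q) /\ intm q (invmx (lg E q))) -> \sum_(q <- L) o q <> 2 * s.
Proof.
move=> sE r2 uL p0L oE unim sumo.
pose x := unif D p0 ^ (s + 1); have x0 : x != 0 by rewrite expfz_neq0 // unif_neq0.
pose l q := if q == p0 then x else 1.
pose ul := @unit_at (lr E) p0 x x0; pose fl := @fin_at (lr E) p0 x.
pose B : lattice := Lattice ul fl.
pose ol (q : P) : int := if q == p0 then s + 1 else 0.
have oxl q : isord D q (l q) (ol q).
  rewrite /l /ol; case: eqP => [->|_]; last by apply: isord0; rewrite ?invr1 ?oner_neq0 //; exact: dO1.
  by exists 1; rewrite invr1 oner_neq0 mul1r; split => //; exact: dO1.
have oB q : isord D q (\det (lg B q *m invmx (lg E q))) (ol q + ol q - o q).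
  rewrite det_mulmx det_inv; have -> : \det (lg B q) = l q * l q by rewrite /= det_scalar [X in _ ^+ X]r2 expr2.
  apply: isordM; first exact: isordM.
  exact: isordV.
have h1 q : q \notin L -> intm q (lg E q *m invmx (lg B q)) /\ intm q (lg B q *m invmx (lg E q)).
  move=> qL; have /negPf e : q != p0 by apply: contraNneq qL => ->.
  by rewrite /= e invmx1 mulmx1 mul1mx; exact: unim.
have := rr_simple G ul fl sE uL h1 (fun q _ => oB q).
rewrite sumrB sumo big_split /=.
have -> : \sum_(q <- L) ol q = s + 1.
  by rewrite (bigD1_seq p0) //= /ol eqxx big1 ?addr0 // => q /negPf ->.
have r2' : (lr E)%:Z = 2 by rewrite r2.
move=> [a [b [ha hb eab]]]; rewrite r2' in eab; rewrite -/B in ha hb.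
have b4 : (lr B * lr E <= b)%N by rewrite /= r2; move: eab; lia.
have B2 : (1 < lr B)%N by rewrite /= r2.
have [p [M [M0 hM vM]]] := vanishing p0 B2 sE (erefl : lr E = lr B) (fun q => erefl) hb b4.
have up : (((π p)^-1)%:M : 'M[K]_(lr B)) \in unitmx.
  by rewrite unitmxE det_scalar unitfE expf_neq0 // invr_eq0 unif_neq0.
have op : isord D p (\det (((π p)^-1)%:M : 'M[K]_(lr B))) (- 1 + - 1).
  by rewrite det_scalar /= r2 expr2; apply: isordM; apply: isordV; exact: isord_unif.
have RB : RR E B (a%:Z - b%:Z) by exists a, b.
have [a2 [b2 [[ca hca] [cb hcb] e2]]] := (rr_step G E up _ op).1 RB.
set C := lmod p up in ca hca cb hcb.
have hMC : lhom C E M.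
  move=> q; have [->|/eqP qp] := eqVneq q p; last by rewrite /homp lmodq //; exact: hM.
  by rewrite /homp lmodp mul_scalar_mx -!scalemxAl.
have b20 : (0 < b2)%N.
  rewrite lt0n; apply/eqP => z; subst b2; have [_ sp _] := hcb; have [c ec] := sp M hMC.
  by rewrite ec big_ord0 eqxx in M0.
have a20 : (0 < a2)%N by move: e2 eab; rewrite r2; lia.
pose j0 := Ordinal a20; have hN : lhom E C (ca j0) by have [] := hca.
have N0 : ca j0 != 0.
  apply/eqP => z; have [_ _ fr] := hca; have := fr (fun i => (i == j0)%:R) _ j0; rewrite eqxx => h.
  move/eqP: (oner_neq0 k); apply; apply: h; rewrite (bigD1 j0) //= ?eqxx rmorph1 scale1r z add0r.
  by rewrite big1 // => i /negPf ->; rewrite rmorph0 scale0r.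
have /matrix0Pn[i [j Nij]] := N0; have /matrix0Pn[i' [j' Mij]] := M0.
have hδ : lhom C C (delta_mx j i').
  have [c [c0 cE]] : exists c, (forall q, c q != 0) /\ forall q, lg C q = (c q)%:M.
    exists (fun q => if q == p then (π p)^-1 * l q else l q); split=> q.
      have lq : l q != 0 by rewrite /l; case: (q =P p0) => _ //; exact: oner_neq0.
      by case: (q =P p) => _ //; rewrite mulf_neq0 // invr_eq0 unif_neq0.
    by rewrite /= /lmod_fun; case: eqP => [->|_] //; rewrite -scalar_mxM.
  move=> q; rewrite /homp cE -scalar_mxC mulmxK.
    by move=> y z; rewrite mxE; case: (_ && _); [exact: dO1|exact: dO0].
  by rewrite -cE lg_unit.
have [_ /(_ (ca j0 *m delta_mx j i' *m M))] := sE; case.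
  by move=> q; apply: hompM (hMC q); apply: hompM (hN q) (hδ q).
move=> c ec; have rk : (\rank (ca j0 *m delta_mx j i' *m M) <= 1)%N.
  apply: leq_trans (mxrankM_maxl _ _) _; apply: leq_trans (mxrankM_maxr _ _) _.
  by rewrite mxrank_delta.
have c0 : c = 0.
  apply: contrapT => /eqP nz; move: rk; rewrite ec -scalemx1 mxrank_scale_nz ?fmorph_eq0 // mxrank1 r2.
  by [].
have := congr1 (fun Y : 'M[K]_(lr E) => Y i j') ec; rewrite c0 rmorph0 raddf0 [RHS]mxE => /eqP; rewrite mxE (bigD1 i') //= big1 => [|y yi].
  rewrite addr0 mulf_eq0 (negPf Mij) orbF mxE (bigD1 j) //= big1 => [|y yj].
    by rewrite addr0 mxE !eqxx mulr1 (negPf Nij).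
  by rewrite mxE (negPf yj) mulr0.
rewrite [(_ *m delta_mx _ _) _ _]mxE big1 ?mul0r // => z _; by rewrite mxE (negPf yi) andbF mulr0.
Qed.
End Parity.
End Parity.

(** * Degrees *)
Module Degrees.
Import Defs.
Export Ranks RiemannRoch.
Import Geo.
Import Defs.
Import Order.TTheory GRing.Theory Num.Theory.
Local Open Scope classical_set_scope.
Local Open Scope ring_scope.

Section Degree.
Variables (k : fieldType) (n : nat) (X : set (pspace k n)) (FF : funfield X).
Local Notation K := (ffK FF).
Local Notation D := (ffD FF).
Local Notation O := (dO D).
Local Notation intm := (intm D).
Local Notation germ := (germ FF).
Local Notation omod := (omod X).
Local Notation lattice := (lattice D).
Local Notation L A := (slat (Lfam (FF := FF) A)).
Variable p0 : X.

Lemma germ_prod (U : opens X) (I : finType) (f : I -> regfun U) : oset U !=set0 ->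
  germ (\prod_i f i) = \prod_i germ (f i).
Proof. by move=> U0; apply: (big_morph _ (@germM _ _ _ FF U) (germ1 FF U0)). Qed.
Lemma germX (U : opens X) (f : regfun U) m : oset U !=set0 -> germ (f ^+ m) = germ f ^+ m.
Proof. by move=> U0; elim: m => [|m IH]; rewrite ?expr0 ?germ1 // !exprS germM IH. Qed.
Lemma germ_det (U : opens X) r (g : 'M[regfun U]_r) : oset U !=set0 -> germ (\det g) = \det (map_mx (fun f => germ f) g).
Proof.
move=> U0; rewrite /determinant germ_sum; apply: eq_bigr => s _; rewrite germM germ_prod //.
congr (_ * _); last by apply: eq_bigr => i _; rewrite mxE.
by rewrite germX // germN germ1.
Qed.

(** The local parameter is a uniformizer of the local ring, and equality of functions off
its zeros is equality of germs. *)
Lemma ord_of_has_order (p : X) (W : opens X) (f : regfun W) m : oset W !=set0 -> has_order p f m -> isord D p (germ f) m.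
Proof.
move=> W0 [V [Vp [t [u [[tp lt] up h]]]]].
have V0 : oset V !=set0 by exists p.
have [y Oy ey] := germ_zero FF tp.
have [V1 [V1V [w [V1p ew]]]] := germ_near Vp (dO_unif D p).
have wp : w (point_in V1p) = 0.
  apply: contrapT => /eqP nz; have := germ_unit FF nz; rewrite ew; exact: unif_nunit.
have [V2 [V2V [V2W [z [V2p ez]]]]] := lt V1 V1p w wp.
have V20 : oset V2 !=set0 by exists p.
have ez' : unif D p = germ z * germ t.
  by rewrite -ew -(germ_restr FF V2W w V20) ez germM germ_restr.
have t0 : germ t != 0 by apply/eqP => e; have := unif_neq0 D p; rewrite ez' e mulr0 eqxx.
have ot : isord D p (germ t) 1.
  have [m1 om] := isord_ex D p t0.
  have z0 : germ z != 0 by apply/eqP => e; have := unif_neq0 D p; rewrite ez' e mul0r eqxx.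
  have [m2 oz] := isord_ex D p z0.
  have e1 : m2 + m1 = 1 by apply: (isord_uniq (isordM oz om)); rewrite -ez'; exact: isord_unif.
  have g2 : 0 <= m2 by apply/(isord_ge oz); exact: germ_in V2p.
  have y0 : y != 0 by apply/eqP => e; rewrite ey e mulr0 eqxx in t0.
  have [m3 oy] := isord_ex D p y0; have g3 : 0 <= m3 by apply/(isord_ge oy).
  have e2 : 1 + m3 = m1 by apply: (isord_uniq (isordM (isord_unif D p) oy)); rewrite -ey.
  by have <- : m1 = 1 by lia.
have u0 : germ u != 0.
  apply/eqP => /(germ_eq0 (FF := FF) V0) e; by rewrite e eqxx in up.
have ou : isord D p (germ u) 0.
  apply: isord0 => //; [exact: germ_in Vp|by have := germ_unit FF up].
pose Z := opensI W V; have Z0 : oset Z !=set0 := ff_meet FF W0 V0.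
have ZW : Z `<=` W := @opensIl _ _ _; have ZV : Z `<=` V := @opensIr _ _ _.
have key (a b : regfun Z) : (forall x (Wx : oset W x) (Vx : oset V x) (Zx : oset Z x), t (point_in Vx) != 0 -> a (point_in Zx) = b (point_in Zx)) ->
    germ a = germ b.
  move=> hab; suff e : (a - b) * restr ZV t = 0.
    have := congr1 (fun c => germ c) e; rewrite germM germB germ_restr // germ0 => /eqP.
    by rewrite mulf_eq0 (negPf t0) orbF subr_eq0 => /eqP.
  apply/val_inj/funext => x; have Zx : oset Z (val x) := set_valP x.
  have ex : x = point_in Zx by exact: val_inj.
  have Wx := ZW _ Zx; have Vx := ZV _ Zx.
  have et : restr ZV t x = t (point_in Vx) by rewrite /=; congr (rf t _); exact: val_inj.
  have -> : \val ((a - b) * restr ZV t) x = (a x - b x) * restr ZV t x by [].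
  have [tz|tz] := eqVneq (t (point_in Vx)) 0; first by rewrite et tz mulr0.
  by rewrite ex (hab _ Wx Vx Zx tz) subrr mul0r.
have rW (a : regfun W) x (Wx : oset W x) (Zx : oset Z x) : restr ZW a (point_in Zx) = a (point_in Wx).
  by rewrite /=; congr (rf a _); exact: val_inj.
have rV (a : regfun V) x (Vx : oset V x) (Zx : oset Z x) : restr ZV a (point_in Zx) = a (point_in Vx).
  by rewrite /=; congr (rf a _); exact: val_inj.
have vX (a : regfun Z) j x : (a ^+ j) x = a x ^+ j.
  by elim: j => [|j IH]; rewrite ?expr0 // !exprS -IH.
have otn (j : nat) : isord D p (germ t ^+ j) j%:Z.
  elim: j => [|j IH]; first by rewrite expr0; apply: isord0; rewrite ?invr1 ?oner_neq0 //; exact: dO1.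
  by rewrite exprS -[j.+1]add1n PoszD; exact: isordM.
case: m h => [m|m] h.
- have := key (restr ZW f) (restr ZV u * restr ZV t ^+ m) _.
  rewrite germM germX // !germ_restr // => ->; first by rewrite -[Posz m]add0r; exact: isordM.
  move=> x Wx Vx Zx tx; have -> : (restr ZV u * restr ZV t ^+ m) (point_in Zx) = restr ZV u (point_in Zx) * (restr ZV t ^+ m) (point_in Zx) by [].
  by rewrite vX (rW _ _ Wx) !(rV _ _ Vx) (h x Wx Vx tx).
- have e : germ (restr ZW f * restr ZV t ^+ m.+1) = germ (restr ZV u).
    apply: key => x Wx Vx Zx tx.
    have -> : (restr ZW f * restr ZV t ^+ m.+1) (point_in Zx) = restr ZW f (point_in Zx) * (restr ZV t ^+ m.+1) (point_in Zx) by [].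
    by rewrite vX (rW _ _ Wx) !(rV _ _ Vx) (h x Wx Vx tx) NegzE -exprnN mulfVK // expf_neq0.
  rewrite germM germX // !germ_restr // in e.
  have -> : germ f = germ u * (germ t ^+ m.+1)^-1 by rewrite -e mulfK // expf_neq0.
  by rewrite -[Negz m]add0r NegzE; apply: isordM => //; apply: isordV; exact: otn.
Qed.

Lemma iso_slat (A B : lattice) x y : lhom A B x -> lhom B A y -> x *m y = 1%:M -> y *m x = 1%:M -> iso (L A) (L B).
Proof.
move=> /(of_lhom p0)[f hf] /(of_lhom p0)[g hg] exy eyx; exists f, g.
split=> U s; apply: val_inj; rewrite /= ?hg ?hf ?hg -mulmxA ?exy ?eyx mulmx1 //.
Qed.
Lemma iso_trans (E F H : omod) : iso E F -> iso F H -> iso E H.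
Proof.
move=> [f [f' [h1 h2]]] [g [g' [k1 k2]]]; exists (hcomp f g), (hcomp g' f').
by split=> U s /=; rewrite ?k1 ?h1 ?h2 ?k2.
Qed.

Section Frames.
Variables (F : omod) (ff : ft FF F).
Lemma frame_int (U : opens X) (e : 'I_(lr (ftG ff)) -> sec F U) q : frame e -> oset U q ->
  let M := \matrix_i lval (ftk ff U (e i)) in M \in unitmx ->
  intm q (M *m invmx (lg (ftG ff) q)) /\ intm q (lg (ftG ff) q *m invmx M).
Proof.
move=> fe Uq M uM; split.
  by apply: intm_row => i; rewrite row_mul rowK; exact: ftk_mem.
have [V [t [T [Vq uT ht hT]]]] := ft_basis ff q.
have Wq : oset (opensI V U) q by []; have W0 : oset (opensI V U) !=set0 by exists q.
have -> : lg (ftG ff) q *m invmx M = (lg (ftG ff) q *m invmx T) *m (T *m invmx M) by rewrite mulmxA mulmxKV.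
apply: intmM; first exact: (hT q Vq).2.
apply: intm_row => j; have [b [hb _]] := fe _ (@opensIr _ V U) (res (@opensIl _ V U) (t j)).
have -> : row j (T *m invmx M) = \row_i germ (b i).
  rewrite row_mul -ht -(ftk_res ff (@opensIl _ V U)) // hb ftk_sum -[RHS](mulmxK uM) [_ *m M]mulmx_sum_row.
  by congr (_ *m _); apply: eq_bigr => i _; rewrite ftk_res // rowK mxE.
by move=> i i'; rewrite mxE; exact: germ_in Wq.
Qed.
End Frames.

(** A rational frame identifies the generic fibre with K^r; the divisor of the determinant
of that frame is the negative of the divisor of the determinants of the lattice in these
coordinates. *)
Theorem degree_lattice (F : omod) r d : bundle F r -> degree F d ->
  exists (A : lattice) (S : seq X) (o : X -> int),
    [/\ lr A = r /\ iso F (L A), uniq S /\ p0 \in S, forall q, isord D q (\det (lg A q)) (o q),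
        forall q, q \notin S -> intm q (lg A q) /\ intm q (invmx (lg A q)) & d = - \sum_(q <- S) o q].
Proof.
move=> bF [r1 [U [s [S0 [o0 [[U0 fs] [uS hS] ho ->]]]]]].
have [ff] := ft_exists FF p0 (bundle_finite_type bF).
have [er fM] := frame_basis bF ff U0 fs; subst r1; set M := \matrix_i _ in fM.
have uM : M \in unitmx by rewrite -row_free_unit.
set G := ftG ff in s fs ho M fM uM *.
pose g q := lg G q *m invmx M; have ug q : g q \in unitmx by rewrite unitmx_mul lg_unit unitmx_inv.
have gi q : invmx (g q) = M *m invmx (lg G q).
  have e : g q *m (M *m invmx (lg G q)) = 1%:M by rewrite mulmxA mulmxKV // mulmxV ?lg_unit.
  by rewrite -[RHS](mulKmx (ug q)) e mulmx1.
have fg : finite_set [set q | ~ (intm q (g q) /\ intm q (invmx (g q)))].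
  apply: finite_imp (finite_or (lg_fin G) (finite_or (intm_fin D M) (intm_fin D (invmx M)))) => q [[h1 h2] [h3 h4]].
  by rewrite gi; split; exact: intmM.
pose A : lattice := Lattice ug fg.
pose o q := if q \in S0 then - o0 q else 0.
have iA : iso F (L A).
  apply: iso_trans (bundle_iso bF ff) _; apply: (@iso_slat G A (invmx M) M); rewrite ?mulVmx ?mulmxV //.
    by move=> q; rewrite /homp -[lg A q]/(g q) mulmxV ?ug //; exact: intm1.
  move=> q; rewrite /homp; suff -> : lg A q *m M *m invmx (lg G q) = 1%:M by exact: intm1.
    by rewrite -[lg A q]/(g q) /g (mulmxKV uM) (mulmxV (lg_unit G q)).
have unim q : q \notin S0 -> intm q (g q) /\ intm q (invmx (g q)).
  move=> qS; have Uq : oset U q by apply: contrapT => /hS; rewrite (negPf qS).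
  by rewrite gi; have [h1 h2] := frame_int fs Uq uM.
have oA q : isord D q (\det (lg A q)) (o q).
  rewrite /o; case: (boolP (q \in S0)) => [qS|/unim[h1 h2]]; last exact: ord_unimod.
  have [V [t [h [Vq ft_ eh hh]]]] := ho q qS; have V0 : oset V !=set0 by exists q.
  have W0 : oset (opensI U V) !=set0 := ff_meet FF U0 V0.
  have oh := ord_of_has_order W0 hh.
  have [_ fT] := frame_basis bF ff V0 ft_; set T := \matrix_i _ in fT.
  have uT : T \in unitmx by rewrite -row_free_unit.
  have eM : M = map_mx (fun f => germ f) h *m T.
    apply/row_matrixP => i; rewrite row_mul mulmx_sum_row rowK -(ftk_res ff (@opensIl _ U V)) // eh ftk_sum.
    by apply: eq_bigr => j _; rewrite ftk_res // rowK !mxE.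
  have [h1 h2] := frame_int ft_ Vq uT.
  have oT : isord D q (\det (lg G q *m invmx T)) 0.
    apply: ord_unimod => //; first by rewrite unitmx_mul lg_unit unitmx_inv.
    suff -> : invmx (lg G q *m invmx T) = T *m invmx (lg G q) by [].
    have uu : lg G q *m invmx T \in unitmx by rewrite unitmx_mul lg_unit unitmx_inv.
    have e : (lg G q *m invmx T) *m (T *m invmx (lg G q)) = 1%:M by rewrite mulmxA mulmxKV // mulmxV ?lg_unit.
    by rewrite -[RHS](mulKmx uu) e mulmx1.
  have dT : \det T != 0 by rewrite -unitfE -unitmxE.
  have -> : \det (lg A q) = \det (lg G q *m invmx T) * (germ (\det h))^-1.
    rewrite -[lg A q]/(g q) /g !det_mulmx !det_inv eM det_mulmx germ_det // invfM -mulrA.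
    by congr (_ * _); rewrite mulrC.
  by rewrite -[- o0 q]add0r; apply: isordM => //; exact: isordV.
exists A, (if p0 \in S0 then S0 else p0 :: S0), o; split => //.
- by split; [exact: (bundle_rank bF ff p0)|exact: iA].
- by case: ifP => h; split=> //=; rewrite ?h ?uS ?mem_head.
- by move=> q hq; apply: unim; move: hq; case: ifP => // _; rewrite inE negb_or => /andP[].
- have e : \sum_(q <- S0) o q = - \sum_(q <- S0) o0 q.
    by rewrite -sumrN; apply: eq_big_seq => q qS; rewrite /o qS.
  by case: ifP => h; [rewrite e opprK|rewrite big_cons e /o h add0r opprK].
Qed.
End Degree.
End Degrees.

(** * The numbers of a helix *)
Module Assembly.
Import Defs.
Export Parity Degrees.
Import Geo.
Import Defs.
Import Order.TTheory GRing.Theory Num.Theory.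
Local Open Scope classical_set_scope.
Local Open Scope ring_scope.

Section Assembly.
Variables (k : fieldType) (n : nat) (X : set (pspace k n)) (FF : funfield X).
Local Notation K := (ffK FF).
Local Notation D := (ffD FF).
Local Notation intm := (intm D).
Local Notation omod := (omod X).
Local Notation lattice := (lattice D).
Local Notation L A := (slat (Lfam (FF := FF) A)).
Variable p0 : X.

(** On the zero sheaf every scalar is the identity, which contradicts uniqueness. *)
Lemma simple_rank (E : omod) (A : lattice) : iso E (L A) -> simple_omod E -> (0 < lr A)%N.
Proof.
move=> [f [f' [h1 h2]]] sE; rewrite lt0n; apply/eqP => rA.
have z U (s : sec E U) : s = 0.
  have fz : f U s = 0.
    by apply: lsec_eq => U0; apply/rowP => -[j jlt]; exfalso; move: jlt; rewrite rA.
  by rewrite -(h1 U s) fz linear0.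
have [c [_ u]] := sE (hid E).
have e1 : c = 1 by apply: u => U s; etransitivity; [exact: z|symmetry; exact: z].
have e0 : c = 0 by apply: u => U s; etransitivity; [exact: z|symmetry; exact: z].
by have := oner_neq0 k; rewrite -e1 e0 eqxx.
Qed.

Lemma lbasis_size (A B : lattice) m m' (b : 'I_m -> 'M[K]_(lr A, lr B)) (b' : 'I_m' -> 'M[K]_(lr A, lr B)) :
  lbasis b -> lbasis b' -> m = m'.
Proof.
move=> hb hb'; have [hl _ _] := hb; have [hl' _ _] := hb'.
have /choice[f hf] := fun j => of_lhom p0 (hl j); have /choice[f' hf'] := fun j => of_lhom p0 (hl' j).
exact: basis_uniq (basis_of_lbasis p0 hf hb) (basis_of_lbasis p0 hf' hb').
Qed.

Lemma helix_ranks (E : int -> omod) d (b : 'I_d -> hom (E (-1)) (E 0)) : two_periodic_helix E -> hom_basis b ->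
  exists x : int -> nat, (forall i : int, (x (i - 2)%R + x i = d * x (i - 1)%R)%N) /\ forall i r, bundle (E i) r -> x i = r.
Proof.
move=> hE hb; have [ee ex mu] := hE.
have /choice[m hm] : forall i : int, exists m, exists (b : 'I_m -> hom (E (i - 1)) (E i)) (a : 'I_m -> hom (E (i - 2)) (E (i - 1))),
    [/\ hom_basis b, epi (evalm b), mono (powh a) & exact_at (powh a) (evalm b)].
  by move=> i; have [lm im] := mu i; exact: mutation_of lm im.
have step (i : int) : m i = m (i - 1).
  have [c [_ [hc _ _ _]]] := hm i; have [c' [_ [hc' _ _ _]]] := hm (i - 1).
  have gen (j : int) : j = i - 2 -> forall q (e : 'I_q -> hom (E j) (E (i - 1))), hom_basis e -> m i = q.
    by move=> -> q e he; exact: (@helix_step _ _ _ E hE i _ _ c e hc he).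
  by apply: (gen (i - 1 - 1)) hc'; rewrite -addrA.
have md : forall i, m i = d.
  apply: (@int_spread _ 0) => [|i mi].
    by have [c [_ [hc _ _ _]]] := hm 0; exact: (basis_uniq hc hb).
  by rewrite -step (step (i + 1)) addrK.
have ff i : ft FF (E i).
  have [[c _] _ _] := ee i; have h : exists f : ft FF (E i), True by have [f] := ft_exists FF p0 c; exists f.
  exact: sval (cid h).
exists (fun i => lr (ftG (ff i))); split=> [i|i r bi]; last exact: (bundle_rank bi (ff i) p0).
have [c [a [_ eb ma ea]]] := hm i.
by rewrite (rank_mutation p0 (ff (i - 1)) (ff i) (ff (i - 2)) eb ma ea) md.
Qed.

Lemma helix_no_back (E : int -> omod) (A B : lattice) m (c : 'I_m -> 'M[K]_(lr B, lr A)) : two_periodic_helix E ->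
  iso (E (-1)) (L A) -> iso (E 0) (L B) -> lbasis c -> m = 0%N.
Proof.
move=> [ee ex _] [e [e' [k1 k2]]] [f [f' [h1 h2]]] hc; case: m c hc => // m c [cl _ fr].
have [_ _ /(_ (E (-1)))pair] := ee 0; have [coh _ _] := ee (-1).
have z := pairing_hom0 (pair coh) (ex (-1) 0 isT).
have [g hg] := of_lhom p0 (cl ord0).
have c0 : c ord0 = 0.
  apply: (hom_mx_inj p0) => U s; rewrite -hg mulmx0.
  have := z (hcomp f (hcomp g e')) U (f' U s); rewrite /= h2 => /(congr1 (e U)).
  by rewrite k2 linear0 => ->.
have := fr (fun i => (i == ord0)%:R) _ ord0; rewrite eqxx => h.
case/eqP: (oner_neq0 k); apply: h; rewrite (bigD1 ord0) //= ?eqxx c0 scaler0 add0r big1 // => i /negPf ->.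
by rewrite rmorph0 scale0r.
Qed.
End Assembly.

Section Pair.
Variables (k K : fieldType) (P : choiceType) (D : dvrs k K P) (G : genus1 D).
Local Notation intm := (intm D).
Local Notation lattice := (lattice D).
Lemma sum_support (S L : seq P) (o : P -> int) : uniq S -> uniq L -> {subset S <= L} -> (forall q, q \notin S -> o q = 0) ->
  \sum_(q <- L) o q = \sum_(q <- S) o q.
Proof.
move=> uS uL sub z; rewrite (bigID (mem S)) /= [X in _ + X]big1 // addr0 -big_filter.
apply: perm_big; apply: uniq_perm; rewrite ?filter_uniq // => q; rewrite mem_filter /=.
by case: (boolP (q \in S)) => // /sub ->.
Qed.

Lemma rr_pair (A B : lattice) (SA SB : seq P) (oA oB : P -> int) : simple A -> lr B = lr A -> uniq SA -> uniq SB ->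
  (forall q, isord D q (\det (lg A q)) (oA q)) -> (forall q, isord D q (\det (lg B q)) (oB q)) ->
  (forall q, q \notin SA -> intm q (lg A q) /\ intm q (invmx (lg A q))) ->
  (forall q, q \notin SB -> intm q (lg B q) /\ intm q (invmx (lg B q))) ->
  RR A B (- ((lr A)%:Z * (\sum_(q <- SB) oB q - \sum_(q <- SA) oA q))).
Proof.
case: B => n g u f /= sA en uA uB hA hB iA iB; subst n.
have zA q : q \notin SA -> oA q = 0.
  by move=> /iA[h1 h2]; apply: isord_uniq (hA q) _; apply: ord_unimod => //; exact: lg_unit.
have zB q : q \notin SB -> oB q = 0.
  by move=> /iB[h1 h2]; apply: isord_uniq (hB q) _; apply: ord_unimod.
have h1 q : q \notin undup (SA ++ SB) -> intm q (lg A q *m invmx (g q)) /\ intm q (g q *m invmx (lg A q)).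
  by rewrite mem_undup mem_cat negb_or => /andP[/iA[a1 a2] /iB[b1 b2]]; split; exact: intmM.
have h2 q : q \in undup (SA ++ SB) -> isord D q (\det (g q *m invmx (lg A q))) (oB q - oA q).
  by move=> _; rewrite det_mulmx det_inv; exact: isordM (hB q) (isordV (hA q)).
have := rr_simple G u f sA (undup_uniq _) h1 h2; rewrite sumrB.
rewrite (sum_support uB (undup_uniq _) _ zB) ?(sum_support uA (undup_uniq _) _ zA) // => q qS;
  by rewrite mem_undup mem_cat qS ?orbT.
Qed.
End Pair.
End Assembly.

Import Defs.
Import Assembly.
Import Geo.
Import Defs.
Import Order.TTheory GRing.Theory Num.Theory.
Local Open Scope classical_set_scope.
Local Open Scope ring_scope.

Theorem theorem1p2 (k : closedFieldType) (k_char0 : [pchar k] =i pred0)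
  (n : nat) (X : set (pspace k n)) (X_elliptic : elliptic_curve X)
  (Em1 E0 : omod X) (rm1 r0 : nat) (dm1 d0 : int) (d : nat)
  (Em1_bundle : bundle Em1 rm1) (E0_bundle : bundle E0 r0)
  (Em1_simple : simple_omod Em1) (E0_simple : simple_omod E0)
  (Em1_degree : degree Em1 dm1) (E0_degree : degree E0 d0)
  (slopes : slope dm1 rm1 < slope d0 r0)
  (d_def : hom_dim Em1 E0 d) :
  (exists E : int -> omod X,
     two_periodic_helix E /\ E (-1) = Em1 /\ E 0 = E0)
  <->
  ((d = 2%N /\ rm1 = 1%N /\ r0 = 1%N /\ d0 = dm1 + 2) \/
   ((2 < d)%N /\
    0 < d%:Z * rm1%:Z * r0%:Z - rm1%:Z ^+ 2 - r0%:Z ^+ 2)).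

Proof.
pose FF := curve_funfield X_elliptic.1.
have [_ [_ [_ [_ [_ [[[p0 _] _] _ _ _]]]]]] := Em1_degree.
have [G] := genus1_ext FF p0 X_elliptic.2.
have [A [SA [oA [[rA iA] [uA pA] hA unA eA]]]] := degree_lattice FF p0 Em1_bundle Em1_degree.
have [B [SB [oB [[rB iB] [uB pB] hB unB eB]]]] := degree_lattice FF p0 E0_bundle E0_degree.
have mA : (0 < rm1)%N by rewrite -rA; exact: simple_rank iA Em1_simple.
have mB : (0 < r0)%N by rewrite -rB; exact: simple_rank iB E0_simple.
have sA := simple_of p0 mA rA iA Em1_simple; have sB := simple_of p0 mB rB iB E0_simple.
have [b hb] := lattice_basis p0 iA iB d_def.
split; last first.
  move=> h; apply: (converse p0 G Em1_bundle E0_bundle iA iB sA sB hb); rewrite rA rB.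
  case: h => [[-> [-> [-> _]]]|[d2 h]]; [by left|right; split=> //].
  by move: h; rewrite !expr2; nia.
move=> [E [hE [e1 e0]]]; subst Em1 E0; have [bd hbd] := d_def.
have [x [rec xr]] := helix_ranks FF p0 hE hbd.
have x1 := xr _ _ Em1_bundle; have x0 := xr _ _ E0_bundle.
have [d2 [h2 h3]] : _ := helix_numbers rec (etrans (congr1 (leq 1) x1) mA).
have [d3|d3] := ltnP 2 d.
  by right; split=> //; have := h3 d3; rewrite x1 x0 !expr2; nia.
left; have ed : d = 2%N by lia.
subst d; have er : rm1 = r0 by rewrite -x1 -x0 h2.
have [m [m' [[c hc] [c' hc'] em]]] := rr_pair G sA (etrans rB (etrans (esym er) (esym rA))) uA uB hA hB unA unB.
have m2 : m = 2%N := lbasis_size p0 hc hb.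
have m0 : m' = 0%N := helix_no_back p0 hE iA iB hc'.
have key : r0%:Z * (d0 - dm1) = 2.
  by move: em; rewrite m2 m0 rA er eA eB opprK [- _ + _]addrC -mulrN opprB => <-.
have e2 : (r0 * `|d0 - dm1|)%N = 2%N by exact: etrans (esym (abszM _ _)) (congr1 absz key).
have rle : (r0 <= 2)%N by apply: dvdn_leq => //; rewrite -e2 dvdn_mulr.
have [r1|r2] : r0 = 1%N \/ r0 = 2%N by lia.
  by rewrite er r1; split=> //; do 2 split=> //; move: key; rewrite r1; lia.
exfalso; have e1 : d0 - dm1 = 1 by move: key; rewrite r2; lia.
have [s [es|es]] : exists s : int, dm1 = 2 * s \/ d0 = 2 * s.
- have := divz_eq dm1 2; have := modz_ge0 dm1 (isT : (2 : int) != 0); have := ltz_pmod dm1 (isT : (0 : int) < 2).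
  set q := divz _ _; set t := modz _ _ => t2 t0 eq; have [tz|tz] : t = 0 \/ t = 1 by lia.
    by exists q; left; lia.
  by exists (q + 1); right; lia.
- apply: (no_even G sA (etrans rA (etrans er r2)) uA pA hA unA (s := - s)).
  by rewrite -[LHS]opprK -eA es mulrN.
- apply: (no_even G sB (etrans rB r2) uB pB hB unB (s := - s)).
  by rewrite -[LHS]opprK -eB es mulrN.
Qed.
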